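(* Let $N=2$, let $b>0$, let $X_1,\dots,X_M\in\mathbb{R}^3$ be distinct points and let $Z_1,\dots,Z_M>0$. Let $\rho\in\mathcal{P}^-$ and set $\alpha_i=\rho(\{X_i\})$ for $i=1,\dots,M$ (so that $\alpha_i\ge 0$ and $\sum_{i}\alpha_i\le 1$). Then the $\Gamma$-limit $G$ of the functionals $G_\varepsilon$ as $\varepsilon\to0$, with respect to the weak* convergence of measures, satisfies $$G(\rho)=\sum_{i=1}^M g_b(Z_i,\alpha_i),$$ that is, $G^-(\rho)=G^+(\rho)=\sum_{i=1}^M g_b(Z_i,\alpha_i)$.
   Context: $\mathcal{P}$ is the set of Borel probability measures on $\mathbb{R}^3$ and $\mathcal{P}^-$ the set of nonnegative Borel measures $\rho$ on $\mathbb{R}^3$ with $\|\rho\|:=\int d\rho\le 1$; weak* convergence is tested against continuous functions vanishing at infinity. Functions are identified with the measures having them as densities with respect to Lebesgue measure. For a finite nonnegative Borel measure $\rho$ on $\mathbb{R}^3$ define - $\mathcal{T}(\rho)=\int_{\mathbb{R}^3}|\nabla\sqrt\rho|^2\,dx$ if $\rho$ is absolutely continuous with $\sqrt\rho\in H^1(\mathbb{R}^3)$, and $\mathcal{T}(\rho)=+\infty$ otherwise; - $\mathcal{U}_X(\rho)=\int\frac{1}{|x-X|}\,d\rho(x)$ for $X\in\mathbb{R}^3$; - (case $N=2$) $\mathcal{C}(\rho)=\inf\{\int_{\mathbb{R}^3\times\mathbb{R}^3}\frac{1}{|x_1-x_2|}\,dP(x_1,x_2)\}$, the infimum being over nonnegative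 Borel measures $P$ on $\mathbb{R}^3\times\mathbb{R}^3$ whose two marginals are both equal to $\rho$. On $\mathcal{P}$ write $T,C$ for $\mathcal{T},\mathcal{C}$, and $U(\rho)=\sum_{k=1}^M Z_k\,\mathcal{U}_{X_k}(\rho)$. For $\varepsilon>0$ and $\rho\in\mathcal{P}$, $$G_\varepsilon(\rho)=\varepsilon^2T(\rho)+\varepsilon bC(\rho)-\varepsilon U(\rho),$$ with $G_\varepsilon(\rho)=+\infty$ if $T(\rho)=+\infty$. For $\rho\in\mathcal{P}^-$, $G^-(\rho)$ (the $\Gamma$-liminf) and $G^+(\rho)$ (the $\Gamma$-limsup) are the infima of $\liminf_{\varepsilon\to0}G_\varepsilon(\rho_\varepsilon)$ and $\limsup_{\varepsilon\to0}G_\varepsilon(\rho_\varepsilon)$ respectively, over all families $(\rho_\varepsilon)_{\varepsilon>0}$ in $\mathcal{P}$ converging weakly* to $\rho$ as $\varepsilon\to0$; the $\Gamma$-limit $G$ is their common value when they coincide. Fractional transport cost: for a measure $\rho\in\mathcal{P}^-$ with $\|\rho\|=\alpha$, $$C(\rho,2\alpha-1)=\min\{\mathcal{C}(\mu): 0\le\mu\le\rho,\ \|\mu\|=2\alpha-1\}\ \text{ if }\alpha\ge 1/2,\qquad C(\rho,2\alpha-1)=0\ \text{ otherwise.}$$ For $b,Z>0$ and $\alpha\in[0,1]$, $$g_b(Z,\alpha)=\inf\{\mathcal{T}(\rho)+b\,C(\rho,2\alpha-1)-Z\,\mathcal{U}_0(\rho)\ :\ \|\rho\|=\alpha\},$$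 the infimum being over $\rho\in\mathcal P^-$ with $\|\rho\|=\alpha$ and $\mathcal{T}(\rho)<+\infty$. *)

(* Defs.v *)
From HB Require Import structures.
From mathcomp Require Export all_boot all_order all_algebra.
From mathcomp Require Export all_classical all_reals all_analysis.
Export Order.TTheory GRing.Theory Num.Theory.
Export numFieldNormedType.Exports.

Set Implicit Arguments.
Unset Strict Implicit.
Unset Printing Implicit Defensive.

Local Open Scope classical_set_scope.
Local Open Scope ring_scope.

(* R^3 as an iterated product, with the product topology and the product
   sigma-algebra (which is the Borel sigma-algebra of R^3).  measurableTypeR R
   is R with its Borel sets, on which lebesgue_measure lives.  The library
   norm on products is the sup norm, hence the separate Euclidean norm. *)
Definition E3 (R : realType) :=
  (measurableTypeR R * measurableTypeR R * measurableTypeR R)%type.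

Definition leb3 (R : realType) : {measure set (E3 R) -> \bar R} :=
  ((lebesgue_measure \x lebesgue_measure) \x lebesgue_measure)%E.

Section defs.
Variable R : realType.
Local Notation E3 := (E3 R).
Local Notation leb3 := (leb3 R).

Definition enorm (x : E3) : R :=
  Num.sqrt (x.1.1 ^+ 2 + x.1.2 ^+ 2 + x.2 ^+ 2).

(* 1 / |x - y|, with value +oo on the diagonal (0^-1 = +oo in \bar R). *)
Definition coulomb_kernel (x y : E3) : \bar R := ((enorm (x - y))%:E^-1)%E.

Fixpoint iter_derive (s : seq E3) (f : E3 -> R) : E3 -> R :=
  if s is v :: s' then 'D_v (iter_derive s' f) else f.

Definition smooth (f : E3 -> R) : Prop :=
  forall s : seq E3, continuous (iter_derive s f) /\
    forall x v, derivable (iter_derive s f) x v.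

Definition test_function (phi : E3 -> R) : Prop :=
  smooth phi /\ compact (closure [set x | phi x != 0]).

Definition weak_derivative (v : E3) (u w : E3 -> R) : Prop :=
  forall phi, test_function phi ->
    (\int[leb3]_x (u x * 'D_v phi x)%:E = - \int[leb3]_x (w x * phi x)%:E)%E.

Definition e1 : E3 := (1, 0, 0).
Definition e2 : E3 := (0, 1, 0).
Definition e3 : E3 := (0, 0, 1).

(* u \in H^1(R^3), with weak gradient g. *)
Definition H1_gradient (u : E3 -> R) (g : E3 -> E3) : Prop :=
  [/\ u \in Lfun leb3 2%:E,
      (fun x => (g x).1.1 : R) \in Lfun leb3 2%:E /\
        weak_derivative e1 u (fun x => (g x).1.1),
      (fun x => (g x).1.2 : R) \in Lfun leb3 2%:E /\
        weak_derivative e2 u (fun x => (g x).1.2) &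
      (fun x => (g x).2 : R) \in Lfun leb3 2%:E /\
        weak_derivative e3 u (fun x => (g x).2)].

Definition has_density (rho : {measure set E3 -> \bar R}) (f : E3 -> R) :=
  [/\ measurable_fun setT f, (forall x, 0 <= f x) &
      forall A, measurable A -> rho A = (\int[leb3]_(x in A) (f x)%:E)%E].

(* The density f of rho and the weak gradient g of sqrt f are unique up to
   leb3-null sets, so the infimum is over a set with at most one element; it is
   empty, with infimum +oo, unless rho has a density f with sqrt f \in H^1. *)
Definition kinetic (rho : {measure set E3 -> \bar R}) : \bar R :=
  ereal_inf [set t | exists f g,
    [/\ has_density rho f, H1_gradient (fun x => Num.sqrt (f x)) g &
        t = (\int[leb3]_x (enorm (g x) ^+ 2)%:E)%E]].

Definition attraction (X : E3) (rho : {measure set E3 -> \bar R}) : \bar R :=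
  (\int[rho]_x coulomb_kernel x X)%E.

Definition coupling (rho : {measure set E3 -> \bar R})
    (P : {measure set (E3 * E3) -> \bar R}) : Prop :=
  forall A, measurable A ->
    pushforward P fst A = rho A /\ pushforward P snd A = rho A.

Definition coulomb_cost (rho : {measure set E3 -> \bar R}) : \bar R :=
  ereal_inf [set (\int[P]_p coulomb_kernel p.1 p.2)%E | P in coupling rho].

(* C(rho, 2 alpha - 1), to be used with rho of total mass alpha.  The infimum
   is attained, so it is the minimum. *)
Definition fractional_cost (rho : {measure set E3 -> \bar R}) (alpha : R)
    : \bar R :=
  if 2^-1 <= alpha then
    ereal_inf [set coulomb_cost mu | mu in
      [set mu : {measure set E3 -> \bar R} |
        (forall A, measurable A -> (mu A <= rho A)%E) /\
        mu setT = (2 * alpha - 1)%:E]]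
  else 0%E.

Definition cell_energy (b Z alpha : R) : \bar R :=
  ereal_inf [set (kinetic rho + b%:E * fractional_cost rho alpha
                  - Z%:E * attraction (0 : E3)%R rho)%E | rho in
    [set rho : subprobability E3 R |
      rho setT = alpha%:E /\ (kinetic rho < +oo)%E]].

Definition nuclear_attraction (M : nat) (X : 'I_M -> E3) (Z : 'I_M -> R)
    (rho : {measure set E3 -> \bar R}) : \bar R :=
  (\sum_(k < M) (Z k)%:E * attraction (X k) rho)%E.

Definition G_eps (b : R) (M : nat) (X : 'I_M -> E3) (Z : 'I_M -> R) (eps : R)
    (rho : probability E3 R) : \bar R :=
  if kinetic rho == +oo%E then +oo%E
  else ((eps ^+ 2)%:E * kinetic rho + (eps * b)%:E * coulomb_cost rho
        - eps%:E * nuclear_attraction X Z rho)%E.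

Definition vanishing_at_infinity (f : E3 -> R) : Prop :=
  forall e : R, 0 < e ->
    exists2 K : set E3, compact K & forall x, ~ K x -> `|f x| < e.

Definition weak_star_cvg (r : R -> probability E3 R)
    (rho : subprobability E3 R) : Prop :=
  forall f : E3 -> R, continuous f -> vanishing_at_infinity f ->
    (\int[r eps]_x (f x)%:E)%E @[eps --> 0^'+] --> (\int[rho]_x (f x)%:E)%E.

(* Families are indexed by all of R, but only their values at small eps > 0
   matter. *)
Definition Gamma_liminf (G : R -> probability E3 R -> \bar R)
    (rho : subprobability E3 R) : \bar R :=
  ereal_inf [set limf_einf (fun eps => G eps (r eps)) 0^'+ |
             r in [set r | weak_star_cvg r rho]].

Definition Gamma_limsup (G : R -> probability E3 R -> \bar R)
    (rho : subprobability E3 R) : \bar R :=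
  ereal_inf [set limf_esup (fun eps => G eps (r eps)) 0^'+ |
             r in [set r | weak_star_cvg r rho]].

End defs.

(* Main.v *)
(* Contracting a measure by a factor e multiplies T by e^-2 and C, U by e^-1, so
   that a piece of mass concentrated at the scale e near a nucleus contributes
   the energy of a cell problem, independently of e.

   Lower bound. The Young form of Coulomb uncertainty,
   U_X(u^2) <= 3 h |u|^2 + |grad u|^2 / (4 h), makes e^2 T bounded along
   families of bounded energy. Cutting a measure with cutoffs of a fixed small
   radius r around the nuclei costs O(e^2 / r^2) in kinetic energy and O(e / r)
   in attraction; weighting the optimal plan by the cutoff at both points and
   symmetrising it gives a plan of the localized measure with mass at least
   2 m - 1. After rescaling, the pieces compete in the cell problems, up to a
   small defect of mass, which is removed by a dilation or filled by a far and
   spread out bump (lemma [cell_energy_near]).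

   Upper bound. Compactly supported almost optimal measures of the cell problems
   are contracted to the nuclei. What is left of the limit is discretized, each
   cell of a grid being replaced by a bump on a small shell around its corner,
   so that all supports are disjoint, even when the corner is a nucleus. The
   parts of the pieces which are not coupled with themselves are coupled with
   each other by the half-turn of the circle (lemma [half_turn_matrix]); this
   costs O(1), hence O(e) in the functional. A diagonal argument in the mesh of
   the grid concludes. *)
From HB Require Import structures.
Require Import Defs.
From mathcomp Require Import measurable_realfun ring lra zify.
Set Implicit Arguments.
Unset Strict Implicit.
Unset Printing Implicit Defensive.

Local Open Scope classical_set_scope.
Local Open Scope ring_scope.

(** * Measures given by their integrals *)

(** The kinetic energy only sees weak gradients, so Coulomb uncertainty is proved for them directly.
    The field x / |x| has divergence 2 / |x|, and each component is nondecreasing along its own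
    axis, so its difference quotients are nonnegative. Shifted onto [u ^+ 2], they are controlled by
    increments of [u], hence by integrals of the gradient along segments; Fatou's lemma gives the
    limit. In the cell problems the delicate variable is the mass, since the transported mass 2 *
    alpha - 1 moves with it. Plans carrying at least this mass are stable under localization,
    scaling and addition of mass, and a surplus can be trimmed. The value 1/2 is a threshold: up to
    it the zero plan is enough, and from it on the uncoupled part, of mass 1 - m, is large enough to
    absorb the mass that is added. Weak* limits lose mass at infinity, and cell competitors lose
    some when they are cut off. In the upper bound neither loss is renormalized: the diffuse piece
    takes whatever is missing from mass one, and its bounded potential is made negligible by the
    factor [eps]. *)

Section measure_constructions.
Import HBNNSimple.
Context d (T : measurableType d) (R : realType).
Implicit Types mu nu lam : {measure set T -> \bar R}.
Local Open Scope ereal_scope.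

(** Increasing simple approximations of [h] reduce the identity, by monotone convergence on both
    sides, to level sets, where it is the hypothesis on [nu]. *)
Lemma ge0_integral_density mu nu (f : T -> R) (h : T -> \bar R) :
  measurable_fun setT f -> (forall x, (0 <= f x)%R) ->
  (forall A, measurable A -> nu A = \int[mu]_(x in A) (f x)%:E) ->
  measurable_fun setT h -> (forall x, 0 <= h x) ->
  \int[nu]_x h x = \int[mu]_x ((f x)%:E * h x).
Proof.
move=> mf f0 nuE mh h0.
have mfE : measurable_fun setT (EFin \o f) by exact/measurable_EFinP.
pose g := nnsfun_approx measurableT mh.
have hE x : h x = limn (EFin \o g ^~ x).
  by apply/esym/cvg_lim => //; exact: cvg_nnsfun_approx.
transitivity (limn (fun n => \int[nu]_x (g n x)%:E)).
  rewrite -monotone_convergence//.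
  - by apply: eq_integral => x _; exact: hE.
  - by move=> n; exact/measurable_EFinP.
  - by move=> n x _; rewrite lee_fin.
  - by move=> x _ m n mn; rewrite lee_fin; exact/lefP/nd_nnsfun_approx.
transitivity (limn (fun n => \int[mu]_x ((f x)%:E * (g n x)%:E))); last first.
  rewrite -monotone_convergence//.
  - apply: eq_integral => x _; apply/cvg_lim => //.
    by apply: cvgeZl => //; exact: cvg_nnsfun_approx.
  - by move=> n; apply: emeasurable_funM => //; exact/measurable_EFinP.
  - by move=> n x _; rewrite mule_ge0 ?lee_fin.
  - move=> x _ m n mn; rewrite lee_wpmul2l ?lee_fin//.
    exact/lefP/nd_nnsfun_approx.
congr (limn _); apply/funext => n.
have indE (m : {measure set T -> \bar R}) (r : R) :
    \int[m]_x (r * \1_(g n @^-1` [set r]) x)%:E = r%:E * m (g n @^-1` [set r]).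
  rewrite integralZl_indic_nnsfun//; congr (_ * _).
  by rewrite integral_indic// setIT.
transitivity (\sum_(r \in range (g n)) r%:E * nu (g n @^-1` [set r])).
  under eq_integral do rewrite fimfunE -fsumEFin//.
  rewrite ge0_integral_fsum//; last 2 first.
  - by move=> y; exact/measurable_EFinP/measurable_funM.
  - by move=> y x _; rewrite nnfun_muleindic_ge0.
  by apply: eq_fsbigr => r _; exact: indE.
transitivity (\int[mu]_x (\sum_(r \in range (g n))
    (f x)%:E * (r * \1_(g n @^-1` [set r]) x)%:E)); last first.
  apply: eq_integral => x _; rewrite [in RHS](fimfunE _ x) -fsumEFin//.
  by rewrite ge0_mule_fsumr// => r; exact: nnfun_muleindic_ge0.
rewrite ge0_integral_fsum//; last 2 first.
- move=> r; apply: emeasurable_funM => //.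
  by apply/measurable_EFinP/measurable_funM.
- by move=> r x _; rewrite mule_ge0 ?lee_fin// -lee_fin nnfun_muleindic_ge0.
apply: eq_fsbigr => r /[1!inE] -[t _ <-{r}].
set r := g n t; have r0 : (0 <= r)%R by rewrite /r.
under [RHS]eq_integral do rewrite EFinM muleCA.
rewrite ge0_integralZl//; last 2 first.
- apply: emeasurable_funM => //; exact/measurable_EFinP.
- by move=> x _; rewrite mule_ge0 ?lee_fin.
congr (_ * _); rewrite nuE// integral_mkcond; apply: eq_integral => x _.
by rewrite epatch_indic.
Qed.

Lemma density_ex mu (f : T -> R) :
  measurable_fun setT f -> (forall x, (0 <= f x)%R) ->
  exists nu : {measure set T -> \bar R},
    (forall A, measurable A -> nu A = \int[mu]_(x in A) (f x)%:E) /\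
    forall h : T -> \bar R, measurable_fun setT h -> (forall x, 0 <= h x) ->
      \int[nu]_x h x = \int[mu]_x ((f x)%:E * h x).
Proof.
move=> mf f0.
have mfE : measurable_fun setT (EFin \o f) by exact/measurable_EFinP.
pose nu := fun A : set T => \int[mu]_(x in A) (f x)%:E.
have nu0 : nu set0 = 0 by rewrite /nu integral_set0.
have nu_ge0 A : 0 <= nu A by apply: integral_ge0 => x _; rewrite lee_fin.
have nu_sa : semi_sigma_additive nu.
  move=> F mF tF mUF; rewrite /nu ge0_integral_bigcup//=; last 2 first.
  - exact: measurable_funTS.
  - by move=> x _; rewrite lee_fin.
  by apply: is_cvg_ereal_nneg_natsum => n _; exact: nu_ge0.
pose M := isMeasure.Build d T R nu nu0 nu_ge0 nu_sa.
pose nuM : {measure set T -> \bar R} := HB.pack nu M.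
exists nuM; split => // h mh h0; exact: ge0_integral_density.
Qed.

Lemma sub_measure_ex mu lam : mu setT < +oo ->
  (forall A, measurable A -> lam A <= mu A) ->
  exists nu : {measure set T -> \bar R},
    forall A, measurable A -> mu A = lam A + nu A.
Proof.
move=> mufin le.
have fmu A : measurable A -> mu A \is a fin_num.
  move=> mA; rewrite ge0_fin_numE//; apply: le_lt_trans mufin.
  by apply: le_measure; rewrite ?inE.
have flam A : measurable A -> lam A \is a fin_num.
  by move=> mA; rewrite ge0_fin_numE// (le_lt_trans (le A mA))// -ge0_fin_numE ?fmu.
(* The absolute value makes [nu] nonnegative on every set, measurable or not, as the measure
   structure asks. *)
pose nu := fun A : set T => `|mu A - lam A|.
have nuE A : measurable A -> nu A = mu A - lam A.
  by move=> mA; rewrite /nu gee0_abs// sube_ge0 ?le// flam.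
have nu0 : nu set0 = 0 by rewrite /nu !measure0 subee// abse0.
have nu_ge0 A : 0 <= nu A by exact: abse_ge0.
have nu_sa : semi_sigma_additive nu.
  move=> F mF tF mUF; rewrite nuE//.
  rewrite [X in X @ _ --> _](_ : _ = fun n =>
    \sum_(0 <= i < n) mu (F i) - \sum_(0 <= i < n) lam (F i)); last first.
    apply/funext => n; rewrite -sumeN; last first.
      by move=> i j _ _; rewrite fin_num_adde_defl// flam.
    by rewrite -big_split/=; apply: eq_bigr => i _; rewrite nuE.
  apply: cvgeB.
  - by rewrite fin_num_adde_defr// fmu.
  - exact: measure_semi_sigma_additive.
  - exact: measure_semi_sigma_additive.
pose M := isMeasure.Build d T R nu nu0 nu_ge0 nu_sa.
exists (HB.pack nu M : {measure set T -> \bar R}) => A mA /=.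
by rewrite nuE// addeC subeK// flam.
Qed.

Lemma sub_measure_integral mu lam nu (h : T -> \bar R) :
  (forall A, measurable A -> mu A = lam A + nu A) ->
  measurable_fun setT h -> (forall x, 0 <= h x) ->
  \int[mu]_x h x = \int[lam]_x h x + \int[nu]_x h x.
Proof.
move=> E mh h0; rewrite -ge0_integral_measure_add//.
apply: eq_measure_integral => A mA _.
by rewrite E//; exact/esym/measure_addE.
Qed.

Lemma scale_measure_ex mu (c : R) : (0 <= c)%R ->
  exists nu : {measure set T -> \bar R},
    (forall A, nu A = c%:E * mu A) /\
    forall h : T -> \bar R, measurable_fun setT h -> (forall x, 0 <= h x) ->
      \int[nu]_x h x = c%:E * \int[mu]_x h x.
Proof.
move=> c0; exists (mscale (NngNum c0) mu); split=> // h mh h0.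
by rewrite ge0_integral_mscale.
Qed.

Lemma sum_measure_ex (I : finType) (m : I -> {measure set T -> \bar R}) :
  exists nu : {measure set T -> \bar R},
    (forall A, measurable A -> nu A = \sum_i m i A) /\
    forall h : T -> \bar R, measurable_fun setT h -> (forall x, 0 <= h x) ->
      \int[nu]_x h x = \sum_i \int[m i]_x h x.
Proof.
suff /(_ (index_enum I)) [nu [nuA nuh]] : forall s : seq I,
    exists nu : {measure set T -> \bar R},
    (forall A, measurable A -> nu A = \sum_(i <- s) m i A) /\
    forall h : T -> \bar R, measurable_fun setT h -> (forall x, 0 <= h x) ->
      \int[nu]_x h x = \sum_(i <- s) \int[m i]_x h x by exists nu.
elim => [|i s [nu [nuA nuh]]].
  exists (mzero : {measure set T -> \bar R}); split => [A mA|h mh h0].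
    by rewrite big_nil.
  by rewrite big_nil integral_measure_zero.
exists (measure_add (m i) nu); split => [A mA|h mh h0].
  by rewrite big_cons -nuA//; exact: measure_addE.
by rewrite big_cons ge0_integral_measure_add// nuh.
Qed.

(** An alias of [mu] indexed by the proof of the mass bound, so that the structure can be declared
    on it; [probability_of] and [finite_of] follow the same pattern. *)
Definition subprobability_of mu & mu setT <= 1 : set T -> \bar R := mu.

HB.instance Definition _ mu H := Measure.on (@subprobability_of mu H).
HB.instance Definition _ mu H :=
  Measure_isSubProbability.Build _ _ _ (@subprobability_of mu H) H.

Lemma subprobability_ex mu : mu setT <= 1 ->
  exists p : subprobability T R, forall A, p A = mu A.
Proof. by move=> mu1; exists (subprobability_of mu1). Qed.

Definition probability_of mu & mu setT = 1 : set T -> \bar R := mu.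

HB.instance Definition _ mu H := Measure.on (@probability_of mu H).
HB.instance Definition _ mu H :=
  Measure_isProbability.Build _ _ _ (@probability_of mu H) H.

Lemma probability_ex mu : mu setT = 1 ->
  exists p : probability T R, forall A, p A = mu A.
Proof. by move=> mu1; exists (probability_of mu1). Qed.

End measure_constructions.

Lemma push_measure_ex d1 d2 (T1 : measurableType d1) (T2 : measurableType d2)
    (R : realType) (mu : {measure set T1 -> \bar R}) (phi : T1 -> T2) :
  measurable_fun setT phi ->
  exists nu : {measure set T2 -> \bar R},
    (forall A, nu A = mu (phi @^-1` A)) /\
    forall h : T2 -> \bar R, measurable_fun setT h -> (forall x, 0 <= h x)%E ->
      (\int[nu]_x h x = \int[mu]_x h (phi x))%E.
Proof.
move=> mphi.
have [nu nuE] : exists nu : {measure set T2 -> \bar R},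
    (nu : set T2 -> \bar R) = pushforward mu phi.
  by unshelve eexists (pushforward mu phi : {measure set T2 -> \bar R}).
exists nu; split=> [A|h mh h0]; first by rewrite nuE.
rewrite (_ : (\int[nu]_x h x = \int[pushforward mu phi]_x h x)%E) ?nuE//.
by rewrite ge0_integral_pushforward// => x _; exact: h0.
Qed.

(** * Borel sets and affine changes of variables in R^3 *)

Section space.
Variable R : realType.
Local Notation E3 := (E3 R).
Local Notation leb3 := (leb3 R).
Local Notation lam := (@lebesgue_measure R).

(** Half-open cubes of side 1/(n+1) with corners in the lattice of that mesh. Over all meshes they
    are countably many, which serves Borel measurability here; at a fixed mesh they form the grid of
    the upper bound. *)
Definition cell (k : nat * (int * int * int)) : set E3 :=
  (`[k.2.1.1%:~R / k.1.+1%:R, (k.2.1.1 + 1)%:~R / k.1.+1%:R[ `*`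
   `[k.2.1.2%:~R / k.1.+1%:R, (k.2.1.2 + 1)%:~R / k.1.+1%:R[) `*`
   `[k.2.2%:~R / k.1.+1%:R, (k.2.2 + 1)%:~R / k.1.+1%:R[.

Lemma measurable_cell k : measurable (cell k).
Proof. by apply: measurableX; [apply: measurableX|]; exact: measurable_itv. Qed.

Lemma cell_width (n : nat) (i : int) (s t : R) :
  s \in `[i%:~R / n.+1%:R, (i + 1)%:~R / n.+1%:R[ ->
  t \in `[i%:~R / n.+1%:R, (i + 1)%:~R / n.+1%:R[ -> `|s - t| < n.+1%:R^-1.
Proof.
rewrite !in_itv/= (intrD _ i 1) mulrDl mul1r.
move: (i%:~R / n.+1%:R : R) (n.+1%:R^-1 : R) => p q /andP[s1 s2] /andP[t1 t2].
by rewrite ltr_norml; lra.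
Qed.

Lemma cell_floor (n : nat) (t : R) :
  t \in `[(Num.floor (n.+1%:R * t))%:~R / n.+1%:R,
          (Num.floor (n.+1%:R * t) + 1)%:~R / n.+1%:R[.
Proof.
rewrite in_itv/= ler_pdivrMr ?ltr_pdivlMr// mulrC.
by rewrite floor_le_tmp floorD1_gt.
Qed.

(** Every point of an open set lies in a cell contained in the set once the mesh is small enough,
    and there are countably many cells. *)
Lemma open_measurable3 (U : set E3) : open U -> measurable U.
Proof.
move=> oU.
suff -> : U = \bigcup_(k in [set: nat * (int * int * int)])
    (if `[< cell k `<=` U >] then cell k else set0).
  apply: countable_bigcupT_measurable => // k.
  by case: ifPn => _; [exact: measurable_cell|exact: measurable0].
apply/seteqP; split => [x Ux|x [k _]]; last first.
  by case: asboolP => // kU /kU.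
have /nbhs_ballP[e /= e0 eU] : nbhs x U by apply: open_nbhs_nbhs.
have [n ne] : exists n, n.+1%:R^-1 < e :> R.
  by have /ltr_add_invr[n] := e0; rewrite add0r; exists n.
pose k := (n, (Num.floor (n.+1%:R * x.1.1), Num.floor (n.+1%:R * x.1.2),
  Num.floor (n.+1%:R * x.2))).
exists k => //; case: asboolP => [_|[]].
  by split; [split|]; exact: cell_floor.
move=> y [[y1 y2] y3]; apply: eU.
split; [split|]; rewrite /ball/= (lt_trans _ ne)//.
- exact: cell_width (cell_floor _ _) y1.
- exact: cell_width (cell_floor _ _) y2.
- exact: cell_width (cell_floor _ _) y3.
Qed.

Lemma continuous_measurable3 (f : E3 -> R) : continuous f -> measurable_fun setT f.
Proof.
move=> cf; apply: (measurability _ (RGenOpens.measurableE R)).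
move=> _ [_ [a [b ->] <-]]; rewrite setTI; apply: open_measurable3.
by apply: open_comp => // x _; exact: cf.
Qed.

(** Both sides are measures in [A] agreeing on half-open intervals, which determine Lebesgue
    measure. *)
Lemma lebesgue_measure_affine (c e : R) (A : set R) : 0 < e -> measurable A ->
  (lam A = e%:E * lam ((fun x => c + e * x)%R @^-1` A))%E.
Proof.
move=> e0 mA.
have mphi : measurable_fun setT ((fun x => c + e * x) : measurableTypeR R -> measurableTypeR R).
  by apply: measurable_funD => //; exact: measurable_funM.
have [nu [nuE _]] := push_measure_ex (lebesgue_measure : {measure set (measurableTypeR R) -> \bar R}) mphi.
have [mu [muE _]] := scale_measure_ex nu (ltW e0).
rewrite -nuE -muE; apply: lebesgue_measure_unique => // X [[a b] _ <-].
rewrite muE nuE.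
have -> : (fun x => c + e * x) @^-1` `]a, b]%classic =
    `](a - c) / e, (b - c) / e]%classic.
  apply/seteqP; split => x /=; rewrite !in_itv/= ltr_pdivrMr ?ler_pdivlMr//;
  move=> /andP[? ?]; apply/andP; split; lra.
have HJ : lam [set` `](a - c) / e, (b - c) / e]] = _ := lebesgue_measure_itv _.
rewrite [X in (_ * X)%E]HJ lebesgue_measure_itv/= !lte_fin.
rewrite ltr_pM2r ?invr_gt0// ltrD2r.
case: ifPn => _; last by rewrite mule0.
by rewrite -!EFinD -EFinM; congr EFin; field; rewrite gt_eqF.
Qed.

Lemma ge0_integral_affine1 (c e : R) (f : measurableTypeR R -> \bar R) : 0 < e ->
  measurable_fun setT f -> (forall x, 0 <= f x)%E ->
  (\int[lam]_x f x = e%:E * \int[lam]_x f (c + e * x)%R)%E.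
Proof.
move=> e0 mf f0.
have mphi : measurable_fun setT ((fun x => c + e * x) : measurableTypeR R -> measurableTypeR R).
  by apply: measurable_funD => //; exact: measurable_funM.
have [nu [nuE nuI]] := push_measure_ex (lebesgue_measure : {measure set (measurableTypeR R) -> \bar R}) mphi.
have [mu [muE muI]] := scale_measure_ex nu (ltW e0).
rewrite -(nuI f)// -(muI f)//; apply: eq_measure_integral => A mA _.
by rewrite [RHS]muE nuE -lebesgue_measure_affine.
Qed.

Local Notation itvn n := (`[- n%:R, n%:R]%classic : set (measurableTypeR R)).

Lemma itvn_cover (t : R) : exists n, forall m, (n <= m)%N -> itvn m t.
Proof.
exists (Num.trunc `|t|).+1 => m nm; rewrite /= in_itv/= -ler_norml.
apply: (le_trans (ltW (truncnS_gt _))).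
by rewrite ler_nat.
Qed.

Lemma lebesgue_itvn n : (lam (itvn n) < +oo)%E.
Proof. by rewrite lebesgue_measure_itv/=; case: ifPn => _; rewrite ?ltry. Qed.

(* The library has no sigma-finite instance on a product of measures: [leb2s]
   and [leb3s] are copies that carry one. *)
Definition leb2s : set (measurableTypeR R * measurableTypeR R)%type -> \bar R :=
  (lam \x lam)%E.
HB.instance Definition _ := Measure.on leb2s.

Lemma leb2s_itvn n : (leb2s (itvn n `*` itvn n) < +oo)%E.
Proof.
rewrite /leb2s product_measure1E; [|exact: measurable_itv..].
by rewrite lte_mul_pinfty// ?lebesgue_itvn// ge0_fin_numE// lebesgue_itvn.
Qed.

Lemma sigma_finite_leb2s : sigma_finite setT leb2s.
Proof.
exists (fun n => itvn n `*` itvn n).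
  rewrite predeqE => -[x y]; split=> // _.
  have [n nx] := itvn_cover x; have [m my] := itvn_cover y.
  by exists (maxn n m) => //; split; [apply: nx|apply: my];
    rewrite (leq_maxl, leq_maxr).
by move=> n; split; [apply: measurableX; exact: measurable_itv|exact: leb2s_itvn].
Qed.

HB.instance Definition _ :=
  Measure_isSigmaFinite.Build _ _ _ leb2s sigma_finite_leb2s.

Definition box n : set E3 := (itvn n `*` itvn n) `*` itvn n.

Lemma measurable_box n : measurable (box n).
Proof. by apply: measurableX; [apply: measurableX|]; exact: measurable_itv. Qed.

Lemma box_cover (x : E3) : exists n, forall m, (n <= m)%N -> box m x.
Proof.
have [n1 h1] := itvn_cover x.1.1; have [n2 h2] := itvn_cover x.1.2.
have [n3 h3] := itvn_cover x.2; exists (maxn (maxn n1 n2) n3) => m.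
rewrite !geq_max => /andP[/andP[? ?] ?].
by split; [split; [exact: h1|exact: h2]|exact: h3].
Qed.

Lemma leb3_box n : (leb3 (box n) < +oo)%E.
Proof.
rewrite [X in (X < _)%E](_ : _ = (leb2s \x lam)%E (box n))//.
rewrite product_measure1E; last 2 first.
- by apply: measurableX; exact: measurable_itv.
- exact: measurable_itv.
rewrite lte_mul_pinfty ?lebesgue_itvn// ge0_fin_numE//.
exact: leb2s_itvn.
Qed.

Definition leb3s : set E3 -> \bar R := leb3.
HB.instance Definition _ := Measure.on leb3s.

Lemma sigma_finite_leb3s : sigma_finite setT leb3s.
Proof.
exists box.
  rewrite predeqE => x; split=> // _.
  by have [n nx] := box_cover x; exists n => //; exact: nx.
by move=> n; split; [exact: measurable_box|exact: leb3_box].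
Qed.

HB.instance Definition _ :=
  Measure_isSigmaFinite.Build _ _ _ leb3s sigma_finite_leb3s.

Lemma integral_leb3 (f : E3 -> \bar R) : measurable_fun setT f -> (forall x, 0 <= f x)%E ->
  (\int[leb3]_x f x = \int[lam]_x \int[lam]_y \int[lam]_z f (x, y, z))%E.
Proof.
move=> mf f0.
rewrite (fubini_tonelli1 (m1 := leb2s : {sigma_finite_measure set _ -> \bar R}) (m2 := lam))//.
rewrite (fubini_tonelli1 (m1 := lam) (m2 := lam))//.
  exact: (measurable_fun_fubini_tonelli_F (m2 := lam)).
by move=> x; apply: integral_ge0.
Qed.

(** The passage from cell coordinates to the scale [e] around [X]. The inverse has the same form,
    with [- (e^-1 *: X)] and [e^-1] in place of [X] and [e]. *)
Definition affine (X : E3) (e : R) (x : E3) : E3 := X + e *: x.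

Lemma measurable_affine X e : measurable_fun setT (affine X e).
Proof.
apply: measurable_fun_pair; first apply: measurable_fun_pair.
all: apply: measurable_funD => //; apply: measurable_funM => //.
- by apply: measurableT_comp => //; exact: measurable_fst.
- by apply: (measurableT_comp measurable_snd).
Qed.

(** Tonelli reduces the formula to one coordinate at a time, each contributing a factor [e]. *)
Lemma ge0_integral_affine (X : E3) (e : R) (f : E3 -> \bar R) : 0 < e ->
  measurable_fun setT f -> (forall x, 0 <= f x)%E ->
  (\int[leb3]_x f x = (e ^+ 3)%:E * \int[leb3]_x f (affine X e x))%E.
Proof.
move=> e0 mf f0.
have mfa : measurable_fun setT (f \o affine X e).
  by apply: measurableT_comp => //; exact: measurable_affine.
rewrite (integral_leb3 mf f0) (integral_leb3 mfa (fun x => f0 _)).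
have affV (c : R) (g : measurableTypeR R -> \bar R) : measurable_fun setT g ->
    (forall x, 0 <= g x)%E ->
    (\int[lam]_x g (c + e * x)%R = e^-1%:E * \int[lam]_x g x)%E.
  move=> mg g0; rewrite [in RHS](@ge0_integral_affine1 c e)// muleA -EFinM.
  by rewrite mulVf ?mul1e// gt_eqF.
pose F3 (p : measurableTypeR R * measurableTypeR R) := (\int[lam]_z f (p.1, p.2, z))%E.
have mF3 : measurable_fun setT F3.
  have := measurable_fun_fubini_tonelli_F (m2 := lam) f mf f0.
  by congr measurable_fun; apply/funext => -[].
have F30 p : (0 <= F3 p)%E by apply: integral_ge0.
have mF3' x : measurable_fun setT (fun y => F3 (x, y)).
  by apply: (measurableT_comp mF3); exact: measurable_fun_pair.
pose F2 (x : measurableTypeR R) := (\int[lam]_y F3 (x, y))%E.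
have mF2 : measurable_fun setT F2.
  exact: (measurable_fun_fubini_tonelli_F (m2 := lam) F3 mF3 F30).
have F20 p : (0 <= F2 p)%E by apply: integral_ge0.
have comp1 (g : measurableTypeR R -> \bar R) c : measurable_fun setT g ->
    measurable_fun setT (fun x => g (c + e * x)).
  move=> mg; apply: (measurableT_comp mg).
  by apply: measurable_funD => //; exact: measurable_funM.
have e10 : (0 <= e^-1%:E :> \bar R)%E by rewrite lee_fin invr_ge0 ltW.
have -> : (\int[lam]_x \int[lam]_y \int[lam]_z (f \o affine X e) (x, y, z) =
    \int[lam]_x ((e^-1 * e^-1)%:E * F2 (X.1.1 + e * x)%R))%E.
  apply: eq_integral => x _.
  transitivity (\int[lam]_y (e^-1%:E * F3 ((X.1.1 + e * x)%R, (X.1.2 + e * y)%R)))%E.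
    apply: eq_integral => y _.
    rewrite -(affV X.2 (fun z => f (X.1.1 + e * x, X.1.2 + e * y, z)))//.
    by apply: (measurableT_comp mf); exact: measurable_fun_pair.
  rewrite ge0_integralZl//; last first.
    exact: (comp1 (fun y => F3 (X.1.1 + e * x, y)) X.1.2 (mF3' _)).
  rewrite (affV X.1.2 (fun y => F3 ((X.1.1 + e * x)%R, y)) (mF3' _) (fun y => F30 _)).
  by rewrite muleA -EFinM.
rewrite [X in (_ = _ * X)%E](_ : _ = (e^-1 * e^-1)%:E * \int[lam]_x F2 (X.1.1 + e * x)%R)%E; last first.
  apply: ge0_integralZl => //; first exact: comp1.
  by rewrite lee_fin !mulr_ge0 ?invr_ge0 ?ltW.
rewrite (affV X.1.1 F2)// !muleA -!EFinM.
rewrite [X in (X%:E * _)%E](_ : _ = 1) ?mul1e//.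
by field; rewrite gt_eqF.
Qed.

End space.

(** * Functions flat at the origin *)

Section flat.
Variable R : realType.

(** The powers of 1/t make the family stable under derivation: a derivative is a combination of the
    functions of index k + 1 and k + 2. *)
Definition flat (k : nat) (t : R) : R :=
  if 0 < t then t^-1 ^+ k * expR (- t^-1) else 0.

Lemma flat_ge0 k t : 0 <= flat k t.
Proof.
by rewrite /flat; case: ifPn => // t0; rewrite mulr_ge0 ?expR_ge0// exprn_ge0// invr_ge0 ltW.
Qed.

Lemma flat_le0 k t : t <= 0 -> flat k t = 0.
Proof. by rewrite /flat leNgt => /negbTE ->. Qed.

(** With s = 1/t and n = k + 2, the inequality (s/n)^n <= exp s bounds s^k exp(-s) by n^n s^(-2). A
    quadratic bound is what makes the derivative at the origin vanish in [is_derive_flat]. *)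
Lemma flat_sqr k t : flat k t <= k.+2%:R ^+ k.+2 * t ^+ 2.
Proof.
rewrite /flat; case: ifPn => [t0|_]; last by rewrite mulr_ge0 ?sqr_ge0// exprn_ge0.
set n := k.+2; set s := t^-1.
have s0 : 0 < s by rewrite invr_gt0.
have n0 : 0 < n%:R :> R by rewrite ltr0n.
have : (s / n%:R) ^+ n <= expR s.
  have -> : expR s = expR (s / n%:R) ^+ n by rewrite -expRM_natr mulfVK// gt_eqF.
  rewrite lerXn2r ?nnegrE ?expR_ge0 ?divr_ge0 ?(ltW s0)//.
  by apply: le_trans (expR_ge1Dx _); rewrite lerDr.
rewrite expr_div_n ler_pdivrMr ?exprn_gt0// => h.
have -> : t ^+ 2 = s ^- 2 by rewrite /s exprVn invrK.
rewrite ler_pdivlMr ?exprn_gt0// mulrAC -exprD addn2 -/n.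
by rewrite expRN ler_pdivrMr ?expR_gt0// mulrC.
Qed.

Lemma is_derive_flat k (t : R) :
  is_derive t (1 : R) (flat k) (- k%:R * flat k.+1 t + flat k.+2 t).
Proof.
have [t0|t0|->] := ltgtP t 0.
- rewrite !flat_le0 ?ltW// mulr0 addr0.
  apply: (near_eq_is_derive (f := cst 0)) => //=.
  near=> s; rewrite flat_le0//; apply: ltW; near: s; exact: lt_nbhsl.
- apply: (near_eq_is_derive (f := fun s : R => s^-1 ^+ k * expR (- s^-1))).
    by near=> s; rewrite /flat ifT//; near: s; exact: lt_nbhsr.
  have tn0 : t != 0 by rewrite gt_eqF.
  have dV : is_derive t 1 (fun s : R => s^-1) (- t^-1 ^+ 2).
    by apply: DeriveDef; [exact: derivableV|rewrite deriveV// derive_id scaler1 exprVn].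
  have dE : is_derive t 1 (fun s : R => expR (- s^-1)) (t^-1 ^+ 2 * expR (- t^-1)).
    have H := @is_derive1_comp R expR (fun s : R => - s^-1) t _ _
      (is_derive_expR _) (is_deriveN dV).
    by apply: (is_derive_eq H); rewrite opprK mulrC.
  have -> : (fun s : R => s^-1 ^+ k * expR (- s^-1)) =
      (fun s : R => s^-1) ^+ k * (fun s : R => expR (- s^-1)).
    by apply/funext => s; rewrite fctE exprfctE.
  apply: (is_derive_eq (is_deriveM (is_deriveX k dV) dE)).
  rewrite /flat t0 exprfctE.
  have E (a b : R) : a *: b = a * b by [].
  move: (t^-1) (expR _) => u w; rewrite !E.
  by case: k => [|k] /=; rewrite ?exprS; ring.
- rewrite !flat_le0// mulr0 addr0.
  have lim0 : (fun h : R => h^-1 *: ((flat k \o shift 0) (h *: (1 : R)) - flat k 0)) @ 0^' --> (0 : R).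
    apply/cvgr0Pnorm_le => e e0; near=> h.
    rewrite /= (@flat_le0 k 0)// subr0 addr0 normrZ normfV (ger0_norm (flat_ge0 _ _)).
    have h0 : h != 0 by near: h; exact: nbhs_dnbhs_neq.
    rewrite [h *: 1]mulr1 mulrC ler_pdivrMr ?normr_gt0//.
    apply: (le_trans (flat_sqr _ _)).
    rewrite -(real_normK (num_real h)) expr2 mulrA ler_pM2r ?normr_gt0// -ler_pdivlMl ?exprn_gt0//.
    near: h; apply: dnbhs0_le.
    by rewrite mulr_gt0// invr_gt0 exprn_gt0.
  by apply: DeriveDef; [apply/cvg_ex; exists 0|exact/cvg_lim].
Unshelve. all: by end_near. Qed.

Lemma continuous_flat k : continuous (flat k).
Proof.
move=> t; apply: differentiable_continuous; apply/derivable1_diffP.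
by have [] := is_derive_flat k t.
Qed.

End flat.

(** * Smoothness by closure properties *)

Section smooth.
Variable R : realType.
Local Notation E3 := (E3 R).
Implicit Types f g : E3 -> R.

(** Directional derivatives become derivatives of real functions, to which the one-variable chain
    rule applies. *)
Lemma is_derive_line f x v t d :
  is_derive (x + t *: v) v f d <-> is_derive t 1 (fun s : R => f (x + s *: v)) d.
Proof.
have E (h : R) : h *: v + (x + t *: v) = x + (h *: (1 : R) + t) *: v.
  by rewrite [h *: 1]mulr1 scalerDl addrCA.
have dE : derivable f (x + t *: v) v = derivable (fun s : R => f (x + s *: v)) t 1.
  apply: (congr1 (fun F : R -> R => cvg (F @ 0^'))); apply/funext => h /=.
  by rewrite E.
have DE : 'D_v f (x + t *: v) = 'D_1 (fun s : R => f (x + s *: v)) t.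
  apply: (congr1 (fun F : R -> R => lim (F @ 0^'))); apply/funext => h /=.
  by rewrite E.
by split => -[]; [rewrite dE DE|rewrite -dE -DE].
Qed.

Lemma is_derive_comp3 (phi : R -> R) f x v d d' :
  is_derive x v f d -> is_derive (f x) 1 phi d' -> is_derive x v (phi \o f) (d' * d).
Proof.
have {1 3}-> : x = x + 0 *: v by rewrite scale0r addr0.
move=> /is_derive_line df dphi; apply/is_derive_line.
have -> : (fun s : R => (phi \o f) (x + s *: v)) = phi \o (fun s : R => f (x + s *: v)) by [].
by apply: is_derive1_comp; rewrite scale0r addr0.
Qed.

(** A class of expressions closed under directional derivatives: the smoothness of a concrete
    function, which quantifies over all iterated derivatives, follows from writing it as such an
    expression. [el_smooth] lets abstract smooth functions take part. *)
Inductive elementary : (E3 -> R) -> Prop :=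
| el_smooth f : smooth f -> elementary f
| el_cst c : elementary (fun=> c)
| el_x1 : elementary (fun x => x.1.1)
| el_x2 : elementary (fun x => x.1.2)
| el_x3 : elementary (fun x => x.2)
| el_add f g : elementary f -> elementary g -> elementary (fun x => f x + g x)
| el_mul f g : elementary f -> elementary g -> elementary (fun x => f x * g x)
| el_flat k f : elementary f -> elementary (fun x => flat k (f x)).

Lemma is_derive_proj (p : E3 -> R) x v :
  (forall h y z, p (h *: y + z) = h * p y + p z) -> is_derive x v p (p v).
Proof.
move=> pl.
have lim : (fun h : R => h^-1 *: ((p \o shift x) (h *: v) - p x)) @ 0^' --> p v.
  apply: cvg_near_cst; near=> h.
  have h0 : h != 0 by near: h; exact: nbhs_dnbhs_neq.
  by rewrite /= pl addrK -[LHS]/(h^-1 * (h * p v)) mulKf.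
by apply: DeriveDef; [apply/cvg_ex; exists (p v)|exact/cvg_lim].
Unshelve. all: by end_near. Qed.

Lemma elementary_derive f : elementary f ->
  continuous f /\ forall v, elementary ('D_v f) /\ forall x, derivable f x v.
Proof.
elim => {f} [f sf|c||||f g _ [cf df] _ [cg dg]|f g ef [cf df] eg [cg dg]|k f ef [cf df]].
- split; first by have [] := sf [::].
  move=> v; split; last by move=> x; have [_] := sf [::]; exact.
  apply: el_smooth => s.
  suff -> : iter_derive s ('D_v f) = iter_derive (rcons s v) f by exact: sf.
  by rewrite /iter_derive; elim: s => //= w s ->.
- split; first by move=> x; exact: cvg_cst.
  move=> v; split; last by move=> x; exact: derivable_cst.
  by rewrite (_ : 'D_v _ = fun=> 0); [exact: el_cst|apply/funext => x; exact: derive_cst].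
- split; first by move=> x; apply: (cvg_comp fst fst); exact: cvg_fst.
  move=> v; have d x := is_derive_proj (p := fun x => x.1.1) x v (fun _ _ _ => erefl).
  split; last by move=> x; exact: ex_derive.
  rewrite (_ : 'D_v _ = fun=> v.1.1); first exact: el_cst.
  by apply/funext => x; exact: derive_val.
- split; first by move=> x; apply: (cvg_comp fst snd); [exact: cvg_fst|exact: cvg_snd].
  move=> v; have d x := is_derive_proj (p := fun x => x.1.2) x v (fun _ _ _ => erefl).
  split; last by move=> x; exact: ex_derive.
  rewrite (_ : 'D_v _ = fun=> v.1.2); first exact: el_cst.
  by apply/funext => x; exact: derive_val.
- split; first by move=> x; exact: cvg_snd.
  move=> v; have d x := is_derive_proj (p := fun x => x.2) x v (fun _ _ _ => erefl).
  split; last by move=> x; exact: ex_derive.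
  rewrite (_ : 'D_v _ = fun=> v.2); first exact: el_cst.
  by apply/funext => x; exact: derive_val.
- split; first by move=> x; apply: cvgD; [exact: cf|exact: cg].
  move=> v; have [ef df'] := df v; have [eg dg'] := dg v.
  split; last by move=> x; exact: derivableD.
  rewrite (_ : 'D_v _ = fun x => 'D_v f x + 'D_v g x); first exact: el_add.
  by apply/funext => x; exact: deriveD.
- split; first by move=> x; apply: cvgM; [exact: cf|exact: cg].
  move=> v; have [ef' df'] := df v; have [eg' dg'] := dg v.
  split; last by move=> x; exact: derivableM.
  rewrite (_ : 'D_v _ = fun x => f x * 'D_v g x + g x * 'D_v f x).
    by apply: el_add; exact: el_mul.
  by apply/funext => x; rewrite deriveM.
- split; first by move=> x; apply: continuous_comp; [exact: cf|exact: continuous_flat].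
  move=> v; have [ef' df'] := df v.
  have d x : is_derive x v (fun x => flat k (f x))
      ((- k%:R * flat k.+1 (f x) + flat k.+2 (f x)) * 'D_v f x).
    apply: (@is_derive_comp3 (flat k) f); first exact: derivableP.
    exact: is_derive_flat.
  split; last by move=> x; exact: ex_derive.
  rewrite (_ : 'D_v _ = fun x => (- k%:R * flat k.+1 (f x) + flat k.+2 (f x)) * 'D_v f x).
    apply: el_mul => //; apply: el_add; last exact: el_flat.
    by apply: el_mul; [exact: el_cst|exact: el_flat].
  by apply/funext => x; exact: derive_val.
Qed.

Lemma elementary_smooth f : elementary f -> smooth f.
Proof.
move=> ef s; have es : elementary (iter_derive s f).
  by elim: s => //= v s /elementary_derive[_ /(_ v)[]].
have [cs ds] := elementary_derive es.
by split=> // x v; have [_] := ds v; exact.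
Qed.

End smooth.

(** * Test functions, square integrable functions and their rescaling *)

Section tests.
Variable R : realType.
Local Notation E3 := (E3 R).
Local Notation leb3 := (leb3 R).
Local Notation box := (@box R).
Implicit Types (f g u w phi psi : E3 -> R).

Lemma box_normP n (x : E3) : box n x <-> `|x| <= n%:R.
Proof.
rewrite !prod_normE !ge_max /box/=; split.
  by move=> [[/= h1 h2] h3]; rewrite !ler_norml; move: h1 h2 h3; rewrite !in_itv/= => -> -> ->.
by move=> /andP[/andP[h1 h2] h3]; split; [split|]; rewrite /= in_itv/= -ler_norml.
Qed.

Lemma compact_box n : compact (box n).
Proof. by apply: compact_setX; [apply: compact_setX|]; exact: segment_compact. Qed.

Lemma closed_box n : closed (box n).
Proof. by apply: compact_closed; [exact: norm_hausdorff|exact: compact_box]. Qed.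

Lemma test_box phi : test_function phi ->
  exists n, forall x, ~ box n x -> phi x = 0.
Proof.
move=> [_ /compact_bounded[M [_ HM]]].
exists (Num.trunc `|M|).+2 => x nx; apply/eqP/negPn/negP => px; apply: nx.
apply/box_normP; apply: (le_trans (HM (`|M| + 1) _ x _)).
- by rewrite (le_lt_trans (ler_norm _))// ltrDl.
- exact: subset_closure.
- by rewrite -[X in _ <= X]natr1 lerD2r ltW// truncnS_gt.
Qed.

Lemma box_test n phi : smooth phi -> (forall x, ~ box n x -> phi x = 0) ->
  test_function phi.
Proof.
move=> sphi phi0; split=> //.
apply: (subclosed_compact _ (@compact_box n)); first exact: closed_closure.
rewrite closureE => x; apply; split; first exact: closed_box.
by move=> y /= py; apply: contrapT => /phi0 /eqP; rewrite (negbTE py).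
Qed.

Lemma smooth_derive f v : smooth f -> smooth ('D_v f).
Proof.
move=> sf; apply: elementary_smooth.
by have [_ /(_ v)[]] := elementary_derive (el_smooth sf).
Qed.

Lemma smooth_continuous f : smooth f -> continuous f.
Proof. by move=> /(_ [::])[]. Qed.

Lemma smooth_derivable f x v : smooth f -> derivable f x v.
Proof. by move=> /(_ [::])[_]; exact. Qed.

Lemma smooth_mul f g : smooth f -> smooth g -> smooth (fun x => f x * g x).
Proof. by move=> sf sg; apply: elementary_smooth; apply: el_mul; exact: el_smooth. Qed.

Lemma smooth_measurable f : smooth f -> measurable_fun setT f.
Proof. by move=> /smooth_continuous; exact: continuous_measurable3. Qed.

Lemma derive_out_box n phi v : (forall x, ~ box n x -> phi x = 0) ->
  forall x, ~ box n x -> 'D_v phi x = 0.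
Proof.
move=> phi0 x nx; rewrite (near_eq_derive (g := cst 0)) ?derive_cst//.
have : nbhs x (~` box n) by apply: open_nbhs_nbhs; split=> //; exact/closed_openC/closed_box.
by apply: filterS => y /phi0 ->.
Qed.

Lemma test_derive phi v : test_function phi -> test_function ('D_v phi).
Proof.
move=> tphi; have [n phi0] := test_box tphi.
by apply: (@box_test n); [exact: smooth_derive tphi.1|exact: derive_out_box].
Qed.

Lemma test_mul phi f : smooth f -> test_function phi ->
  test_function (fun x => f x * phi x).
Proof.
move=> sf tphi; have [n phi0] := test_box tphi.
apply: (@box_test n); first exact: smooth_mul tphi.1.
by move=> x /phi0 ->; rewrite mulr0.
Qed.

Lemma test_bounded phi : test_function phi ->
  exists2 C, 0 <= C & forall x, `|phi x| <= C.
Proof.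
move=> tphi; have [n phi0] := test_box tphi.
have : compact (phi @` box n).
  apply: continuous_compact; last exact: compact_box.
  by apply: continuous_subspaceT; exact: smooth_continuous tphi.1.
move=> /compact_bounded[M [_ HM]]; exists (`|M| + 1) => [|x].
  by rewrite addr_ge0.
have [bx|/phi0 ->] := pselect (box n x); last by rewrite normr0 addr_ge0.
apply: (HM (`|M| + 1)); last by exists x.
by rewrite (le_lt_trans (ler_norm _))// ltrDl.
Qed.

Lemma is_derive_affine f X (e : R) x v d : is_derive (affine X e x) v f d ->
  is_derive x v (f \o affine X e) (e * d).
Proof.
have := (is_derive_line f (affine X e x) v 0 d).1.
rewrite scale0r addr0 => H /H df.
have := (is_derive_line (f \o affine X e) x v 0 (e * d)).2.
rewrite scale0r addr0; apply.
have -> : (fun s : R => (f \o affine X e) (x + s *: v)) =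
    (fun s : R => f (affine X e x + s *: v)) \o (fun s : R => e * s).
  apply/funext => s /=; congr (f _); rewrite /affine scalerDr addrA scalerA.
  by [].
rewrite mulrC; apply: is_derive1_comp; first by rewrite mulr0.
apply: (is_derive_eq (is_deriveZ (e : R) (is_derive_id (0:R) (1:R)))).
by rewrite [LHS]mulr1.
Qed.

Lemma derive_affine f X (e : R) v : smooth f ->
  'D_v (f \o affine X e) = (fun x => e * 'D_v f (affine X e x)).
Proof.
move=> sf; apply/funext => x; apply: derive_val.
by apply: is_derive_affine; apply: derivableP; exact: smooth_derivable.
Qed.

Lemma continuous_affine X (e : R) : continuous (affine X e : E3 -> E3).
Proof.
by move=> x; apply: cvgD; [exact: cvg_cst|exact: scaler_continuous].
Qed.

Lemma smooth_affine f X (e : R) : smooth f -> smooth (f \o affine X e).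
Proof.
move=> sf s.
have E : iter_derive s (f \o affine X e) =
    (fun x => e ^+ size s * iter_derive s f (affine X e x)).
  elim: s => [|v s IH]; first by apply/funext => x; rewrite /= expr0 mul1r.
  have ss : smooth (iter_derive s f).
    by elim: s {IH} => [|w s' ih]; [exact: sf|exact: smooth_derive].
  rewrite [LHS]/= IH; apply/funext => x.
  have d : is_derive x v (iter_derive s f \o affine X e)
     (e * 'D_v (iter_derive s f) (affine X e x)).
    by apply: is_derive_affine; apply: derivableP; exact: smooth_derivable.
  apply: derive_val; rewrite /= exprSr -mulrA.
  exact: (is_deriveZ (e ^+ size s) d).
rewrite E; have [cs ds] := sf s; split.
  move=> x; apply: cvgM; first exact: cvg_cst.
  by apply: continuous_comp; [exact: continuous_affine|exact: cs].
move=> x v; apply: derivableZ; apply: ex_derive.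
by apply: is_derive_affine; apply: derivableP; exact: ds.
Qed.

Lemma test_affine phi X (e : R) : 0 < e -> test_function phi ->
  test_function (phi \o affine X e).
Proof.
move=> e0 tphi; have [n phi0] := test_box tphi.
pose m := (Num.trunc ((n%:R + `|X|) / e)).+1.
apply: (@box_test m); first exact: smooth_affine tphi.1.
move=> x nx /=; apply: phi0 => /box_normP; rewrite leNgt => /negP; apply.
have : m%:R < `|x| by rewrite ltNge; apply/negP => /box_normP.
have : (n%:R + `|X|) / e < m%:R := truncnS_gt _.
move=> h1 h2; have := lt_trans h1 h2; rewrite ltr_pdivrMr// => h3.
have : `|e *: x| <= `|affine X e x| + `|X|.
  have -> : e *: x = affine X e x - X by rewrite /affine addrAC subrr add0r.
  exact: ler_normB.
rewrite normrZ gtr0_norm// mulrC => h4.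
by rewrite -(ltrD2r `|X|) (lt_le_trans h3).
Qed.

Definition L2 u := measurable_fun setT u /\
  (\int[leb3]_x (u x ^+ 2)%:E < +oo)%E.

Lemma LfunP2 u : u \in Lfun leb3 2%:E <-> L2 u.
Proof.
split=> [lu|[mu ui]].
  have /integrableP[_ h] := Lfun2_integrable_sqr lu.
  move: lu; rewrite inE => /andP[]; rewrite inE => mu _; split=> //.
  by move: h; under eq_integral do rewrite gee0_abs ?lee_fin ?sqr_ge0//.
rewrite inE; apply/andP; split; first by rewrite inE.
rewrite inE /finite_norm unlock /= poweR_lty//.
rewrite (eq_integral (fun x => (u x ^+ 2)%:E))// => x _.
by rewrite powR_mulrn// real_normK// num_real.
Qed.

Lemma L2_sqr u : L2 u -> leb3.-integrable setT (fun x => (u x ^+ 2)%:E).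
Proof.
move=> [mu ui]; apply/integrableP; split.
  by apply/measurable_EFinP; exact: measurable_funX.
by under eq_integral do rewrite gee0_abs ?lee_fin ?sqr_ge0//.
Qed.

Lemma L2_mul u w : L2 u -> L2 w -> leb3.-integrable setT (fun x => (u x * w x)%:E).
Proof.
move=> lu lw; have := integrableD measurableT (L2_sqr lu) (L2_sqr lw).
apply: le_integrable => //.
  by apply/measurable_EFinP; apply: measurable_funM; [exact: lu.1|exact: lw.1].
move=> x _; rewrite /= lee_fin normrM.
rewrite [leRHS]ger0_norm ?addr_ge0 ?sqr_ge0//.
rewrite -(real_normK (num_real (u x))) -(real_normK (num_real (w x))).
by have := sqr_ge0 (`|u x| - `|w x|); have := sqr_ge0 (`|u x| + `|w x|); nra.
Qed.

Lemma bounded_box_integrable n (f : E3 -> R) (C : R) : measurable_fun setT f ->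
  (forall x, `|f x| <= C) -> (forall x, ~ box n x -> f x = 0) ->
  leb3.-integrable setT (EFin \o f).
Proof.
move=> mf fC f0; apply: (@le_integrable _ _ _ leb3 setT measurableT _ (fun x => (C * \1_(box n) x)%:E)).
- exact/measurable_EFinP.
- move=> x _; rewrite /= lee_fin.
  have C0 : 0 <= C by apply: le_trans (fC x).
  rewrite [leRHS]ger0_norm ?mulr_ge0// indicE.
  have [bx|nx] := pselect (box n x); first by rewrite mem_set// mulr1.
  by rewrite f0// normr0 mulr_ge0.
- rewrite (_ : (fun x => _) = (fun x => C%:E * (\1_(box n) x : R)%:E)%E)//.
  apply: integrableZl => //; apply/integrableP; split.
    by apply/measurable_EFinP; apply: measurable_indic; exact: measurable_box.
  rewrite (eq_integral (fun x => (\1_(box n) x : R)%:E)); last first.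
    by move=> x _; rewrite gee0_abs// lee_fin.
  by rewrite integral_indic ?setIT//; [exact: leb3_box|exact: measurable_box].
Qed.

Lemma test_integrable phi : test_function phi -> leb3.-integrable setT (EFin \o phi).
Proof.
move=> tphi; have [n phi0] := test_box tphi; have [C _ phiC] := test_bounded tphi.
exact: (bounded_box_integrable (smooth_measurable tphi.1) phiC phi0).
Qed.

Lemma test_L2 phi : test_function phi -> L2 phi.
Proof.
move=> tphi; have := test_integrable (test_mul tphi.1 tphi).
by move=> /integrableP[_ h]; split; [exact: smooth_measurable tphi.1|];
  move: h; under eq_integral do rewrite /= -expr2 ger0_norm ?sqr_ge0//.
Qed.

Lemma integrable_affine (f : E3 -> \bar R) X (e : R) : 0 < e ->
  leb3.-integrable setT f -> leb3.-integrable setT (f \o affine X e).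
Proof.
move=> e0 /integrableP[mf fi]; apply/integrableP; split.
  by apply: measurableT_comp => //; exact: measurable_affine.
move: fi; rewrite (ge0_integral_affine X e0)//; last exact: measurableT_comp.
rewrite !ltey; apply: contraNN => /eqP ->.
by rewrite gt0_muley// lte_fin exprn_gt0.
Qed.

Lemma integral_affine (f : E3 -> \bar R) X (e : R) : 0 < e ->
  leb3.-integrable setT f ->
  (\int[leb3]_x f x = (e ^+ 3)%:E * \int[leb3]_x f (affine X e x))%E.
Proof.
move=> e0 fi; have mf := measurable_int _ fi.
have fai : leb3.-integrable setT (f \o affine X e) by exact: integrable_affine.
rewrite integralE [in RHS](integralE _ _ (fun x => f (affine X e x))).
rewrite muleBr//; last first.
  apply: fin_num_adde_defl; rewrite fin_numN.
  exact: (integrable_neg_fin_num measurableT fai).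
have p := ge0_integral_affine X e0 (measurable_funepos mf) (fun x => funepos_ge0 f x).
have n := ge0_integral_affine X e0 (measurable_funeneg mf) (fun x => funeneg_ge0 f x).
have pE : (fun x => f (affine X e x))^\+%E = (fun x => f^\+%E (affine X e x)).
  exact: (funepos_comp f (affine X e)).
have nE : (fun x => f (affine X e x))^\-%E = (fun x => f^\-%E (affine X e x)).
  exact: (funeneg_comp f (affine X e)).
by rewrite [X in (X - _)%E]p [X in (_ - X)%E]n pE nE.
Qed.

End tests.

(** * The fundamental lemma of the calculus of variations *)

Section fundamental.
Variable R : realType.
Local Notation E3 := (E3 R).
Local Notation leb3 := (leb3 R).
Local Notation box := (@box R).

Definition obox (a b : E3) : set E3 :=
  (`]a.1.1, b.1.1[ `*` `]a.1.2, b.1.2[) `*` `]a.2, b.2[.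

Definition oboxes : set (set E3) := [set B | exists a b, B = obox a b].

Definition symbox n : set E3 :=
  obox (- n%:R, - n%:R, - n%:R) (n%:R, n%:R, n%:R).

Lemma symbox_sub n : symbox n `<=` box n.
Proof.
by move=> x [[h1 h2] h3]; split; [split|]; apply: subset_itv_oo_cc.
Qed.

Lemma symbox_cover (x : E3) : exists n, symbox n x.
Proof.
have [n /(_ n (leqnn n)) bx] := box_cover x; exists n.+1.
have h (t : R) : t \in `[- n%:R, n%:R] -> t \in `]- n.+1%:R, n.+1%:R[.
  by rewrite !in_itv/= => /andP[h1 h2]; have := ltr_nat R n n.+1; rewrite ltnSn => h; apply/andP; split; lra.
by case: bx => [[h1 h2] h3]; split; [split|]; exact: h.
Qed.

Lemma setI_closed_oboxes : setI_closed oboxes.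
Proof.
move=> _ _ [a [b ->]] [c [d ->]].
pose M (s t : R) := Num.max s t; pose m (s t : R) := Num.min s t.
exists (M a.1.1 c.1.1, M a.1.2 c.1.2, M a.2 c.2).
exists (m b.1.1 d.1.1, m b.1.2 d.1.2, m b.2 d.2).
apply/seteqP; split => x; rewrite /obox/= !in_itv/= !gt_max !lt_min.
  by move=> [[[/andP[-> ->] /andP[-> ->]] /andP[-> ->]] [[/andP[-> ->] /andP[-> ->]] /andP[-> ->]]].
by move=> [[/andP[/andP[-> ->] /andP[-> ->]] /andP[/andP[-> ->] /andP[-> ->]]] /andP[/andP[-> ->] /andP[-> ->]]].
Qed.

Lemma measurable_obox a b : measurable (obox a b).
Proof. by apply: measurableX; [apply: measurableX|]; exact: measurable_itv. Qed.

(** The preimage of an open interval under a coordinate is a countable union of boxes growing in the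
    two other directions. So the coordinates, and with them the identity, are measurable from the
    sigma-algebra generated by the boxes. *)
Lemma measurable_oboxes (A : set E3) : measurable A = <<s oboxes >> A.
Proof.
apply/propext; split; last first.
  move: A; apply: smallest_sub; first by split;
    [exact: measurable0|by move=> A mA; rewrite setTD; exact: measurableC|
     by move=> F mF; exact: bigcupT_measurable].
  by move=> _ [a [b ->]]; exact: measurable_obox.
move=> mA; pose T := g_sigma_algebraType oboxes.
have gen (B : nat -> set E3) : (forall n, oboxes (B n)) ->
    @measurable _ T (\bigcup_n B n).
  by move=> oB; apply: bigcupT_measurable => n; apply: sub_sigma_algebra; exact: oB.
have : measurable_fun setT (fun x : T => ((x : E3).1.1, (x : E3).1.2, (x : E3).2)).
{ apply: measurable_fun_pair; first apply: measurable_fun_pair.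
  all: apply: (measurability _ (RGenOpens.measurableE R)).
  all: move=> _ [_ [a [b ->] <-]]; rewrite setTI.
  - rewrite (_ : _ @^-1` _ = \bigcup_n obox (a, - n%:R, - n%:R) (b, n%:R, n%:R)).
      by apply: gen => n; exists (a, - n%:R, - n%:R), (b, n%:R, n%:R).
    apply/seteqP; split=> x; last by case=> n _ [[? ?] ?].
    move=> xab; by have [n [[h1 h2] h3]] := symbox_cover x; exists n.
  - rewrite (_ : _ @^-1` _ = \bigcup_n obox (- n%:R, a, - n%:R) (n%:R, b, n%:R)).
      by apply: gen => n; exists (- n%:R, a, - n%:R), (n%:R, b, n%:R).
    apply/seteqP; split=> x; last by case=> n _ [[? ?] ?].
    move=> xab; by have [n [[h1 h2] h3]] := symbox_cover x; exists n.
  - rewrite (_ : _ @^-1` _ = \bigcup_n obox (- n%:R, - n%:R, a) (n%:R, n%:R, b)).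
      by apply: gen => n; exists (- n%:R, - n%:R, a), (n%:R, n%:R, b).
    apply/seteqP; split=> x; last by case=> n _ [[? ?] ?].
    move=> xab; by have [n [[h1 h2] h3]] := symbox_cover x; exists n. }
move=> /(_ measurableT A mA); rewrite setTI.
by rewrite (_ : _ @^-1` A = A)//; apply/seteqP; split => -[[? ?] ?].
Qed.

(** As exp(-1/(n s)) tends to 1 for s > 0, these smooth functions, all supported in the same
    interval, converge pointwise to its indicator. *)
Definition bump1 (n : nat) (a b t : R) : R :=
  flat 0 (n.+1%:R * (t - a)) * flat 0 (n.+1%:R * (b - t)).

Lemma flat0_le1 (t : R) : flat 0 t <= 1.
Proof.
rewrite /flat; case: ifPn => // t0; rewrite expr0 mul1r -expR0 ler_expR.
by rewrite oppr_le0 invr_ge0 ltW.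
Qed.

Lemma flat0_cvg (s : R) : 0 < s -> flat 0 (n.+1%:R * s) @[n --> \oo] --> (1 : R).
Proof.
move=> s0; rewrite (_ : (fun n => _) = (fun n => expR (- (n.+1%:R^-1 * s^-1)))); last first.
  by apply/funext => n; rewrite /flat mulr_gt0// expr0 mul1r invfM.
rewrite -[X in _ --> X]expR0.
apply: continuous_cvg; first exact: continuous_expR.
rewrite -[X in _ --> X]oppr0 -[X in _ --> - X](mul0r s^-1).
by apply: cvgN; apply: cvgM; [exact: cvg_harmonic|exact: cvg_cst].
Qed.

Lemma bump1_out n a b t : ~~ (t \in `]a, b[) -> bump1 n a b t = 0.
Proof.
rewrite in_itv/= negb_and -!leNgt /bump1 => /orP[ta|bt].
  by rewrite flat_le0 ?mul0r// pmulr_rle0// subr_le0.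
by rewrite [X in _ * X]flat_le0 ?mulr0// pmulr_rle0// subr_le0.
Qed.

Lemma bump1_cvg a b t : bump1 n a b t @[n --> \oo] --> (\1_(`]a, b[%classic) t : R).
Proof.
rewrite indicE; have [tab|tab] := boolP (t \in `]a, b[).
  rewrite mem_set// -[X in _ --> X]mulr1.
  move: tab; rewrite in_itv/= => /andP[h1 h2].
  by apply: cvgM; apply: flat0_cvg; rewrite subr_gt0.
rewrite memNset; last exact/negP.
by under eq_fun do rewrite bump1_out//; exact: cvg_cst.
Qed.

Lemma bump1_ge0 n a b t : 0 <= bump1 n a b t.
Proof. by rewrite mulr_ge0 ?flat_ge0. Qed.

Lemma bump1_le1 n a b t : bump1 n a b t <= 1.
Proof. by rewrite -[leRHS]mulr1 ler_pM ?flat_ge0 ?flat0_le1. Qed.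

Definition bump3 n (a b x : E3) : R :=
  bump1 n a.1.1 b.1.1 x.1.1 * bump1 n a.1.2 b.1.2 x.1.2 * bump1 n a.2 b.2 x.2.

Lemma bump3_out n a b x : ~ obox a b x -> bump3 n a b x = 0.
Proof.
move=> nx; rewrite /bump3.
have [h1|h1] := boolP (x.1.1 \in `]a.1.1, b.1.1[); last by rewrite bump1_out ?mul0r.
have [h2|h2] := boolP (x.1.2 \in `]a.1.2, b.1.2[); last by rewrite [X in _ * X * _]bump1_out ?mulr0 ?mul0r.
have [h3|h3] := boolP (x.2 \in `]a.2, b.2[); last by rewrite [X in _ * X]bump1_out ?mulr0.
by exfalso; apply: nx; split; [split|].
Qed.

Lemma bump3_cvg a b x : bump3 n a b x @[n --> \oo] --> (\1_(obox a b) x : R).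
Proof.
rewrite (_ : \1_(obox a b) x = \1_(`]a.1.1, b.1.1[%classic) x.1.1 *
  \1_(`]a.1.2, b.1.2[%classic) x.1.2 * \1_(`]a.2, b.2[%classic) x.2 :> R).
  by apply: cvgM; [apply: cvgM|]; exact: bump1_cvg.
by rewrite !indicE /obox !in_setX -!natrM !mulnb.
Qed.

Lemma bump3_ge0 n a b x : 0 <= bump3 n a b x.
Proof. by apply: mulr_ge0; [apply: mulr_ge0|]; exact: bump1_ge0. Qed.

Lemma bump3_le1 n a b x : bump3 n a b x <= 1.
Proof.
have le1 (s t : R) : 0 <= s -> 0 <= t -> s <= 1 -> t <= 1 -> s * t <= 1.
  by move=> s0 t0 s1 t1; rewrite -[leRHS]mulr1 ler_pM.
have ge n' c d t := bump1_ge0 n' c d t; have le n' c d t := bump1_le1 n' c d t.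
exact: (le1 _ _ (mulr_ge0 (ge _ _ _ _) (ge _ _ _ _)) (ge _ _ _ _)
  (le1 _ _ (ge _ _ _ _) (ge _ _ _ _) (le _ _ _ _) (le _ _ _ _)) (le _ _ _ _)).
Qed.

Lemma obox_sub_box a b : exists N, obox a b `<=` box N.
Proof.
have [k1 ha] := box_cover a; have [k2 hb] := box_cover b.
exists (maxn k1 k2) => x [[q1 q2] q3].
have {ha} [[a1 a2] a3] := ha _ (leq_maxl k1 k2).
have {hb} [[b1 b2] b3] := hb _ (leq_maxr k1 k2).
move: a1 a2 a3 b1 b2 b3 q1 q2 q3.
rewrite /box/= !in_itv/= => /andP[? ?] /andP[? ?] /andP[? ?] /andP[? ?] /andP[? ?] /andP[? ?].
by move=> /andP[? ?] /andP[? ?] /andP[? ?]; split; [split|]; apply/andP; split; lra.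
Qed.

Lemma test_bump3 n a b : test_function (bump3 n a b).
Proof.
have [N sub] := obox_sub_box a b; apply: (@box_test _ N).
  apply: elementary_smooth.
  have el1 (c d : R) (p : E3 -> R) : elementary p -> elementary (fun x => bump1 n c d (p x)).
    move=> ep; apply: el_mul; apply: el_flat; apply: el_mul; try exact: el_cst.
      by apply: el_add => //; exact: el_cst.
    apply: el_add; first exact: el_cst.
    by rewrite (_ : (fun x => - p x) = (fun x => (-1) * p x));
      [apply: el_mul => //; exact: el_cst|apply/funext => x; rewrite mulN1r].
  by apply: el_mul; [apply: el_mul|]; apply: el1; [exact: el_x1|exact: el_x2|exact: el_x3].
by move=> x nx; apply: bump3_out => /sub.
Qed.

(** By dominated convergence along [bump3], [z] has zero integral over every box. Inside a fixed box
    the positive and the negative part of [z] then define finite measures that agree on a pi-system,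
    hence everywhere; evaluating them on the sets where z > 0 and z < 0 shows that both vanish. *)
Lemma fundamental_lemma (z : E3 -> R) : measurable_fun setT z ->
  (forall n, leb3.-integrable (box n) (EFin \o z)) ->
  (forall phi, test_function phi -> (\int[leb3]_x (z x * phi x)%:E = 0)%E) ->
  {ae leb3, forall x, z x = 0}.
Proof.
move=> mz iz z0.
have mzE : measurable_fun setT (EFin \o z) by exact/measurable_EFinP.
have zbox a b : (\int[leb3]_x (z x * \1_(obox a b) x)%:E = 0)%E.
  have [N sub] := obox_sub_box a b.
  have iN : leb3.-integrable setT (fun x => (`|z x| * \1_(box N) x)%:E).
    have := iz N; rewrite integrable_mkcond; last exact: measurable_box.
    move=> /integrable_abse; apply: eq_integrable => // x _ /=.
    by rewrite patchE indicE; case: (x \in _); rewrite ?mulr1 ?mulr0 ?abse0.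
  have mI c d : measurable_fun setT (\1_(obox c d) : E3 -> R).
    by apply: measurable_indic; exact: measurable_obox.
  have H1 x : [set: E3] x -> (z x * bump3 n a b x)%:E @[n --> \oo] --> (z x * \1_(obox a b) x)%:E.
    by move=> _; apply: cvg_EFin; [exact: nearW|apply: cvgM; [exact: cvg_cst|exact: bump3_cvg]].
  have H2 x n : [set: E3] x -> (`|(z x * bump3 n a b x)%:E| <= (`|z x| * \1_(box N) x)%:E)%E.
    move=> _; rewrite lee_fin normrM; have [ox|nx] := pselect (obox a b x); last first.
      by rewrite bump3_out// normr0 mulr0 mulr_ge0.
    rewrite indicE mem_set ?mulr1; last exact: sub.
    by rewrite ler_piMr// ger0_norm ?bump3_ge0 ?bump3_le1.
  have H3 n : measurable_fun [set: E3] (fun x => (z x * bump3 n a b x)%:E).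
    apply/measurable_EFinP; apply: measurable_funM => //.
    exact: smooth_measurable (test_bump3 n a b).1.
  have H4 : measurable_fun [set: E3] (fun x => (z x * \1_(obox a b) x)%:E).
    by apply/measurable_EFinP; exact: measurable_funM.
  have [_ _] := dominated_convergence measurableT H3 H4 (aeW _ H1) iN (aeW _ H2).
  rewrite (_ : [sequence _]_n = cst 0%E).
    by move=> /cvg_lim <-//; rewrite lim_cst.
  by apply/funext => n /=; rewrite z0//; exact: test_bump3.
suff ze n : {ae leb3, forall x, symbox n x -> z x = 0}.
  have : leb3.-negligible (\bigcup_n [set x | ~ (symbox n x -> z x = 0)]).
    by apply: negligible_bigcup => n; exact: ze.
  apply: negligibleS => x /= zx; have [n sx] := symbox_cover x.
  by exists n => // /(_ sx).
have mzp : measurable_fun setT (fun x => Num.max (z x) 0 * \1_(symbox n) x).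
  by apply: measurable_funM; [exact: measurable_maxr|apply: measurable_indic; exact: measurable_obox].
have mzn : measurable_fun setT (fun x => Num.max (- z x) 0 * \1_(symbox n) x).
  apply: measurable_funM; [apply: measurable_maxr => //; exact: measurableT_comp|].
  by apply: measurable_indic; exact: measurable_obox.
have zp0 x : 0 <= Num.max (z x) 0 * \1_(symbox n) x by rewrite mulr_ge0// le_max lexx orbT.
have zn0 x : 0 <= Num.max (- z x) 0 * \1_(symbox n) x by rewrite mulr_ge0// le_max lexx orbT.
have [mp [mpE _]] := density_ex leb3 mzp zp0.
have [mn [mnE _]] := density_ex leb3 mzn zn0.
have iS : leb3.-integrable setT (fun x => (`|z x| * \1_(symbox n) x)%:E).
  have := iz n; rewrite integrable_mkcond; last exact: measurable_box.
  apply: le_integrable => //.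
    apply/measurable_EFinP; apply: measurable_funM; first exact: measurableT_comp.
    by apply: measurable_indic; exact: measurable_obox.
  move=> x _; rewrite patchE !indicE/=.
  have [sx|sx] := pselect (symbox n x).
    by rewrite mem_set// mulr1 mem_set ?normr_id//; exact: symbox_sub.
  by rewrite memNset// mulr0 normr0 abse_ge0.
have fin (w : E3 -> R) : measurable_fun setT w -> (forall x, 0 <= w x) ->
    (forall x, w x <= `|z x| * \1_(symbox n) x) -> leb3.-integrable setT (EFin \o w).
  move=> mw w0 wz; apply: le_integrable iS => //; first exact/measurable_EFinP.
  by move=> x _; rewrite lee_fin ger0_norm// ger0_norm// mulr_ge0.
have ip : leb3.-integrable setT (fun x => (Num.max (z x) 0 * \1_(symbox n) x)%:E).
  by apply: (fin _ mzp zp0) => x; rewrite ler_wpM2r// ge_max ler_norm normr_ge0.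
have im : leb3.-integrable setT (fun x => (Num.max (- z x) 0 * \1_(symbox n) x)%:E).
  by apply: (fin _ mzn zn0) => x; rewrite ler_wpM2r// ge_max -normrN ler_norm normr_ge0.
have osym k : oboxes (symbox k) by eexists; eexists.
have agree A : oboxes A -> mp A = mn A.
  move=> oA; have [a [b AE]] := setI_closed_oboxes oA (osym n).
  have mA : measurable A by case: oA => c [d ->]; exact: measurable_obox.
  have ipA := integrableS measurableT mA (@subsetT _ _) ip.
  have imA := integrableS measurableT mA (@subsetT _ _) im.
  have fp := integrable_fin_num mA ipA; have fm := integrable_fin_num mA imA.
  rewrite mpE// mnE// -[LHS](subeK _ fm) -[RHS]add0e; congr (_ + _)%E.
  apply: (etrans (esym (@integralB_EFin _ _ _ leb3 A
    (fun x => Num.max (z x) 0 * \1_(symbox n) x)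
    (fun x => Num.max (- z x) 0 * \1_(symbox n) x) mA ipA imA))).
  rewrite integral_mkcond -[RHS](zbox a b); apply: eq_integral => x _.
  rewrite -AE patchE [in RHS]indicE in_setI; case: (x \in A) => /=; last by rewrite mulr0.
  rewrite -EFinB -mulrBl indicE; congr ((_ * _)%:E).
  have [z_ge0|z_le0] := leP 0 (z x).
    by rewrite max_r ?oppr_le0// subr0.
  by rewrite max_l ?oppr_ge0 ?(ltW z_le0)// sub0r opprK.
have eqm A : measurable A -> mp A = mn A.
  apply: (measure_unique oboxes symbox) => //.
  - by apply/funext => B; exact: measurable_oboxes.
  - exact: setI_closed_oboxes.
  - by apply/seteqP; split => // x _; have [k sx] := symbox_cover x; exists k.
  move=> k; rewrite mpE; last exact: measurable_obox.
  have mk : measurable (symbox k) by exact: measurable_obox.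
  have := integrable_fin_num mk (integrableS measurableT mk (@subsetT _ _) ip).
  by rewrite ge0_fin_numE//; apply: integral_ge0 => x _; rewrite lee_fin.
have zero (w : E3 -> R) : measurable_fun setT w -> (forall x, 0 <= w x) ->
    (\int[leb3]_x (w x)%:E = 0)%E -> {ae leb3, forall x, w x = 0}.
  move=> mw w0 wi.
  have mwE : measurable_fun setT (EFin \o w) by exact/measurable_EFinP.
  have /(ae_eq_integral_abs leb3 measurableT mwE) : (\int[leb3]_x `|(EFin \o w) x| = 0)%E.
    by rewrite -[RHS]wi; apply: eq_integral => x _; rewrite /= ger0_norm.
  by apply: filterS => x /(_ I) [].
have mpos : measurable [set x | 0 < z x].
  by rewrite -[X in measurable X]setTI; exact: measurable_fun_ltr.
have mneg : measurable [set x | z x < 0].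
  by rewrite -[X in measurable X]setTI; exact: measurable_fun_ltr.
have /zero : (\int[leb3]_x (Num.max (z x) 0 * \1_(symbox n) x)%:E = 0)%E.
  transitivity (mp [set x | 0 < z x]).
    rewrite mpE// [RHS]integral_mkcond; apply: eq_integral => x _; rewrite patchE.
    case: ifPn => //; rewrite notin_setE/= => /negP; rewrite -leNgt => zx.
    by rewrite max_r// mul0r.
  rewrite eqm// mnE//; apply: integral0_eq => x /= zx.
  by rewrite max_r ?mul0r// oppr_le0 ltW.
have /zero : (\int[leb3]_x (Num.max (- z x) 0 * \1_(symbox n) x)%:E = 0)%E.
  transitivity (mn [set x | z x < 0]).
    rewrite mnE// [RHS]integral_mkcond; apply: eq_integral => x _; rewrite patchE.
    case: ifPn => //; rewrite notin_setE/= => /negP; rewrite -leNgt => zx.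
    by rewrite max_r ?oppr_le0// mul0r.
  rewrite -eqm// mpE//; apply: integral0_eq => x /= zx.
  by rewrite max_r ?mul0r// ltW.
move=> /(_ mzn zn0) hn /(_ mzp zp0) hp.
move: hn hp; apply: filterS2 => x; rewrite !indicE => hn hp sx.
move: hn hp; rewrite mem_set// !mulr1.
have [z_ge0|z_lt0] := leP 0 (z x); first by [].
by move=> + _; rewrite max_l ?oppr_ge0 ?(ltW z_lt0)// => /eqP; rewrite oppr_eq0 => /eqP.
Qed.

End fundamental.

(** * Translations paired with test functions *)

Section shift.
Variable R : realType.
Local Notation E3 := (E3 R).
Local Notation leb3 := (leb3 R).
Local Notation box := (@box R).
Local Notation lam := (@lebesgue_measure R).
Implicit Types (u w g phi psi F : E3 -> R) (v x : E3).

Lemma affine1 v x : affine v 1 x = x + v.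
Proof. by rewrite /affine scale1r addrC. Qed.

Lemma measurable_shift v : measurable_fun setT (fun x : E3 => x + v).
Proof.
by rewrite (_ : (fun x => _) = affine v 1);
  [exact: measurable_affine|apply/funext => x; rewrite affine1].
Qed.

Lemma ge0_integral_shift (f : E3 -> \bar R) v : measurable_fun setT f ->
  (forall x, 0 <= f x)%E -> (\int[leb3]_x f (x + v)%R = \int[leb3]_x f x)%E.
Proof.
move=> mf f0; rewrite [RHS](ge0_integral_affine v (@ltr01 R))// expr1n mul1e.
by apply: eq_integral => x _; rewrite affine1.
Qed.

Lemma integral_shift (f : E3 -> \bar R) v : leb3.-integrable setT f ->
  (\int[leb3]_x f (x + v)%R = \int[leb3]_x f x)%E.
Proof.
move=> fi; rewrite [RHS](integral_affine v (@ltr01 R))// expr1n mul1e.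
by apply: eq_integral => x _; rewrite affine1.
Qed.

Lemma L2_shift u v : L2 u -> L2 (fun x => u (x + v)).
Proof.
move=> [mu ui]; split; first by apply: measurableT_comp => //; exact: measurable_shift.
rewrite (ge0_integral_shift v (f := fun x => (u x ^+ 2)%:E))//.
  by apply/measurable_EFinP; exact: measurable_funX.
by move=> x; rewrite lee_fin sqr_ge0.
Qed.

Lemma L2_add u w : L2 u -> L2 w -> L2 (fun x => u x + w x).
Proof.
move=> lu lw; split; first exact: measurable_funD lu.1 lw.1.
have := integrableD measurableT (integrableZl measurableT 2 (L2_sqr lu)) (integrableZl measurableT 2 (L2_sqr lw)).
move=> /integrableP[_]; apply: le_lt_trans; apply: ge0_le_integral => //.
- by move=> x _; rewrite lee_fin sqr_ge0.
- by apply/measurable_EFinP; apply: measurable_funX; exact: measurable_funD lu.1 lw.1.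
- apply/measurable_EFinP; apply: measurableT_comp => //; apply: measurable_funD;
    by apply: measurable_funM => //; apply: measurable_funX; first [exact: lu.1|exact: lw.1].
move=> x _; rewrite lee_fin; apply: le_trans (ler_norm _).
by have := sqr_ge0 (u x - w x); nra.
Qed.

Lemma L2_cmul c u : L2 u -> L2 (fun x => c * u x).
Proof.
move=> lu; split; first exact: measurable_funM lu.1.
have := integrableZl measurableT (c ^+ 2) (L2_sqr lu).
move=> /integrableP[_]; apply: le_lt_trans; apply: ge0_le_integral => //.
- by move=> x _; rewrite lee_fin sqr_ge0.
- by apply/measurable_EFinP; apply: measurable_funX; exact: measurable_funM lu.1.
- apply/measurable_EFinP; apply: measurableT_comp => //.
  by apply: measurable_funM => //; apply: measurable_funX; exact: lu.1.
by move=> x _; rewrite lee_fin exprMn ler_norm.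
Qed.

Lemma measurable_box_indic n : measurable_fun setT (\1_(box n) : E3 -> R).
Proof. by apply: measurable_indic; exact: measurable_box. Qed.

Lemma L2_box n : L2 (\1_(box n) : E3 -> R).
Proof.
have mI := measurable_box_indic n; split=> //.
rewrite (eq_integral (fun x => (\1_(box n) x : R)%:E)); last first.
  by move=> x _; rewrite indicE -natrX -mulnn mulnb andbb.
by rewrite integral_indic ?setIT//; [exact: leb3_box|exact: measurable_box].
Qed.

Lemma L2_integrable_box u n : L2 u -> leb3.-integrable (box n) (EFin \o u).
Proof.
move=> lu; have mb := @measurable_box R n.
apply/(integrable_mkcond _ mb); apply: eq_integrable (L2_mul lu (L2_box n)) => // x _.
by rewrite patchE indicE; case: (x \in _); rewrite ?mulr1 ?mulr0.
Qed.

(** One bounded function with bounded support dominates all translates with [t] in a compact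
    interval: the domination required to differentiate under the integral. *)
Lemma test_dom psi v (T : R) : test_function psi -> exists (C : R) m, 0 <= C /\
  forall x (t : R), `|t| <= T -> `|psi (x + t *: v)| <= C * \1_(box m) x.
Proof.
move=> tpsi; have [n psi0] := test_box tpsi; have [C C0 psiC] := test_bounded tpsi.
pose m := (Num.trunc (n%:R + T * `|v|)).+1; exists C, m; split=> // x t tT.
rewrite indicE; have [bx|nx] := pselect (box m x); first by rewrite mem_set// mulr1.
rewrite memNset// mulr0 psi0 ?normr0// => /box_normP bx; apply: nx; apply/box_normP.
have -> : x = x + t *: v - t *: v by rewrite addrK.
apply: (le_trans (ler_normB _ _)); apply: (@le_trans _ _ (n%:R + T * `|v|)).
  by rewrite lerD// normrZ ler_wpM2r.
exact: (ltW (truncnS_gt _)).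
Qed.

(** The translation acts on the test function, so this is differentiable in [t] although [u] is only
    square integrable. *)
Definition pairing u phi v (t : R) : R := \int[leb3]_x (u x * phi (x + t *: v)).

Lemma test_shift phi v (t : R) : test_function phi -> test_function (fun x => phi (x + t *: v)).
Proof.
move=> tphi; rewrite (_ : (fun x => _) = phi \o affine (t *: v) 1).
  exact: test_affine.
by apply/funext => x /=; rewrite affine1.
Qed.

Lemma derive_line phi v x (t : R) : smooth phi ->
  is_derive t (1 : R) (fun s : R => phi (x + s *: v)) ('D_v phi (x + t *: v)).
Proof. by move=> sphi; apply/is_derive_line; apply: derivableP; exact: smooth_derivable. Qed.

Lemma is_derive_pairing u phi v (t : R) : L2 u -> test_function phi ->
  is_derive t (1 : R) (pairing u phi v) (pairing u ('D_v phi) v t).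
Proof.
move=> lu tphi.
have tD := test_derive v tphi.
(* The radius |t| + 1 covers all parameters at distance less than 1 from [t]. *)
have [C [m [C0 domC]]] := test_dom v (`|t| + 1) tD.
pose G x := `|u x| * (C * \1_(box m) x).
have Ia : `](t - 1), (t + 1)[%classic t by rewrite /= in_itv/=; apply/andP; split; lra.
have intf s : `](t - 1), (t + 1)[%classic s ->
    leb3.-integrable setT (EFin \o (fun x => u x * phi (x + s *: v))).
  by move=> _; exact: (L2_mul lu (test_L2 (test_shift v s tphi))).
have derf x (s : R) : is_derive s (1 : R) (fun r : R => u x * phi (x + r *: v))
    (u x * 'D_v phi (x + s *: v)).
  by have := is_deriveZ (u x) (derive_line v x s tphi.1).
have derf1 s x : `](t - 1), (t + 1)[%classic s -> setT x ->
    derivable (fun r : R => u x * phi (x + r *: v)) s 1.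
  by move=> _ _; exact: ex_derive.
have G0 x : 0 <= G x by rewrite !mulr_ge0.
have iG : leb3.-integrable setT (EFin \o G).
  have := integrable_norm (L2_mul lu (L2_cmul C (L2_box m))).
  apply: eq_integrable => // x _; rewrite /G /= normrM; congr (_ * _)%:E.
  by rewrite ger0_norm// mulr_ge0.
have d1E x s : partial1of2 (fun (r : R) (x : E3) => u x * phi (x + r *: v)) s x = u x * 'D_v phi (x + s *: v).
  by rewrite /partial1of2 derive1E; exact: derive_val.
have Gub s x : `](t - 1), (t + 1)[%classic s -> setT x ->
    `|partial1of2 (fun (r : R) (x : E3) => u x * phi (x + r *: v)) s x| <= G x.
  rewrite /= in_itv/= => /andP[s1 s2] _; rewrite d1E normrM ler_wpM2l// domC//.
  by have := ler_norm t; have := ler_norm (- t); rewrite normrN ler_norml => ? ?; apply/andP; split; lra.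
have dF := derivable_under_integral measurableT Ia intf derf1 G0 iG Gub.
apply: DeriveDef; first exact: dF.
rewrite -derive1E (differentiation_under_integral measurableT Ia intf derf1 G0 iG Gub).
by apply: eq_Rintegral => x _; rewrite d1E.
Qed.

Lemma pairing_shift u phi v (t : R) : L2 u -> test_function phi ->
  pairing u phi (- v) t = \int[leb3]_x (u (x + t *: v) * phi x).
Proof.
move=> lu tphi; rewrite /pairing /Rintegral; congr fine.
rewrite -(integral_shift (t *: v) (f := fun x => (u x * phi (x + t *: - v))%:E)).
  by apply: eq_integral => x _; rewrite scalerN addrK.
exact: (L2_mul lu (test_L2 (test_shift (- v) t tphi))).
Qed.

Lemma derive_opp phi v x : smooth phi -> 'D_(- v) phi x = - 'D_v phi x.
Proof.
move=> sphi; apply: derive_val.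
have := (is_derive_line phi x (- v) 0 (- 'D_v phi x)).2.
rewrite scale0r addr0; apply.
have -> : (fun s : R => phi (x + s *: - v)) = (fun s : R => phi (x + s *: v)) \o -%R.
  by apply/funext => s /=; rewrite scaleNr scalerN.
rewrite -mulrN1; apply: is_derive1_comp.
rewrite oppr0; have := derive_line v x 0 sphi; by rewrite scale0r addr0.
Qed.

(** The weak derivative is tested on translates of [phi]. The direction is [- v] because moving
    [phi] backwards amounts to moving [u] forwards, see [pairing_shift]; this sign cancels the one
    in the weak derivative. *)
Lemma pairing_weak u g phi v (t : R) : L2 u -> L2 g -> weak_derivative v u g ->
  test_function phi -> pairing u ('D_(- v) phi) (- v) t = pairing g phi (- v) t.
Proof.
move=> lu lg wd tphi.
have := wd _ (test_shift (- v) t tphi).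
have E x : 'D_v (fun x => phi (x + t *: - v)) x = 'D_v phi (x + t *: - v).
  have e : (fun x => phi (x + t *: - v)) = phi \o affine (t *: - v) 1.
    by apply/funext => y /=; rewrite affine1.
  have := congr1 (fun F => F x) (derive_affine (t *: - v) 1 v tphi.1).
  by rewrite /= -e => ->; rewrite mul1r affine1.
under eq_integral do rewrite E.
move=> e; rewrite /pairing /Rintegral.
congr fine.
transitivity (\int[leb3]_x (- (u x * 'D_v phi (x + t *: - v))%:E))%E.
  by apply: eq_integral => x _; rewrite derive_opp ?mulrN//; exact: tphi.1.
rewrite integralN; last first.
  have := integrable_fin_num measurableT (L2_mul lu (test_L2 (test_shift (- v) t (test_derive v tphi)))).
  move=> h; apply: integrable_add_def => //.
  exact: (L2_mul lu (test_L2 (test_shift (- v) t (test_derive v tphi)))).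
by rewrite e oppeK.
Qed.

Lemma continuous_pairing u phi v : L2 u -> test_function phi -> continuous (pairing u phi v).
Proof.
move=> lu tphi t; apply: differentiable_continuous; apply/derivable1_diffP.
by have [] := is_derive_pairing v t lu tphi.
Qed.

(** The identity u(x + h v) - u(x) = integral over [0, h] of g(x + t v), tested against [phi]. *)
Lemma pairing_FTC u g phi v (h : R) : 0 < h -> L2 u -> L2 g -> weak_derivative v u g ->
  test_function phi ->
  (\int[lam]_(t in `[0%R, h]) (pairing g phi (- v) t)%:E =
   (pairing u phi (- v) h)%:E - (pairing u phi (- v) 0)%:E)%E.
Proof.
move=> h0 lu lg wd tphi.
have d t : is_derive t (1 : R) (pairing u phi (- v)) (pairing g phi (- v) t).
  by rewrite -(pairing_weak t lu lg wd tphi); exact: is_derive_pairing.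
have cu := continuous_pairing (v := - v) lu tphi.
apply: continuous_FTC2 => //.
- by apply: continuous_subspaceT; exact: continuous_pairing.
- split.
  + by move=> t _; exact: ex_derive.
  + by apply: cvg_at_right_filter; exact: cu.
  + by apply: cvg_at_left_filter; exact: cu.
- by move=> t _; rewrite derive1E; exact: derive_val.
Qed.

End shift.

(** * Increments of Sobolev functions along a direction *)

Section difference_quotient.
Variable R : realType.
Local Notation E3 := (E3 R).
Local Notation leb3 := (leb3 R).
Local Notation box := (@box R).
Local Notation lam := (@lebesgue_measure R).
Local Notation M := (measurableTypeR R).
Implicit Types (u w g phi psi F : E3 -> R) (v x : E3) (h : R).

(** As a factor of the integrand, the indicator lets [t] range over the whole line, where Tonelli
    and Fubini are applied. *)
Definition strip h (t : R) : R := \1_(`[0, h]%classic) t.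

Lemma measurable_strip h : measurable_fun setT (strip h : M -> R).
Proof. by apply: measurable_indic; exact: measurable_itv. Qed.

Lemma strip_ge0 h t : 0 <= strip h t. Proof. by []. Qed.

Lemma measurable_line v : measurable_fun setT (fun p : E3 * M => p.1 + (p.2 : R) *: v).
Proof.
apply: measurable_fun_pair; first apply: measurable_fun_pair.
all: apply: measurable_funD; last by apply: measurable_funM => //; exact: measurable_snd.
- by apply: (measurableT_comp (f := fst)); [exact: measurable_fst|apply: (measurableT_comp (f := fst)); exact: measurable_fst].
- by apply: (measurableT_comp (f := snd)); [exact: measurable_snd|apply: (measurableT_comp (f := fst)); exact: measurable_fst].
- by apply: (measurableT_comp (f := snd)); [exact: measurable_snd|exact: measurable_fst].
Qed.

Lemma measurable_along g v h : measurable_fun setT g ->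
  measurable_fun setT (fun p : E3 * M => g (p.1 + (p.2 : R) *: v) * strip h p.2).
Proof.
move=> mg; apply: measurable_funM.
  by apply: (measurableT_comp mg); exact: measurable_line.
by apply: (measurableT_comp (measurable_strip h)); exact: measurable_snd.
Qed.

Lemma measurable_along_x g v h x : measurable_fun setT g ->
  measurable_fun setT (fun t : M => g (x + (t : R) *: v) * strip h t).
Proof.
move=> mg; have mp : measurable_fun setT (fun t : M => (x, t)) by exact: measurable_fun_pair.
exact: (measurableT_comp (measurable_along v h mg) mp).
Qed.

(** The integral of |g| along the segment from x to x + h v, not divided by [h]; possibly
    infinite. *)
Definition mean g v h x : \bar R :=
  (\int[lam]_t (`|g (x + (t : R) *: v)| * strip h t)%:E)%E.

Lemma measurable_mean g v h : measurable_fun setT g -> measurable_fun setT (mean g v h).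
Proof.
move=> mg; apply: (measurable_fun_fubini_tonelli_F (m2 := lam)
  (fun p : E3 * M => (`|g (p.1 + (p.2 : R) *: v)| * strip h p.2)%:E)).
  apply/measurable_EFinP; apply: (measurable_along v h (g := fun x => `|g x|)).
  exact: measurableT_comp.
by move=> p; rewrite lee_fin mulr_ge0.
Qed.

Lemma mean_ge0 g v h x : (0 <= mean g v h x)%E.
Proof. by apply: integral_ge0 => t _; rewrite lee_fin mulr_ge0. Qed.

(** Tonelli moves the integral in [t] outside. For each [t] Young's inequality |w g| <= eta w^2 / 2
    + g^2 / (2 eta) is integrated in [x], where the translation of [g] disappears; what is left is
    constant over an interval of length [h]. *)
Lemma strip_bound w g v h (eta : R) : L2 w -> L2 g -> 0 <= h -> 0 < eta ->
  (\int[leb3]_x (`|w x|%:E * mean g v h x) <= (h / 2)%:E *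
    (eta%:E * \int[leb3]_x (w x ^+ 2)%:E + eta^-1%:E * \int[leb3]_x (g x ^+ 2)%:E))%E.
Proof.
move=> lw lg h0 eta0; have mg := lg.1; have mw := lw.1.
have mng : measurable_fun setT (fun x => `|g x|) by exact: measurableT_comp.
have mnw : measurable_fun setT (fun x => `|w x|) by exact: measurableT_comp.
have mgE : measurable_fun setT (fun x => (g x ^+ 2)%:E).
  by apply/measurable_EFinP; exact: measurable_funX.
have mwE : measurable_fun setT (fun x => (w x ^+ 2)%:E).
  by apply/measurable_EFinP; exact: measurable_funX.
pose B := (eta%:E * \int[leb3]_x (w x ^+ 2)%:E + eta^-1%:E * \int[leb3]_x (g x ^+ 2)%:E)%E.
have I0 (f : E3 -> R) : (0 <= \int[leb3]_x (f x ^+ 2)%:E)%E.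
  by apply: integral_ge0 => x _; rewrite lee_fin sqr_ge0.
have B0 : (0 <= B)%E.
  by apply: adde_ge0; apply: mule_ge0 => //; rewrite lee_fin ?invr_ge0 ltW.
pose k (p : E3 * M) := (`|w p.1| * (`|g (p.1 + (p.2 : R) *: v)| * strip h p.2))%:E.
have mk : measurable_fun setT k.
  apply/measurable_EFinP; apply: measurable_funM.
    by apply: (measurableT_comp mnw); exact: measurable_fst.
  exact: (measurable_along v h mng).
have k0 p : (0 <= k p)%E by rewrite lee_fin !mulr_ge0.
rewrite [leLHS](_ : _ = \int[leb3]_x \int[lam]_t k (x, t))%E; last first.
  apply: eq_integral => x _; rewrite -ge0_integralZl//.
  - by apply/measurable_EFinP; exact: (measurable_along_x v h x mng).
  - by move=> t _; rewrite lee_fin mulr_ge0.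
rewrite (fubini_tonelli (m1 := @leb3s R : {sigma_finite_measure set _ -> \bar R}) (m2 := lam) k mk k0).
apply: (@le_trans _ _ (\int[lam]_t (2^-1%:E * B * (strip h t)%:E)))%E.
  apply: ge0_le_integral => //.
  - by move=> t _; apply: integral_ge0.
  - exact: (measurable_fun_fubini_tonelli_G (m1 := @leb3s R : {sigma_finite_measure set _ -> \bar R}) k mk k0).
  - by apply: measurable_funeM; apply/measurable_EFinP; exact: measurable_strip.
  move=> t _; pose gt x := g (x + (t : R) *: v).
  have lgt : L2 gt by exact: L2_shift.
  apply: (@le_trans _ _ (\int[leb3]_x ((strip h t)%:E * ((eta / 2 * w x ^+ 2)%:E + (eta^-1 / 2 * gt x ^+ 2)%:E))))%E.
    apply: ge0_le_integral => //.
    - by apply: (measurableT_comp mk); exact: measurable_fun_pair.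
    - apply/measurable_EFinP; apply: measurable_funM => //; apply: measurable_funD;
      by apply: measurable_funM => //; apply: measurable_funX; first [exact: mw|exact: lgt.1].
    move=> x _; rewrite /k /= -EFinD -EFinM lee_fin -/(gt x) mulrA mulrC ler_wpM2l//.
    rewrite -(real_normK (num_real (w x))) -(real_normK (num_real (gt x))).
    move: (`|w x|) (`|gt x|) => a c.
    have E : eta / 2 * a ^+ 2 + eta^-1 / 2 * c ^+ 2 - a * c = (eta * a - c) ^+ 2 * (eta^-1 / 2).
      by field; rewrite gt_eqF.
    by rewrite -subr_ge0 E mulr_ge0 ?sqr_ge0// divr_ge0 ?invr_ge0 ?ltW.
  rewrite ge0_integralZl//; last 3 first.
  - by apply: emeasurable_funD; apply/measurable_EFinP;
      apply: measurable_funM => //; apply: measurable_funX; first [exact: mw|exact: lgt.1].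
  - by move=> x _; rewrite -EFinD lee_fin addr_ge0// mulr_ge0 ?sqr_ge0// ?divr_ge0// ?invr_ge0 ltW.
  - by rewrite lee_fin strip_ge0.
  rewrite muleC lee_wpmul2r ?lee_fin//.
  rewrite ge0_integralD//; last 4 first.
  - by move=> x _; rewrite lee_fin mulr_ge0 ?sqr_ge0// divr_ge0// ltW.
  - by apply/measurable_EFinP; apply: measurable_funM => //; exact: measurable_funX.
  - by move=> x _; rewrite lee_fin mulr_ge0 ?sqr_ge0// divr_ge0// invr_ge0 ltW.
  - by apply/measurable_EFinP; apply: measurable_funM => //; apply: measurable_funX; exact: lgt.1.
  under eq_integral do rewrite EFinM.
  rewrite ge0_integralZl//; last 2 first.
  - by move=> x _; rewrite lee_fin sqr_ge0.
  - by rewrite lee_fin divr_ge0// ltW.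
  under [X in (_ + X)%E]eq_integral do rewrite EFinM.
  rewrite ge0_integralZl//; last 3 first.
  - by apply/measurable_EFinP; apply: measurable_funX; exact: lgt.1.
  - by move=> x _; rewrite lee_fin sqr_ge0.
  - by rewrite lee_fin divr_ge0// invr_ge0 ltW.
  rewrite (ge0_integral_shift (t *: v) (f := fun x => (g x ^+ 2)%:E))//; last first.
    by move=> x; rewrite lee_fin sqr_ge0.
  rewrite /B; move: (I0 w) (I0 g).
  move: (\int[leb3]_x (w x ^+ 2)%:E)%E (\int[leb3]_x (g x ^+ 2)%:E)%E => Iw Ig Iw0 Ig0.
  rewrite ge0_muleDr ?mule_ge0 ?lee_fin ?invr_ge0 ?(ltW eta0)//.
  by rewrite !muleA -!EFinM (mulrC eta) (mulrC eta^-1).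
rewrite ge0_integralZl//; last 3 first.
- by apply/measurable_EFinP; exact: measurable_strip.
- by move=> t _; rewrite lee_fin.
- by rewrite mule_ge0// lee_fin invr_ge0.
have -> : (\int[lam]_t (strip h t)%:E = h%:E)%E.
  have mI : measurable (`[0, h]%classic : set M) by exact: measurable_itv.
  have HL : lam [set` `[0, h]] = _ := lebesgue_measure_itv _.
  rewrite (@integral_indic _ _ _ lam setT _ _ mI)// setIT [LHS]HL/= lte_fin.
  by case: ltP => [_|hle0]; [rewrite oppr0 adde0|congr EFin; apply/le_anti/andP].
by rewrite muleC muleA -EFinM.
Qed.

(** [strip_bound] with the indicator of a box as [w] makes the mean integrable on that box, hence
    finite almost everywhere there. *)
Lemma mean_fin_num_ae g v h : L2 g -> 0 <= h ->
  {ae leb3, forall x, mean g v h x \is a fin_num}.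
Proof.
move=> lg h0.
suff mf n : {ae leb3, forall x, box n x -> mean g v h x \is a fin_num}.
  have : leb3.-negligible (\bigcup_n [set x | ~ (box n x -> mean g v h x \is a fin_num)]).
    by apply: negligible_bigcup => n; exact: mf.
  apply: negligibleS => x /= zx; have [n bx] := box_cover x.
  by exists n => // /(_ (bx _ (leqnn n))).
have mm := measurable_mean v h lg.1.
have : leb3.-integrable setT (fun x => `|\1_(box n) x : R|%:E * mean g v h x)%E.
  apply/integrableP; split.
    apply: emeasurable_funM => //; apply/measurable_EFinP.
    by apply: measurableT_comp => //; exact: measurable_box_indic.
  rewrite (eq_integral (fun x => `|\1_(box n) x : R|%:E * mean g v h x)%E); last first.
    by move=> x _; rewrite gee0_abs// mule_ge0// mean_ge0.
  apply: (le_lt_trans (strip_bound v (L2_box R n) lg h0 (@ltr01 R))).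
  rewrite invr1 !mul1e lte_mul_pinfty ?lee_fin ?divr_ge0//.
  by rewrite lte_add_pinfty//; [exact: (L2_box R n).2|exact: lg.2].
move=> /(integrable_ae measurableT); apply: filterS => x /(_ I) /= + bx.
by rewrite indicE mem_set//= normr1 mul1e.
Qed.

(** Let Gamma(x) be the integral of g(x + t v) over [0, h]. By Fubini and [pairing_FTC], u(x + h v)
    - u(x) - Gamma(x) is orthogonal to all test functions, hence zero almost everywhere; and |Gamma|
    is at most the mean. *)
Lemma increment_le_mean u g v h : L2 u -> L2 g -> weak_derivative v u g -> 0 < h ->
  {ae leb3, forall x, (`|u (x + h *: v) - u x|%:E <= mean g v h x)%E}.
Proof.
move=> lu lg wd h0; have mg := lg.1.
pose k (p : E3 * M) := g (p.1 + (p.2 : R) *: v) * strip h p.2.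
have mk : measurable_fun setT k by exact: measurable_along.
have mkE : measurable_fun setT (EFin \o k) by exact/measurable_EFinP.
pose GE x := (\int[lam]_t (k (x, t))%:E)%E.
pose Gamma x := fine (GE x).
have mGE : measurable_fun setT GE.
  rewrite (_ : GE = (fun x => fubini_F lam (EFin \o k)^\+ x - fubini_F lam (EFin \o k)^\- x)%E).
    apply: emeasurable_funB; apply: measurable_fun_fubini_tonelli_F => //.
      exact: measurable_funepos.
    exact: measurable_funeneg.
  apply/funext => x; rewrite /GE integralE /fubini_F.
  have -> : (fun t => (k (x, t))%:E)^\+%E = (fun t => (EFin \o k)^\+%E (x, t)).
    exact: (funepos_comp (EFin \o k) (pair x)).
  have -> : (fun t => (k (x, t))%:E)^\-%E = (fun t => (EFin \o k)^\-%E (x, t)).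
    exact: (funeneg_comp (EFin \o k) (pair x)).
  by [].
have mGamma : measurable_fun setT Gamma by apply: measurableT_comp => //; exact: measurable_fine.
have GE_le x : (`|GE x| <= mean g v h x)%E.
  apply: (le_trans (le_abse_integral _ _ _)) => //.
    by apply/measurable_EFinP; exact: (measurable_along_x v h x mg).
  rewrite le_eqVlt; apply/orP; left; apply/eqP; apply: eq_integral => t _.
  by rewrite /= normrM (ger0_norm (strip_ge0 _ _)).
(* Where [GE x] is infinite, [fine] returns 0 and the bound is trivial. *)
have Gamma_le x : (`|Gamma x|%:E <= mean g v h x)%E.
  apply: le_trans (GE_le x); rewrite /Gamma.
  by case: (GE x) => [r| |] //=; rewrite normr0 ?leey.
have iw w : L2 w -> leb3.-integrable setT (fun x => `|w x|%:E * mean g v h x)%E.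
  move=> lw; apply/integrableP; split.
    apply: emeasurable_funM; last exact: measurable_mean.
    by apply/measurable_EFinP; apply: measurableT_comp => //; exact: lw.1.
  rewrite (eq_integral (fun x => `|w x|%:E * mean g v h x)%E); last first.
    by move=> x _; rewrite gee0_abs// mule_ge0// mean_ge0.
  apply: (le_lt_trans (strip_bound v lw lg (ltW h0) (@ltr01 R))).
  rewrite invr1 !mul1e lte_mul_pinfty ?lee_fin ?divr_ge0 ?ltW//.
  by rewrite lte_add_pinfty//; [exact: lw.2|exact: lg.2].
have iGw w : L2 w -> leb3.-integrable setT (fun x => (Gamma x * w x)%:E).
  move=> lw; apply: le_integrable (iw w lw) => //.
    by apply/measurable_EFinP; apply: measurable_funM => //; exact: lw.1.
  move=> x _; rewrite [leRHS]gee0_abs ?mule_ge0 ?mean_ge0//.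
  by rewrite /= normrM mulrC EFinM lee_wpmul2l// lee_fin.
have lsu : L2 (fun x => u (x + h *: v)) by exact: L2_shift.
have FubG phi : test_function phi -> (\int[leb3]_x (Gamma x * phi x)%:E =
    \int[lam]_(t in `[0%R, h]) (pairing g phi (- v) t)%:E)%E.
  move=> tphi; have lphi := test_L2 tphi; have mphi := lphi.1.
  pose K (p : E3 * M) := (k p * phi p.1)%:E.
  have mK : measurable_fun setT K.
    apply/measurable_EFinP; apply: measurable_funM => //.
    by apply: (measurableT_comp mphi); exact: measurable_fst.
  (* Integrability on the product comes from [strip_bound] for [phi] and [g], through [iw]. *)
  have iK : (@leb3s R \x lam)%E.-integrable setT K.
    apply/(@integrable12ltyP _ _ _ _ R (@leb3s R : {sigma_finite_measure set _ -> \bar R}) lam K mK) => //.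
    have /integrableP[_] := iw phi lphi; congr (_ < _)%E; apply: eq_integral => x _.
    rewrite gee0_abs ?mule_ge0 ?mean_ge0// /mean -ge0_integralZl//; last 2 first.
    - apply/measurable_EFinP.
      by apply: (measurable_along_x v h x (g := fun x => `|g x|)); exact: measurableT_comp.
    - by move=> t _; rewrite lee_fin mulr_ge0.
    apply: eq_integral => t _; rewrite /K /k /= normrM (normrM (g _)) (ger0_norm (strip_ge0 _ _)).
    by rewrite -EFinM mulrC.
  transitivity (\int[leb3]_x \int[lam]_t K (x, t))%E.
    apply: ae_eq_integral => //.
    - by have /integrableP[] := iGw phi lphi.
    - exact: (@measurable_fubini_F _ _ _ _ R (@leb3s R : {sigma_finite_measure set _ -> \bar R}) lam K iK).
    have := mean_fin_num_ae v lg (ltW h0); apply: filterS => x mfin _.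
    have ik : lam.-integrable setT (fun t => (k (x, t))%:E).
      apply/integrableP; split.
        by apply/measurable_EFinP; exact: (measurable_along_x v h x mg).
      move: mfin; rewrite ge0_fin_numE ?mean_ge0//; congr (_ < _)%E.
      by apply: eq_integral => t _; rewrite /= normrM (ger0_norm (strip_ge0 _ _)).
    transitivity (\int[lam]_t ((k (x, t))%:E * (phi x)%:E))%E; last first.
      by apply: eq_integral => t _; rewrite /K EFinM.
    by rewrite (integralZr _ ik)// /Gamma EFinM fineK//; exact: integrable_fin_num ik.
  rewrite (@integral12_prod_meas1 _ _ _ _ R (@leb3s R : {sigma_finite_measure set _ -> \bar R}) lam K iK).
  rewrite -(@integral21_prod_meas1 _ _ _ _ R (@leb3s R : {sigma_finite_measure set _ -> \bar R}) lam K iK).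
  rewrite [RHS]integral_mkcond; apply: eq_integral => t _.
  have ig : leb3.-integrable setT (fun x => (g (x + (t : R) *: v) * phi x)%:E).
    exact: (L2_mul (L2_shift (t *: v) lg) lphi).
  transitivity (\int[leb3]_x ((strip h t)%:E * (g (x + (t : R) *: v) * phi x)%:E))%E.
    by apply: eq_integral => x _; rewrite /K /k -EFinM/= mulrAC mulrC.
  rewrite integralZl// patchE /strip indicE.
  case: ifPn => _; last by rewrite mul0e.
  by rewrite mul1e (pairing_shift v t lg tphi) /Rintegral fineK//; exact: integrable_fin_num.
pose z x := u (x + h *: v) - u x - Gamma x.
have mz : measurable_fun setT z.
  by apply: measurable_funB => //; apply: measurable_funB; [exact: lsu.1|exact: lu.1].
have z0 : {ae leb3, forall x, z x = 0}.
  apply: fundamental_lemma => // [n|phi tphi].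
    have mb := @measurable_box R n.
    have i1 := L2_integrable_box n lsu; have i2 := L2_integrable_box n lu.
    have i3 : leb3.-integrable (box n) (EFin \o Gamma).
      apply/(integrable_mkcond _ mb); apply: eq_integrable (iGw _ (L2_box R n)) => // x _.
      by rewrite patchE indicE; case: (x \in _); rewrite ?mulr1 ?mulr0.
    exact: (integrableB mb (integrableB mb i1 i2) i3).
  have lphi := test_L2 tphi.
  have i1 := L2_mul lsu lphi; have i2 := L2_mul lu lphi; have i3 := iGw _ lphi.
  transitivity (\int[leb3]_x (((u (x + h *: v) * phi x)%:E - (u x * phi x)%:E) - (Gamma x * phi x)%:E))%E.
    by apply: eq_integral => x _; rewrite /z -!EFinB !mulrBl.
  rewrite (integralB measurableT (integrableB measurableT i1 i2) i3) (integralB measurableT i1 i2).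
  rewrite FubG// (pairing_FTC h0 lu lg wd tphi) !(pairing_shift _ _ lu tphi) /Rintegral.
  rewrite !fineK; last 2 first.
  - by under eq_integral do rewrite scale0r addr0; exact: integrable_fin_num i2.
  - exact: integrable_fin_num i1.
  under [X in (_ - (_ - X))%E]eq_integral do rewrite scale0r addr0.
  rewrite subee// fin_numB; apply/andP.
  by split; [exact: integrable_fin_num i1|exact: integrable_fin_num i2].
move: z0; apply: filterS => x /eqP; rewrite subr_eq0 => /eqP ->; exact: Gamma_le.
Qed.

End difference_quotient.

(** * Coulomb uncertainty for weak gradients *)

Section coulomb.
Variable R : realType.
Local Notation E3 := (E3 R).
Local Notation leb3 := (leb3 R).
Implicit Types (u w g phi psi F : E3 -> R) (v x : E3) (h : R).

Lemma L2_bounded_integrable u F : L2 u -> measurable_fun setT F ->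
  (forall x, `|F x| <= 1) -> leb3.-integrable setT (fun x => (u x ^+ 2 * F x)%:E).
Proof.
move=> lu mF F1; apply: le_integrable (L2_sqr lu) => //.
  by apply/measurable_EFinP; apply: measurable_funM => //; apply: measurable_funX; exact: lu.1.
by move=> x _; rewrite /= lee_fin normrM ler_piMr.
Qed.

(** A discrete integration by parts: the difference of [F] is moved onto [u ^+ 2], and u^2 - uh^2
    factors as the increment of [u], bounded by the mean of [g], times w = u + uh. [strip_bound]
    applies to [w] and [g], and the integral of w^2 is at most four times that of u^2. *)
Lemma monotone_by_parts u g F v h (eta : R) : L2 u -> L2 g -> weak_derivative v u g ->
  measurable_fun setT F -> (forall x, `|F x| <= 1) ->
  0 < h -> 0 < eta ->
  (\int[leb3]_x (u x ^+ 2 * (F x - F (x - h *: v)))%:E <= (h / 2)%:E *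
    ((4 * eta)%:E * \int[leb3]_x (u x ^+ 2)%:E + eta^-1%:E * \int[leb3]_x (g x ^+ 2)%:E))%E.
Proof.
move=> lu lg wd mF F1 h0 eta0.
pose uh x := u (x + h *: v); have luh : L2 uh by exact: L2_shift.
pose w x := u x + uh x; have lw : L2 w by exact: L2_add.
have mFh : measurable_fun setT (fun x => F (x - h *: v)).
  by apply: (measurableT_comp mF); exact: measurable_shift.
have i1 := L2_bounded_integrable lu mF F1.
have i2 := L2_bounded_integrable lu mFh (fun x => F1 _).
have i3 := L2_bounded_integrable luh mF F1.
have -> : (\int[leb3]_x (u x ^+ 2 * (F x - F (x - h *: v)))%:E =
    \int[leb3]_x ((u x ^+ 2 - uh x ^+ 2) * F x)%:E)%E.
  transitivity (\int[leb3]_x ((u x ^+ 2 * F x)%:E - (u x ^+ 2 * F (x - h *: v))%:E))%E.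
    by apply: eq_integral => x _; rewrite mulrBr.
  rewrite (integralB measurableT i1 i2) -(integral_shift (h *: v) i2).
  transitivity (\int[leb3]_x ((u x ^+ 2 * F x)%:E - (uh x ^+ 2 * F x)%:E))%E.
    rewrite (integralB measurableT i1 i3); congr (_ - _)%E.
    by apply: eq_integral => x _; rewrite addrK.
  by apply: eq_integral => x _; rewrite -EFinB mulrBl.
have mg := lg.1; have mw := lw.1; have mu := lu.1; have muh := luh.1.
have msq : measurable_fun setT (fun x => u x ^+ 2 - uh x ^+ 2).
  by apply: measurable_funB; exact: measurable_funX.
have ae := increment_le_mean lu lg wd h0.
apply: (@le_trans _ _ (\int[leb3]_x (`|w x|%:E * mean g v h x))%E).
  apply: (@le_trans _ _ (\int[leb3]_x `|(u x ^+ 2 - uh x ^+ 2) * F x|%:E)%E).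
    apply: (le_trans (lee_abs _)).
    apply: (@le_abse_integral _ _ _ leb3 setT (fun x => ((u x ^+ 2 - uh x ^+ 2) * F x)%:E)) => //.
    by apply/measurable_EFinP; exact: measurable_funM.
  apply: ae_ge0_le_integral => //.
  - by apply/measurable_EFinP; apply: measurableT_comp => //; exact: measurable_funM.
  - by move=> x _; rewrite mule_ge0 ?mean_ge0.
  - apply: emeasurable_funM; last exact: measurable_mean.
    by apply/measurable_EFinP; exact: measurableT_comp.
  move: ae; apply: filterS => x ax _.
  apply: (@le_trans _ _ (`|w x|%:E * `|uh x - u x|%:E)%E); last exact: lee_wpmul2l.
  rewrite -EFinM lee_fin normrM [leRHS](_ : _ = `|u x ^+ 2 - uh x ^+ 2|).
    by rewrite ler_piMr.
  by rewrite -normrM -[RHS]normrN; congr (`|_|); rewrite /w; ring.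
apply: (le_trans (strip_bound v lw lg (ltW h0) eta0)).
apply: lee_wpmul2l; first by rewrite lee_fin divr_ge0// ltW.
apply: leeD => //; rewrite mulrC EFinM -muleA.
apply: lee_wpmul2l; first by rewrite lee_fin ltW.
apply: (@le_trans _ _ (\int[leb3]_x ((2 * u x ^+ 2)%:E + (2 * uh x ^+ 2)%:E))%E).
  apply: ge0_le_integral => //.
  - by move=> x _; rewrite lee_fin sqr_ge0.
  - by apply/measurable_EFinP; exact: measurable_funX.
  - by apply: emeasurable_funD; apply/measurable_EFinP; apply: measurable_funM => //; exact: measurable_funX.
  by move=> x _; rewrite -EFinD lee_fin /w; have := sqr_ge0 (u x - uh x); nra.
have iu := integrableZl measurableT 2 (L2_sqr lu).
have iuh := integrableZl measurableT 2 (L2_sqr luh).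
rewrite (integralD measurableT iu iuh) (integralZl measurableT (L2_sqr lu)) (integralZl measurableT (L2_sqr luh)).
rewrite (ge0_integral_shift (h *: v) (f := fun x => (u x ^+ 2)%:E)); last 2 first.
- by apply/measurable_EFinP; exact: measurable_funX.
- by move=> x; rewrite lee_fin sqr_ge0.
rewrite -ge0_muleDl ?lee_fin// -EFinD.
by rewrite (_ : 2 + 2 = 4)//; lra.
Qed.

(** One component of x / |x| as a function of its own coordinate [s], where [q] is the sum of the
    squares of the other two. *)
Definition unit1 (s q : R) : R := s / Num.sqrt (s ^+ 2 + q).

Lemma unit1_le1 s q : 0 <= q -> `|unit1 s q| <= 1.
Proof.
move=> q0; rewrite /unit1 normrM normfV (ger0_norm (sqrtr_ge0 _)).
have [e|n0] := eqVneq (Num.sqrt (s ^+ 2 + q)) 0; first by rewrite e invr0 mulr0.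
have N0 : 0 < Num.sqrt (s ^+ 2 + q) by rewrite lt0r n0 sqrtr_ge0.
by rewrite ler_pdivrMr// mul1r -sqrtr_sqr ler_sqrt ?lerDl// addr_ge0 ?sqr_ge0.
Qed.

Lemma unit1N s q : unit1 (- s) q = - unit1 s q.
Proof. by rewrite /unit1 sqrrN mulNr. Qed.

Lemma unit1_ge0 s q : 0 <= s -> 0 <= unit1 s q.
Proof. by move=> s0; rewrite divr_ge0// sqrtr_ge0. Qed.

Lemma unit1_mono_pos s t q : 0 <= q -> 0 <= s -> s <= t -> unit1 s q <= unit1 t q.
Proof.
move=> q0 s0 st; have t0 := le_trans s0 st.
have [e|sn0] := eqVneq s 0; first by rewrite {1}/unit1 e mul0r unit1_ge0.
have sp : 0 < s by rewrite lt0r sn0.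
have tp := lt_le_trans sp st.
have Ns : 0 < s ^+ 2 + q by rewrite ltr_wpDr// exprn_gt0.
have Nt : 0 < t ^+ 2 + q by rewrite ltr_wpDr// exprn_gt0.
rewrite /unit1 ler_pdivrMr ?sqrtr_gt0// mulrAC ler_pdivlMr ?sqrtr_gt0//.
rewrite -ler_sqr ?nnegrE ?mulr_ge0 ?sqrtr_ge0// !exprMn (sqr_sqrtr (ltW Ns)) (sqr_sqrtr (ltW Nt)).
have st2 : s ^+ 2 <= t ^+ 2 by rewrite ler_sqr.
by have := ler_wpM2r q0 st2; nra.
Qed.

Lemma unit1_mono s t q : 0 <= q -> s <= t -> unit1 s q <= unit1 t q.
Proof.
move=> q0 st; have [s0|s0] := leP 0 s; first exact: unit1_mono_pos.
have [t0|t0] := leP 0 t.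
  apply: (@le_trans _ _ 0); last exact: unit1_ge0.
  by rewrite -oppr_ge0 -unit1N unit1_ge0// oppr_ge0 ltW.
rewrite -lerN2 -!unit1N; apply: unit1_mono_pos => //; first by rewrite oppr_ge0 ltW.
by rewrite lerN2.
Qed.

Lemma unit1_quotient (s q : R) : 0 <= q -> 0 < s ^+ 2 + q ->
  n.+1%:R * (unit1 s q - unit1 (s - n.+1%:R^-1) q) @[n --> \oo] -->
  q / Num.sqrt (s ^+ 2 + q) ^+ 3.
Proof.
move=> q0 N0; pose N := Num.sqrt (s ^+ 2 + q).
have Np : 0 < N by rewrite sqrtr_gt0.
pose hn n : R := n.+1%:R^-1; pose Nn n := Num.sqrt ((s - hn n) ^+ 2 + q).
have hn0 : hn n @[n --> \oo] --> (0 : R) by exact: cvg_harmonic.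
have NnN : Nn n @[n --> \oo] --> N.
  apply: continuous_cvg; first exact: sqrt_continuous.
  apply: cvgD; last exact: cvg_cst.
  have sh : s - hn n @[n --> \oo] --> s.
    by rewrite -[X in _ --> X]subr0; apply: cvgB => //; exact: cvg_cst.
  by rewrite expr2; under eq_fun do rewrite expr2; exact: cvgM.
(* Rationalizing the difference of square roots turns the quotient into an expression continuous in
   the step; the right-hand side is its value at step 0. *)
have -> : q / N ^+ 3 = (s * (0 - 2 * s) / (N + N) + N) / (N * N).
  have -> : q = N ^+ 2 - s ^+ 2 by rewrite sqr_sqrtr ?ltW// addrC addKr.
  by field; rewrite gt_eqF//=; apply/eqP => ?; lra.
have lim : (s * (hn n - 2 * s) / (N + Nn n) + N) / (N * Nn n) @[n --> \oo] -->
    (s * (0 - 2 * s) / (N + N) + N) / (N * N).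
  apply: cvgM.
    apply: cvgD; last exact: cvg_cst.
    apply: cvgM.
      by apply: cvgM; [exact: cvg_cst|apply: cvgB => //; exact: cvg_cst].
    apply: cvgV; first by rewrite gt_eqF// addr_gt0.
    by apply: cvgD => //; exact: cvg_cst.
  apply: cvgV; first by rewrite gt_eqF// mulr_gt0.
  by apply: cvgM => //; exact: cvg_cst.
apply: cvg_trans lim; apply: near_eq_cvg; near=> n.
have Nnp : 0 < Nn n.
  by near: n; apply: (cvgr_gt N).
have hnp : 0 < hn n by rewrite invr_gt0.
rewrite /unit1 -/N -/(hn n) -/(Nn n).
have e1 : N ^+ 2 = s ^+ 2 + q by rewrite sqr_sqrtr// ltW.
have e2 : Nn n ^+ 2 = (s - hn n) ^+ 2 + q by rewrite sqr_sqrtr// addr_ge0 ?sqr_ge0.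
have -> : n.+1%:R = (hn n)^-1 by rewrite invrK.
have e3 : hn n - 2 * s = (Nn n ^+ 2 - N ^+ 2) / hn n.
  by rewrite e1 e2; field; rewrite gt_eqF.
by rewrite e3; field; rewrite !gt_eqF//= addr_gt0.
Unshelve. all: by end_near. Qed.


Local Notation coord1 := (fun x : E3 => x.1.1 : R).
Local Notation coord2 := (fun x : E3 => x.1.2 : R).
Local Notation coord3 := (fun x : E3 => x.2 : R).

(** The vector field x / |x|, with value 0 at the origin by the convention on division. *)
Definition unit3 (i : 'I_3) (x : E3) : R :=
  match val i with
  | 0%N => unit1 x.1.1 (x.1.2 ^+ 2 + x.2 ^+ 2)
  | 1%N => unit1 x.1.2 (x.1.1 ^+ 2 + x.2 ^+ 2)
  | _ => unit1 x.2 (x.1.1 ^+ 2 + x.1.2 ^+ 2)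
  end.

Definition axis (i : 'I_3) : E3 :=
  match val i with 0%N => e1 R | 1%N => e2 R | _ => e3 R end.

Definition comp3 (i : 'I_3) (y : E3) : R :=
  match val i with 0%N => y.1.1 | 1%N => y.1.2 | _ => y.2 end.

Lemma sum_comp3 (y : E3) : \sum_(i < 3) comp3 i y ^+ 2 = enorm y ^+ 2.
Proof. by rewrite !big_ord_recr big_ord0 /= add0r /enorm sqr_sqrtr// !addr_ge0 ?sqr_ge0. Qed.

Lemma enorm_ge0 (y : E3) : 0 <= enorm y.
Proof. exact: sqrtr_ge0. Qed.

Lemma enorm_eq0 (y : E3) : enorm y = 0 -> y = 0.
Proof.
move=> /(congr1 (fun t => t ^+ 2)); rewrite -sum_comp3 expr0n/= => /eqP.
rewrite psumr_eq0 => [/allP h|i _]; last exact: sqr_ge0.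
have c i : comp3 i y = 0.
  by apply/eqP; rewrite -sqrf_eq0; apply: h; rewrite mem_index_enum.
have := c ord0; have := c (inord 1); have := c (inord 2).
rewrite /comp3 /= !inordK//.
by case: y {c h} => -[a b] d /= -> -> ->.
Qed.

Lemma measurable_coord1 : measurable_fun setT coord1.
Proof. by apply: (measurableT_comp (f := fst)); exact: measurable_fst. Qed.

Lemma measurable_coord2 : measurable_fun setT coord2.
Proof. by apply: (measurableT_comp (f := snd)); [exact: measurable_snd|exact: measurable_fst]. Qed.

Lemma measurable_coord3 : measurable_fun setT coord3.
Proof. exact: measurable_snd. Qed.

Lemma measurable_enorm : measurable_fun setT (@enorm R).
Proof.
apply: (measurableT_comp (f := @Num.sqrt R)); first exact: continuous_measurable_fun (@sqrt_continuous R).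
apply: measurable_funD; first apply: measurable_funD; apply: measurable_funX;
  [exact: measurable_coord1|exact: measurable_coord2|exact: measurable_coord3].
Qed.

Lemma measurable_enormV : measurable_fun setT (fun y : E3 => (enorm y)^-1).
Proof.
rewrite (_ : (fun y => _) = (fun y : E3 => enorm y `^ (-1))).
  by apply: (measurableT_comp (f := (@powR R)^~ (-1))); [exact: measurable_powR|exact: measurable_enorm].
by apply/funext => y; rewrite powR_inv1// enorm_ge0.
Qed.

Lemma unit3E i (y : E3) : unit3 i y = comp3 i y / enorm y.
Proof.
rewrite /unit3 /comp3 /unit1 /enorm; case: i => -[|[|k]] /= _; congr (_ / Num.sqrt _); ring.
Qed.

Lemma measurable_unit3 i : measurable_fun setT (unit3 i).
Proof.
rewrite (_ : unit3 i = fun y => comp3 i y / enorm y); last by apply/funext => y; exact: unit3E.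
apply: measurable_funM; last first.
  exact: measurable_enormV.
by rewrite /comp3; case: i => -[|[|k]] /= _;
  [exact: measurable_coord1|exact: measurable_coord2|exact: measurable_coord3].
Qed.

Lemma unit3_le1 i y : `|unit3 i y| <= 1.
Proof. by rewrite /unit3; case: i => -[|[|k]] /= _; apply: unit1_le1; rewrite addr_ge0 ?sqr_ge0. Qed.

Lemma unit3_shift i y h : unit3 i (y - h *: axis i) =
  unit1 (comp3 i y - h) (\sum_(j < 3 | j != i) comp3 j y ^+ 2).
Proof.
rewrite /unit3 /axis /comp3 big_mkcond !big_ord_recr big_ord0 /=.
by case: i => -[|[|[|//]]] /= ilt; rewrite /eq_op/= ?[h *: 0]mulr0 ?[h *: 1]mulr1 ?subr0 ?add0r ?addr0.
Qed.

Lemma unit3_mono i y h : 0 <= h -> unit3 i (y - h *: axis i) <= unit3 i y.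
Proof.
move=> h0; rewrite unit3_shift -[y in leRHS]subr0 -[in leRHS](scale0r (axis i)) unit3_shift.
apply: unit1_mono; first by apply: sumr_ge0 => j _; exact: sqr_ge0.
by rewrite subr0 gerBl.
Qed.

Lemma sum_others (y : E3) i :
  comp3 i y ^+ 2 + \sum_(j < 3 | j != i) comp3 j y ^+ 2 = enorm y ^+ 2.
Proof. by rewrite -sum_comp3 [in RHS](bigD1 i). Qed.

Lemma cvg_sumr (I : Type) (r : seq I) (f : I -> nat -> R) (l : I -> R) :
  (forall i, f i n @[n --> \oo] --> l i) ->
  \sum_(i <- r) f i n @[n --> \oo] --> \sum_(i <- r) l i.
Proof.
move=> fl; elim: r => [|i r IH].
  by rewrite big_nil; under eq_fun do rewrite big_nil; exact: cvg_cst.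
by rewrite big_cons; under eq_fun do rewrite big_cons; exact: cvgD.
Qed.

(** The divergence of x / |x| in R^3. The derivative of component i is the sum of the two other
    squares over |y|^3, and these three sums add up to 2 |y|^2. *)
Lemma unit3_divergence (y : E3) : 0 < enorm y ->
  n.+1%:R * (\sum_(i < 3) (unit3 i y - unit3 i (y - n.+1%:R^-1 *: axis i)))
    @[n --> \oo] --> 2 / enorm y.
Proof.
move=> y0.
have -> : 2 / enorm y = \sum_(i < 3) ((\sum_(j < 3 | j != i) comp3 j y ^+ 2) / enorm y ^+ 3).
  rewrite -mulr_suml.
  have -> : \sum_(i < 3) \sum_(j < 3 | j != i) comp3 j y ^+ 2 = 2 * enorm y ^+ 2.
    transitivity (\sum_(i < 3) (enorm y ^+ 2 - comp3 i y ^+ 2)).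
      by apply: eq_bigr => i _; rewrite -(sum_others y i) addrC addKr.
    by rewrite sumrB sum_comp3 sumr_const card_ord -mulr_natl; ring.
  by field; rewrite gt_eqF.
under eq_fun do rewrite mulr_sumr.
apply: cvg_sumr => i.
under eq_fun do rewrite unit3_shift.
rewrite (_ : unit3 i y = unit1 (comp3 i y) (\sum_(j < 3 | j != i) comp3 j y ^+ 2)); last first.
  by rewrite -[y in LHS]subr0 -[in LHS](scale0r (axis i)) unit3_shift subr0.
have -> : enorm y = Num.sqrt (comp3 i y ^+ 2 + \sum_(j < 3 | j != i) comp3 j y ^+ 2).
  by rewrite sum_others sqrtr_sqr ger0_norm// enorm_ge0.
apply: unit1_quotient; first by apply: sumr_ge0 => j _; exact: sqr_ge0.
by rewrite sum_others exprn_gt0.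
Qed.

(** At the origin each component jumps from -1 to 0, so the quotients diverge, in agreement with the
    infinite value of the kernel on the diagonal. *)
Lemma unit3_origin n : n.+1%:R * (\sum_(i < 3) (unit3 i 0 - unit3 i (0 - n.+1%:R^-1 *: axis i))) =
  3 * n.+1%:R.
Proof.
have E i : unit3 i 0 - unit3 i (0 - n.+1%:R^-1 *: axis i) = 1.
  rewrite unit3_shift unit3E /enorm /=.
  have -> : comp3 i 0 = 0 by rewrite /comp3; case: i => -[|[|k]].
  rewrite mul0r sub0r big1 => [|j _]; last by rewrite /comp3; case: j => -[|[|k]] ? /=; rewrite expr0n.
  rewrite /unit1 addr0 sqrtr_sqr sub0r mulNr opprK normrN ger0_norm ?invr_ge0// divff//.
by rewrite (eq_bigr (fun=> 1))// sumr_const card_ord mulrC.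
Qed.

Lemma enormB (x y : E3) : enorm (x - y) = enorm (y - x).
Proof. by rewrite /enorm /=; congr Num.sqrt; ring. Qed.

Lemma coulomb_kernel_ge0 (x y : E3) : (0 <= coulomb_kernel x y)%E.
Proof. by rewrite inve_ge0 lee_fin enorm_ge0. Qed.

Lemma coulomb_kernelC (x y : E3) : coulomb_kernel x y = coulomb_kernel y x.
Proof. by rewrite /coulomb_kernel enormB. Qed.

Lemma coulomb_kernelE (x y : E3) : coulomb_kernel x y =
  (if enorm (x - y)%R == 0%R then +oo else ((enorm (x - y)%R)^-1)%:E)%E.
Proof. by rewrite /coulomb_kernel inver. Qed.

Lemma measurable_sub3 : measurable_fun setT (fun p : E3 * E3 => p.1 - p.2).
Proof.
have c1 := measurable_coord1; have c2 := measurable_coord2; have c3 := measurable_coord3.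
have f1 : measurable_fun setT (fst : E3 * E3 -> E3) by exact: measurable_fst.
have f2 : measurable_fun setT (snd : E3 * E3 -> E3) by exact: measurable_snd.
apply: measurable_fun_pair; first apply: measurable_fun_pair.
all: apply: measurable_funB.
- exact: (measurableT_comp c1 f1).
- exact: (measurableT_comp c1 f2).
- exact: (measurableT_comp c2 f1).
- exact: (measurableT_comp c2 f2).
- exact: (measurableT_comp c3 f1).
- exact: (measurableT_comp c3 f2).
Qed.

Lemma measurable_kernel2 :
  measurable_fun setT (fun p : E3 * E3 => coulomb_kernel p.1 p.2).
Proof.
rewrite (_ : (fun p => _) = (fun p : E3 * E3 =>
  if enorm (p.1 - p.2)%R == 0%R then +oo else ((enorm (p.1 - p.2)%R)^-1)%:E)%E); last first.
  by apply/funext => p; rewrite coulomb_kernelE.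
have mn : measurable_fun setT (fun p : E3 * E3 => enorm (p.1 - p.2)).
  exact: (measurableT_comp measurable_enorm measurable_sub3).
apply: measurable_fun_ifT => //; first exact: measurable_fun_eqr.
by apply/measurable_EFinP; exact: (measurableT_comp measurable_enormV measurable_sub3).
Qed.

Lemma measurable_kernel X : measurable_fun setT (fun x => coulomb_kernel x X).
Proof.
have mp : measurable_fun setT (fun x : E3 => (x, X)) by exact: measurable_fun_pair.
exact: (measurableT_comp measurable_kernel2 mp).
Qed.

Lemma limn_einf_homo (a b : nat -> \bar R) : (forall n, a n <= b n)%E ->
  (limn_einf a <= limn_einf b)%E.
Proof.
move=> ab; rewrite !limn_einf_lim; apply: lee_lim; try exact: is_cvg_einfs.
apply: nearW => n; apply: le_ereal_inf_tmp => _ [m nm <-].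
by apply: le_trans (ab m); apply: ereal_inf_lbound; exists m.
Qed.

Lemma limn_einf_cst (c : \bar R) : limn_einf (fun=> c) = c.
Proof. by apply: (cvg_limn_einf_sup _).1; exact: cvg_cst. Qed.

Lemma L2_gradient u (d : E3 -> E3) : H1_gradient u d ->
  [/\ L2 u, forall i, L2 (fun x => comp3 i (d x)) &
    forall i, weak_derivative (axis i) u (fun x => comp3 i (d x))].
Proof.
move=> [/LfunP2 lu [/LfunP2 l1 w1] [/LfunP2 l2 w2] [/LfunP2 l3 w3]].
by split=> // -[[|[|k]]].
Qed.

(** Twice the kernel is the limit of nonnegative difference quotients of the unit field centred at
    [X]. On each axis [monotone_by_parts] bounds their integrals; the step cancels against n + 1,
    and the three axes sum to 6 eta I + J / (2 eta). Fatou's lemma passes to the limit, and halving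
    gives the constants. *)
Lemma coulomb_bound u (d : E3 -> E3) X (eta : R) : H1_gradient u d -> 0 < eta ->
  (\int[leb3]_x ((u x ^+ 2)%:E * coulomb_kernel x X) <=
   (3 * eta)%:E * \int[leb3]_x (u x ^+ 2)%:E
   + (4 * eta)^-1%:E * \int[leb3]_x (enorm (d x) ^+ 2)%:E)%E.
Proof.
move=> /L2_gradient[lu ld wd] eta0; have mu := lu.1.
have mX : measurable_fun setT (fun x : E3 => x - X) by exact: measurable_shift.
pose hn n : R := n.+1%:R^-1.
have hn0 n : 0 < hn n by rewrite invr_gt0.
pose F i x := unit3 i (x - X).
have mF i : measurable_fun setT (F i) by exact: (measurableT_comp (measurable_unit3 i) mX).
have FB i x n : F i x - F i (x - hn n *: axis i) =
    unit3 i (x - X) - unit3 i (x - X - hn n *: axis i).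
  by rewrite /F addrAC.
have D0 i x n : 0 <= F i x - F i (x - hn n *: axis i).
  by rewrite FB subr_ge0 unit3_mono// ltW.
have mD i n : measurable_fun setT (fun x => F i x - F i (x - hn n *: axis i)).
  by apply: measurable_funB => //; apply: (measurableT_comp (mF i)); exact: measurable_shift.
pose f n x := (u x ^+ 2 * (n.+1%:R * \sum_(i < 3) (F i x - F i (x - hn n *: axis i))))%:E.
have mf n : measurable_fun setT (f n).
  apply/measurable_EFinP; apply: measurable_funM; first exact: measurable_funX.
  by apply: measurable_funM => //; apply: measurable_sum => i; exact: mD.
have f0 n x : (0 <= f n x)%E.
  by rewrite lee_fin mulr_ge0 ?sqr_ge0// mulr_ge0// sumr_ge0.
have musq : measurable_fun setT (fun x => (u x ^+ 2)%:E).
  by apply/measurable_EFinP; exact: measurable_funX.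
set I := (\int[leb3]_x (u x ^+ 2)%:E)%E; set J := (\int[leb3]_x (enorm (d x) ^+ 2)%:E)%E.
have I0 : (0 <= I)%E by apply: integral_ge0 => x _; rewrite lee_fin sqr_ge0.
have J0 : (0 <= J)%E by apply: integral_ge0 => x _; rewrite lee_fin sqr_ge0.
have JE : J = (\sum_(i < 3) \int[leb3]_x (comp3 i (d x) ^+ 2)%:E)%E.
  rewrite -ge0_integral_sum//; last 2 first.
  - by move=> i; apply/measurable_EFinP; apply: measurable_funX; exact: (ld i).1.
  - by move=> i x _; rewrite lee_fin sqr_ge0.
  by apply: eq_integral => x _; rewrite -sum_comp3 sumEFin.
have fle n : (\int[leb3]_x f n x <= (6 * eta)%:E * I + (2 * eta)^-1%:E * J)%E.
  have -> : (\int[leb3]_x f n x = n.+1%:R%:E * \sum_(i < 3)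
      \int[leb3]_x (u x ^+ 2 * (F i x - F i (x - hn n *: axis i)))%:E)%E.
    rewrite -ge0_integral_sum//; last 2 first.
    - move=> i; apply/measurable_EFinP; apply: measurable_funM => //; exact: measurable_funX.
    - by move=> i x _; rewrite lee_fin mulr_ge0 ?sqr_ge0.
    rewrite -ge0_integralZl//; last 2 first.
    - apply: emeasurable_sum => i; apply/measurable_EFinP.
      by apply: measurable_funM => //; exact: measurable_funX.
    - by move=> x _; apply: sume_ge0 => i _; rewrite lee_fin mulr_ge0 ?sqr_ge0.
    by apply: eq_integral => x _; rewrite sumEFin -EFinM /f -mulr_sumr mulrCA.
  have step i : (\int[leb3]_x (u x ^+ 2 * (F i x - F i (x - hn n *: axis i)))%:E <=
      (hn n / 2)%:E * ((4 * eta)%:E * I + eta^-1%:E * \int[leb3]_x (comp3 i (d x) ^+ 2)%:E))%E.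
    by apply: monotone_by_parts => // x; exact: unit3_le1.
  have h0 : (0 <= n.+1%:R%:E :> \bar R)%E by rewrite lee_fin.
  apply: (le_trans (lee_wpmul2l h0 (lee_sum _ (fun i _ => step i)))).
  have K0 i : (0 <= \int[leb3]_x (comp3 i (d x) ^+ 2)%:E)%E.
    by apply: integral_ge0 => x _; rewrite lee_fin sqr_ge0.
  rewrite -ge0_sume_distrr; last first.
    by move=> i _; rewrite adde_ge0// mule_ge0// lee_fin ?invr_ge0 ?mulr_ge0// ltW.
  rewrite big_split/= -[X in (_ + X)%E]ge0_sume_distrr; last by move=> i _; exact: K0.
  have S3 (a : \bar R) : (\sum_(i < 3) a = 3%:E * a)%E.
    rewrite !big_ord_recr big_ord0/= add0e (_ : 3%:E = 1%:E + 1%:E + 1%:E)%E.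
      by rewrite !ge0_muleDl ?adde_ge0 ?lee_fin// !mul1e.
    by rewrite -!EFinD; congr EFin; lra.
  rewrite -JE S3 muleA -EFinM.
  have -> : n.+1%:R * (hn n / 2) = 2^-1 by rewrite mulrA mulfV// mul1r.
  rewrite ge0_muleDr ?mule_ge0 ?lee_fin ?invr_ge0 ?(ltW eta0)//; last first.
    by rewrite mulr_ge0// ltW.
  apply: leeD; last by rewrite muleA -EFinM -invfM.
  rewrite !muleA -!EFinM.
  by rewrite (_ : 2^-1 * 3 * (4 * eta) = 6 * eta)//; lra.
(* The singular point is included: there both sides are infinite, unless [u x] is zero and the left
   one vanishes. *)
have hS x : (2%:E * ((u x ^+ 2)%:E * coulomb_kernel x X) <= limn_einf (f ^~ x))%E.
  rewrite coulomb_kernelE; case: eqP => [xX|/eqP xX].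
    have x0 : x - X = 0 by exact: enorm_eq0.
    have [->|un0] := eqVneq (u x) 0.
      by rewrite expr0n/= mul0e mule0 -(limn_einf_cst 0%E); apply: limn_einf_homo => n; exact: f0.
    have u2 : 0 < u x ^+ 2 by rewrite exprn_even_gt0.
    suff -> : limn_einf (f ^~ x) = +oo%E by rewrite leey.
    apply: (cvg_limn_einf_sup _).1; apply/cvgeryP.
    rewrite (_ : (fun n => _) = (fun n => (u x ^+ 2 * 3) * n.+1%:R)); last first.
      apply/funext => n; rewrite -mulrA -unit3_origin; congr (_ * (_ * _)).
      by apply: eq_bigr => i _; rewrite FB x0.
    have c0 : 0 < u x ^+ 2 * 3 by rewrite mulr_gt0.
    apply/cvgryPge => A; near=> n.
    rewrite -ler_pdivrMl// ltW// (lt_trans _ (_ : n%:R < _))// ?ltr_nat//.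
    by near: n; have /cvgryPgt := @cvgr_idn R; exact.
  have xp : 0 < enorm (x - X) by rewrite lt0r xX enorm_ge0.
  rewrite -!EFinM; have -> // : limn_einf (f ^~ x) = (u x ^+ 2 * (2 / enorm (x - X)))%:E.
    apply: (cvg_limn_einf_sup _).1; apply: cvg_EFin; first exact: nearW.
    apply: cvgM; first exact: cvg_cst.
    have := unit3_divergence xp; apply: cvg_trans; apply: near_eq_cvg.
    by apply: nearW => n; congr (_ * _); apply: eq_bigr => i _; rewrite FB.
  by rewrite lee_fin mulrCA.
have mK := measurable_kernel X.
have k0 x : (0 <= (u x ^+ 2)%:E * coulomb_kernel x X)%E.
  by rewrite mule_ge0 ?coulomb_kernel_ge0// lee_fin sqr_ge0.
have two : (2%:E * \int[leb3]_x ((u x ^+ 2)%:E * coulomb_kernel x X) <=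
    (6 * eta)%:E * I + (2 * eta)^-1%:E * J)%E.
  rewrite -ge0_integralZl//; last exact: emeasurable_funM.
  apply: (@le_trans _ _ (\int[leb3]_x limn_einf (f ^~ x))%E).
    apply: ge0_le_integral => //.
    - by move=> x _; rewrite mule_ge0.
    - by apply: measurable_funeM; exact: emeasurable_funM.
    - rewrite (_ : (fun x => _) = (fun x => - limn_esup (fun n => - f n x))%E).
        apply: measurableT_comp => //.
        by apply: (measurable_fun_limn_esup (f := fun n x => - f n x)%E) => n; exact: measurableT_comp.
      by apply/funext => x; rewrite (limn_esupN (f ^~ x)) oppeK.
  apply: (le_trans (fatou leb3 measurableT mf (fun n x _ => f0 n x))).
  rewrite -[leRHS]limn_einf_cst; exact: limn_einf_homo.
rewrite -(@lee_pmul2l _ 2%:E)//; apply: (le_trans two).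
clearbody I J; rewrite ge0_muleDr ?mule_ge0 ?lee_fin ?invr_ge0 ?mulr_ge0 ?(ltW eta0)//.
rewrite !muleA -!EFinM le_eqVlt; apply/orP; left; apply/eqP.
by congr (_%:E * _ + _%:E * _)%E; [ring|field; rewrite gt_eqF].
Unshelve. all: by end_near. Qed.

End coulomb.

(** * Cutoffs *)

Section cutoff.
Variable R : realType.
Local Notation E3 := (E3 R).
Local Notation leb3 := (leb3 R).
Implicit Types (u w phi psi F : E3 -> R) (v x X : E3) (h : R).

(** The factor [expR 1] normalizes the value at the origin to 1. *)
Definition bump (x : E3) : R := expR 1 * flat 0 (1 - enorm x ^+ 2).

Lemma enorm_sqr (x : E3) : enorm x ^+ 2 = x.1.1 ^+ 2 + x.1.2 ^+ 2 + x.2 ^+ 2.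
Proof. by rewrite sqr_sqrtr// !addr_ge0 ?sqr_ge0. Qed.

Lemma elementary_profile k :
  elementary (fun x : E3 => flat k (1 - enorm x ^+ 2)).
Proof.
apply: el_flat.
rewrite (_ : (fun x : E3 => _) = (fun x : E3 => 1 + (-1) * (x.1.1 * x.1.1 + x.1.2 * x.1.2 + x.2 * x.2))).
  apply: el_add; first exact: el_cst.
  apply: el_mul; first exact: el_cst.
  by do 2?apply: el_add; apply: el_mul; first [exact: el_x1|exact: el_x2|exact: el_x3].
by apply/funext => x; rewrite enorm_sqr; ring.
Qed.

Lemma smooth_bump : smooth bump.
Proof.
apply: elementary_smooth; apply: el_mul; first exact: el_cst.
exact: elementary_profile.
Qed.

Lemma bump_ge0 x : 0 <= bump x.
Proof. by rewrite mulr_ge0 ?expR_ge0 ?flat_ge0. Qed.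

Lemma bump_le1 x : bump x <= 1.
Proof.
rewrite /bump /flat; case: ifPn => [q0|_]; last by rewrite mulr0.
rewrite expr0 mul1r -expRD -[leRHS]expR0 ler_expR subr_le0.
have q1 : 1 - enorm x ^+ 2 <= 1 by rewrite lerBlDr lerDl sqr_ge0.
by rewrite -[leLHS]invr1 lef_pV2 ?posrE.
Qed.

Lemma bump_out x : 1 <= enorm x -> bump x = 0.
Proof.
by move=> x1; rewrite /bump flat_le0 ?mulr0// subr_le0 -[leLHS](expr1n _ 2) lerXn2r ?nnegrE ?enorm_ge0.
Qed.

(** The unit sphere is included, because [flat 1] and [flat 2] vanish at 0. The gradient thus
    vanishes wherever the bump does, as [supported] demands. *)
Lemma derive_bump_out x v : 1 <= enorm x -> 'D_v bump x = 0.
Proof.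
move=> x1.
have q0 : 1 - enorm x ^+ 2 <= 0.
  by rewrite subr_le0 -[leLHS](expr1n _ 2) lerXn2r ?nnegrE ?enorm_ge0.
pose q (y : E3) : R := 1 - enorm y ^+ 2.
have eq : elementary q.
  rewrite (_ : q = (fun x : E3 => 1 + (-1) * (x.1.1 * x.1.1 + x.1.2 * x.1.2 + x.2 * x.2))).
    apply: el_add; first exact: el_cst.
    apply: el_mul; first exact: el_cst.
    by do 2?apply: el_add; apply: el_mul; first [exact: el_x1|exact: el_x2|exact: el_x3].
  by apply/funext => y; rewrite /q enorm_sqr; ring.
have dq : is_derive x v q ('D_v q x).
  by apply: derivableP; have [_ /(_ v)[_]] := elementary_derive eq; exact.
have d1 : is_derive x v (flat 0 \o q) 0.
  have := is_derive_comp3 dq (is_derive_flat 0 (q x)).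
  by rewrite (@flat_le0 _ 1 (q x) q0) (@flat_le0 _ 2 (q x) q0) mulr0 addr0 mul0r.
apply: derive_val; have := is_deriveZ (expR 1) d1.
by rewrite scaler0.
Qed.

(** With q = |x|^2 the logarithm of the square is -2q / (1 - q), at least -4q when q <= 1/2; then
    exp y >= 1 + y. For larger q the left side is negative. This quadratic control at the centre
    feeds [cutoff_kernel]. *)
Lemma bump_sqr_ge x : 1 - 4 * enorm x ^+ 2 <= bump x ^+ 2.
Proof.
have [q2|q2] := leP (enorm x ^+ 2) (1 / 2); last first.
  by apply: (@le_trans _ _ 0); [lra|exact: sqr_ge0].
have p0 : 0 < 1 - enorm x ^+ 2 by lra.
rewrite /bump /flat p0 expr0 mul1r -expRD -expRM_natr.
apply: le_trans (expR_ge1Dx _); rewrite lerD2l.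
set q := enorm x ^+ 2 in q2 p0 *.
have -> : (1 - (1 - q)^-1) * 2 = - (2 * q) / (1 - q) by field; rewrite gt_eqF.
rewrite mulNr lerN2 ler_pdivrMr//.
have qq : 0 <= q by exact: sqr_ge0.
nra.
Qed.

Lemma enorm_scale (c : R) x : 0 <= c -> enorm (c *: x) = c * enorm x.
Proof.
move=> c0; rewrite /enorm -[in RHS](ger0_norm c0) -sqrtr_sqr -sqrtrM ?sqr_ge0//.
by congr Num.sqrt; rewrite /= !mulrDr -!exprMn.
Qed.

Lemma norm_le_enorm x : `|x| <= enorm x.
Proof.
have h (a t : R) : a ^+ 2 <= t -> `|a| <= Num.sqrt t.
  by move=> at_; rewrite -sqrtr_sqr ler_sqrt// (le_trans _ at_)// sqr_ge0.
have s1 := sqr_ge0 (x.1.1 : R); have s2 := sqr_ge0 (x.1.2 : R); have s3 := sqr_ge0 (x.2 : R).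
rewrite !prod_normE !ge_max; apply/andP; split; first (apply/andP; split).
- by apply: h; rewrite -addrA lerDl addr_ge0.
- by apply: h; rewrite addrAC lerDr addr_ge0.
- by apply: h; rewrite lerDr addr_ge0.
Qed.

Lemma test_bump : test_function bump.
Proof.
apply: (@box_test _ 1); first exact: smooth_bump.
move=> x nx; apply: bump_out; rewrite leNgt; apply/negP => x1; apply: nx.
by apply/box_normP; apply: (le_trans (norm_le_enorm x)); rewrite ltW.
Qed.

Definition cutoff X (r : R) : E3 -> R := bump \o affine (- (r^-1 *: X)) r^-1.

Lemma cutoff_arg X (r : R) x : affine (- (r^-1 *: X)) r^-1 x = r^-1 *: (x - X).
Proof. by rewrite /affine scalerBr addrC. Qed.

Lemma smooth_cutoff X r : smooth (cutoff X r).
Proof. by apply: smooth_affine; exact: smooth_bump. Qed.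

Lemma test_cutoff X r : 0 < r -> test_function (cutoff X r).
Proof. by move=> r0; apply: test_affine; [rewrite invr_gt0|exact: test_bump]. Qed.

Lemma cutoff_ge0 X r x : 0 <= cutoff X r x.
Proof. exact: bump_ge0. Qed.

Lemma cutoff_le1 X r x : cutoff X r x <= 1.
Proof. exact: bump_le1. Qed.

Lemma cutoff_sqr_le1 X r x : cutoff X r x ^+ 2 <= 1.
Proof. by rewrite exprn_ile1 ?cutoff_ge0 ?cutoff_le1. Qed.

Lemma cutoff_enorm X r x : 0 < r -> r <= enorm (x - X) -> 1 <= enorm (r^-1 *: (x - X)).
Proof. by move=> r0 rx; rewrite enorm_scale ?invr_ge0 ?(ltW r0)// ler_pdivlMl ?mulr1. Qed.

Lemma cutoff_out X r x : 0 < r -> r <= enorm (x - X) -> cutoff X r x = 0.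
Proof. by move=> r0 rx; rewrite /cutoff/= cutoff_arg bump_out// cutoff_enorm. Qed.

Lemma derive_cutoff X r x v : 'D_v (cutoff X r) x = r^-1 * 'D_v bump (r^-1 *: (x - X)).
Proof.
have := congr1 (fun F => F x) (derive_affine (- (r^-1 *: X)) r^-1 v smooth_bump).
by rewrite /= cutoff_arg.
Qed.

Lemma derive_cutoff_out X r x v : 0 < r -> r <= enorm (x - X) -> 'D_v (cutoff X r) x = 0.
Proof. by move=> r0 rx; rewrite derive_cutoff derive_bump_out ?mulr0// cutoff_enorm. Qed.

Lemma cutoff_derive_bound : exists2 C : R, 0 <= C & forall X r x (i : 'I_3), 0 < r ->
  `|'D_(axis R i) (cutoff X r) x| <= C / r.
Proof.
have h i := test_bounded (test_derive (axis R i) test_bump).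
have [C0 c0 H0] := h ord0; have [C1 c1 H1] := h (inord 1); have [C2 c2 H2] := h (inord 2).
exists (C0 + C1 + C2); first by rewrite !addr_ge0.
move=> X r x i r0; rewrite derive_cutoff normrM [_ / r]mulrC ger0_norm ?invr_ge0 ?(ltW r0)// ler_wpM2l ?invr_ge0 ?(ltW r0)//.
have : (i == ord0) || (i == inord 1) || (i == inord 2).
  by case: i => -[|[|[|]]]//= ?; rewrite -!val_eqE/= ?inordK.
move=> /orP[/orP[/eqP->|/eqP->]|/eqP->].
- by apply: (le_trans (H0 _)); rewrite -addrA lerDl addr_ge0.
- by apply: (le_trans (H1 _)); rewrite addrAC lerDr addr_ge0.
- by apply: (le_trans (H2 _)); rewrite lerDr addr_ge0.
Qed.

(* Near [X] the defect [1 - cutoff^2] is quadratic, which absorbs the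
   singularity of the Coulomb kernel. *)
Lemma cutoff_kernel X r x : 0 < r ->
  (coulomb_kernel x X <= (cutoff X r x ^+ 2)%:E * coulomb_kernel x X + (2 / r)%:E)%E.
Proof.
move=> r0; rewrite coulomb_kernelE; case: eqP => [e|/eqP n0].
  have -> : x = X by apply/eqP; rewrite -subr_eq0; apply/eqP/enorm_eq0.
  have -> : cutoff X r X = 1.
    rewrite /cutoff/= cutoff_arg subrr scaler0 /bump /enorm /= !expr0n/= !addr0 sqrtr0 expr0n/= subr0.
    by rewrite /flat ltr01 expr0 mul1r invr1 -expRD subrr expR0.
  by rewrite expr1n mul1e addye.
have N0 : 0 < enorm (x - X) by rewrite lt0r n0 enorm_ge0.
rewrite -EFinM -EFinD lee_fin; set N := enorm (x - X) in n0 N0 *.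
rewrite -lerBlDl -[X in X - _]mul1r -mulrBl ler_pdivrMr//.
have B : 1 - 4 * (N / r) ^+ 2 <= cutoff X r x ^+ 2.
  have := bump_sqr_ge (r^-1 *: (x - X)).
  by rewrite enorm_scale ?invr_ge0 ?(ltW r0)// -/N [r^-1 * N]mulrC /cutoff/= cutoff_arg.
have s0 := sqr_ge0 (cutoff X r x).
rewrite mulrAC -mulrA; have p0 : 0 < N / r by rewrite divr_gt0.
set p := N / r in B p0 *.
by have [p2|p2] := leP p (1 / 2); nra.
Qed.

Definition grad u (x : E3) : E3 := ('D_(e1 R) u x, 'D_(e2 R) u x, 'D_(e3 R) u x).

Lemma comp3_grad i u x : comp3 i (grad u x) = 'D_(axis R i) u x.
Proof. by rewrite /comp3 /axis; case: (val i) => [|[|]]. Qed.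

Lemma comp3D i (x y : E3) : comp3 i (x + y) = comp3 i x + comp3 i y.
Proof. by rewrite /comp3; case: (val i) => [|[|]]. Qed.

Lemma comp3Z i c (x : E3) : comp3 i (c *: x) = c * comp3 i x.
Proof. by rewrite /comp3; case: (val i) => [|[|]]. Qed.

Lemma comp30 i : comp3 i (0 : E3) = 0.
Proof. by rewrite /comp3; case: (val i) => [|[|]]. Qed.

Lemma gradient_L2 u (d : E3 -> E3) : L2 u -> (forall i, L2 (fun x => comp3 i (d x))) ->
  (forall i, weak_derivative (axis R i) u (fun x => comp3 i (d x))) -> H1_gradient u d.
Proof.
move=> lu ld wd; split; first exact/LfunP2.
- by split; [apply/LfunP2; exact: (ld (@Ordinal 3 0 isT))|exact: (wd (@Ordinal 3 0 isT))].
- by split; [apply/LfunP2; exact: (ld (@Ordinal 3 1 isT))|exact: (wd (@Ordinal 3 1 isT))].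
- by split; [apply/LfunP2; exact: (ld (@Ordinal 3 2 isT))|exact: (wd (@Ordinal 3 2 isT))].
Qed.

Lemma L2_bounded_mul F u (C : R) : measurable_fun setT F -> (forall x, `|F x| <= C) ->
  L2 u -> L2 (fun x => F x * u x).
Proof.
move=> mF FC lu; split; first exact: measurable_funM mF lu.1.
have := integrableZl measurableT (C ^+ 2) (L2_sqr lu).
move=> /integrableP[_]; apply: le_lt_trans; apply: ge0_le_integral => //.
- by move=> x _; rewrite lee_fin sqr_ge0.
- by apply/measurable_EFinP; apply: measurable_funX; exact: measurable_funM mF lu.1.
- apply/measurable_EFinP; apply: measurableT_comp => //.
  by apply: measurable_funM => //; apply: measurable_funX; exact: lu.1.
move=> x _; rewrite lee_fin exprMn; apply: le_trans (ler_norm _).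
rewrite ler_wpM2r ?sqr_ge0// -(real_normK (num_real (F x))) lerXn2r ?nnegrE//.
by apply: le_trans (FC x).
Qed.

(** The Leibniz rule: [f * phi] is itself a test function, on which the weak derivative of [u] is
    tested. *)
Lemma weak_derivative_mul v u w f : L2 u -> L2 w -> smooth f -> weak_derivative v u w ->
  weak_derivative v (fun x => f x * u x) (fun x => f x * w x + u x * 'D_v f x).
Proof.
move=> lu lw sf wd phi tphi.
have t1 := test_mul sf tphi.
have t2 := test_mul (smooth_derive v sf) tphi.
have t3 := test_mul sf (test_derive v tphi).
have i1 := L2_mul lu (test_L2 (test_derive v t1)).
have i2 := L2_mul lu (test_L2 t2).
have i3 := L2_mul lw (test_L2 t1).
have E x : 'D_v (fun x => f x * phi x) x = f x * 'D_v phi x + 'D_v f x * phi x.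
  have := deriveM (smooth_derivable (x := x) (v := v) sf) (smooth_derivable (x := x) (v := v) tphi.1).
  by move=> ->; congr (_ + _); rewrite mulrC.
transitivity (\int[leb3]_x ((u x * 'D_v (fun x => f x * phi x) x)%:E - (u x * ('D_v f x * phi x))%:E))%E.
  by apply: eq_integral => x _; rewrite -EFinB E; congr EFin; ring.
rewrite (integralB measurableT i1 i2) (wd _ t1) -fin_num_oppeD; last exact: integrable_fin_num.
congr (- _)%E; rewrite -(integralD measurableT i3 i2); apply: eq_integral => x _.
by rewrite -EFinD; congr EFin; ring.
Qed.

Lemma affineK X e : e != 0 -> cancel (affine X e) (affine (- (e^-1 *: X)) e^-1).
Proof. by move=> e0 x; rewrite cutoff_arg /affine addrAC subrr add0r scalerK. Qed.

Lemma affineVK X e : e != 0 -> cancel (affine (- (e^-1 *: X)) e^-1) (affine X e).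
Proof. by move=> e0 x; rewrite cutoff_arg /affine scalerA divff// scale1r addrC subrK. Qed.

Lemma weak_derivative_affine v u w X (e c : R) : 0 < e -> L2 u -> L2 w -> weak_derivative v u w ->
  weak_derivative v (fun x => c * u (affine X e x)) (fun x => c * e * w (affine X e x)).
Proof.
move=> e0 lu lw wd phi tphi; have en0 : e != 0 by rewrite gt_eqF.
pose psi := phi \o affine (- (e^-1 *: X)) e^-1.
have tpsi : test_function psi by apply: test_affine => //; rewrite invr_gt0.
have phiE x : phi x = psi (affine X e x) by rewrite /psi /= affineK.
have DE x : 'D_v phi x = e * 'D_v psi (affine X e x).
  have -> : phi = psi \o affine X e by apply/funext => y; rewrite phiE.
  by have := congr1 (fun F => F x) (derive_affine X e v tpsi.1).
have i1 := L2_mul lu (test_L2 (test_derive v tpsi)).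
have i2 := L2_mul lw (test_L2 tpsi).
have j1 := integrable_affine X e0 i1.
have j2 := integrable_affine X e0 i2.
transitivity ((c * e)%:E * \int[leb3]_x (u (affine X e x) * 'D_v psi (affine X e x))%:E)%E.
  rewrite -(integralZl measurableT j1); apply: eq_integral => x _.
  by rewrite DE -EFinM; congr EFin; ring.
transitivity (- ((c * e)%:E * \int[leb3]_x (w (affine X e x) * psi (affine X e x))%:E))%E; last first.
  rewrite -(integralZl measurableT j2); congr (- _)%E; apply: eq_integral => x _.
  by rewrite phiE -EFinM; congr EFin; ring.
rewrite -muleN; congr (_ * _)%E.
have := wd _ tpsi; rewrite (integral_affine X e0 i1) (integral_affine X e0 i2) -muleN.
move=> /(congr1 (fun y => ((e ^+ 3)^-1)%:E * y)%E); rewrite !muleA -!EFinM mulVf ?mul1e//.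
by rewrite expf_neq0.
Qed.

Lemma L2_affine u X e : 0 < e -> L2 u -> L2 (u \o affine X e).
Proof.
move=> e0 lu; split; first by apply: measurableT_comp lu.1 _; exact: measurable_affine.
by have /integrableP[_] := integrable_affine X e0 (L2_sqr lu);
  under eq_integral do rewrite /= ger0_norm ?sqr_ge0//.
Qed.

End cutoff.

(** * Kinetic energy *)

Section amplitude.
Variable R : realType.
Local Notation E3 := (E3 R).
Local Notation leb3 := (leb3 R).
Local Notation meas3 := {measure set E3 -> \bar R}.
Implicit Types (u w : E3 -> R) (g : E3 -> E3) (X : E3) (rho : meas3).

Definition energy g : \bar R := (\int[leb3]_x (enorm (g x) ^+ 2)%:E)%E.

(* [u] is the square root of the density of [rho], and [g] its gradient. Here
   and below a measure is specified by its integrals of nonnegative functions. *)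
Definition amplitude rho u g : Prop :=
  [/\ forall x, 0 <= u x, H1_gradient u g &
    forall h, measurable_fun setT h -> (forall x, 0 <= h x)%E ->
      (\int[rho]_x h x = \int[leb3]_x ((u x ^+ 2)%:E * h x))%E].

(** The gradient is asked to vanish too, at every point and not almost everywhere, so that disjoint
    supports make energies add pointwise in [amplitude_sum]. *)
Definition supported u g (S : set E3) := forall x, ~ S x -> u x = 0 /\ g x = 0.

Lemma integral_one d (T : measurableType d) (mu : {measure set T -> \bar R}) :
  (\int[mu]_x 1 = mu setT)%E.
Proof. by rewrite integral_cst// mul1e. Qed.

Lemma integral_indicE d (T : measurableType d) (mu : {measure set T -> \bar R}) A :
  measurable A -> (\int[mu]_x (\1_A x)%:E = mu A)%E.
Proof. by move=> mA; rewrite integral_indic// setIT. Qed.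

Lemma measurable_indicE d (T : measurableType d) (A : set T) : measurable A ->
  measurable_fun setT (fun x => (\1_A x : R)%:E).
Proof. by move=> mA; apply/measurable_EFinP; exact: measurable_indic. Qed.

Lemma amplitude_measurable rho u g : amplitude rho u g -> measurable_fun setT u.
Proof. by move=> [_ /L2_gradient[[]]]. Qed.

Lemma kinetic_le rho u g : amplitude rho u g -> (kinetic rho <= energy g)%E.
Proof.
move=> au; have mu := amplitude_measurable au; case: au => u0 hg hrho.
apply: ereal_inf_lbound; exists (fun x => u x ^+ 2), g; split => //.
  split; [exact: measurable_funX|by move=> x; exact: sqr_ge0|].
  move=> A mA; rewrite -(integral_indicE _ mA) hrho//.
  - rewrite [in RHS]integral_mkcond; apply: eq_integral => x _.
    by rewrite epatch_indic.
  - exact: measurable_indicE.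
rewrite (_ : (fun x => _) = u)//; apply/funext => x.
by rewrite sqrtr_sqr ger0_norm.
Qed.

(** An infimum below a strict bound gives an amplitude of almost minimal energy; later arguments pay
    for this slack. *)
Lemma kinetic_lt rho y : (kinetic rho < y)%E ->
  exists u g, amplitude rho u g /\ (energy g < y)%E.
Proof.
move=> /ereal_inf_lt[_ [f [g [[mf f0 fE] hg ->]]] lty].
exists (fun x => Num.sqrt (f x)), g; split => //; split => // h mh h0.
rewrite (ge0_integral_density mf f0 fE mh h0).
by apply: eq_integral => x _; rewrite sqr_sqrtr.
Qed.

Lemma amplitude_mass rho u g : amplitude rho u g ->
  rho setT = (\int[leb3]_x (u x ^+ 2)%:E)%E.
Proof.
move=> [_ _ hrho]; rewrite -integral_one hrho//.
by under eq_integral do rewrite mule1.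
Qed.

Lemma amplitude_mass_lty rho u g : amplitude rho u g -> (rho setT < +oo)%E.
Proof. by move=> au; rewrite (amplitude_mass au); case: au => _ /L2_gradient[[]]. Qed.

Lemma measurable_energy u g : H1_gradient u g ->
  measurable_fun setT (fun x => enorm (g x) ^+ 2).
Proof.
move=> /L2_gradient[_ lg _]; under eq_fun do rewrite -sum_comp3.
by apply: measurable_sum => i; apply: measurable_funX; exact: (lg i).1.
Qed.

Lemma energy_sum u g : H1_gradient u g ->
  energy g = (\sum_(i < 3) \int[leb3]_x (comp3 i (g x) ^+ 2)%:E)%E.
Proof.
move=> /L2_gradient[_ lg _]; rewrite /energy -ge0_integral_sum//.
- by apply: eq_integral => x _; rewrite sumEFin sum_comp3.
- by move=> i; apply/measurable_EFinP; apply: measurable_funX; exact: (lg i).1.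
- by move=> i x _; rewrite lee_fin sqr_ge0.
Qed.

Lemma energy_ge0 g : (0 <= energy g)%E.
Proof. by apply: integral_ge0 => x _; rewrite lee_fin sqr_ge0. Qed.

Lemma energy_lty u g : H1_gradient u g -> (energy g < +oo)%E.
Proof.
move=> hg; rewrite (energy_sum hg); have [_ lg _] := L2_gradient hg.
by apply: lte_sum_pinfty => i _; exact: (lg i).2.
Qed.

Lemma attraction_bound rho u g X (eta : R) : amplitude rho u g -> 0 < eta ->
  (attraction X rho <= (3 * eta)%:E * rho setT + (4 * eta)^-1%:E * energy g)%E.
Proof.
move=> au eta0; rewrite (amplitude_mass au); case: au => u0 hg hrho.
rewrite /attraction hrho; [exact: coulomb_bound|exact: measurable_kernel|].
by move=> x; exact: coulomb_kernel_ge0.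
Qed.

Lemma weak_derivative_cmul v u w (c : R) : L2 u -> L2 w -> weak_derivative v u w ->
  weak_derivative v (fun x => c * u x) (fun x => c * w x).
Proof.
move=> lu lw wd phi tphi.
have i1 := L2_mul lu (test_L2 (test_derive v tphi)).
have i2 := L2_mul lw (test_L2 tphi).
under eq_integral do rewrite -mulrA EFinM.
under [in RHS]eq_integral do rewrite -mulrA EFinM.
by rewrite (integralZl measurableT i1) (integralZl measurableT i2) (wd _ tphi) muleN.
Qed.

Lemma energyZ u g (c : R) : H1_gradient u g -> 0 <= c ->
  energy (fun x => c *: g x) = ((c ^+ 2)%:E * energy g)%E.
Proof.
move=> hg c0; rewrite /energy.
under eq_integral do rewrite enorm_scale// exprMn EFinM.
rewrite ge0_integralZl//.
- by apply/measurable_EFinP; exact: measurable_energy hg.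
- by move=> x _; rewrite lee_fin sqr_ge0.
- by rewrite lee_fin sqr_ge0.
Qed.

Lemma H1_gradientZ u g (c : R) : H1_gradient u g ->
  H1_gradient (fun x => c * u x) (fun x => c *: g x).
Proof.
move=> /L2_gradient[lu lg wd]; apply: gradient_L2 => [|i|i].
- exact: L2_cmul.
- by under eq_fun do rewrite comp3Z; exact: L2_cmul.
- have -> : (fun x => comp3 i (c *: g x)) = (fun x => c * comp3 i (g x)).
    by apply/funext => x; rewrite comp3Z.
  exact: weak_derivative_cmul.
Qed.

Lemma amplitude_scale rho rho' u g (c : R) : 0 <= c -> amplitude rho u g ->
  (forall h, measurable_fun setT h -> (forall x, 0 <= h x)%E ->
    (\int[rho']_x h x = c%:E * \int[rho]_x h x)%E) ->
  amplitude rho' (fun x => Num.sqrt c * u x) (fun x => Num.sqrt c *: g x).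
Proof.
move=> c0 au rho'E; have mu := amplitude_measurable au; case: au => u0 hg hrho.
split=> [x||h mh h0]; [by rewrite mulr_ge0|exact: H1_gradientZ|].
rewrite rho'E// hrho// -ge0_integralZl//.
- by apply: eq_integral => x _; rewrite exprMn sqr_sqrtr// EFinM muleA.
- by apply: emeasurable_funM => //; apply/measurable_EFinP; exact: measurable_funX.
- by move=> x _; rewrite mule_ge0 ?lee_fin ?sqr_ge0.
Qed.

Lemma amplitude_affine rho rho' u g X (e : R) : 0 < e -> amplitude rho u g ->
  (forall h, measurable_fun setT h -> (forall x, 0 <= h x)%E ->
    (\int[rho']_x h x = \int[rho]_x h (affine X e x))%E) ->
  exists u' g', [/\ amplitude rho' u' g', energy g' = ((e ^- 2)%:E * energy g)%E &
    forall S, supported u g S -> supported u' g' [set y | exists2 x, S x & y = affine X e x]].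
Proof.
move=> e0 au rho'E; have mu := amplitude_measurable au; case: au => u0 hg hrho.
have en0 : e != 0 by rewrite gt_eqF.
(* The factor e^(-3/2) preserves the mass; the chain rule adds 1/e to the gradient, whence e^(-2) in
   the energy. *)
pose c := (Num.sqrt (e ^+ 3))^-1; pose inv := affine (- (e^-1 *: X)) e^-1.
have e30 : 0 < e ^+ 3 by rewrite exprn_gt0.
have c0 : 0 <= c by rewrite invr_ge0.
have cE : e ^+ 3 * c ^+ 2 = 1 by rewrite exprVn sqr_sqrtr ?ltW// divff ?gt_eqF.
have Vinv : inv \o affine X e = id by apply/funext => x; rewrite /inv/= affineK.
have minv : measurable_fun setT inv by exact: measurable_affine.
have ei0 : 0 < e^-1 by rewrite invr_gt0.
exists (fun y => c * u (inv y)), (fun y => (c * e^-1) *: g (inv y)).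
have hg' : H1_gradient (fun y => c * u (inv y)) (fun y => (c * e^-1) *: g (inv y)).
  have [lu lg wd] := L2_gradient hg; apply: gradient_L2 => [|i|i].
  - by apply: L2_cmul; exact: (L2_affine _ ei0 lu).
  - under eq_fun do rewrite comp3Z; apply: L2_cmul.
    exact: (L2_affine _ ei0 (lg i)).
  - have -> : (fun x => comp3 i ((c * e^-1) *: g (inv x))) = (fun x => c * e^-1 * comp3 i (g (inv x))).
      by apply/funext => x; rewrite comp3Z.
    exact: (weak_derivative_affine _ _ ei0 lu (lg i) (wd i)).
split.
- split=> // [x|h mh h0]; first by rewrite mulr_ge0.
  have mha : measurable_fun setT (h \o affine X e).
    by apply: measurableT_comp => //; exact: measurable_affine.
  have mu2 : measurable_fun setT (fun x => (u x ^+ 2)%:E).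
    by apply/measurable_EFinP; exact: measurable_funX.
  rewrite rho'E// hrho//.
  rewrite [RHS](@ge0_integral_affine _ X e)//.
  + rewrite -[RHS]ge0_integralZl//.
    * apply: eq_integral => x _; rewrite -/((inv \o affine X e) x) Vinv/=.
      by rewrite exprMn muleA -EFinM mulrA cE mul1r.
    * apply: emeasurable_funM => //; apply/measurable_EFinP.
      apply: measurable_funX; apply: measurable_funM => //.
      by rewrite -[X in measurable_fun _ X]/(u \o (inv \o affine X e)) Vinv.
    * by move=> x _; rewrite mule_ge0 ?lee_fin ?sqr_ge0.
    * by rewrite lee_fin ltW.
  + apply: emeasurable_funM => //; apply/measurable_EFinP.
    apply: measurable_funX; apply: measurable_funM => //.
    exact: measurableT_comp.
  + by move=> x; rewrite mule_ge0 ?lee_fin ?sqr_ge0.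
- rewrite /energy (@ge0_integral_affine _ X e)//.
  + rewrite -!ge0_integralZl//.
    * apply: eq_integral => x _; rewrite -/((inv \o affine X e) x) Vinv/=.
      rewrite enorm_scale ?mulr_ge0// ?(ltW ei0)// -!EFinM !exprMn; congr EFin.
      by rewrite -[RHS]mul1r -cE -exprVn; ring.
    * by apply/measurable_EFinP; exact: measurable_energy hg.
    * by move=> x _; rewrite lee_fin sqr_ge0.
    * by rewrite lee_fin invr_ge0 sqr_ge0.
    * apply/measurable_EFinP; apply: (measurableT_comp (measurable_energy hg')).
      exact: measurable_affine.
    * by move=> x _; rewrite lee_fin sqr_ge0.
    * by rewrite lee_fin ltW.
  + by apply/measurable_EFinP; exact: measurable_energy hg'.
  + by move=> x; rewrite lee_fin sqr_ge0.
- move=> S sS y nS; have [x0 x1] : u (inv y) = 0 /\ g (inv y) = 0.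
    by apply: sS => Sy; apply: nS; exists (inv y); rewrite ?affineVK.
  by rewrite x0 x1 mulr0 scaler0.
Qed.

Lemma sqr_add_young (a b eta : R) : 0 < eta ->
  (a + b) ^+ 2 <= (1 + eta) * a ^+ 2 + (1 + eta^-1) * b ^+ 2.
Proof.
move=> e0; have e1 : eta * eta^-1 = 1 by rewrite divff// gt_eqF.
rewrite -subr_ge0.
have -> : (1 + eta) * a ^+ 2 + (1 + eta^-1) * b ^+ 2 - (a + b) ^+ 2 =
   eta * (a - eta^-1 * b) ^+ 2.
  have -> : eta * (a - eta^-1 * b) ^+ 2 = eta * a ^+ 2 - 2 * (eta * eta^-1) * a * b + eta * eta^-1 * eta^-1 * b ^+ 2 by ring.
  by rewrite e1; ring.
by rewrite mulr_ge0 ?sqr_ge0 ?ltW.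
Qed.

(** Young's inequality splits the two terms of the product rule. The main term keeps the weight
    [cutoff X r x ^+ 2], so that pieces cut around separate nuclei can be summed; the other one uses
    |grad cutoff| <= C0 / r per coordinate, and the factor 3 counts the coordinates. *)
Lemma amplitude_cutoff : exists2 C : R, 0 <= C &
  forall rho rho' u g X r (eta : R), 0 < r -> 0 < eta -> amplitude rho u g ->
  (forall h, measurable_fun setT h -> (forall x, 0 <= h x)%E ->
    (\int[rho']_x h x = \int[rho]_x ((cutoff X r x ^+ 2)%:E * h x))%E) ->
  exists u' g', [/\ amplitude rho' u' g',
    (energy g' <= (1 + eta)%:E * \int[leb3]_x (cutoff X r x ^+ 2 * enorm (g x) ^+ 2)%:E
      + ((1 + eta^-1) * (C / r ^+ 2))%:E * rho setT)%E,
    supported u' g' [set x | enorm (x - X) < r] &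
    forall S, supported u g S -> supported u' g' S].
Proof.
have [C0 C00 HC] := @cutoff_derive_bound R.
exists (3 * C0 ^+ 2); first by rewrite mulr_ge0 ?sqr_ge0.
move=> rho rho' u g X r eta r0 eta0 au rho'E.
have mu := amplitude_measurable au; have mass := amplitude_mass au.
case: au => u0 hg hrho; have [lu lg wd] := L2_gradient hg.
set th := cutoff X r; have sth : smooth th by exact: smooth_cutoff.
have mth : measurable_fun setT th by exact: smooth_measurable.
have th1 x : `|th x| <= 1 by rewrite ger0_norm ?cutoff_ge0 ?cutoff_le1.
have mD v : measurable_fun setT ('D_v th).
  by apply: smooth_measurable; exact: smooth_derive.
pose g' x := th x *: g x + u x *: grad th x.
have g'E i x : comp3 i (g' x) = th x * comp3 i (g x) + u x * 'D_(axis R i) th x.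
  by rewrite comp3D !comp3Z comp3_grad.
have hg' : H1_gradient (fun x => th x * u x) g'.
  apply: gradient_L2 => [|i|i].
  - exact: L2_bounded_mul.
  - under eq_fun do rewrite g'E; apply: L2_add; first exact: L2_bounded_mul.
    under eq_fun do rewrite mulrC.
    by apply: (L2_bounded_mul (C := C0 / r)) => //; [exact: mD|move=> x; exact: HC].
  - have -> : (fun x => comp3 i (g' x)) = (fun x => th x * comp3 i (g x) + u x * 'D_(axis R i) th x).
      by apply/funext => x; rewrite g'E.
    exact: weak_derivative_mul.
exists (fun x => th x * u x), g'; split.
- split=> // [x|h mh h0]; first by rewrite mulr_ge0 ?cutoff_ge0.
  rewrite rho'E// hrho//.
  + by apply: eq_integral => x _; rewrite muleA -EFinM; congr (_ * _)%E; congr EFin; rewrite [RHS]exprMn mulrC.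
  + by apply: emeasurable_funM => //; apply/measurable_EFinP; exact: measurable_funX.
  + by move=> x; rewrite mule_ge0 ?lee_fin ?sqr_ge0.
- have m1 : measurable_fun setT (fun x => (th x ^+ 2 * enorm (g x) ^+ 2)%:E).
    apply/measurable_EFinP; apply: measurable_funM; first exact: measurable_funX.
    exact: measurable_energy hg.
  have m2 : measurable_fun setT (fun x => (u x ^+ 2)%:E).
    by apply/measurable_EFinP; exact: measurable_funX.
  have k1 : 0 <= 1 + eta by rewrite addr_ge0 ?ltW.
  have k2 : 0 <= (1 + eta^-1) * (3 * C0 ^+ 2 / r ^+ 2).
    apply: mulr_ge0; first by rewrite addr_ge0 ?invr_ge0 ?(ltW eta0).
    by apply: divr_ge0; [apply: mulr_ge0 => //; exact: sqr_ge0|exact: sqr_ge0].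
  rewrite mass -!ge0_integralZl//; first last.
  + by move=> x _; rewrite lee_fin mulr_ge0 ?sqr_ge0.
  + by move=> x _; rewrite lee_fin sqr_ge0.
  rewrite -ge0_integralD//; first last.
  + exact: measurable_funeM.
  + by move=> x _; rewrite mule_ge0 ?lee_fin ?sqr_ge0.
  + exact: measurable_funeM.
  + by move=> x _; apply: mule_ge0 => //; rewrite lee_fin; apply: mulr_ge0; exact: sqr_ge0.
  apply: ge0_le_integral => //.
  + by move=> x _; rewrite lee_fin sqr_ge0.
  + by apply/measurable_EFinP; exact: measurable_energy hg'.
  + by apply: emeasurable_funD; exact: measurable_funeM.
  move=> x _; rewrite -!EFinM -EFinD lee_fin -!sum_comp3.
  apply: (@le_trans _ _ (\sum_(i < 3) ((1 + eta) * (th x ^+ 2 * comp3 i (g x) ^+ 2)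
      + (1 + eta^-1) * (u x ^+ 2 * (C0 / r) ^+ 2)))).
    apply: ler_sum => i _; rewrite g'E; apply: (le_trans (sqr_add_young _ _ eta0)).
    rewrite !exprMn lerD2l ler_wpM2l ?addr_ge0 ?invr_ge0 ?(ltW eta0)//.
    rewrite ler_wpM2l ?sqr_ge0// -exprMn -(real_normK (num_real ('D_(axis R i) th x))).
    by rewrite lerXn2r ?nnegrE ?normr_ge0 ?divr_ge0 ?(ltW r0)//; exact: HC.
  rewrite big_split/= sumr_const card_ord -!mulr_sumr lerD2l -mulr_natl expr_div_n.
  by rewrite le_eqVlt; apply/orP; left; apply/eqP; ring.
- move=> x /negP; rewrite -leNgt => rx.
  have thx : th x = 0 by exact: cutoff_out.
  rewrite /g' thx mul0r scale0r add0r; split=> //.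
  have -> : grad th x = 0 by rewrite /grad /th !derive_cutoff_out.
  exact: scaler0.
- by move=> S sS x nS; rewrite /g'; have [-> ->] := sS x nS; rewrite mulr0 scaler0 add0r scale0r.
Qed.

(** With at most one nonzero term, any map fixing zero commutes with the sum. This removes the cross
    terms in squares of sums with disjoint supports. *)
Lemma lone_sum (V W : zmodType) (I : finType) (v : I -> V) (phi : V -> W) :
  phi 0 = 0 -> (forall i j, i != j -> v i = 0 \/ v j = 0) ->
  phi (\sum_i v i) = \sum_i phi (v i).
Proof.
move=> phi0 vv.
have [/existsP[i vi]|/existsPn v0] := boolP [exists i, v i != 0].
  have vj j : j != i -> v j = 0 by move=> /vv[//|vi0]; rewrite vi0 eqxx in vi.
  rewrite (bigD1 i)//= [X in phi (_ + X)]big1 ?addr0//.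
  by rewrite (bigD1 i)//= big1 ?addr0// => j /vj ->.
have v00 i : v i = 0 by move: (v0 i); rewrite negbK => /eqP.
by rewrite !big1// => i _; rewrite v00.
Qed.

Lemma L2_sum (I : Type) (s : seq I) (u : I -> E3 -> R) : (forall i, L2 (u i)) ->
  L2 (fun x => \sum_(i <- s) u i x).
Proof.
move=> lu; elim: s => [|i s ih].
  under eq_fun do rewrite big_nil; split; first exact: measurable_cst.
  by under eq_integral do rewrite expr0n/=; rewrite integral0.
by under eq_fun do rewrite big_cons; exact: L2_add.
Qed.

Lemma weak_derivative_sum (I : Type) (s : seq I) v (u w : I -> E3 -> R) :
  (forall i, L2 (u i)) -> (forall i, L2 (w i)) ->
  (forall i, weak_derivative v (u i) (w i)) ->
  weak_derivative v (fun x => \sum_(i <- s) u i x) (fun x => \sum_(i <- s) w i x).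
Proof.
move=> lu lw wd; elim: s => [|i s ih] phi tphi.
  under eq_integral do rewrite big_nil mul0r.
  under [in RHS]eq_integral do rewrite big_nil mul0r.
  by rewrite integral0 oppe0.
have tD := test_L2 (test_derive v tphi); have tp := test_L2 tphi.
have i1 := L2_mul (lu i) tD; have i2 := L2_mul (L2_sum s lu) tD.
have j1 := L2_mul (lw i) tp; have j2 := L2_mul (L2_sum s lw) tp.
under eq_integral do rewrite big_cons mulrDl EFinD.
under [in RHS]eq_integral do rewrite big_cons mulrDl EFinD.
rewrite (integralD measurableT i1 i2) (integralD measurableT j1 j2) (wd _ _ tphi) (ih _ tphi).
by rewrite fin_num_oppeD//; exact: integrable_fin_num.
Qed.

Lemma amplitude_sum (I : finType) (rho : I -> meas3) rho' (u : I -> E3 -> R)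
    (g : I -> E3 -> E3) (S : I -> set E3) :
  (forall i, amplitude (rho i) (u i) (g i)) -> (forall i, supported (u i) (g i) (S i)) ->
  (forall i j, i != j -> forall x, S i x -> S j x -> False) ->
  (forall h, measurable_fun setT h -> (forall x, 0 <= h x)%E ->
    (\int[rho']_x h x = \sum_i \int[rho i]_x h x)%E) ->
  [/\ amplitude rho' (fun x => \sum_i u i x) (fun x => \sum_i g i x),
    energy (fun x => \sum_i g i x) = (\sum_i energy (g i))%E &
    supported (fun x => \sum_i u i x) (fun x => \sum_i g i x) (\bigcup_i S i)].
Proof.
move=> au sS dS rho'E.
have mu i := amplitude_measurable (au i).
have u0 i x : 0 <= u i x by case: (au i).
have hg i : H1_gradient (u i) (g i) by case: (au i).
have hrho i := let: And3 _ _ h := au i in h.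
have lu i : L2 (u i) by have [] := L2_gradient (hg i).
have lg i k : L2 (fun x => comp3 k (g i x)) by have [_ ] := L2_gradient (hg i).
have wd i k : weak_derivative (axis R k) (u i) (fun x => comp3 k (g i x)).
  by have [_ _] := L2_gradient (hg i).
have dj i j x : i != j -> ~ S i x \/ ~ S j x.
  by move=> /dS/(_ x) h; have [|]:= pselect (S i x); [right|left] => //; auto.
have lone_u x : (\sum_i u i x) ^+ 2 = \sum_i u i x ^+ 2.
  apply: (lone_sum (phi := fun t : R => t ^+ 2)); first by rewrite expr0n.
  by move=> i j ij; have [/sS[-> _]|/sS[-> _]] := dj _ _ x ij; [left|right].
have comp_sum k x : comp3 k (\sum_i g i x) = \sum_i comp3 k (g i x).
  by elim/big_ind2 : _ => [|a b c e' <- <-|//]; rewrite ?comp30 ?comp3D.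
have lone_g x : enorm (\sum_i g i x) ^+ 2 = \sum_i enorm (g i x) ^+ 2.
  apply: (lone_sum (phi := fun t : E3 => enorm t ^+ 2)).
    by rewrite /enorm/= expr0n/= !addr0 sqrtr0 expr0n.
  by move=> i j ij; have [/sS[_ ->]|/sS[_ ->]] := dj _ _ x ij; [left|right].
split.
- split=> [x||h mh h0]; first exact: sumr_ge0.
    apply: gradient_L2 => [|k|k]; first exact: L2_sum.
    + by under eq_fun do rewrite comp_sum; exact: L2_sum.
    + have -> : (fun x => comp3 k (\sum_i g i x)) = (fun x => \sum_i comp3 k (g i x)).
        by apply/funext => x; rewrite comp_sum.
      exact: weak_derivative_sum.
  rewrite rho'E//; under eq_bigr do rewrite hrho//.
  rewrite -ge0_integral_sum//.
  + apply: eq_integral => x _; rewrite lone_u -sumEFin ge0_sume_distrl// => i _.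
    by rewrite lee_fin sqr_ge0.
  + move=> i; apply: emeasurable_funM => //; apply/measurable_EFinP.
    exact: measurable_funX.
  + by move=> i x _; rewrite mule_ge0 ?lee_fin ?sqr_ge0.
- rewrite /energy -ge0_integral_sum//.
  + by apply: eq_integral => x _; rewrite lone_g sumEFin.
  + by move=> i; apply/measurable_EFinP; exact: measurable_energy (hg i).
  + by move=> i x _; rewrite lee_fin sqr_ge0.
- move=> x nS; have h i : u i x = 0 /\ g i x = 0.
    by apply: sS => Six; apply: nS; exists i.
  by rewrite !big1// => i _; case: (h i).
Qed.

End amplitude.

(** * Transport plans *)

Section product_measure_construction.
Context d1 d2 (T1 : measurableType d1) (T2 : measurableType d2) (R : realType).

Definition finite_of d (T : measurableType d) (mu : {measure set T -> \bar R})
  & (mu setT < +oo)%E : set T -> \bar R := mu.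

HB.instance Definition _ d (T : measurableType d) (mu : {measure set T -> \bar R}) H :=
  Measure.on (@finite_of d T mu H).
HB.instance Definition _ d (T : measurableType d) (mu : {measure set T -> \bar R}) H :=
  Measure_isFinite.Build _ _ _ (@finite_of d T mu H) (lty_fin_num_fun H).

Lemma product_measure_ex (mu : {measure set T1 -> \bar R}) (nu : {measure set T2 -> \bar R}) :
  (mu setT < +oo)%E -> (nu setT < +oo)%E ->
  exists Q : {measure set (T1 * T2) -> \bar R},
  forall h : T1 * T2 -> \bar R, measurable_fun setT h -> (forall p, 0 <= h p)%E ->
    (\int[Q]_p h p = \int[mu]_x \int[nu]_y h (x, y))%E /\
    (\int[Q]_p h p = \int[nu]_y \int[mu]_x h (x, y))%E.
Proof.
move=> fmu fnu.
pose m1 : {finite_measure set T1 -> \bar R} := finite_of fmu.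
pose m2 : {finite_measure set T2 -> \bar R} := finite_of fnu.
exists (m1 \x m2)%E => h mh h0; split.
  by rewrite (fubini_tonelli1 (m1 := m1) (m2 := m2)).
by rewrite (fubini_tonelli2 (m1 := m1) (m2 := m2)).
Qed.

End product_measure_construction.

Section plans.
Variable R : realType.
Local Notation E3 := (E3 R).
Local Notation meas3 := {measure set E3 -> \bar R}.
Local Notation meas6 := {measure set (E3 * E3) -> \bar R}.
Implicit Types (rho mu : meas3) (P Q : meas6) (h : E3 -> \bar R) (X : E3).

Definition cost P : \bar R := (\int[P]_p coulomb_kernel p.1 p.2)%E.

Definition equal_marginals P := forall h, measurable_fun setT h -> (forall x, 0 <= h x)%E ->
  (\int[P]_p h p.1 = \int[P]_p h p.2)%E.

(* The plans competing in [fractional_cost rho m], up to an excess of mass. *)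
Definition partial_plan rho (m : R) P : Prop :=
  [/\ rho setT = m%:E, equal_marginals P,
    forall h, measurable_fun setT h -> (forall x, 0 <= h x)%E ->
      (\int[P]_p h p.1 <= \int[rho]_x h x)%E &
    ((2 * m - 1)%:E <= P setT)%E].

Lemma cost_ge0 P : (0 <= cost P)%E.
Proof. by apply: integral_ge0 => p _; exact: coulomb_kernel_ge0. Qed.

Lemma measurable_comp1 h : measurable_fun setT h -> measurable_fun setT (fun p : E3 * E3 => h p.1).
Proof. by move=> mh; apply: (measurableT_comp mh); exact: measurable_fst. Qed.

Lemma measurable_comp2 h : measurable_fun setT h -> measurable_fun setT (fun p : E3 * E3 => h p.2).
Proof. by move=> mh; apply: (measurableT_comp mh); exact: measurable_snd. Qed.

Lemma marginal_ex P : exists mu, forall h, measurable_fun setT h -> (forall x, 0 <= h x)%E ->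
  (\int[mu]_x h x = \int[P]_p h p.1)%E.
Proof.
by have [mu [_ muE]] := push_measure_ex P (measurable_fst : measurable_fun setT (@fst E3 E3)); exists mu.
Qed.

Lemma measure_of_integral mu A : measurable A -> (mu A = \int[mu]_x (\1_A x)%:E)%E.
Proof. by move=> mA; rewrite integral_indicE. Qed.

Lemma coupling_integral mu P : coupling mu P ->
  forall h, measurable_fun setT h -> (forall x, 0 <= h x)%E ->
  (\int[P]_p h p.1 = \int[mu]_x h x)%E /\ (\int[P]_p h p.2 = \int[mu]_x h x)%E.
Proof.
move=> cP h mh h0.
have [m1 [m1E m1h]] := push_measure_ex P (measurable_fst : measurable_fun setT (@fst E3 E3)).
have [m2 [m2E m2h]] := push_measure_ex P (measurable_snd : measurable_fun setT (@snd E3 E3)).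
rewrite -m1h// -m2h//; split; apply: eq_measure_integral => A mA _.
- by rewrite m1E -(cP _ mA).1.
- by rewrite m2E -(cP _ mA).2.
Qed.

Lemma coupling_of_integral mu P :
  (forall h, measurable_fun setT h -> (forall x, 0 <= h x)%E ->
    (\int[P]_p h p.1 = \int[mu]_x h x)%E /\ (\int[P]_p h p.2 = \int[mu]_x h x)%E) ->
  coupling mu P.
Proof.
move=> H A mA; have [h1 h2] := H (fun x => (\1_A x)%:E) (measurable_indicE mA) (fun x => ltac:(by rewrite lee_fin)).
have m1 : measurable (@fst E3 E3 @^-1` A) by rewrite -[X in measurable X]setTI; exact: measurable_fst.
have m2 : measurable (@snd E3 E3 @^-1` A) by rewrite -[X in measurable X]setTI; exact: measurable_snd.
rewrite /pushforward (measure_of_integral mu mA); split.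
- by rewrite -h1 -(integral_indicE P m1).
- by rewrite -h2 -(integral_indicE P m2).
Qed.

Lemma plan_mass rho m P : partial_plan rho m P -> exists p, P setT = p%:E /\ 0 <= p /\ p <= m.
Proof.
move=> [rm _ le1 _]; have := le1 (fun=> 1%E) (@measurable_cst _ _ _ _ _ _) (fun=> lee01).
rewrite !integral_one rm; have P0 : (0 <= P setT)%E by exact: measure_ge0.
move: (P setT) P0 => [p||]//; rewrite ?lee_fin => p0 pm; by exists p.
Qed.

(** Scaling the whole plan down to the mass required lowers its cost and its marginals. The maximum
    with 0 covers masses below 1/2. *)
Lemma plan_trim rho (m : R) P : partial_plan rho m P -> exists P', [/\ partial_plan rho m P',
  P' setT = (Num.max 0 (2 * m - 1))%:E & (cost P' <= cost P)%E].
Proof.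
move=> pP; have [p [Pp [p0 pm]]] := plan_mass pP; case: pP => rm eP le1 massP.
set M := Num.max 0 (2 * m - 1).
have M0 : 0 <= M by rewrite le_max lexx.
have Mp : M <= p by rewrite ge_max p0/=; move: massP; rewrite Pp lee_fin.
(* If [p] is 0, so is [M], and the convention on the inverse gives s = 0, as it should be. *)
pose s := M / p; have s0 : 0 <= s by rewrite divr_ge0.
have s1 : s <= 1.
  have [p00|pn] := eqVneq p 0; first by rewrite /s p00 invr0 mulr0.
  by rewrite ler_pdivrMr ?mul1r// lt0r pn.
have sp : s * p = M.
  have [p00|pn] := eqVneq p 0; last by rewrite divfK.
  by rewrite p00 mulr0; apply/eqP; rewrite eq_le M0 -p00.
have [P' [P'A P'E]] := scale_measure_ex P s0.
have mc := @measurable_kernel2 R.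
exists P'; split; first split => //.
- by move=> h mh h0; rewrite !P'E ?eP//; [exact: measurable_comp2|exact: measurable_comp1].
- move=> h mh h0; rewrite P'E//; last exact: measurable_comp1.
  apply: le_trans (le1 h mh h0); rewrite -[leRHS]mul1e lee_wpmul2r//.
  by apply: integral_ge0.
- by rewrite P'A Pp -EFinM sp lee_fin le_max lexx orbT.
- by rewrite P'A Pp -EFinM sp.
- rewrite /cost P'E//; last by move=> q; exact: coulomb_kernel_ge0.
  rewrite -[leRHS]mul1e lee_wpmul2r//; exact: cost_ge0.
Qed.

Lemma fractional_cost_le rho (m : R) P : partial_plan rho m P ->
  (fractional_cost rho m <= cost P)%E.
Proof.
move=> pP; rewrite /fractional_cost; case: ifPn => [m2|_]; last exact: cost_ge0.
have [P' [[rm eP le1 _] P'm P'c]] := plan_trim pP; apply: le_trans P'c.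
have [mu muE] := marginal_ex P'.
apply: (@le_trans _ _ (coulomb_cost mu)).
  apply: ereal_inf_lbound; exists mu => //; split.
    move=> A mA; rewrite (measure_of_integral mu mA) (measure_of_integral rho mA).
    rewrite muE; [|exact: measurable_indicE|by move=> x; rewrite lee_fin].
    by apply: le1; [exact: measurable_indicE|move=> x; rewrite lee_fin].
  rewrite -(integral_one mu) muE// integral_one P'm max_r//.
  by lra.
apply: ereal_inf_lbound; exists P' => //.
by apply: coupling_of_integral => h mh h0; rewrite muE// eP.
Qed.

Lemma partial_plan0 rho (m : R) : rho setT = m%:E -> m <= 2^-1 -> exists P,
  [/\ partial_plan rho m P, P setT = 0%E & cost P = 0%E].
Proof.
move=> rm m2; exists (mzero : meas6); split => //.
- split=> //.
  + by move=> h mh h0; rewrite !integral_measure_zero.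
  + by move=> h mh h0; rewrite integral_measure_zero integral_ge0.
  + by rewrite /mzero lee_fin; lra.
- by rewrite /cost integral_measure_zero.
Qed.

Lemma fractional_cost_lt rho (m : R) K : rho setT = m%:E -> (fractional_cost rho m < K)%E ->
  exists P, [/\ partial_plan rho m P, P setT = (Num.max 0 (2 * m - 1))%:E & (cost P < K)%E].
Proof.
move=> rm; rewrite /fractional_cost; case: ifPn => [m2|].
  move=> /ereal_inf_lt[_ [mu [muA mum] <-]] /ereal_inf_lt[_ [P cP <-]] PK.
  have H := coupling_integral cP.
  have PT : P setT = (2 * m - 1)%:E.
    rewrite -mum -(integral_one P) -(integral_one mu).
    by have [] := H (fun=> 1%E) (@measurable_cst _ _ _ _ _ _) (fun=> lee01).
  exists P; split => //; first split => //.
  - by move=> h mh h0; have [-> ->] := H h mh h0.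
  - move=> h mh h0; have [-> _] := H h mh h0.
    by apply: ge0_le_measure_integral.
  - by rewrite PT.
  - by rewrite PT max_r//; lra.
rewrite -ltNge => m2 K0; have [P [pP P0 cP]] := partial_plan0 rm (ltW m2).
exists P; split => //; last by rewrite cP.
by rewrite P0 max_l//; lra.
Qed.

(** For a probability the mass 2 * 1 - 1 to be coupled is the full mass. *)
Lemma coupling_plan rho P : rho setT = 1%E -> coupling rho P -> partial_plan rho 1 P.
Proof.
move=> r1 /coupling_integral H; split => //.
- by move=> h mh h0; have [-> ->] := H h mh h0.
- by move=> h mh h0; have [-> _] := H h mh h0.
- rewrite -integral_one; have [-> _] := H (fun=> 1%E) (@measurable_cst _ _ _ _ _ _) (fun=> lee01).
  by rewrite integral_one r1 lee_fin; lra.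
Qed.

Lemma symmetrise_ex Q : exists Q', forall H : E3 * E3 -> \bar R,
  measurable_fun setT H -> (forall p, 0 <= H p)%E ->
  (\int[Q']_p H p = 2^-1%:E * (\int[Q]_p H p + \int[Q]_p H (p.2, p.1)))%E.
Proof.
have [Qs [_ QsE]] := push_measure_ex Q (@measurable_swap _ _ E3 E3).
have [S [_ SE]] := sum_measure_ex (fun b : bool => if b then Q else Qs).
have [Q' [_ Q'E]] := scale_measure_ex S (ltac:(by rewrite invr_ge0) : 0 <= 2^-1 :> R).
by exists Q' => H mH H0; rewrite Q'E// SE// big_bool/= QsE.
Qed.

Lemma half_double (x : \bar R) : (2^-1%:E * (x + x) = x)%E.
Proof.
case: x => [x| |]/=; first by rewrite -EFinD -EFinM; congr EFin; field.
- by rewrite addye// gt0_muley// lte_fin invr_gt0.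
- by rewrite addeNy gt0_muleNy// lte_fin invr_gt0.
Qed.

(* Symmetrising the plan weighted by [w(x) w(y)] gives a plan for the measure
   weighted by [w]; as [w(x) w(y) >= w(x) + w(y) - 1], enough mass is kept. *)
Lemma partial_plan_weight rho rho' (m m' : R) P (w : E3 -> R) : partial_plan rho m P ->
  measurable_fun setT w -> (forall x, 0 <= w x <= 1) -> rho' setT = m'%:E ->
  (forall h, measurable_fun setT h -> (forall x, 0 <= h x)%E ->
    (\int[rho']_x h x = \int[rho]_x ((w x)%:E * h x))%E) ->
  exists P', partial_plan rho' m' P' /\
    cost P' = (\int[P]_p ((w p.1 * w p.2)%:E * coulomb_kernel p.1 p.2))%E.
Proof.
move=> pP mw w01 rm' rho'E.
have w0 x : 0 <= w x by have /andP[] := w01 x.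
have w1 x : w x <= 1 by have /andP[] := w01 x.
have [p [Pp [p0 pm]]] := plan_mass pP; case: pP => rm eP le1 massP.
have mW1 : measurable_fun setT (fun p : E3 * E3 => w p.1) by apply: (measurableT_comp mw); exact: measurable_fst.
have mW2 : measurable_fun setT (fun p : E3 * E3 => w p.2) by apply: (measurableT_comp mw); exact: measurable_snd.
have mW : measurable_fun setT (fun p : E3 * E3 => w p.1 * w p.2) by exact: measurable_funM.
have W0 (q : E3 * E3) : 0 <= w q.1 * w q.2 by rewrite mulr_ge0.
have [Q [_ QE]] := density_ex P mW W0.
have [P' P'E] := symmetrise_ex Q.
have mwE : measurable_fun setT (fun x => (w x)%:E) by exact/measurable_EFinP.
exists P'; split; last first.
  have mc := @measurable_kernel2 R.
  rewrite /cost P'E//; last by move=> q; exact: coulomb_kernel_ge0.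
  rewrite (_ : (\int[Q]_p coulomb_kernel (p.2, p.1).1 (p.2, p.1).2)%E = (\int[Q]_p coulomb_kernel p.1 p.2)%E).
    by rewrite half_double QE// => q; exact: coulomb_kernel_ge0.
  by apply: eq_integral => q _; rewrite coulomb_kernelC.
split => //.
- move=> h mh h0; rewrite !P'E//=; first by rewrite addeC.
  + exact: measurable_comp2.
  + exact: measurable_comp1.
- move=> h mh h0; rewrite P'E//=; last exact: measurable_comp1.
  have m1 := measurable_comp1 mh; have m2 := measurable_comp2 mh.
  have mwh : measurable_fun setT (fun x => (w x)%:E * h x)%E by exact: emeasurable_funM.
  have wh0 x : (0 <= (w x)%:E * h x)%E by rewrite mule_ge0// lee_fin.
  rewrite rho'E// !QE//; apply: le_trans (le1 _ mwh wh0).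
  rewrite -[leRHS]half_double; apply: lee_wpmul2l; first by rewrite lee_fin invr_ge0.
  rewrite [X in (_ <= _ + X)%E](eP _ mwh wh0).
  apply: leeD; apply: ge0_le_integral => //.
  + by move=> q _; rewrite mule_ge0// lee_fin.
  + by apply: emeasurable_funM => //; exact/measurable_EFinP.
  + exact: (measurable_comp1 mwh).
  + by move=> q _; rewrite lee_wpmul2r// lee_fin ler_piMr.
  + by move=> q _; rewrite mule_ge0// lee_fin.
  + by apply: emeasurable_funM => //; exact/measurable_EFinP.
  + exact: (measurable_comp2 mwh).
  + by move=> q _; rewrite lee_wpmul2r// lee_fin ler_piMl.
- have P'T : P' setT = (\int[P]_q (w q.1 * w q.2)%:E)%E.
    rewrite -(integral_one P') P'E; [|exact: measurable_cst|by []].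
    rewrite half_double QE; [|exact: measurable_cst|by []].
    by apply: eq_integral => q _; rewrite mule1.
  have w0E x : (0 <= (w x)%:E)%E by rewrite lee_fin.
  have fin (f : E3 * E3 -> R) : measurable_fun setT f -> (forall q, 0 <= f q <= 1) ->
      exists2 a, (\int[P]_q (f q)%:E)%E = a%:E & 0 <= a.
    move=> mf f01.
    have i0 : (0 <= \int[P]_q (f q)%:E)%E.
      by apply: integral_ge0 => q _; rewrite lee_fin; have /andP[] := f01 q.
    have : (\int[P]_q (f q)%:E <= p%:E)%E.
      rewrite -Pp -integral_one; apply: ge0_le_integral => //.
      + by move=> q _; rewrite lee_fin; have /andP[] := f01 q.
      + exact/measurable_EFinP.
      + by move=> q _; rewrite lee_fin; have /andP[] := f01 q.
    move: i0; case: (\int[P]_q (f q)%:E)%E => [a| |]//.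
    by rewrite lee_fin => a0 _; exists a.
  have [a aE a0] := fin _ mW1 (fun q => w01 q.1).
  have [k kE k0] := fin _ mW (fun q => ltac:(by rewrite W0/= mulr_ile1)).
  have [c cE c0] : exists2 c, (\int[P]_q (1 - w q.1)%:E)%E = c%:E & 0 <= c.
    apply: fin; first by apply: measurable_funB => //; exact: measurable_cst.
    by move=> q; have := w01 q.1; clear; lra.
  (* Here a, k, c are the integrals against [P] of w(x), w(x) w(y) and 1 - w(x). From k >= 2a - p =
     p - 2c, p >= 2m - 1 and c <= m - m' follows k >= 2m' - 1. *)
  have ac : p = a + c.
  { apply/EFin_inj; rewrite -Pp EFinD -aE -cE -ge0_integralD//.
      rewrite -integral_one; apply: eq_integral => q _.
      by rewrite -EFinD; congr EFin; ring.
    all: first [by move=> q _; rewrite lee_fin ?subr_ge0|exact/measurable_EFinP|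
      by apply/measurable_EFinP; apply: measurable_funB => //; exact: measurable_cst]. }
  have m1w : measurable_fun setT (fun x : E3 => (1 - w x)%:E).
    by apply/measurable_EFinP; apply: measurable_funB => //; exact: measurable_cst.
  have w1E x : (0 <= (1 - w x)%:E)%E by rewrite lee_fin subr_ge0.
  have cm : c <= m - m'.
    suff : ((c + m')%:E <= m%:E)%E by rewrite lee_fin; clear; lra.
    rewrite EFinD -rm -rm' -cE.
    have -> : rho' setT = (\int[rho]_x (w x)%:E)%E.
      rewrite -(integral_one rho') rho'E; [|exact: measurable_cst|by []].
      by apply: eq_integral => x _; rewrite mule1.
    apply: (le_trans (leeD (le1 _ m1w w1E) (lexx _))).
    rewrite -ge0_integralD//.
    rewrite -integral_one; apply: ge0_le_integral => //.
    + by move=> x _; rewrite adde_ge0.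
    + exact: emeasurable_funD.
    + by move=> x _; rewrite -EFinD lee_fin; clear; lra.
  have ak : 2 * a <= k + p.
  { suff : ((a + a)%:E <= (k + p)%:E)%E by rewrite lee_fin; clear; lra.
    rewrite !EFinD -Pp -integral_one -kE -{1}aE -aE [X in (_ + X <= _)%E](eP _ mwE w0E).
    rewrite -!ge0_integralD//.
      apply: ge0_le_integral => //.
      * by move=> q _; rewrite adde_ge0// lee_fin.
      * by apply: emeasurable_funD; exact/measurable_EFinP.
      * by apply: emeasurable_funD; [exact/measurable_EFinP|exact: measurable_cst].
      move=> q _; rewrite -!EFinD lee_fin.
      have := mulr_ge0 (ltac:(by rewrite subr_ge0) : 0 <= 1 - w q.1) (ltac:(by rewrite subr_ge0) : 0 <= 1 - w q.2).
      clear; lra.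
    all: first [by move=> q _; rewrite lee_fin|exact/measurable_EFinP|exact: measurable_cst]. }
  rewrite P'T kE lee_fin; move: massP; rewrite Pp lee_fin; clear -ac cm ak; lra.
Qed.

Lemma kernel_affine X (e : R) (x y : E3) : 0 < e ->
  coulomb_kernel (affine X e x) (affine X e y) = (e^-1%:E * coulomb_kernel x y)%E.
Proof.
move=> e0; rewrite !coulomb_kernelE.
have -> : affine X e x - affine X e y = e *: (x - y).
  by rewrite /affine scalerBr opprD addrACA subrr add0r.
rewrite enorm_scale ?(ltW e0)// mulf_eq0 (gt_eqF e0)/=.
case: ifPn => _; first by rewrite gt0_muley// lte_fin invr_gt0.
by rewrite -EFinM invfM.
Qed.

Lemma attraction_affine rho rho' X (e : R) : 0 < e ->
  (forall h, measurable_fun setT h -> (forall x, 0 <= h x)%E ->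
    (\int[rho']_x h x = \int[rho]_x h (affine X e x))%E) ->
  attraction X rho' = (e^-1%:E * attraction (0 : E3)%R rho)%E.
Proof.
move=> e0 rho'E; rewrite /attraction rho'E; last 2 first.
- exact: measurable_kernel.
- by move=> x; exact: coulomb_kernel_ge0.
rewrite -ge0_integralZl//; first last.
- by rewrite lee_fin invr_ge0 ltW.
- by move=> x _; exact: coulomb_kernel_ge0.
- exact: measurable_kernel.
apply: eq_integral => x _; rewrite -(kernel_affine X)//.
by congr coulomb_kernel; rewrite /affine scaler0 addr0.
Qed.

Lemma partial_plan_affine rho rho' (m : R) P X (e : R) : 0 < e -> partial_plan rho m P ->
  (forall h, measurable_fun setT h -> (forall x, 0 <= h x)%E ->
    (\int[rho']_x h x = \int[rho]_x h (affine X e x))%E) ->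
  exists P', [/\ partial_plan rho' m P', P' setT = P setT & cost P' = (e^-1%:E * cost P)%E].
Proof.
move=> e0 [rm eP le1 massP] rho'E.
have ma := measurable_affine X e.
have mha h : measurable_fun setT h -> measurable_fun setT (h \o affine X e).
  by move=> mh; apply: measurableT_comp.
have mf : measurable_fun setT (fun p : E3 * E3 => (affine X e p.1, affine X e p.2)).
  apply: measurable_fun_pair; apply: (measurableT_comp ma).
  - exact: measurable_fst.
  - exact: measurable_snd.
have [P' [P'A P'E]] := push_measure_ex P mf.
have mc := @measurable_kernel2 R.
exists P'; split.
- split.
  + by rewrite -(integral_one rho') rho'E// integral_one.
  + move=> h mh h0; rewrite (P'E _ (measurable_comp1 mh) (fun p => h0 p.1)) (P'E _ (measurable_comp2 mh) (fun p => h0 p.2)).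
    exact: (eP (h \o affine X e) (mha _ mh) (fun x => h0 _)).
  + move=> h mh h0; rewrite P'E//=; last exact: measurable_comp1.
    rewrite rho'E//.
    exact: (le1 (h \o affine X e) (mha _ mh) (fun x => h0 _)).
  + by rewrite P'A preimage_setT.
- by rewrite P'A preimage_setT.
- rewrite /cost P'E//; last by move=> q; exact: coulomb_kernel_ge0.
  under eq_integral do rewrite kernel_affine//.
  rewrite ge0_integralZl//; last by rewrite lee_fin invr_ge0 ltW.
  by move=> q _; exact: coulomb_kernel_ge0.
Qed.

(** Scaling preserves the mass condition because s (2m - 1) >= 2 s m - 1 for s <= 1. *)
Lemma partial_plan_scale rho rho' (m s : R) P : 0 <= s <= 1 -> partial_plan rho m P ->
  (forall h, measurable_fun setT h -> (forall x, 0 <= h x)%E ->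
    (\int[rho']_x h x = s%:E * \int[rho]_x h x)%E) ->
  exists P', partial_plan rho' (s * m) P' /\ cost P' = (s%:E * cost P)%E.
Proof.
move=> /andP[s0 s1] pP rho'E.
have [p [Pp [p0 pm]]] := plan_mass pP; case: pP => rm eP le1 massP.
have [P' [P'A P'E]] := scale_measure_ex P s0.
have mc := @measurable_kernel2 R.
exists P'; split; last by rewrite /cost P'E// => q; exact: coulomb_kernel_ge0.
split.
- by rewrite -(integral_one rho') rho'E// integral_one rm.
- by move=> h mh h0; rewrite !P'E ?eP//; [exact: measurable_comp2|exact: measurable_comp1].
- move=> h mh h0; rewrite P'E//; last exact: measurable_comp1.
  by rewrite rho'E// lee_wpmul2l ?lee_fin// le1.
- by rewrite P'A Pp -EFinM lee_fin; move: massP; rewrite Pp lee_fin; nra.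
Qed.

End plans.

Section plan_add.
Variable R : realType.
Local Notation E3 := (E3 R).
Local Notation meas3 := {measure set E3 -> \bar R}.
Local Notation meas6 := {measure set (E3 * E3) -> \bar R}.
Implicit Types (rho mu tau : meas3) (P Q : meas6) (h : E3 -> \bar R) (X : E3).

(* A residual part of [mu] and the new mass [tau] are coupled with each other. *)
Lemma partial_plan_add mu tau rho (m d : R) P K : 2^-1 <= m -> 0 < d -> m + d <= 1 ->
  partial_plan mu m P -> tau setT = d%:E ->
  (forall x, attraction x tau <= K%:E)%E ->
  (forall h, measurable_fun setT h -> (forall x, 0 <= h x)%E ->
    (\int[rho]_x h x = \int[mu]_x h x + \int[tau]_x h x)%E) ->
  exists P', partial_plan rho (m + d) P' /\ (cost P' <= cost P + (2 * K)%:E)%E.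
Proof.
move=> m2 d0 md /plan_trim[P1 [[mum eP le1 _] P1T P1c]] taud tauK rhoE.
have mc := @measurable_kernel2 R.
have P1T' : P1 setT = (2 * m - 1)%:E by rewrite P1T max_r//; lra.
have [lam lamE] := marginal_ex P1.
have lamle A : measurable A -> (lam A <= mu A)%E.
  move=> mA; rewrite (measure_of_integral lam mA) (measure_of_integral mu mA).
  rewrite lamE; [|exact: measurable_indicE|by move=> x; rewrite lee_fin].
  by apply: le1; [exact: measurable_indicE|move=> x; rewrite lee_fin].
have [kap kapE] := sub_measure_ex (ltac:(by rewrite mum ltry) : (mu setT < +oo)%E) lamle.
have kapI := sub_measure_integral kapE.
have lamT : lam setT = (2 * m - 1)%:E.
  by rewrite -(integral_one lam) lamE// integral_one.
(* The mass m - (2m - 1) of the uncoupled part [kap]. Symmetrising [kap] times [tau] and scaling by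
   2/k gives a plan of mass 2d with marginals tau + (d/k) kap. It fits into the space left, as d <=
   k; the total mass is 2(m + d) - 1, and the new cost is at most (2/k) K k = 2K. *)
pose k := 1 - m; have k0 : 0 < k by rewrite /k; lra.
have kapT : kap setT = k%:E.
  have := kapE _ measurableT; rewrite mum lamT.
  have : (0 <= kap setT)%E by exact: measure_ge0.
  case: (kap setT) => [x _|//|//]; rewrite -EFinD => -[E].
  by congr EFin; rewrite /k; lra.
have [Q QE] := product_measure_ex (ltac:(by rewrite kapT ltry) : (kap setT < +oo)%E)
   (ltac:(by rewrite taud ltry) : (tau setT < +oo)%E).
have [Q' Q'E] := symmetrise_ex Q.
have kk : 0 <= 2 / k by rewrite divr_ge0 ?(ltW k0).
have [Q2 [_ Q2E]] := scale_measure_ex Q' kk.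
have [P' [_ P'E]] := sum_measure_ex (fun b : bool => if b then P1 else Q2).
have Q1 h : measurable_fun setT h -> (forall x, 0 <= h x)%E ->
    (\int[Q]_p h p.1 = d%:E * \int[kap]_x h x)%E.
  move=> mh h0; have [-> _] := QE _ (measurable_comp1 mh) (fun q => h0 q.1).
  under eq_integral do rewrite /= integral_cst// taud muleC.
  by rewrite ge0_integralZl// lee_fin ltW.
have Q2' h : measurable_fun setT h -> (forall x, 0 <= h x)%E ->
    (\int[Q]_p h p.2 = k%:E * \int[tau]_x h x)%E.
  move=> mh h0; have [_ ->] := QE _ (measurable_comp2 mh) (fun q => h0 q.2).
  under eq_integral do rewrite /= integral_cst// kapT muleC.
  by rewrite ge0_integralZl// lee_fin ltW.
have marg h : measurable_fun setT h -> (forall x, 0 <= h x)%E ->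
    (\int[Q2]_p h p.1 = (d / k)%:E * \int[kap]_x h x + \int[tau]_x h x)%E.
  move=> mh h0; rewrite Q2E//; last exact: measurable_comp1.
  rewrite Q'E//=; last exact: measurable_comp1.
  rewrite Q1// Q2'//.
  have : (0 <= \int[kap]_x h x)%E by exact: integral_ge0.
  have : (0 <= \int[tau]_x h x)%E by exact: integral_ge0.
  move: (\int[kap]_x h x)%E (\int[tau]_x h x)%E => A B B0 A0.
  rewrite muleA -EFinM ge0_muleDr ?mule_ge0 ?lee_fin ?(ltW d0) ?(ltW k0)//.
  rewrite !muleA -!EFinM; congr (_%:E * _ + _)%E; first by field; rewrite gt_eqF.
  by rewrite -[RHS]mul1e; congr (_ * _)%E; congr EFin; field; rewrite gt_eqF.
exists P'; split; last first.
  rewrite /cost P'E//; last by move=> q; exact: coulomb_kernel_ge0.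
  rewrite big_bool/=; apply: leeD => //.
  rewrite Q2E//; last by move=> q; exact: coulomb_kernel_ge0.
  rewrite Q'E//; last by move=> q; exact: coulomb_kernel_ge0.
  rewrite (_ : (\int[Q]_p coulomb_kernel (p.2, p.1).1 (p.2, p.1).2)%E = (\int[Q]_p coulomb_kernel p.1 p.2)%E); last first.
    by apply: eq_integral => q _; rewrite coulomb_kernelC.
  rewrite half_double; have [-> _] := QE _ mc (fun q => coulomb_kernel_ge0 q.1 q.2).
  apply: (@le_trans _ _ ((2 / k)%:E * (K%:E * k%:E))%E).
    rewrite lee_wpmul2l ?lee_fin// -kapT -integral_cst//.
    apply: ge0_le_integral => //.
    + by move=> x _; apply: integral_ge0 => y _; exact: coulomb_kernel_ge0.
    + have := measurable_fun_fubini_tonelli_F (m2 := finite_of (ltac:(by rewrite taud ltry) : (tau setT < +oo)%E)) _ mc (fun q => coulomb_kernel_ge0 q.1 q.2).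
      exact.
    + move=> x _; apply: le_trans (tauK x); rewrite /attraction.
      by rewrite le_eqVlt; apply/orP; left; apply/eqP; apply: eq_integral => y _; rewrite coulomb_kernelC.
  rewrite -!EFinM lee_fin le_eqVlt; apply/orP; left; apply/eqP; field.
  by rewrite gt_eqF.
split.
- by rewrite -(integral_one rho) rhoE// !integral_one mum taud.
- move=> h mh h0; have m1 := measurable_comp1 mh; have m2' := measurable_comp2 mh.
  rewrite !P'E// !big_bool/= eP//; congr (_ + _)%E.
  by rewrite !Q2E// !Q'E//= [X in (_ * (_ * X))%E = _]addeC.
- move=> h mh h0; have m1 := measurable_comp1 mh.
  rewrite P'E// big_bool/= marg// rhoE// (kapI _ mh h0) lamE//.
  have dk : d / k <= 1 by rewrite ler_pdivrMr// mul1r /k; clear -md; lra.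
  have : (0 <= \int[kap]_x h x)%E by exact: integral_ge0.
  move: (\int[kap]_x h x)%E (\int[tau]_x h x)%E (\int[P1]_x h x.1)%E => A B D A0.
  by rewrite -addeA; apply: leeD => //; apply: leeD => //; rewrite -[leRHS]mul1e lee_wpmul2r.
- have := marg (fun=> 1%E) (@measurable_cst _ _ _ _ _ _) (fun=> lee01).
  rewrite -(integral_one P') P'E// big_bool/= => ->; rewrite !integral_one P1T' kapT taud.
  rewrite -!EFinM -!EFinD lee_fin divfK ?gt_eqF//; clear; lra.
Qed.


End plan_add.

(** * A smooth probability supported in a shell *)

Section bump_measure.
Variable R : realType.
Local Notation E3 := (E3 R).
Local Notation leb3 := (leb3 R).
Local Notation meas3 := {measure set E3 -> \bar R}.
Local Notation meas6 := {measure set (E3 * E3) -> \bar R}.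
Implicit Types (rho mu : meas3) (P Q : meas6) (u phi psi : E3 -> R) (g : E3 -> E3).

(** By translation invariance the integral of psi(x + t v) is constant near t = 0. Written as a
    [pairing] with the indicator of a large box, it can be differentiated at 0. *)
Lemma integral_derive_test psi (v : E3) : test_function psi -> (\int[leb3]_x ('D_v psi x)%:E = 0)%E.
Proof.
move=> tpsi; have [C [m [C0 dom]]] := test_dom v 1 tpsi.
pose u : E3 -> R := \1_(@box R m).
have lu : L2 u by exact: L2_box.
have out x (t : R) : `|t| <= 1 -> ~ @box R m x -> psi (x + t *: v) = 0.
  move=> t1 nx; have := dom x t t1; rewrite indicE memNset// mulr0 normr_le0.
  by move=> /eqP.
have D := is_derive_pairing v 0 lu tpsi.
have cstn : \forall t \near (0 : R), pairing u psi v t = cst (pairing u psi v 0) t.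
  exists 1; first exact: ltr01; move=> t; rewrite /ball_ /= sub0r normrN => t1.
  have E (s : R) : `|s| <= 1 -> pairing u psi v s = \int[leb3]_x psi (x + s *: v).
    move=> s1; rewrite /pairing; congr fine; apply: eq_integral => x _; congr EFin.
    have [bx|nx] := pselect (@box R m x); first by rewrite /u indicE mem_set// mul1r.
    by rewrite out// mulr0.
  rewrite /cst (E t (ltW t1)) (E 0); last by rewrite normr0 ler01.
  rewrite /Rintegral; congr fine.
  have ti := test_integrable tpsi.
  rewrite (integral_shift (t *: v) ti) scale0r.
  by apply: eq_integral => x _; rewrite addr0.
have : 'D_1 (pairing u psi v) 0 = 0.
  by rewrite (near_eq_derive (g := cst (pairing u psi v 0))) ?derive_cst.
rewrite (@derive_val _ _ _ _ _ _ _ D) => D0.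
have tD := test_derive v tpsi.
rewrite -(fineK (integrable_fin_num measurableT (test_integrable tD))).
rewrite -[RHS]/(0%:E) -D0; congr EFin; rewrite /pairing; congr fine.
apply: eq_integral => x _; rewrite scale0r addr0; congr EFin.
have [bx|nx] := pselect (@box R m x); first by rewrite /u indicE mem_set// mul1r.
rewrite (derive_out_box (n := m)) ?mulr0// => y ny.
by have := out y 0; rewrite scale0r addr0; apply; rewrite ?normr0.
Qed.

Lemma weak_derivative_test psi (v : E3) : test_function psi -> weak_derivative v psi ('D_v psi).
Proof.
move=> tpsi phi tphi; have sp := tpsi.1; have sh := tphi.1.
have tD := test_derive v tpsi.
have i1 := L2_mul (test_L2 tpsi) (test_L2 (test_derive v tphi)).
have i2 := L2_mul (test_L2 tD) (test_L2 tphi).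
have /eqP := integral_derive_test v (test_mul sp tphi).
have E x : 'D_v (fun x => psi x * phi x) x = psi x * 'D_v phi x + 'D_v psi x * phi x.
  have := deriveM (smooth_derivable (x := x) (v := v) sp) (smooth_derivable (x := x) (v := v) sh).
  by move=> ->; congr (_ + _); rewrite mulrC.
under eq_integral do rewrite E EFinD.
rewrite (integralD measurableT i1 i2).
have := integrable_fin_num measurableT i1; have := integrable_fin_num measurableT i2.
case: (\int[leb3]_x _)%E => [p _| |]//; case: (\int[leb3]_x _)%E => [q _| |]//.
by rewrite -EFinD eqe addr_eq0 => /eqP ->.
Qed.

Lemma H1_gradient_test psi : test_function psi -> H1_gradient psi (grad psi).
Proof.
move=> tpsi; apply: gradient_L2 => [|i|i]; first exact: test_L2.
- have -> : (fun x => comp3 i (grad psi x)) = 'D_(axis R i) psi.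
    by apply/funext => x; rewrite comp3_grad.
  by apply: test_L2; exact: test_derive.
- have -> : (fun x => comp3 i (grad psi x)) = 'D_(axis R i) psi.
    by apply/funext => x; rewrite comp3_grad.
  exact: weak_derivative_test.
Qed.

Lemma leb3_box_gt0 : (0 < leb3 (@box R 1))%E.
Proof.
rewrite [X in (_ < X)%E](_ : _ = (@leb2s R \x (lebesgue_measure : {measure set (measurableTypeR R) -> \bar R}))%E (@box R 1))//.
rewrite product_measure1E; last 2 first.
- by apply: measurableX; exact: measurable_itv.
- exact: measurable_itv.
pose J : set (measurableTypeR R) := `[- 1%:R, 1%:R]%classic.
have p : (0 < (lebesgue_measure : {measure set (measurableTypeR R) -> \bar R}) J)%E.
  have -> : (lebesgue_measure : {measure set (measurableTypeR R) -> \bar R}) J = _ := lebesgue_measure_itv _.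
  by rewrite /= lte_fin; case: ifPn => [_|]; rewrite ?sube_gt0 ?lte_fin; lra.
apply: mule_gt0 => //.
rewrite [X in (_ < X)%E](_ : _ = ((lebesgue_measure : {measure set (measurableTypeR R) -> \bar R}) \x (lebesgue_measure : {measure set (measurableTypeR R) -> \bar R}))%E (J `*` J))//.
rewrite product_measure1E; [|exact: measurable_itv..].
exact: mule_gt0.
Qed.

Lemma shell_bounds (p q s : R) : (p - 3) ^+ 2 + q ^+ 2 + s ^+ 2 <= 1 ->
  2 ^+ 2 <= p ^+ 2 + q ^+ 2 + s ^+ 2 <= 4 ^+ 2.
Proof.
move=> H; have q0 := sqr_ge0 q; have s0 := sqr_ge0 s.
have p2 : 2 <= p.
  rewrite leNgt; apply/negP => p2.
  by have := mulr_gt0 (ltac:(by lra) : 0 < 2 - p) (ltac:(by lra) : 0 < 4 - p); lra.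
have p4 : p <= 4.
  rewrite leNgt; apply/negP => p4.
  by have := mulr_gt0 (ltac:(by lra) : 0 < p - 2) (ltac:(by lra) : 0 < p - 4); lra.
have := sqr_ge0 (p - 2); lra.
Qed.

Lemma bump_measure_ex : exists beta u g, [/\ amplitude beta u g, beta setT = 1%E &
  supported u g [set x | 2 <= enorm x <= 4]].
Proof.
(* The unit ball centred at distance 3 lies between the spheres of radii 2 and 4. *)
pose X : E3 := (3, 0, 0); pose th := cutoff X 1.
have tth : test_function th by exact: test_cutoff.
have hg := H1_gradient_test tth.
have mth : measurable_fun setT th by apply: smooth_measurable; exact: tth.1.
have [nu [_ nuE]] := density_ex leb3 (measurable_funX 2 mth) (fun x => sqr_ge0 (th x)).
have au : amplitude nu th (grad th) by split => // x; exact: cutoff_ge0.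
have qlty := amplitude_mass_lty au.
have q0 : (0 < nu setT)%E.
  (* The mass is positive: on the cube of half-side 1/4 around [X] the squared cutoff is at least 1
     - 4 * 3/16 = 1/4. *)
  rewrite (amplitude_mass au) (@ge0_integral_affine _ X 4^-1)//; last 2 first.
  - by apply/measurable_EFinP; exact: measurable_funX.
  - by move=> x; rewrite lee_fin sqr_ge0.
  apply: mule_gt0; first by rewrite lte_fin exprn_gt0.
  apply: (@lt_le_trans _ _ (4^-1%:E * leb3 (@box R 1))%E).
    by apply: mule_gt0; [rewrite lte_fin|exact: leb3_box_gt0].
  rewrite -integral_cst//; last exact: measurable_box.
  rewrite integral_mkcond; apply: ge0_le_integral => //.
  - by move=> x _; rewrite patchE; case: ifP => _; rewrite lee_fin.
  - apply/(measurable_restrictT _ (@measurable_box R 1)); exact: measurable_cst.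
  - apply/measurable_EFinP; apply: measurable_funX; apply: (measurableT_comp mth).
    exact: measurable_affine.
  move=> x _; rewrite patchE; case: ifPn => [|_]; last by rewrite lee_fin sqr_ge0.
  rewrite inE => -[[/= b1 b2] b3]; rewrite lee_fin /th /cutoff/= cutoff_arg.
  rewrite /affine addrAC subrr add0r invr1 scale1r.
  apply: le_trans (bump_sqr_ge _); rewrite enorm_scale// exprMn enorm_sqr.
  have sq (y : R) : y \in `[- 1%:R, 1%:R] -> y ^+ 2 <= 1.
    by rewrite in_itv/= -ler_norml => y1; rewrite -(real_normK (num_real y)) exprn_ile1.
  by have := sq _ b1; have := sq _ b2; have := sq _ b3; lra.
have [q [qE q0']] : exists q, nu setT = q%:E /\ 0 < q.
  by move: q0 qlty; case: (nu setT) => [q| |]//; rewrite lte_fin; exists q.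
have qi0 : 0 <= q^-1 by rewrite invr_ge0 ltW.
have [beta [betaA betaE]] := scale_measure_ex nu qi0.
exists beta, (fun x => Num.sqrt q^-1 * th x), (fun x => Num.sqrt q^-1 *: grad th x); split.
- exact: amplitude_scale au betaE.
- by rewrite betaA qE -EFinM mulVf// gt_eqF.
move=> x nx; have x1 : 1 <= enorm (x - X).
  rewrite leNgt; apply/negP => x1; apply: nx => /=.
  have h0 := enorm_ge0 (x - X); have h1 := enorm_ge0 x.
  have e1 := enorm_sqr (x - X); have e2 := enorm_sqr x.
  have c1 : (x - X).1.1 = x.1.1 - 3 :> R by [].
  have c2 : (x - X).1.2 = x.1.2 :> R by rewrite /= subr0.
  have c3 : (x - X).2 = x.2 :> R by rewrite /= subr0.
  rewrite c1 c2 c3 in e1.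
  have l1 : enorm (x - X) ^+ 2 <= 1 by rewrite exprn_ile1// ltW.
  move: l1; rewrite e1 => /shell_bounds/andP[lo hi].
  by apply/andP; split; rewrite -(@ler_pXn2r _ 2) ?nnegrE// e2.
have -> : th x = 0 by exact: cutoff_out.
have -> : grad th x = 0 by rewrite /grad /th !derive_cutoff_out.
by rewrite mulr0 scaler0.
Qed.

End bump_measure.

(** * The cell problem *)

Section cell_energy.
Variable R : realType.
Local Notation E3 := (E3 R).
Local Notation leb3 := (leb3 R).
Local Notation meas3 := {measure set E3 -> \bar R}.
Local Notation meas6 := {measure set (E3 * E3) -> \bar R}.
Implicit Types (rho mu : meas3) (P Q : meas6) (u phi psi : E3 -> R) (g : E3 -> E3).

(** Competitors enter the cell problem only through this certificate: upper bounds on energy and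
    cost, a lower bound on attraction. *)
Lemma cell_energy_le (b Z alpha : R) rho u g P (t c a : R) : 0 <= b -> 0 <= Z -> alpha <= 1 ->
  amplitude rho u g -> partial_plan rho alpha P ->
  (energy g <= t%:E)%E -> (cost P <= c%:E)%E -> (a%:E <= attraction (0 : E3)%R rho)%E ->
  (cell_energy b Z alpha <= (t + b * c - Z * a)%:E)%E.
Proof.
move=> b0 Z0 a1 au pP gt Pc aA.
have [p pE] := subprobability_ex (ltac:(by case: pP => -> *; rewrite lee_fin) : (rho setT <= 1)%E).
have pI h : measurable_fun setT h -> (forall x, 0 <= h x)%E -> (\int[p]_x h x = \int[rho]_x h x)%E.
  by move=> mh h0; apply: eq_measure_integral => A mA _; exact: pE.
have aup : amplitude p u g.
  by case: au => u0 hg hrho; split => // h mh h0; rewrite pI// hrho.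
have pPp : partial_plan p alpha P.
  case: pP => rm eP le1 mP; split => //; first by rewrite -rm; exact: pE.
  by move=> h mh h0; rewrite pI//; exact: le1.
have kt : (kinetic p <= t%:E)%E by exact: le_trans (kinetic_le aup) gt.
apply: (@le_trans _ _ (kinetic p + b%:E * fractional_cost p alpha - Z%:E * attraction (0 : E3)%R p)%E).
  apply: ereal_inf_lbound; exists p => //; split; first by case: pPp.
  exact: le_lt_trans (ltry t).
rewrite EFinB EFinD !EFinM; apply: leeB; first apply: leeD => //.
- by rewrite lee_wpmul2l ?lee_fin//; exact: le_trans (fractional_cost_le pPp) Pc.
- rewrite lee_wpmul2l ?lee_fin//; apply: (le_trans aA); rewrite /attraction pI//.
    exact: measurable_kernel.
  by move=> x; exact: coulomb_kernel_ge0.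
Qed.

(** [attraction_bound] at eta = Z/4, where the gradient term has coefficient exactly 1 after
    multiplication by [Z]. It bounds the cell functional below by -(3/4) Z^2 m. *)
Lemma attraction_le_energy (Z m t a : R) rho u g : 0 < Z -> amplitude rho u g ->
  rho setT = m%:E -> (energy g <= t%:E)%E -> (a%:E <= attraction (0 : E3)%R rho)%E ->
  Z * a <= t + 3 / 4 * Z ^+ 2 * m.
Proof.
move=> Z0 au rm gt aA.
have Z4 : 0 < Z / 4 by rewrite divr_gt0.
have := le_trans aA (attraction_bound 0 au Z4); rewrite rm.
have g0 := energy_ge0 g; move: gt g0; case: (energy g) => [e| |]//.
rewrite -?EFinM -?EFinD !lee_fin => et e0.
have -> : 4 * (Z / 4) = Z by field.
move=> H; have {}H : Z * a <= Z * (3 * (Z / 4) * m + Z^-1 * e) by rewrite ler_pM2l.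
apply: (le_trans H); rewrite mulrDr !mulrA divff ?gt_eqF// mul1r; lra.
Qed.

(** A one-sided continuity of the cell problem in the mass, with [delta] independent of the
    competitor and of its radius [r]. For m >= alpha everything is scaled by alpha / m. For m <
    alpha a bump of mass alpha - m is added at a distance and width [n], where its energy and its
    interactions are O(1/n). *)
Lemma cell_energy_near (b Z alpha eta : R) : 0 < b -> 0 < Z -> 0 <= alpha <= 1 -> 0 < eta ->
  exists2 delta : R, 0 < delta & forall mu u g P (m t c a r : R),
    amplitude mu u g -> supported u g [set x | enorm x <= r] -> partial_plan mu m P ->
    `|m - alpha| < delta ->
    (energy g <= t%:E)%E -> (cost P <= c%:E)%E -> (a%:E <= attraction (0 : E3)%R mu)%E ->
    (cell_energy b Z alpha <= (t + b * c - Z * a + eta)%:E)%E.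
Proof.
move=> b0 Z0 /andP[al0 al1] eta0.
pose k := 3 / 4 * Z ^+ 2; have k0 : 0 <= k by rewrite mulr_ge0 ?sqr_ge0.
have k1 : 0 < k + 1 by rewrite ltr_wpDl.
(* The first bound pays for the scaling; the second, when alpha > 1/2, keeps [m] at least 1/2, the
   range of [partial_plan_add]. *)
pose delta := Num.min (eta / (k + 1)) (if 2^-1 < alpha then alpha - 2^-1 else 1).
have [beta [ub [gb [aub betaT sb]]]] := @bump_measure_ex R.
exists delta.
  rewrite lt_min divr_gt0//=; case: ifPn => //; lra.
move=> mu u g P m t c a r au su pP mal gt Pc aA.
have muT : mu setT = m%:E by case: pP.
have m0 : 0 <= m by rewrite -lee_fin -muT.
have ZaE := attraction_le_energy Z0 au muT gt aA.
have c0 : 0 <= c by rewrite -lee_fin; exact: le_trans (cost_ge0 P) Pc.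
have t0 : 0 <= t by rewrite -lee_fin; exact: le_trans (energy_ge0 g) gt.
have bc0 : 0 <= b * c by rewrite mulr_ge0// ltW.
have [ltd1 ltd2] : `|m - alpha| < eta / (k + 1) /\ `|m - alpha| < if 2^-1 < alpha then alpha - 2^-1 else 1.
  by move: mal; rewrite lt_min => /andP[].
have [alm|mal'] := leP alpha m.
  pose s := alpha / m.
  have sm : s * m = alpha.
    have [mz|mn] := eqVneq m 0; last by rewrite divfK.
    by rewrite mz mulr0; apply/eqP; rewrite eq_le al0 -mz alm.
  have s0 : 0 <= s by rewrite divr_ge0.
  have s1 : s <= 1.
    have [mz|mn] := eqVneq m 0; first by rewrite /s mz invr0 mulr0.
    by rewrite ler_pdivrMr ?mul1r// lt0r mn.
  have [mu' [_ mu'E]] := scale_measure_ex mu s0.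
  have au' := amplitude_scale s0 au mu'E.
  have [P' [pP' cP']] := partial_plan_scale (ltac:(by rewrite s0 s1) : 0 <= s <= 1) pP mu'E.
  rewrite sm in pP'.
  apply: (@le_trans _ _ (s * t + b * (s * c) - Z * (s * a))%:E).
    apply: (cell_energy_le (ltW b0) (ltW Z0) al1 au' pP').
    - rewrite (energyZ (let: And3 _ hg _ := au in hg)) ?sqrtr_ge0//.
      by rewrite sqr_sqrtr// [leRHS]EFinM; apply: lee_wpmul2l; rewrite ?lee_fin.
    - by rewrite cP' [leRHS]EFinM; apply: lee_wpmul2l; rewrite ?lee_fin.
    - rewrite /attraction mu'E; [|exact: measurable_kernel|by move=> x; exact: coulomb_kernel_ge0].
      by rewrite EFinM lee_wpmul2l// lee_fin.
  rewrite lee_fin.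
  have d1 : (m - alpha) * (k + 1) < eta by rewrite -ltr_pdivlMr// (le_lt_trans (ler_norm _)).
  (* The functional is at least -k m by [attraction_le_energy], so dropping the fraction 1 - s
     raises it by at most k (m - alpha). *)
  have : (1 - s) * - (t + b * c - Z * a) <= (1 - s) * (k * m).
    by apply: ler_wpM2l; rewrite ?subr_ge0// /k; lra.
  have -> : (1 - s) * (k * m) = k * (m - s * m) by ring.
  rewrite sm; lra.
pose d := alpha - m; have d0 : 0 < d by rewrite /d; lra.
have d1 : d <= 1 by rewrite /d; lra.
have ebl : (energy gb < +oo)%E by case: aub => _ /energy_lty.
pose tb := fine (energy gb).
have tbE : energy gb = tb%:E by rewrite fineK// ge0_fin_numE// energy_ge0.
have tb0 : 0 <= tb by rewrite -lee_fin -tbE energy_ge0.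
pose L := (tb + 2 * b * (3 + tb)) / eta.
have L0 : 0 <= L by rewrite divr_ge0 ?(ltW eta0)// addr_ge0// !mulr_ge0 ?addr_ge0// ltW.
(* Exceeding [r] puts the dilated shell, of inner radius 2n, outside the support; exceeding [L]
   brings the cost of the bump below [eta]. *)
pose n := L + `|r| + 1; have n1 : 1 <= n by rewrite /n lerDr addr_ge0.
have n0 : 0 < n by exact: lt_le_trans n1.
have Ln : tb + 2 * b * (3 + tb) <= eta * n.
  have -> : tb + 2 * b * (3 + tb) = eta * L by rewrite /L mulrCA divff ?mulr1// gt_eqF.
  by rewrite ler_pM2l// /n -addrA lerDl addr_ge0.
have [be [_ beE]] := scale_measure_ex beta (ltW d0).
have aube := amplitude_scale (ltW d0) aub beE.
have [tau [_ tauE]] := push_measure_ex be (measurable_affine (0 : E3) n).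
have [ut [gt' [aut et st]]] := amplitude_affine n0 aube tauE.
have hgb : H1_gradient ub gb by case: aub.
have etE : energy gt' = (n ^- 2 * (d * tb))%:E.
  by rewrite et (energyZ hgb) ?sqrtr_ge0// sqr_sqrtr ?(ltW d0)// tbE -!EFinM.
have tauT : tau setT = d%:E.
  by rewrite -(integral_one tau) tauE// beE// integral_one betaT mule1.
have sbe : supported (fun x => Num.sqrt d * ub x) (fun x => Num.sqrt d *: gb x) [set x | 2 <= enorm x <= 4].
  by move=> x /sb[-> ->]; rewrite mulr0 scaler0.
have {}st := st _ sbe.
have [rho [_ rhoE]] := sum_measure_ex (fun i : bool => if i then mu else tau).
pose U (i : bool) := if i then u else ut; pose G (i : bool) := if i then g else gt'.
have dis (i j : bool) : i != j -> forall x,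
    (if i then [set x | enorm x <= r] else [set y | exists2 x, 2 <= enorm x <= 4 & y = affine 0 n x]) x ->
    (if j then [set x | enorm x <= r] else [set y | exists2 x, 2 <= enorm x <= 4 & y = affine 0 n x]) x -> False.
  have far x y : enorm x <= r -> 2 <= enorm y <= 4 -> x = affine 0 n y -> False.
    move=> xr /andP[y2 _] E; move: xr; rewrite E /affine add0r enorm_scale ?(ltW n0)// => xr.
    have rn : r < n by have := ler_norm r; have := L0; rewrite /n; clear; lra.
    have : n * 2 <= n * enorm y by rewrite ler_pM2l.
    by move: xr rn n0; clear; lra.
  case: i; case: j => //= _ x.
  - by move=> xr [y y2 E]; exact: far xr y2 E.
  - by move=> [y y2 E] xr; exact: far xr y2 E.
have [aur er _] := @amplitude_sum R bool (fun i : bool => if i then mu else tau) rho U G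
  (fun i : bool => if i then [set x | enorm x <= r] else [set y | exists2 x, 2 <= enorm x <= 4 & y = affine 0 n x])
  (ltac:(by case)) (ltac:(by case)) dis rhoE.
have rI h : measurable_fun setT h -> (forall x, 0 <= h x)%E ->
    (\int[rho]_x h x = \int[mu]_x h x + \int[tau]_x h x)%E.
  by move=> mh h0; rewrite rhoE// big_bool.
have rhoT : rho setT = alpha%:E.
  rewrite -(integral_one rho) rI; [|exact: measurable_cst|by []].
  by rewrite !integral_one muT tauT -EFinD; congr EFin; rewrite /d; ring.
have erho : (energy (fun x => (\sum_i G i x)%R) <= (t + n ^- 2 * (d * tb))%:E)%E.
  by rewrite er big_bool/= etE EFinD leeD.
have arho : (a%:E <= attraction (0 : E3)%R rho)%E.
  apply: (le_trans aA); rewrite /attraction rI; [|exact: measurable_kernel|by move=> x; exact: coulomb_kernel_ge0].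
  by rewrite leeDl// integral_ge0// => x _; exact: coulomb_kernel_ge0.
have n2 : n ^- 2 * (d * tb) <= n^-1 * tb.
  have ni : n^-1 <= 1 by rewrite invf_le1.
  have ni0 : 0 <= n^-1 by rewrite invr_ge0 ltW.
  by rewrite -exprVn expr2 -mulrA ler_wpM2l// mulrA ler_piMl// mulr_ile1// (ltW d0).
have nL : n^-1 * (tb + 2 * b * (3 + tb)) <= eta by rewrite ler_pdivrMl// [leRHS]mulrC.
have bt : 0 <= n^-1 * (2 * b * (3 + tb)).
  by rewrite mulr_ge0 ?invr_ge0 ?(ltW n0)// !mulr_ge0 ?addr_ge0// ltW.
have [al2|al2] := leP alpha 2^-1.
  have [P' [pP' _ cP']] := partial_plan0 rhoT al2.
  have cP0 : (cost P' <= 0%:E)%E by rewrite cP'.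
  have := cell_energy_le (ltW b0) (ltW Z0) al1 aur pP' erho cP0 arho; move=> /le_trans; apply.
  by rewrite lee_fin mulr0; clear -n2 nL bt bc0; lra.
move: ltd2; rewrite al2 => ltd2.
have m2 : 2^-1 <= m by have := ler_norm (alpha - m); rewrite distrC; clear -ltd2; lra.
(* [attraction_bound] at eta = 1/n, the inverse of the width of the bump: both of its terms are then
   of order 1/n. *)
pose K := d * (3 + tb) / n.
have tauK x : (attraction x tau <= K%:E)%E.
  have ni0 : 0 < n^-1 by rewrite invr_gt0.
  apply: (le_trans (attraction_bound x aut ni0)).
  rewrite tauT etE -!EFinM -EFinD lee_fin.
  have -> : (4 * n^-1)^-1 * (n ^- 2 * (d * tb)) = n^-1 * (d * tb) / 4 by field; rewrite gt_eqF.
  rewrite /K; have : 0 <= n^-1 * (d * tb) by rewrite !mulr_ge0 ?(ltW ni0) ?(ltW d0).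
  clear; lra.
have [P' [pP' cP']] := partial_plan_add m2 d0 (ltac:(by rewrite /d; clear -al1; lra) : m + d <= 1) pP tauT tauK rI.
have md : m + d = alpha by rewrite /d; ring.
rewrite md in pP'.
have cP2 : (cost P' <= (c + 2 * K)%:E)%E by apply: (le_trans cP'); rewrite EFinD leeD.
have := cell_energy_le (ltW b0) (ltW Z0) al1 aur pP' erho cP2 arho; move=> /le_trans; apply.
rewrite lee_fin.
have KK : b * (2 * K) <= n^-1 * (2 * b * (3 + tb)).
  have -> : b * (2 * K) = d * (n^-1 * (2 * b * (3 + tb))) by rewrite /K; ring.
  by rewrite ler_piMl.
clear -n2 KK nL; lra.
Qed.

End cell_energy.

(** * Lower bound *)

Section localization.
Variable R : realType.
Local Notation E3 := (E3 R).
Local Notation leb3 := (leb3 R).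
Local Notation meas3 := {measure set E3 -> \bar R}.
Local Notation meas6 := {measure set (E3 * E3) -> \bar R}.
Implicit Types (rho mu : meas3) (P Q : meas6) (u phi psi : E3 -> R) (g : E3 -> E3) (X : E3).

Lemma measurable_cutoff X r : measurable_fun setT (cutoff X r).
Proof. by apply: smooth_measurable; exact: smooth_cutoff. Qed.

Lemma measurable_cutoff_sqr X r : measurable_fun setT (fun x => (cutoff X r x ^+ 2)%:E).
Proof. by apply/measurable_EFinP; apply: measurable_funX; exact: measurable_cutoff. Qed.

Lemma attraction_cutoff rho X (r : R) : 0 < r ->
  (attraction X rho <= \int[rho]_x ((cutoff X r x ^+ 2)%:E * coulomb_kernel x X)
     + (2 / r)%:E * rho setT)%E.
Proof.
move=> r0; have mk := measurable_kernel X; have mc := measurable_cutoff_sqr X r.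
rewrite -integral_cst// -ge0_integralD//.
- apply: ge0_le_integral => //.
  + by move=> x _; exact: coulomb_kernel_ge0.
  + by apply: emeasurable_funD; [exact: emeasurable_funM|exact: measurable_cst].
  + by move=> x _; exact: cutoff_kernel.
- by move=> x _; rewrite mule_ge0 ?lee_fin ?sqr_ge0 ?coulomb_kernel_ge0.
- exact: emeasurable_funM.
- by move=> x _; rewrite lee_fin divr_ge0 ?(ltW r0).
Qed.

(** The density is multiplied by the squared cutoff, then dilated by 1/e into cell coordinates.
    Energy and cost are bounded by weighted integrals that can be summed over the nuclei; in the
    attraction only the regular remainder of [cutoff_kernel] is lost. *)
Lemma localize : exists2 C : R, 0 <= C &
  forall rho u g (m0 m : R) P X (r eta e : R), 0 < r -> 0 < eta -> 0 < e ->
  amplitude rho u g -> partial_plan rho m0 P ->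
  (\int[rho]_x (cutoff X r x ^+ 2)%:E = m%:E)%E ->
  exists mu u' g' P', [/\ amplitude mu u' g', supported u' g' [set x | enorm x <= r / e],
    partial_plan mu m P' &
    [/\ (energy g' <= (e ^+ 2)%:E * ((1 + eta)%:E * \int[leb3]_x (cutoff X r x ^+ 2 * enorm (g x) ^+ 2)%:E
          + ((1 + eta^-1) * (C / r ^+ 2))%:E * rho setT))%E,
      cost P' = (e%:E * \int[P]_p ((cutoff X r p.1 ^+ 2 * cutoff X r p.2 ^+ 2)%:E
          * coulomb_kernel p.1 p.2))%E &
      (attraction X rho <= e^-1%:E * attraction (0 : E3)%R mu + (2 / r)%:E * rho setT)%E]].
Proof.
have [C C0 HC] := @amplitude_cutoff R; exists C => //.
move=> rho u g m0 m P X r eta e r0 eta0 e0 au pP mE.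
have mth := measurable_cutoff_sqr X r.
have [rho' [_ rho'E]] := density_ex rho (measurable_funX 2 (measurable_cutoff X r)) (fun x => sqr_ge0 (cutoff X r x)).
have [u1 [g1 [au1 e1 s1 _]]] := HC _ _ _ _ X r eta r0 eta0 au rho'E.
have rho'T : rho' setT = m%:E.
  rewrite -(integral_one rho') rho'E; [|exact: measurable_cst|by []].
  by rewrite -mE; apply: eq_integral => x _; rewrite mule1.
have [P1 [pP1 cP1]] := partial_plan_weight pP (measurable_funX 2 (measurable_cutoff X r))
  (fun x => ltac:(by rewrite sqr_ge0 cutoff_sqr_le1)) rho'T rho'E.
have ei0 : 0 < e^-1 by rewrite invr_gt0.
have [mu [_ muE]] := push_measure_ex rho' (measurable_affine (- (e^-1 *: X)) e^-1).
have [u2 [g2 [au2 e2 s2]]] := amplitude_affine ei0 au1 muE.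
have [P2 [pP2 _ cP2]] := partial_plan_affine ei0 pP1 muE.
exists mu, u2, g2, P2; split => //.
  move=> y ny; apply: (s2 _ s1) => -[x /= xr yE]; apply: ny => /=.
  rewrite yE cutoff_arg enorm_scale ?(ltW ei0)// mulrC ler_pM2r// ltW//.
split.
- rewrite e2 exprVn invrK; apply: lee_wpmul2l => //.
  by rewrite lee_fin sqr_ge0.
- by rewrite cP2 invrK cP1.
- have rhoE h : measurable_fun setT h -> (forall x, 0 <= h x)%E ->
      (\int[rho']_x h x = \int[mu]_x h (affine X e x))%E.
    move=> mh h0; rewrite muE//; last first.
      by apply: measurableT_comp => //; exact: measurable_affine.
    by apply: eq_integral => x _; rewrite affineVK// gt_eqF.
  rewrite -(attraction_affine e0 rhoE) /attraction rho'E.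
  + exact: attraction_cutoff.
  + exact: measurable_kernel.
  + by move=> x; exact: coulomb_kernel_ge0.
Qed.

Lemma lone_sum_le1 (I : finType) (f : I -> R) : (forall i, 0 <= f i <= 1) ->
  (forall i j, i != j -> f i = 0 \/ f j = 0) -> \sum_i f i <= 1.
Proof.
move=> f01 ff; have [/existsP[i fi]|/existsPn f0] := boolP [exists i, f i != 0].
  rewrite (bigD1 i)//= big1 ?addr0; first by have /andP[] := f01 i.
  by move=> j /ff[//|fi0]; rewrite fi0 eqxx in fi.
by rewrite big1// => i _; move: (f0 i); rewrite negbK => /eqP.
Qed.

(** Cauchy-Schwarz, through Lagrange's identity. *)
Lemma dot_le_enorm (x y : E3) :
  x.1.1 * y.1.1 + x.1.2 * y.1.2 + x.2 * y.2 <= enorm x * enorm y.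
Proof.
set p := (X in X <= _); have [p0|p0] := leP p 0.
  by apply: (le_trans p0); rewrite mulr_ge0 ?enorm_ge0.
have n0 : 0 <= enorm x * enorm y by rewrite mulr_ge0 ?enorm_ge0.
rewrite -(@ler_pXn2r _ 2) ?nnegrE ?(ltW p0)// exprMn !enorm_sqr -subr_ge0 /p.
move: (x.1.1 : R) (x.1.2 : R) (x.2 : R) (y.1.1 : R) (y.1.2 : R) (y.2 : R) => a b c a' b' c'.
have -> : (a ^+ 2 + b ^+ 2 + c ^+ 2) * (a' ^+ 2 + b' ^+ 2 + c' ^+ 2) - (a * a' + b * b' + c * c') ^+ 2
  = (a * b' - b * a') ^+ 2 + (a * c' - c * a') ^+ 2 + (b * c' - c * b') ^+ 2 by ring.
by rewrite !addr_ge0 ?sqr_ge0.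
Qed.

Lemma enorm_add (x y : E3) : enorm (x + y) <= enorm x + enorm y.
Proof.
rewrite -(@ler_pXn2r _ 2) ?nnegrE ?addr_ge0 ?enorm_ge0// sqrrD !enorm_sqr.
have := dot_le_enorm x y; set n := enorm x * enorm y => H.
have e1 : (x + y).1.1 = x.1.1 + y.1.1 :> R by [].
have e2 : (x + y).1.2 = x.1.2 + y.1.2 :> R by [].
have e3 : (x + y).2 = x.2 + y.2 :> R by [].
by rewrite e1 e2 e3; lra.
Qed.

Lemma enorm_triangle (x y z : E3) : enorm (x - z) <= enorm (x - y) + enorm (y - z).
Proof. by rewrite (_ : x - z = (x - y) + (y - z)) ?enorm_add// addrA subrK. Qed.

Lemma cutoff_disjoint (I : finType) (X : I -> E3) (r : R) : 0 < r ->
  (forall i j, i != j -> 2 * r <= enorm (X i - X j)) -> forall i j x, i != j ->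
  cutoff (X i) r x = 0 \/ cutoff (X j) r x = 0.
Proof.
move=> r0 sep i j x ij; have [h|h] := leP r (enorm (x - X i)); first by left; exact: cutoff_out.
right; apply: cutoff_out => //; rewrite leNgt; apply/negP => h'.
have := sep _ _ ij; rewrite leNgt => /negP; apply.
by apply: le_lt_trans (enorm_triangle _ x _) _; rewrite enormB; lra.
Qed.

Lemma sum_cutoff_le (I : finType) (X : I -> E3) (r : R) (h : E3 -> R) mu : 0 < r ->
  (forall i j, i != j -> 2 * r <= enorm (X i - X j)) ->
  measurable_fun setT h -> (forall x, 0 <= h x) ->
  (\sum_i \int[mu]_x (cutoff (X i) r x ^+ 2 * h x)%:E <= \int[mu]_x (h x)%:E)%E.
Proof.
move=> r0 sep mh h0.
have mi i : measurable_fun setT (fun x => (cutoff (X i) r x ^+ 2 * h x)%:E).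
  by apply/measurable_EFinP; apply: measurable_funM => //; apply: measurable_funX; exact: measurable_cutoff.
rewrite -ge0_integral_sum//; last by move=> i x _; rewrite lee_fin mulr_ge0 ?sqr_ge0.
apply: ge0_le_integral => //.
- by move=> x _; apply: sume_ge0 => i _; rewrite lee_fin mulr_ge0 ?sqr_ge0.
- exact: emeasurable_sum.
- exact/measurable_EFinP.
move=> x _; rewrite sumEFin lee_fin -mulr_suml ler_piMl//.
apply: lone_sum_le1 => [i|i j ij]; first by rewrite sqr_ge0 cutoff_sqr_le1.
by have [->|->] := cutoff_disjoint r0 sep x ij; [left|right]; rewrite expr0n.
Qed.

(** Pairs of points not lying near a common nucleus are dropped, which is allowed by the sign of the
    kernel. *)
Lemma sum_cutoff_cost_le (I : finType) (X : I -> E3) (r : R) P : 0 < r ->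
  (forall i j, i != j -> 2 * r <= enorm (X i - X j)) ->
  (\sum_i \int[P]_p ((cutoff (X i) r p.1 ^+ 2 * cutoff (X i) r p.2 ^+ 2)%:E
     * coulomb_kernel p.1 p.2) <= cost P)%E.
Proof.
move=> r0 sep; have mc := @measurable_kernel2 R.
have w0 i x : 0 <= cutoff (X i) r x ^+ 2 by exact: sqr_ge0.
have mw i : measurable_fun setT (fun p : E3 * E3 => (cutoff (X i) r p.1 ^+ 2 * cutoff (X i) r p.2 ^+ 2)%:E).
  apply/measurable_EFinP; apply: measurable_funM; apply: measurable_funX.
    by apply: (measurableT_comp (measurable_cutoff _ _)); exact: measurable_fst.
  by apply: (measurableT_comp (measurable_cutoff _ _)); exact: measurable_snd.
rewrite -ge0_integral_sum//; first last.
- by move=> i p _; apply: mule_ge0; [rewrite lee_fin mulr_ge0|exact: coulomb_kernel_ge0].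
- by move=> i; exact: emeasurable_funM.
apply: ge0_le_integral => //.
- by move=> p _; apply: sume_ge0 => i _; apply: mule_ge0; [rewrite lee_fin mulr_ge0|exact: coulomb_kernel_ge0].
- by apply: emeasurable_sum => i _; exact: emeasurable_funM.
move=> p _; rewrite -ge0_sume_distrl; last by move=> i _; rewrite lee_fin mulr_ge0.
rewrite -[leRHS]mul1e; apply: lee_wpmul2r; first exact: coulomb_kernel_ge0.
rewrite sumEFin lee_fin; apply: lone_sum_le1 => [i|i j ij].
  by rewrite mulr_ge0//= mulr_ile1// cutoff_sqr_le1.
by have [->|->] := cutoff_disjoint r0 sep p.1 ij; [left|right]; rewrite expr0n mul0r.
Qed.

Lemma cutoff_vanishing X (r : R) : 0 < r ->
  continuous (fun x => cutoff X r x ^+ 2) /\ vanishing_at_infinity (fun x => cutoff X r x ^+ 2).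
Proof.
move=> r0; have tth := test_cutoff X r0; split.
  move=> x; have cx : {for x, continuous (cutoff X r)} by exact: (smooth_continuous tth.1).
  exact: (cvgM cx cx).
move=> e e0; have [n out] := test_box tth.
exists (@box R n); first exact: compact_box.
by move=> x /out ->; rewrite expr0n normr0.
Qed.

Lemma measurable_singleton3 X : measurable [set X].
Proof.
rewrite (_ : [set X] = ([set X.1.1] `*` [set X.1.2]) `*` [set X.2]); last first.
  by apply/seteqP; split => [x /= ->|[[x y] z] [[/= -> ->] ->]]//; case: X => -[].
by apply: measurableX; [apply: measurableX|]; exact: measurable_set1.
Qed.

(** The squared cutoffs equal 1 at [X] and vanish eventually at any other point; they are dominated
    by 1. *)
Lemma cutoff_mass_cvg rho X : (rho setT < +oo)%E ->
  (\int[rho]_x (cutoff X n.+1%:R^-1 x ^+ 2)%:E)%E @[n --> \oo] --> rho [set X].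
Proof.
move=> fin; have mX := measurable_singleton3 X.
rewrite -(integral_indicE rho mX).
apply: (@dominated_cvg _ _ _ rho setT measurableT _ _ (cst 1%E)).
- by move=> n; exact: measurable_cutoff_sqr.
- move=> x _; rewrite indicE; have [->|xX] := eqVneq x X.
    rewrite mem_set//; apply: cvg_near_cst; apply: nearW => n.
    rewrite /cutoff/= cutoff_arg subrr scaler0 /bump /enorm /= !expr0n/= !addr0 sqrtr0 expr0n/= subr0.
    by rewrite /flat ltr01 expr0 mul1r invr1 -expRD subrr expR0 expr1n.
  rewrite memNset/=; last by move=> /= e; rewrite e eqxx in xX.
  apply: cvg_near_cst.
  have d0 : 0 < enorm (x - X).
    rewrite lt0r enorm_ge0 andbT; apply: contra_neq xX => /enorm_eq0 e.
    by apply/eqP; rewrite -subr_eq0 e.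
  have := near_infty_natSinv_lt (PosNum d0); apply: filterS => n /= nd.
  by rewrite cutoff_out ?expr0n// ltW.
- by [].
- apply/integrableP; split; first exact: measurable_cst.
  by under eq_integral do rewrite /= normr1; rewrite integral_one.
- by move=> n x _; rewrite lee_fin ger0_norm ?sqr_ge0 ?cutoff_sqr_le1.
Qed.

End localization.

(** * The liminf inequality *)

Section lower_bound.
Variable R : realType.
Local Notation E3 := (E3 R).
Local Notation leb3 := (leb3 R).
Local Notation meas3 := {measure set E3 -> \bar R}.
Local Notation meas6 := {measure set (E3 * E3) -> \bar R}.
Implicit Types (rho mu : meas3) (P Q : meas6) (u : E3 -> R) (g : E3 -> E3).

Lemma fin_lower_bound (I : finType) (d : I -> R) : (forall i, 0 < d i) ->
  exists2 e : R, 0 < e & forall i, e <= d i.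
Proof.
move=> d0; suff [e e0 H] : exists2 e : R, 0 < e & forall i, i \in index_enum I -> e <= d i.
  by exists e => // i; apply: H; exact: mem_index_enum.
elim: (index_enum I) => [|i s [e e0 H]]; first by exists 1.
exists (Num.min (d i) e); first by rewrite lt_min d0.
move=> j; rewrite inE => /orP[/eqP->|/H js]; first by rewrite ge_min lexx.
by rewrite ge_min js orbT.
Qed.

Lemma sum_fin (I : finType) (f : I -> \bar R) (T : R) : (forall i, (0 <= f i)%E) ->
  (\sum_i f i <= T%:E)%E -> exists2 h : I -> R, (forall i, f i = (h i)%:E) & \sum_i h i <= T.
Proof.
move=> f0 fT; have fE i : f i = (fine (f i))%:E.
  rewrite fineK// ge0_fin_numE//; apply: le_lt_trans (ltry T); apply: le_trans fT.
  by rewrite (bigD1 i)//= leeDl// sume_ge0.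
exists (fun i => fine (f i)) => //; rewrite -lee_fin -sumEFin.
by apply: le_trans fT; apply: lee_sum => i _; rewrite -fE.
Qed.

Lemma ex2_and (T : Type) (A B : T -> Prop) : (exists2 x, A x & B x) -> exists x, A x /\ B x.
Proof. by move=> [x ax bx]; exists x. Qed.

(** The order of quantifiers is the point: [delta] and [D] precede [r], [e] and the measure. So [r]
    can be taken small enough for the masses under the cutoffs to be within [delta] of the atoms,
    and [e] small enough for D / r^2 to be harmless. *)
Lemma lower_estimate (b : R) (M : nat) (X : 'I_M -> E3) (Z alpha : 'I_M -> R) (eta : R) :
  0 < b -> (forall i, 0 < Z i) -> (forall i, 0 <= alpha i <= 1) -> 0 < eta ->
  exists delta D : R, [/\ 0 < delta, 0 <= D &
  forall (r e : R) rho u g P (t c : R) (a m : 'I_M -> R), 0 < r -> 0 < e ->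
  (forall i j, i != j -> 2 * r <= enorm (X i - X j)) ->
  amplitude rho u g -> partial_plan rho 1 P -> energy g = t%:E -> cost P = c%:E ->
  (forall i, attraction (X i) rho = (a i)%:E) ->
  (forall i, \int[rho]_x (cutoff (X i) r x ^+ 2)%:E = (m i)%:E)%E ->
  (forall i, `|m i - alpha i| < delta) ->
  (\sum_(i < M) cell_energy b (Z i) (alpha i) <=
    (e ^+ 2 * ((1 + eta) * t + D / r ^+ 2) + b * (e * c) - \sum_(i < M) Z i * (e * (a i - 2 / r))
      + M%:R * eta)%:E)%E].
Proof.
move=> b0 Z0 al01 eta0.
have [C C0 loc] := @localize R.
have [d dP] := choice (fun i => ex2_and (cell_energy_near b0 (Z0 i) (al01 i) eta0)).
have [delta delta0 dd] := fin_lower_bound (fun i => (dP i).1).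
exists delta, (M%:R * ((1 + eta^-1) * C)); split => //.
  by rewrite !mulr_ge0// addr_ge0// invr_ge0 ltW.
move=> r e rho u g P t c a m r0 e0 sep au pP gt Pc aE mE mal.
have hg : H1_gradient u g by case: au.
have rhoT : rho setT = 1%E by case: pP.
have [s sE sT] := @sum_fin _ (fun i => \int[leb3]_x (cutoff (X i) r x ^+ 2 * enorm (g x) ^+ 2)%:E)%E t
  (fun i => ltac:(by apply: integral_ge0 => x _; rewrite lee_fin mulr_ge0 ?sqr_ge0))
  (ltac:(by rewrite -gt; apply: sum_cutoff_le => //; [exact: measurable_energy hg|move=> x; exact: sqr_ge0])).
have [k kE kT] := @sum_fin _ (fun i => \int[P]_p ((cutoff (X i) r p.1 ^+ 2 * cutoff (X i) r p.2 ^+ 2)%:E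
     * coulomb_kernel p.1 p.2))%E c
  (fun i => ltac:(by apply: integral_ge0 => p _; apply: mule_ge0; [rewrite lee_fin mulr_ge0 ?sqr_ge0|exact: coulomb_kernel_ge0]))
  (ltac:(by rewrite -Pc; exact: sum_cutoff_cost_le)).
pose D0 := (1 + eta^-1) * (C / r ^+ 2).
apply: (@le_trans _ _ (\sum_(i < M) (e ^+ 2 * ((1 + eta) * s i + D0) + b * (e * k i)
   - Z i * (e * (a i - 2 / r)) + eta)%:E)%E).
  apply: lee_sum => i _.
  have [mu [u' [g' [P' [au' su' pP' [e' c' a']]]]]] := loc rho u g 1 (m i) P (X i) r eta e r0 eta0 e0 au pP (mE i).
  apply: ((dP i).2 mu u' g' P' (m i) _ _ _ (r / e)) => //.
  - exact: lt_le_trans (mal i) (dd i).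
  - apply: (le_trans e'); rewrite sE rhoT mule1; exact: lexx.
  - by rewrite c' kE -EFinM.
  - move: a'; rewrite aE rhoT mule1.
    case: (attraction _ mu) => [q| |]//; rewrite ?leey// ?gt0_muleNy ?lte_fin ?invr_gt0//.
    rewrite -EFinM -EFinD !lee_fin => a'.
    by rewrite -ler_pdivlMl// lerBlDr.
rewrite sumEFin lee_fin 3!big_split/= -!mulr_sumr big_split/= -!mulr_sumr !sumr_const card_ord.
rewrite sumrN -[eta *+ M]mulr_natl lerD2r; apply: lerB => //; apply: lerD.
  rewrite ler_wpM2l ?sqr_ge0// lerD//; first by rewrite ler_wpM2l// addr_ge0 ?ltW.
  by rewrite le_eqVlt; apply/orP; left; apply/eqP; rewrite /D0 -mulr_natl; ring.
by rewrite ler_wpM2l ?(ltW b0)// ler_wpM2l ?(ltW e0).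
Qed.

Lemma kinetic_attraction_fin (M : nat) (X : 'I_M -> E3) rho u g : amplitude rho u g ->
  exists2 a : 'I_M -> R, forall i, attraction (X i) rho = (a i)%:E &
    forall i (lambda t m : R), 0 < lambda -> energy g = t%:E -> rho setT = m%:E ->
      a i <= 3 * lambda * m + t / (4 * lambda).
Proof.
move=> au; have hg : H1_gradient u g by case: au.
have fin i : attraction (X i) rho \is a fin_num.
  rewrite ge0_fin_numE; last by apply: integral_ge0 => x _; exact: coulomb_kernel_ge0.
  apply: le_lt_trans (attraction_bound (X i) au ltr01) _.
  have := energy_lty hg; have := amplitude_mass_lty au.
  have := energy_ge0 g; have : (0 <= rho setT)%E by exact: measure_ge0.
  case: (rho setT) => [m| |]//; case: (energy g) => [t| |]// _ _ _ _.
  by rewrite -!EFinM -EFinD ltry.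
exists (fun i => fine (attraction (X i) rho)) => [i|i lambda t m l0 gt rm].
  by rewrite fineK.
rewrite -lee_fin fineK//; apply: (le_trans (attraction_bound (X i) au l0)).
by rewrite rm gt -!EFinM -EFinD lee_fin [_^-1 * t]mulrC.
Qed.

(** A strict bound leaves room to replace the two infima, kinetic energy and transport cost, by an
    actual gradient and an actual plan. *)
Lemma G_eps_lt (b : R) (M : nat) (X : 'I_M -> E3) (Z : 'I_M -> R) (e K : R) (p : probability E3 R) :
  0 < b -> 0 < e -> (G_eps b X Z e p < K%:E)%E ->
  exists u g P (t c : R) (a : 'I_M -> R), [/\ amplitude p u g, partial_plan p 1 P,
    energy g = t%:E, cost P = c%:E &
    [/\ forall i, attraction (X i) p = (a i)%:E,
    forall i (lambda : R), 0 < lambda -> a i <= 3 * lambda + t / (4 * lambda),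
    0 <= t, 0 <= c &
    e ^+ 2 * t + e * b * c - e * (\sum_(i < M) Z i * a i) < K]].
Proof.
move=> b0 e0; rewrite /G_eps; case: ifPn => [|]; first by rewrite ltNge leey.
rewrite -ltey => klt.
have [u0 [g0 [au0 _]]] := kinetic_lt klt.
have [a aE _] := kinetic_attraction_fin X au0.
have nucE : nuclear_attraction X Z p = (\sum_(i < M) Z i * a i)%:E.
  rewrite /nuclear_attraction -sumEFin; apply: eq_bigr => i _.
  by rewrite aE EFinM.
have k0 : (0 <= kinetic p)%E.
  by apply: le_ereal_inf_tmp => _ [f [g [_ _ ->]]]; exact: energy_ge0.
have c0 : (0 <= coulomb_cost p)%E.
  by apply: le_ereal_inf_tmp => _ [P _ <-]; exact: cost_ge0.
rewrite nucE -EFinM.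
case kE : (kinetic p) klt k0 => [k| |]// _ k0.
have eb0 : 0 < e * b by rewrite mulr_gt0.
case cE : (coulomb_cost p) c0 => [c| |]// c0; last first.
  by rewrite gt0_muley ?lte_fin// -EFinM addey// addye// ltNge leey.
rewrite -!EFinM -?EFinN -!EFinD lte_fin => ltK.
(* Exceeding both infima by [s] would use up exactly the gap to [K]. *)
pose s := (K - (e ^+ 2 * k + e * b * c - e * (\sum_(i < M) Z i * a i))) / (e ^+ 2 + e * b).
have den : 0 < e ^+ 2 + e * b by rewrite addr_gt0// exprn_gt0.
have s0 : 0 < s by rewrite divr_gt0// subr_gt0.
have [u [g [au glt]]] : exists u g, amplitude p u g /\ (energy g < (k + s)%:E)%E.
  by apply: kinetic_lt; rewrite kE lte_fin ltrDl.
have /ereal_inf_lt[_ [P cP <-] Plt] : (coulomb_cost p < (c + s)%:E)%E.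
  by rewrite cE lte_fin ltrDl.
have gE : exists2 t, energy g = t%:E & 0 <= t.
  have := energy_ge0 g; move: glt; case: (energy g) => [t| |]//.
  by rewrite lee_fin; exists t.
have PE : exists2 c1, cost P = c1%:E & 0 <= c1.
  have := cost_ge0 P; move: Plt; rewrite -/(cost P); case: (cost P) => [t| |]//.
  by rewrite lee_fin; exists t.
have [t tE t0] := gE; have [c1 c1E c10] := PE.
have pT : (p : meas3) setT = 1%E by exact: probability_setT.
have [a' a'E a'B] := kinetic_attraction_fin X au.
have aa i : a' i = a i by apply: EFin_inj; rewrite -a'E aE.
exists u, g, P, t, c1, a; split => //; first exact: coupling_plan.
split => // [i lambda l0|].
  by have := a'B i lambda t 1 l0 tE pT; rewrite aa mulr1.
move: glt Plt; rewrite -/(cost P) tE c1E !lte_fin => lt1 lt2.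
have l1 : e ^+ 2 * t < e ^+ 2 * (k + s) by rewrite ltr_pM2l// exprn_gt0.
have l2 : e * b * c1 < e * b * (c + s) by rewrite ltr_pM2l.
have sE : s * (e ^+ 2 + e * b) = K - (e ^+ 2 * k + e * b * c - e * (\sum_(i < M) Z i * a i)).
  by rewrite /s divfK// gt_eqF.
move: l1 l2 sE; set S := \sum_(i < M) _.
lra.
Qed.

(* The attraction is absorbed by half of the kinetic energy. *)
Lemma kinetic_coercive (b : R) (M : nat) (Z a : 'I_M -> R) (e K t c : R) :
  0 < b -> (forall i, 0 < Z i) -> 0 < e -> 0 <= t -> 0 <= c ->
  (forall i (lambda : R), 0 < lambda -> a i <= 3 * lambda + t / (4 * lambda)) ->
  e ^+ 2 * t + e * b * c - e * (\sum_(i < M) Z i * a i) < K ->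
  e ^+ 2 * t <= 2 * (K + 3 * (\sum_(i < M) Z i + 1) * \sum_(i < M) Z i).
Proof.
move=> b0 Z0 e0 t0 c0 aB H; set S := \sum_(i < M) Z i in H *.
have S0 : 0 <= S by apply: sumr_ge0 => i _; exact: ltW.
have S1 : 0 < S + 1 by rewrite ltr_wpDl.
(* This value of [lambda] is of order 1/e, the inverse of the scale of concentration, so that both
   terms of the bound are of order 1 after multiplication by [e]. The 1 keeps it positive when there
   is no nucleus. *)
have L0 : 0 < (S + 1) / e by rewrite divr_gt0.
have h : e * (\sum_(i < M) Z i * a i) <= 3 * (S + 1) * S + e ^+ 2 * t / (4 * (S + 1)) * S.
  have -> : 3 * (S + 1) * S + e ^+ 2 * t / (4 * (S + 1)) * S
    = e * \sum_(i < M) Z i * (3 * ((S + 1) / e) + t / (4 * ((S + 1) / e))).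
    by rewrite -mulr_suml -/S; field; rewrite !gt_eqF.
  rewrite ler_pM2l//; apply: ler_sum => i _; rewrite ler_pM2l//.
  exact: aB.
have q0 : 0 <= e ^+ 2 * t by rewrite mulr_ge0 ?sqr_ge0.
have : e ^+ 2 * t / (4 * (S + 1)) * S <= e ^+ 2 * t / 2.
  rewrite -mulrA ler_wpM2l// mulrC ler_pdivrMr ?mulr_gt0//; lra.
have : 0 <= e * b * c by rewrite !mulr_ge0 ?(ltW e0) ?(ltW b0).
lra.
Qed.

Lemma ereal_le_real (x y : \bar R) : (forall K : R, (x < K%:E)%E -> (y <= K%:E)%E) -> (y <= x)%E.
Proof.
case: x => [x| |] H; last 2 first.
- exact: leey.
- case: y H => [y| |]// H; last by have := H 0 (ltNyr _).
  by have := H (y - 1) (ltNyr _); rewrite lee_fin lerDl oppr_ge0 ler10.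
apply/lee_addgt0Pr => s s0; rewrite -EFinD; apply: H.
by rewrite lte_fin ltrDl.
Qed.

(** A liminf below [K] only provides energies below [K] for some arbitrarily small [e]. This is
    enough: all other requirements hold for every small [e], and the estimate is applied at a single
    good one. *)
Lemma Gamma_lower (b : R) (M : nat) (X : 'I_M -> E3) (Z : 'I_M -> R)
    (rho : subprobability E3 R) (alpha : 'I_M -> R) (p : R -> probability E3 R) :
  0 < b -> injective X -> (forall i, 0 < Z i) -> (forall i, rho [set X i] = (alpha i)%:E) ->
  weak_star_cvg p rho ->
  (\sum_(i < M) cell_energy b (Z i) (alpha i) <= limf_einf (fun e => G_eps b X Z e (p e)) 0^'+)%E.
Proof.
move=> b0 Xinj Z0 alE wc; apply: ereal_le_real => K.
rewrite limf_einfE => ltK.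
have often (V : set R) : nbhs (0 : R)^'+ V -> exists2 e, V e & (G_eps b X Z e (p e) < K%:E)%E.
  move=> FV; have : (ereal_inf ((fun e => G_eps b X Z e (p e)) @` V) < K%:E)%E.
    by apply: le_lt_trans ltK; apply: ereal_sup_ubound; exists V.
  by move=> /ereal_inf_lt[_ [e Ve <-] lt]; exists e.
have al01 i : 0 <= alpha i <= 1.
  have a0 : (0 <= (alpha i)%:E)%E by rewrite -alE; exact: measure_ge0.
  rewrite -lee_fin a0/= -lee_fin -alE; apply: le_trans (@sprobability_setT _ _ _ rho).
  by apply: le_measure => //; rewrite inE//; exact: measurable_singleton3.
apply/lee_addgt0Pr => s s0.
pose S := \sum_(i < M) Z i; have S0 : 0 <= S by apply: sumr_ge0 => i _; exact: ltW.
(* The bound of [kinetic_coercive] on e^2 t, made nonnegative. *)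
pose K1 := `|2 * (K + 3 * (S + 1) * S)|.
have K10 : 0 <= K1 by exact: normr_ge0.
have den : 0 < 2 * (K1 + M%:R + 1) by rewrite mulr_gt0// ltr_wpDl// addr_ge0.
(* Half of the tolerance [s] pays for eta e^2 t and for the error [eta] of each cell problem; the
   other half is kept for the terms in [e]. *)
pose eta := s / (2 * (K1 + M%:R + 1)); have eta0 : 0 < eta by rewrite divr_gt0.
have etaE : eta * (2 * (K1 + M%:R + 1)) = s by rewrite divfK// gt_eqF.
have [delta [D [delta0 D0 low]]] := lower_estimate X b0 Z0 al01 eta0.
have [q q0 qsep] : exists2 q : R, 0 < q & forall i j, i != j -> 2 * q <= enorm (X i - X j).
  have [q q0 qP] := @fin_lower_bound ('I_M * 'I_M)%type
    (fun ij => if ij.1 == ij.2 then 1 else enorm (X ij.1 - X ij.2) / 2)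
    (ltac:(move=> [i j]/=; case: ifPn => // ij; rewrite divr_gt0// lt0r enorm_ge0 andbT;
      apply: contra_neq ij => /enorm_eq0/eqP; rewrite subr_eq0 => /eqP; exact: Xinj)).
  exists q => // i j /negPf ij; have := qP (i, j); rewrite /= ij ler_pdivlMr// mulrC.
  by [].
have rhofin : ((rho : meas3) setT < +oo)%E by apply: le_lt_trans (@sprobability_setT _ _ _ rho) (ltry 1).
(* The radius is fixed before [e]: it separates the nuclei, and under each cutoff the limit measure
   has little more than its atom. *)
have [r [r0 rq rm]] : exists r : R, [/\ 0 < r, r <= q &
    forall i, (`|\int[rho]_x (cutoff (X i) r x ^+ 2)%:E - (alpha i)%:E| < delta%:E)%E].
  have near_i i : \forall n \near \oo,
      (`|\int[rho]_x (cutoff (X i) n.+1%:R^-1 x ^+ 2)%:E - (alpha i)%:E| < delta%:E)%E.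
    have cv : (\int[rho]_x (cutoff (X i) n.+1%:R^-1 x ^+ 2)%:E)%E @[n --> \oo] --> (alpha i)%:E.
      by rewrite -alE; exact: (cutoff_mass_cvg (X := X i) rhofin).
    by move: cv => /fine_cvgP[fn /cvgrPdist_lt/(_ _ delta0)]; apply: filterS2 fn => n fn;
      rewrite -(fineK fn) -EFinB abse_EFin lte_fin distrC.
  have all_i : \forall n \near \oo, forall i,
      (`|\int[rho]_x (cutoff (X i) n.+1%:R^-1 x ^+ 2)%:E - (alpha i)%:E| < delta%:E)%E.
    exact: filter_forall near_i.
  have [n [h1 h2]] := filter_ex (filterI all_i (near_infty_natSinv_lt (PosNum q0))).
  by exists n.+1%:R^-1; split => //; exact: ltW.
have sep i j : i != j -> 2 * r <= enorm (X i - X j).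
  by move=> /qsep; apply: le_trans; rewrite ler_pM2l.
(* The squared cutoffs are admissible in the weak* convergence, so the strict bound passes from the
   limit to [p e]. *)
have mass_near i : \forall e \near (0 : R)^'+,
    (`|\int[p e]_x (cutoff (X i) r x ^+ 2)%:E - (alpha i)%:E| < delta%:E)%E.
  have [ct vt] := cutoff_vanishing (X i) r0.
  have [x xE] : exists x, (\int[rho]_x (cutoff (X i) r x ^+ 2)%:E = x%:E)%E.
    by have := rm i; case: (\int[rho]_x _)%E => [x| |]//; exists x.
  have := wc _ ct vt; have := rm i; rewrite xE -EFinB abse_EFin lte_fin => xd.
  move=> /fine_cvgP[fn /cvgrPdist_lt/(_ _ (ltac:(by rewrite subr_gt0) : 0 < delta - `|x - alpha i|))].
  apply: filterS2 fn => e fn; rewrite -(fineK fn) -EFinB abse_EFin lte_fin => xy.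
  by apply: (le_lt_trans (ler_distD x _ _)); rewrite -ltrBrDr distrC.
(* The coefficient of [e] in the remaining errors, using e^2 <= e; the 1 makes it positive. *)
pose q2 := (D / r ^+ 2 + 2 / r * S + 1).
have q20 : 0 < q2.
  rewrite ltr_wpDl// addr_ge0//; first by apply: divr_ge0 => //; exact: sqr_ge0.
  by rewrite mulr_ge0// divr_ge0// ltW.
have small : \forall e \near (0 : R)^'+, 0 < e /\ e < Num.min 1 (s / 2 / q2).
  near=> e; split; first by near: e; exact: nbhs_right_gt.
  by near: e; apply: nbhs_right_lt; rewrite lt_min ltr01/= !divr_gt0.
have all_mass : \forall e \near (0 : R)^'+, forall i,
   (`|\int[p e]_x (cutoff (X i) r x ^+ 2)%:E - (alpha i)%:E| < delta%:E)%E.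
  exact: filter_forall mass_near.
have [e [[e0 esm] em] GK] := often _ (filterI small all_mass).
have [u [g [P [t [c [a [au pP gt Pc [aE aB t0 c0 lt]]]]]]]] := G_eps_lt b0 e0 GK.
have coer := kinetic_coercive b0 Z0 e0 t0 c0 aB lt; rewrite -/S in coer.
have mfin i : (\int[p e]_x (cutoff (X i) r x ^+ 2)%:E \is a fin_num)%E.
  by have := em i; case: (\int[p e]_x _)%E.
have := low r e (p e) u g P t c a (fun i => fine (\int[p e]_x (cutoff (X i) r x ^+ 2)%:E)%E)
  r0 e0 sep au pP gt Pc aE (fun i => esym (fineK (mfin i)))
  (fun i => ltac:(by have := em i; rewrite -{1}(fineK (mfin i)) -EFinB abse_EFin lte_fin)).
move=> /le_trans; apply; rewrite -EFinD lee_fin.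
have -> : \sum_(i < M) Z i * (e * (a i - 2 / r)) = e * (\sum_(i < M) Z i * a i) - e * (2 / r) * S.
  rewrite /S !mulr_sumr -sumrB; apply: eq_bigr => i _; ring.
move: lt; set A := \sum_(i < M) Z i * a i => lt.
have K1e : e ^+ 2 * t <= K1 by apply: (le_trans coer); exact: ler_norm.
have h1 : eta * (e ^+ 2 * t) <= eta * K1 by rewrite ler_pM2l.
move: esm; rewrite lt_min => /andP[e1 /ltW es].
have h2 : e * q2 <= s / 2 by rewrite -ler_pdivlMr.
have DD : 0 <= D / r ^+ 2 by rewrite divr_ge0// sqr_ge0.
have h3 : e ^+ 2 * (D / r ^+ 2) <= e * (D / r ^+ 2).
  by rewrite ler_wpM2r// expr2 ler_piMl ?ltW.
have h4 : e * q2 = e * (D / r ^+ 2) + e * (2 / r) * S + e by rewrite /q2; ring.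
move: lt h1 h2 h3 h4 etaE DD; move: (D / r ^+ 2) => DD lt h1 h2 h3 h4 etaE _.
have h5 : e ^+ 2 * ((1 + eta) * t + DD) = e ^+ 2 * t + eta * (e ^+ 2 * t) + e ^+ 2 * DD by ring.
rewrite h5; clear -lt h1 h2 h3 h4 etaE e0 eta0; lra.
Unshelve. all: by end_near. Qed.

End lower_bound.

(** * Upper bound *)

Section exchange_matrix.
Variable R : realType.
Implicit Types (c d e s t : R).

(** The length of the overlap of two intervals is an increment of [clamp], so it telescopes over
    consecutive intervals. *)
Definition clamp c c' t : R := Num.min (Num.max t c) c'.

Lemma clamp_ge c c' t : c <= c' -> c' <= t -> clamp c c' t = c'.
Proof. by move=> cc ct; rewrite /clamp max_l ?min_r// (le_trans cc). Qed.

Lemma clamp_le c c' t : c <= c' -> t <= c -> clamp c c' t = c.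
Proof. by move=> cc ct; rewrite /clamp max_r// min_l. Qed.

Lemma clampB c c' e e' : c <= c' -> e <= e' ->
  clamp c c' e' - clamp c c' e = Num.max 0 (Num.min c' e' - Num.max c e).
Proof.
by move=> cc ee; rewrite /clamp; case: (leP e' c) => ?; case: (leP e c) => ?;
  case: (leP c' e') => ?; repeat (case: leP => ?); lra.
Qed.

Lemma overlapC c c' d d' s :
  Num.max 0 (Num.min c' (d' + s) - Num.max c (d + s)) =
  Num.max 0 (Num.min d' (c' - s) - Num.max d (c - s)).
Proof.
congr Num.max; case: (leP c' (d' + s)) => h1; case: (leP c (d + s)) => h2;
  case: (leP d' (c' - s)) => h3; case: (leP d (c - s)) => h4; lra.
Qed.

(* Lay the masses out as consecutive intervals of [0, 1] and translate by 1/2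
   modulo 1: [a i j] is the mass of interval [i] landing in interval [j]. *)
Lemma half_turn_matrix n (p : nat -> R) : (forall i, 0 <= p i) -> \sum_(0 <= i < n) p i = 1 ->
  exists a : nat -> nat -> R, [/\ forall i j, 0 <= a i j, forall i j, a i j = a j i,
    forall i, a i i = Num.max 0 (2 * p i - 1) &
    forall i, (i < n)%N -> \sum_(0 <= j < n) a i j = p i].
Proof.
move=> p0 p1; pose c k := \sum_(0 <= i < k) p i.
have cS k : c k.+1 = c k + p k by rewrite /c big_nat_recr.
have cle k : c k <= c k.+1 by rewrite cS lerDl.
have cn : c n = 1 by [].
have c0 : c 0 = 0 by rewrite /c big_geq.
have cmono i j : (i <= j)%N -> c i <= c j.
  by move=> ij; rewrite /c [leRHS](@big_cat_nat _ _ _ i)//= lerDl sumr_ge0.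
(* The overlap of interval [i] with interval [j] translated by [s]. The shifts 1/2 and -1/2 together
   form the rotation: the rows telescope to the two parts of interval [i] on either side of 1/2, and
   on the diagonal each shift leaves max(0, p - 1/2). *)
pose ov i j s := clamp (c i) (c i.+1) (c j.+1 + s) - clamp (c i) (c i.+1) (c j + s).
have ovE i j s : ov i j s = Num.max 0 (Num.min (c i.+1) (c j.+1 + s) - Num.max (c i) (c j + s)).
  by rewrite /ov clampB ?lerD2r.
have ov0 i j s : 0 <= ov i j s by rewrite ovE le_max lexx.
have ovC i j s : ov i j s = ov j i (- s) by rewrite !ovE overlapC.
exists (fun i j => ov i j 2^-1 + ov i j (- 2^-1)); split.
- by move=> i j; rewrite addr_ge0.
- by move=> i j; rewrite ovC (ovC i j (- _)) opprK addrC.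
- move=> i; rewrite !ovE cS.
  have := p0 i; set q := p i; move: (c i) => d q0.
  rewrite (_ : Num.min (d + q) (d + q + 2^-1) = d + q); last by case: leP; lra.
  rewrite (_ : Num.max d (d + 2^-1) = d + 2^-1); last by case: leP; lra.
  rewrite (_ : Num.min (d + q) (d + q - 2^-1) = d + q - 2^-1); last by case: leP; lra.
  rewrite (_ : Num.max d (d - 2^-1) = d); last by case: leP; lra.
  by case: leP => h1; case: leP => h2; case: leP => h3; lra.
- move=> i ilt; rewrite big_split/=.
  have tel s : \sum_(0 <= j < n) ov i j s = clamp (c i) (c i.+1) (1 + s) - clamp (c i) (c i.+1) s.
    rewrite /ov (telescope_sumr (fun j => clamp (c i) (c i.+1) (c j + s)))//.
    by rewrite cn c0 add0r.
  have ci0 : 0 <= c i by rewrite -c0 cmono.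
  have ci1 : c i.+1 <= 1 by rewrite -cn cmono.
  have := cle i; rewrite !tel (_ : 1 - 2^-1 = 2^-1); last by lra.
  move=> cc; rewrite clamp_ge//; last by lra.
  rewrite (@clamp_le _ _ (- 2^-1))//; last by lra.
  by rewrite cS; lra.
Qed.

(** [k i] is the mass of piece [i] left by its own plan of mass max(0, 2p - 1), which is the
    diagonal of the half-turn. The off-diagonal entries are divided by [k i * k j] so as to weight
    products of measures with these masses. If [k j] is 0, so is its column, and the division is
    harmless. *)
Lemma exchange_matrix n (p : 'I_n -> R) (k := fun i => p i - Num.max 0 (2 * p i - 1)) :
  (forall i, 0 <= p i) -> \sum_i p i = 1 ->
  exists A : 'I_n -> 'I_n -> R, [/\ forall i j, 0 <= A i j, forall i j, A i j = A j i,
    forall i, A i i = 0 & forall i, k i = 0 \/ \sum_j A i j * k j = 1].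
Proof.
move=> p0 p1; pose pn l := if insub l is Some i then p i else 0.
have pnE (i : 'I_n) : pn i = p i by rewrite /pn valK.
have [a [a0 aC aii arow]] : exists a : nat -> nat -> R, [/\ forall i j, 0 <= a i j, forall i j, a i j = a j i,
    forall i, a i i = Num.max 0 (2 * pn i - 1) &
    forall i, (i < n)%N -> \sum_(0 <= j < n) a i j = pn i].
  apply: half_turn_matrix; first by move=> l; rewrite /pn; case: insub.
  by rewrite big_mkord -p1; apply: eq_bigr => i _; exact: pnE.
have row (i : 'I_n) : \sum_(j < n | j != i) a i j = k i.
  have := arow i (ltn_ord i); rewrite big_mkord (bigD1 i)//= aii pnE => h.
  by rewrite /k -[X in _ = X - _]h addrAC subrr add0r.
have k0 i : 0 <= k i by rewrite -row sumr_ge0.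
have akz (i j : 'I_n) : i != j -> k j = 0 -> a i j = 0.
  move=> ij kj; apply/eqP; rewrite eq_le a0 andbT aC -kj -row (bigD1 i)//= lerDl.
  by rewrite sumr_ge0.
exists (fun i j : 'I_n => if i == j then 0 else a i j / (k i * k j)); split.
- by move=> i j; case: ifP => // _; rewrite divr_ge0// mulr_ge0.
- by move=> i j; rewrite eq_sym; case: ifP => // _; rewrite aC [k i * _]mulrC.
- by move=> i; rewrite eqxx.
move=> i; have [ki|ki] := eqVneq (k i) 0; [by left|right].
rewrite (bigD1 i)//= eqxx mul0r add0r.
rewrite (eq_bigr (fun j : 'I_n => a i j / k i)); last first.
  move=> j ji; rewrite eq_sym (negbTE ji).
  have [kj|kj] := eqVneq (k j) 0; last by field; rewrite ki kj.
  by rewrite (akz i j) ?mul0r// eq_sym.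
by rewrite -mulr_suml row divff.
Qed.

End exchange_matrix.

(** * Couplings assembled from partial plans *)

Section assembly.
Variable R : realType.
Local Notation E3 := (E3 R).
Local Notation leb3 := (leb3 R).
Local Notation meas3 := {measure set E3 -> \bar R}.
Local Notation meas6 := {measure set (E3 * E3) -> \bar R}.
Implicit Types (rho mu : meas3) (P Q : meas6) (h : E3 -> \bar R).

Lemma null_integral mu h : mu setT = 0%E -> measurable_fun setT h -> (forall x, 0 <= h x)%E ->
  (\int[mu]_x h x = 0)%E.
Proof.
move=> mu0 mh h0; rewrite (eq_measure_integral (mzero : meas3)) ?integral_measure_zero// => A mA _.
apply/eqP; rewrite eq_le measure_ge0 andbT; apply: (@le_trans _ _ (mu setT)); last by rewrite mu0.
by apply: le_measure => //; rewrite inE.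
Qed.

(** The part of [rho] that the plan leaves uncoupled; its mass is the [k i] of [exchange_matrix]. *)
Lemma residual_ex rho (m : R) P : partial_plan rho m P -> P setT = (Num.max 0 (2 * m - 1))%:E ->
  exists kap : meas3, [/\ kap setT = (m - Num.max 0 (2 * m - 1))%:E,
    forall h, measurable_fun setT h -> (forall x, 0 <= h x)%E ->
      (\int[rho]_x h x = \int[P]_p h p.1 + \int[kap]_x h x)%E &
    forall A, measurable A -> (kap A <= rho A)%E].
Proof.
move=> [rm eP le1 _] PT; have [lam lamE] := marginal_ex P.
have lamle A : measurable A -> (lam A <= rho A)%E.
  move=> mA; rewrite (measure_of_integral lam mA) (measure_of_integral rho mA).
  rewrite lamE; [|exact: measurable_indicE|by move=> x; rewrite lee_fin].
  by apply: le1; [exact: measurable_indicE|move=> x; rewrite lee_fin].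
have [kap kapE] := sub_measure_ex (ltac:(by rewrite rm ltry) : (rho setT < +oo)%E) lamle.
exists kap; split.
- have := kapE _ measurableT; rewrite rm.
  have -> : lam setT = P setT by rewrite -(integral_one lam) lamE// integral_one.
  rewrite PT; have : (0 <= kap setT)%E by exact: measure_ge0.
  case: (kap setT) => [x _|//|//]; rewrite -EFinD => -[E].
  by congr EFin; move: E; move: (Num.max _ _) => B; lra.
- by move=> h mh h0; rewrite (sub_measure_integral kapE)// lamE.
- by move=> A mA; rewrite (kapE A mA) leeDr.
Qed.

(** Each piece keeps its own plan, and the products of the residual parts are added with the weights
    of the exchange matrix. The zero diagonal leaves only interactions between different pieces,
    bounded by [K]. The constant [L] depends on the masses alone, hence neither on the scale nor on
    the mesh. *)
Lemma coupling_assembly n (p : 'I_n -> R) : (forall i, 0 <= p i) -> \sum_i p i = 1 ->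
  exists2 L : R, 0 <= L & forall (nu : 'I_n -> meas3) rho (Q : 'I_n -> meas6) (K : R),
  (forall i, partial_plan (nu i) (p i) (Q i)) ->
  (forall i, Q i setT = (Num.max 0 (2 * p i - 1))%:E) ->
  (forall i j, i != j -> (\int[nu i]_x \int[nu j]_y coulomb_kernel x y <= K%:E)%E) ->
  0 <= K ->
  (forall h, measurable_fun setT h -> (forall x, 0 <= h x)%E ->
    (\int[rho]_x h x = \sum_i \int[nu i]_x h x)%E) ->
  (coulomb_cost rho <= \sum_i cost (Q i) + (L * K)%:E)%E.
Proof.
move=> p0 p1; have [A [A0 AC Aii Arow]] := exchange_matrix p0 p1.
exists (\sum_i \sum_j A i j); first by apply: sumr_ge0 => i _; exact: sumr_ge0.
move=> nu rho Q K pQ QT cross K0 rhoE.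
have mc := @measurable_kernel2 R.
pose k i := p i - Num.max 0 (2 * p i - 1).
have [kap kapP] := choice (fun i => residual_ex (pQ i) (QT i)).
have kapT i : kap i setT = (k i)%:E by case: (kapP i).
have kapI i h : measurable_fun setT h -> (forall x, 0 <= h x)%E ->
  (\int[nu i]_x h x = \int[Q i]_p h p.1 + \int[kap i]_x h x)%E by case: (kapP i) => _ H _; exact: H.
have kaple i h : measurable_fun setT h -> (forall x, 0 <= h x)%E -> (\int[kap i]_x h x <= \int[nu i]_x h x)%E.
  by move=> mh h0; apply: ge0_le_measure_integral => //; case: (kapP i).
have fkap i : (kap i setT < +oo)%E by rewrite kapT ltry.
have [W WP] := choice (fun ij : 'I_n * 'I_n => product_measure_ex (fkap ij.1) (fkap ij.2)).
have [V VP] := choice (fun ij : 'I_n * 'I_n => scale_measure_ex (W ij) (A0 ij.1 ij.2)).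
have [P1 [_ P1E]] := sum_measure_ex Q.
have [P2 [_ P2E]] := sum_measure_ex V.
have [P [_ PE]] := sum_measure_ex (fun b : bool => if b then P1 else P2).
have PI (H : E3 * E3 -> \bar R) : measurable_fun setT H -> (forall q, 0 <= H q)%E ->
    (\int[P]_q H q = \sum_i \int[Q i]_q H q + \sum_i \sum_j (A i j)%:E * \int[kap i]_x \int[kap j]_y H (x, y))%E.
  move=> mH H0; rewrite PE// big_bool/= P1E// P2E// pair_bigA/=; congr (_ + _)%E.
  by apply: eq_bigr => -[i j] _; rewrite (VP (i, j)).2//= (WP (i, j) _ mH H0).1.
have W1 h i j : measurable_fun setT h -> (forall x, 0 <= h x)%E ->
    (\int[kap i]_x \int[kap j]_y h x = (k j)%:E * \int[kap i]_x h x)%E.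
  move=> mh h0; under eq_integral do rewrite integral_cst// kapT muleC.
  rewrite ge0_integralZl// lee_fin /k.
  by rewrite -lee_fin -[X in (_ <= X)%E]kapT measure_ge0.
have W2 h i j : measurable_fun setT h -> (forall x, 0 <= h x)%E ->
    (\int[kap i]_x \int[kap j]_y h y = (k i)%:E * \int[kap j]_x h x)%E.
  by move=> mh h0; rewrite integral_cst// kapT muleC.
have k0 i : 0 <= k i by rewrite -lee_fin -kapT measure_ge0.
have lump i h : measurable_fun setT h -> (forall x, 0 <= h x)%E ->
    (\sum_j (A i j)%:E * ((k j)%:E * \int[kap i]_x h x) = \int[kap i]_x h x)%E.
  move=> mh h0; have i0 : (0 <= \int[kap i]_x h x)%E by exact: integral_ge0.
  have [ki|row] := Arow i.
    have -> : (\int[kap i]_x h x = 0)%E by apply: null_integral => //; rewrite kapT /k ki.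
    by rewrite big1// => j _; rewrite !mule0.
  move: i0; move: (\int[kap i]_x h x)%E => y y0.
  under eq_bigr do rewrite muleA -EFinM.
  rewrite -ge0_sume_distrl; last by move=> j _; rewrite lee_fin mulr_ge0.
  by rewrite sumEFin row mul1e.
have coup : coupling rho P.
  apply: coupling_of_integral => h mh h0; rewrite rhoE//.
  have -> : (\sum_i \int[nu i]_x h x = \sum_i \int[Q i]_q h q.1 + \sum_i \int[kap i]_x h x)%E.
    by rewrite -big_split/=; apply: eq_bigr => i _; exact: kapI.
  have m1 := measurable_comp1 mh; have m2 := measurable_comp2 mh.
  rewrite !PI//; split.
    congr (_ + _)%E; apply: eq_bigr => i _; rewrite -[RHS](lump i)//.
    by apply: eq_bigr => j _; rewrite -W1.
  congr (_ + _)%E; first by apply: eq_bigr => i _; case: (pQ i) => _ eQ _ _; rewrite eQ.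
  rewrite exchange_big/=; apply: eq_bigr => i _; rewrite -[RHS](lump i)//.
  by apply: eq_bigr => j _; rewrite AC W2.
apply: (@le_trans _ _ (cost P)); first by apply: ereal_inf_lbound; exists P.
have cge q : (0 <= coulomb_kernel q.1 q.2 :> \bar R)%E := coulomb_kernel_ge0 q.1 q.2.
rewrite /cost PI//; apply: leeD => //.
have -> : ((\sum_i \sum_j A i j) * K)%:E = (\sum_i \sum_j ((A i j)%:E * K%:E))%E.
  rewrite mulr_suml -sumEFin; apply: eq_bigr => i _; rewrite mulr_suml -sumEFin.
  by apply: eq_bigr => j _; rewrite EFinM.
apply: lee_sum => i _; apply: lee_sum => j _.
have [<-|ij] := eqVneq i j; first by rewrite Aii !mul0e.
apply: lee_wpmul2l; first by rewrite lee_fin.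
apply: le_trans (cross i j ij) => /=.
have fnu l : (nu l setT < +oo)%E by case: (pQ l) => -> *; rewrite ltry.
have mF (mu : meas3) : (mu setT < +oo)%E -> measurable_fun setT (fun x => \int[mu]_y coulomb_kernel x y)%E.
  by move=> fm; exact: (measurable_fun_fubini_tonelli_F (m2 := finite_of fm) _ mc cge).
apply: (@le_trans _ _ (\int[kap i]_x \int[nu j]_y coulomb_kernel x y)%E).
  apply: ge0_le_integral => //.
  - by move=> x _; apply: integral_ge0 => y _; exact: coulomb_kernel_ge0.
  - exact: mF.
  - exact: mF.
  - move=> x _; apply: kaple; last by move=> y; exact: coulomb_kernel_ge0.
    by apply: (eq_measurable_fun (fun y => coulomb_kernel y x)) => [y _|]; [exact: coulomb_kernelC|exact: measurable_kernel].
apply: kaple; first exact: mF.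
by move=> x; apply: integral_ge0 => y _; exact: coulomb_kernel_ge0.
Qed.

(** The product of [mu] with itself, divided by its mass and trimmed. It is far from optimal, but a
    bounded potential gives it a bounded cost, which suffices for the diffuse piece. *)
Lemma product_plan_ex mu (m : R) : mu setT = m%:E -> 0 <= m <= 1 ->
  exists Q, [/\ partial_plan mu m Q, Q setT = (Num.max 0 (2 * m - 1))%:E &
    forall K : R, (forall x, attraction x mu <= K%:E)%E -> (cost Q <= K%:E)%E].
Proof.
move=> mT /andP[m0 m1]; have fmu : (mu setT < +oo)%E by rewrite mT ltry.
have mc := @measurable_kernel2 R.
have cge q : (0 <= coulomb_kernel q.1 q.2 :> \bar R)%E := coulomb_kernel_ge0 q.1 q.2.
have [W WE] := product_measure_ex fmu fmu.
have mi0 : 0 <= m^-1 by rewrite invr_ge0.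
have [V [_ VE]] := scale_measure_ex W mi0.
have mm : m^-1 * m <= 1 by have [->|mn] := eqVneq m 0; rewrite ?mulr0// mulVf.
have V1 h : measurable_fun setT h -> (forall x, 0 <= h x)%E ->
    (\int[V]_q h q.1 = (m^-1 * m)%:E * \int[mu]_x h x)%E.
  move=> mh h0; have mh1 := measurable_comp1 mh.
  rewrite VE// (WE _ mh1 (fun q => h0 q.1)).1 /=.
  under eq_integral do rewrite integral_cst// mT muleC.
  rewrite ge0_integralZl// ?lee_fin//.
  by move: (\int[mu]_x h x)%E => y; rewrite muleA -EFinM.
have V2 h : measurable_fun setT h -> (forall x, 0 <= h x)%E ->
    (\int[V]_q h q.2 = (m^-1 * m)%:E * \int[mu]_x h x)%E.
  move=> mh h0; have mh2 := measurable_comp2 mh.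
  have E : (\int[W]_q h q.2 = m%:E * \int[mu]_x h x)%E.
    transitivity (\int[mu]_x \int[mu]_y h y)%E; first exact: (WE _ mh2 (fun q => h0 q.2)).1.
    by rewrite integral_cst// mT muleC.
  rewrite VE// E; move: (\int[mu]_x h x)%E => y.
  by rewrite muleA -EFinM.
have pV : partial_plan mu m V.
  split => //.
  - by move=> h mh h0; rewrite V1// V2.
  - move=> h mh h0; rewrite V1// -[leRHS]mul1e lee_wpmul2r ?lee_fin//.
    exact: integral_ge0.
  - have := V1 (fun=> 1%E) (@measurable_cst _ _ _ _ _ _) (fun=> lee01).
    rewrite !integral_one mT => ->; rewrite -EFinM lee_fin.
    have [mz|mn] := eqVneq m 0; first by rewrite mz !mulr0; clear; lra.
    by rewrite mulVf// mul1r; clear -m1; lra.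
have [Q [pQ QT cQ]] := plan_trim pV; exists Q; split => // K HK.
have K0 : 0 <= K.
  by rewrite -lee_fin; apply: le_trans (HK 0); apply: integral_ge0 => y _; exact: coulomb_kernel_ge0.
apply: (le_trans cQ); rewrite /cost VE// (WE _ mc cge).1.
apply: (@le_trans _ _ (m^-1%:E * (K%:E * m%:E))%E).
  apply: lee_wpmul2l; first by rewrite lee_fin.
  rewrite -mT -integral_cst//; apply: ge0_le_integral => //.
  - by move=> x _; apply: integral_ge0 => y _; exact: coulomb_kernel_ge0.
  - exact: (measurable_fun_fubini_tonelli_F (m2 := finite_of fmu) _ mc cge).
  - move=> x _; apply: le_trans (HK x); rewrite /attraction.
    by rewrite le_eqVlt; apply/orP; left; apply/eqP; apply: eq_integral => y _; rewrite coulomb_kernelC.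
rewrite -!EFinM lee_fin mulrCA ler_piMr//.
Qed.

End assembly.

(** * Building blocks of the recovery family *)

Section pieces.
Variable R : realType.
Local Notation E3 := (E3 R).
Local Notation leb3 := (leb3 R).
Local Notation meas3 := {measure set E3 -> \bar R}.
Local Notation meas6 := {measure set (E3 * E3) -> \bar R}.
Implicit Types (rho mu : meas3) (P Q : meas6) (u : E3 -> R) (g : E3 -> E3).

(** The lower bound of [attraction_le_energy]; it makes sums of cell energies meaningful. *)
Lemma cell_energy_ltNy (b Z alpha : R) : 0 < b -> 0 < Z -> (-oo < cell_energy b Z alpha)%E.
Proof.
move=> b0 Z0; apply: (@lt_le_trans _ _ (- (3 / 4 * Z ^+ 2 * alpha))%:E); first exact: ltNyr.
apply: le_ereal_inf_tmp => _ [rho [rT klt] <-].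
have [u [g [au _]]] := kinetic_lt klt.
have [a aE aB] := kinetic_attraction_fin (fun _ : 'I_1 => 0 : E3) au.
have k0 : (0 <= kinetic rho)%E by apply: le_ereal_inf_tmp => _ [f [h [_ _ ->]]]; exact: energy_ge0.
have f0 : (0 <= fractional_cost rho alpha)%E.
  rewrite /fractional_cost; case: ifP => // _.
  by apply: le_ereal_inf_tmp => _ [mu _ <-]; apply: le_ereal_inf_tmp => _ [P _ <-]; exact: cost_ge0.
have b0' : (0 <= b%:E * fractional_cost rho alpha)%E by rewrite mule_ge0// lee_fin ltW.
apply: (@le_trans _ _ (kinetic rho - Z%:E * attraction (0 : E3)%R rho)%E); last first.
  by apply: leeB => //; rewrite leeDl.
have aE0 := aE ord0; rewrite /= in aE0.
case kE : (kinetic rho) klt k0 => [k| |]// klt k0.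
rewrite aE0 -EFinM -EFinB lee_fin; apply/ler_addgt0Pr => s s0.
have [u1 [g1 [au1 lt1]]] : exists u g, amplitude rho u g /\ (energy g < (k + s)%:E)%E.
  by apply: kinetic_lt; rewrite kE lte_fin ltrDl.
have := attraction_le_energy Z0 au1 rT (ltW lt1) (ltac:(by rewrite aE0) : ((a ord0)%:E <= attraction (0 : E3)%R rho)%E).
by lra.
Qed.

(** An almost optimal competitor is cut off at a large radius by [localize] at scale 1. The mass
    drops to some m <= alpha and is not restored: the difference goes to the residual measure. *)
Lemma cell_compact (b Z alpha y : R) : 0 < b -> 0 < Z -> 0 <= alpha <= 1 ->
  (cell_energy b Z alpha < y%:E)%E ->
  exists (mu : meas3) u g P (m r t c a : R), [/\ amplitude mu u g,
    supported u g [set x | enorm x <= r],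
    partial_plan mu m P /\ P setT = (Num.max 0 (2 * m - 1))%:E, 0 <= m <= alpha &
    [/\ 0 < r, energy g = t%:E, cost P = c%:E, (a%:E <= attraction (0 : E3)%R mu)%E &
      t + b * c - Z * a < y]].
Proof.
move=> b0 Z0 /andP[al0 al1] /ereal_inf_lt[_ [rho [rT klt] <-]].
have [u0 [g0 [au0 _]]] := kinetic_lt klt.
have [a aE _] := kinetic_attraction_fin (fun _ : 'I_1 => 0 : E3) au0.
have k0 : (0 <= kinetic rho)%E by apply: le_ereal_inf_tmp => _ [f [h [_ _ ->]]]; exact: energy_ge0.
have f0 : (0 <= fractional_cost rho alpha)%E.
  rewrite /fractional_cost; case: ifP => // _.
  by apply: le_ereal_inf_tmp => _ [mu _ <-]; apply: le_ereal_inf_tmp => _ [P _ <-]; exact: cost_ge0.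
have {aE} := aE ord0; move: (a ord0) => {}a aE /=.
rewrite aE; case kE : (kinetic rho) klt k0 => [k| |]// _ k0.
case fE : (fractional_cost rho alpha) f0 => [f| |]// f0; last first.
  by rewrite gt0_muley ?lte_fin// -EFinM addey// addye// ltNge leey.
rewrite -!EFinM -?EFinN -!EFinD lte_fin => lty.
(* Half of the room below [y] is spent on choosing a gradient and a plan, the other half on cutting
   off. *)
pose gap := (y - (k + b * f - Z * a)) / 2; have gap0 : 0 < gap by rewrite divr_gt0// subr_gt0.
pose s := gap / (1 + b); have b1 : 0 < 1 + b by rewrite addr_gt0.
have s0 : 0 < s by rewrite divr_gt0.
have sE : s * (1 + b) = gap by rewrite /s divfK// gt_eqF.
have [u [g [au glt]]] : exists u g, amplitude rho u g /\ (energy g < (k + s)%:E)%E.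
  by apply: kinetic_lt; rewrite kE lte_fin ltrDl.
have [P [pP PT Plt]] := fractional_cost_lt rT (ltac:(by rewrite fE lte_fin ltrDl) : (fractional_cost rho alpha < (f + s)%:E)%E).
have [t tE t0] : exists2 t, energy g = t%:E & 0 <= t.
  by have := energy_ge0 g; move: glt; case: (energy g) => [t| |]//; rewrite lee_fin; exists t.
have [c cE c0] : exists2 c, cost P = c%:E & 0 <= c.
  by have := cost_ge0 P; move: Plt; case: (cost P) => [c| |]//; rewrite lee_fin; exists c.
have lt2 : t + b * c - Z * a < y - gap.
  move: glt Plt; rewrite tE cE !lte_fin => l1 l2.
  have l3 : b * c < b * (f + s) by rewrite ltr_pM2l.
  have gE : 2 * gap = y - (k + b * f - Z * a) by rewrite /gap; field.
  lra.
have [C C0 loc] := @localize R.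
pose eta := gap / (3 * (t + 1)); have t1 : 0 < t + 1 by rewrite ltr_wpDl.
have eta0 : 0 < eta by rewrite divr_gt0// mulr_gt0.
have etat : eta * t <= gap / 3.
  have -> : eta * t = gap / 3 * (t / (t + 1)) by rewrite /eta; field; rewrite gt_eqF.
  apply: ler_piMr; first by rewrite divr_ge0// ltW.
  by rewrite ler_pdivrMr// mul1r lerDl.
pose D := (1 + eta^-1) * C; have D0 : 0 <= D by rewrite mulr_ge0// addr_ge0// invr_ge0 ltW.
(* Large enough for the kinetic error D / r^2 and the lost attraction 2 Z / r to add up to at most
   gap / 3; [eta] accounts for another third. *)
pose r := 1 + 3 * (D + 2 * Z) / gap.
have DZ : 0 <= D + 2 * Z by rewrite addr_ge0// mulr_ge0// ltW.
have q0 : 0 <= 3 * (D + 2 * Z) / gap by rewrite divr_ge0 ?(ltW gap0)// mulr_ge0.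
have r1 : 1 <= r by rewrite lerDl.
have r0 : 0 < r by exact: lt_le_trans r1.
have [m mE m0] : exists2 m, (\int[rho]_x (cutoff 0 r x ^+ 2)%:E)%E = m%:E & 0 <= m <= alpha.
  have h0 : (0 <= \int[rho]_x (cutoff 0 r x ^+ 2)%:E)%E.
    by apply: integral_ge0 => x _; rewrite lee_fin sqr_ge0.
  have : (\int[rho]_x (cutoff 0 r x ^+ 2)%:E <= alpha%:E)%E.
    rewrite -rT -(integral_one rho); apply: ge0_le_integral => //.
    - by move=> x _; rewrite lee_fin sqr_ge0.
    - exact: measurable_cutoff_sqr.
    - by move=> x _; rewrite lee_fin cutoff_sqr_le1.
  move: h0; case: (\int[rho]_x _)%E => [m| |]//; rewrite !lee_fin => h1 h2.
  by exists m => //; rewrite h1.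
have [mu [u' [g' [P' [au' su' pP' [e' c' a']]]]]] := loc rho u g alpha m P 0 r eta 1 r0 eta0 ltr01 au pP mE.
have hg : H1_gradient u g by case: au.
have rT' : (rho : meas3) setT = alpha%:E := rT.
have [t' t'E t't] : exists2 t', energy g' = t'%:E & t' <= (1 + eta) * t + D / r ^+ 2.
  have : (energy g' <= ((1 + eta) * t + D / r ^+ 2)%:E)%E.
    apply: (le_trans e'); rewrite expr1n mul1e [leRHS]EFinD; apply: leeD.
      rewrite EFinM; apply: lee_wpmul2l; first by rewrite lee_fin addr_ge0// ltW.
      rewrite -tE; apply: ge0_le_integral => //.
      - by move=> x _; rewrite lee_fin mulr_ge0// sqr_ge0.
      - apply/measurable_EFinP; apply: measurable_funM; last exact: measurable_energy hg.
        by apply: measurable_funX; exact: measurable_cutoff.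
      - by apply/measurable_EFinP; exact: measurable_energy hg.
      - by move=> x _; rewrite lee_fin ler_piMl ?sqr_ge0// cutoff_sqr_le1.
    rewrite rT' -EFinM lee_fin /D mulrA ler_piMr//.
    by rewrite divr_ge0// sqr_ge0.
  by have := energy_ge0 g'; case: (energy g') => [t'| |]// _; rewrite lee_fin; exists t'.
have cP' : (cost P' <= c%:E)%E.
  rewrite c' mul1e -cE; have mc := @measurable_kernel2 R.
  apply: ge0_le_integral => //.
  - by move=> p _; apply: mule_ge0; [rewrite lee_fin mulr_ge0 ?sqr_ge0|exact: coulomb_kernel_ge0].
  - apply: emeasurable_funM => //; apply/measurable_EFinP; apply: measurable_funM; apply: measurable_funX.
      by apply: (measurableT_comp (measurable_cutoff _ _)); exact: measurable_fst.
    by apply: (measurableT_comp (measurable_cutoff _ _)); exact: measurable_snd.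
  - move=> p _; rewrite -[leRHS]mul1e; apply: lee_wpmul2r; first exact: coulomb_kernel_ge0.
    by rewrite lee_fin mulr_ile1 ?sqr_ge0 ?cutoff_sqr_le1.
have [P2 [pP2 P2T cP2]] := plan_trim pP'.
have [c2 c2E c2c] : exists2 c2, cost P2 = c2%:E & c2 <= c.
  have := cost_ge0 P2; have := le_trans cP2 cP'.
  by case: (cost P2) => [c2| |]//; rewrite lee_fin; exists c2.
exists mu, u', g', P2, m, (r / 1), t', c2, (a - 2 / r); split => //.
split => //; first by rewrite divr1.
  move: a'; rewrite invr1 mul1e rT' aE; case: (attraction _ mu) => [q| |]//; rewrite ?leey//.
  rewrite -EFinM -EFinD !lee_fin => a'.
  have : 2 / r * alpha <= 2 / r by rewrite ler_piMr// divr_ge0// ltW.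
  clear -a'; lra.
have bc : b * c2 <= b * c by rewrite ler_pM2l.
have rem : D / r ^+ 2 + 2 * Z / r <= gap / 3.
  apply: (@le_trans _ _ ((D + 2 * Z) / r)).
    rewrite [leRHS]mulrDl lerD2r expr2 invfM mulrA; apply: ler_piMr; first by rewrite divr_ge0// ltW.
    by rewrite invf_le1.
  rewrite ler_pdivrMr//.
  have -> : gap / 3 * r = gap / 3 + (D + 2 * Z) by rewrite /r; field; rewrite gt_eqF.
  by rewrite lerDr divr_ge0// ltW.
have -> : Z * (a - 2 / r) = Z * a - 2 * Z / r by field; rewrite gt_eqF.
move: t't etat rem lt2 bc gap0; move: (D / r ^+ 2) (2 * Z / r) => d1 d2; clear; lra.
Qed.

Lemma integral_near mu u g (S : set E3) (m v e : R) (h : E3 -> R) : amplitude mu u g ->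
  supported u g S -> mu setT = m%:E -> measurable_fun setT h -> (forall x, 0 <= h x) ->
  0 <= v -> 0 <= e -> (forall x, S x -> `|h x - v| <= e) ->
  exists2 y, (\int[mu]_x (h x)%:E)%E = y%:E & `|y - v * m| <= e * m.
Proof.
move=> au su muT mh h0 v0 e0 hv; have mu_ := amplitude_measurable au.
have mE := amplitude_mass au; rewrite muT in mE.
have hrho : (\int[mu]_x (h x)%:E = \int[leb3]_x ((u x ^+ 2)%:E * (h x)%:E))%E.
  by case: au => _ _ H; rewrite H//; exact/measurable_EFinP.
have mu2 : measurable_fun setT (fun x => (u x ^+ 2)%:E).
  by apply/measurable_EFinP; exact: measurable_funX.
have mhE : measurable_fun setT (fun x => (h x)%:E) by exact/measurable_EFinP.
have ave (k : R) : 0 <= k -> (\int[leb3]_x (k%:E * (u x ^+ 2)%:E) = (k * m)%:E)%E.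
  move=> k0; rewrite ge0_integralZl//; first by rewrite -mE.
  by move=> x _; rewrite lee_fin sqr_ge0.
have up : (\int[mu]_x (h x)%:E <= ((v + e) * m)%:E)%E.
  rewrite hrho -ave ?addr_ge0//; apply: ge0_le_integral => //.
  - by move=> x _; rewrite mule_ge0 ?lee_fin ?sqr_ge0.
  - exact: emeasurable_funM.
  - exact: measurable_funeM.
  move=> x _; rewrite -!EFinM lee_fin mulrC.
  have [Sx|/su[-> _]] := pselect (S x); last by rewrite expr0n !mulr0.
  rewrite ler_wpM2r ?sqr_ge0//; have := ler_norm (h x - v); have := hv x Sx; lra.
have y0 : (0 <= \int[mu]_x (h x)%:E)%E by apply: integral_ge0 => x _; rewrite lee_fin.
have lo : ((v * m)%:E <= \int[mu]_x (h x)%:E + (e * m)%:E)%E.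
  rewrite hrho -!ave// -ge0_integralD//.
  - apply: ge0_le_integral => //.
    + by move=> x _; rewrite mule_ge0 ?lee_fin ?sqr_ge0.
    + exact: measurable_funeM.
    + by apply: emeasurable_funD; [exact: emeasurable_funM|exact: measurable_funeM].
    move=> x _; rewrite -!EFinM -EFinD lee_fin [u x ^+ 2 * _]mulrC -mulrDl.
    have [Sx|/su[-> _]] := pselect (S x); last by rewrite expr0n !mulr0.
    rewrite ler_wpM2r ?sqr_ge0//; have := ler_norm (v - h x); have := hv x Sx; rewrite distrC; lra.
  - by move=> x _; rewrite mule_ge0 ?lee_fin ?sqr_ge0.
  - exact: emeasurable_funM.
  - by move=> x _; rewrite mule_ge0 ?lee_fin ?sqr_ge0.
  - exact: measurable_funeM.
move: up y0 lo; case: (\int[mu]_x _)%E => [y| |]//; rewrite -EFinD !lee_fin => up y0 lo.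
by exists y => //; rewrite ler_norml; lra.
Qed.

Lemma bump_sum (J : finType) (y : J -> E3) (w : J -> R) (r : R) beta u0 g0 :
  amplitude beta u0 g0 -> supported u0 g0 [set x | 2 <= enorm x <= 4] -> 0 < r ->
  (forall a b, a != b -> 10 * r <= enorm (y a - y b)) -> (forall a, 0 <= w a) ->
  exists (sig : meas3) u g, [/\ amplitude sig u g,
    supported u g (\bigcup_a [set x | 2 * r <= enorm (x - y a) <= 4 * r]) &
    forall h, measurable_fun setT h -> (forall x, 0 <= h x)%E ->
      (\int[sig]_x h x = \sum_a (w a)%:E * \int[beta]_x h (affine (y a) r x))%E].
Proof.
move=> ab sb r0 sep w0.
have [be beP] := choice (fun a => scale_measure_ex beta (w0 a)).
have aube a := amplitude_scale (w0 a) ab (beP a).2.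
have [ta taP] := choice (fun a => push_measure_ex (be a) (measurable_affine (y a) r)).
have H a : exists ug : (E3 -> R) * (E3 -> E3), amplitude (ta a) ug.1 ug.2 /\
    supported ug.1 ug.2 [set x | 2 * r <= enorm (x - y a) <= 4 * r].
  have [u' [g' [au' _ su']]] := amplitude_affine r0 (aube a) (taP a).2.
  exists (u', g'); split => //= x nx; apply: (su' [set x | 2 <= enorm x <= 4]).
    by move=> z /sb[-> ->]; rewrite mulr0 scaler0.
  move=> -[z /= /andP[z2 z4] xE]; apply: nx => /=.
  rewrite xE /affine addrAC subrr add0r enorm_scale ?(ltW r0)// !(mulrC _ r).
  by rewrite !ler_pM2l// z2.
have [ug ugP] := choice H.
have [sig [_ sigE]] := sum_measure_ex ta.
(* Two shells of outer radius 4r with centres at distance at least 10r are disjoint. *)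
have dis a b : a != b -> forall x, [set x | 2 * r <= enorm (x - y a) <= 4 * r] x ->
    [set x | 2 * r <= enorm (x - y b) <= 4 * r] x -> False.
  move=> /sep ab' x /= /andP[_ xa] /andP[_ xb].
  have := enorm_triangle (y a) x (y b); rewrite (enormB (y a) x); lra.
have [aus _ sus] := amplitude_sum (fun a => (ugP a).1) (fun a => (ugP a).2) dis sigE.
exists sig, (fun x => \sum_a (ug a).1 x), (fun x => \sum_a (ug a).2 x); split => //.
move=> h mh h0; rewrite sigE//; apply: eq_bigr => a _.
have mha : measurable_fun setT (h \o affine (y a) r).
  by apply: measurableT_comp => //; exact: measurable_affine.
by rewrite (taP a).2// (beP a).2.
Qed.

End pieces.

(** * A finite grid of cubes *)

Section grid.
Variable R : realType.
Local Notation E3 := (E3 R).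
Implicit Types (x y : E3) (n : nat).

(** At mesh 1/(n+1), this number of cells on each side of the origin reaches the distance n + 1, so
    the grid refines and exhausts the space at once. *)
Definition half_size n := (n.+1 * n.+1)%N.

Definition grid_index n (i : 'I_(half_size n).*2) : int := (i : nat)%:Z - (half_size n)%:Z.

Local Notation J n := ('I_(half_size n).*2 * 'I_(half_size n).*2 * 'I_(half_size n).*2)%type.

Definition grid_cell n (j : J n) : set E3 :=
  @cell R (n, (grid_index j.1.1, grid_index j.1.2, grid_index j.2)).

Definition grid_site n (j : J n) : E3 :=
  ((grid_index j.1.1)%:~R / n.+1%:R, (grid_index j.1.2)%:~R / n.+1%:R, (grid_index j.2)%:~R / n.+1%:R).

(* The point outside of the grid receives the mass which the grid misses; it
   escapes to infinity with [n]. *)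
Definition grid_point n (o : option (J n)) : E3 :=
  if o is Some j then grid_site j else (n%:R + 2, 0, 0).

Lemma grid_index_inj n : injective (@grid_index n).
Proof. by move=> i j /addIr[ij]; exact: val_inj. Qed.

Lemma floor_cell n (i : int) (t : R) :
  t \in `[i%:~R / n.+1%:R, (i + 1)%:~R / n.+1%:R[ -> Num.floor (n.+1%:R * t) = i.
Proof.
rewrite in_itv/= => /andP[h1 h2]; apply: floor_def.
by rewrite -ler_pdivrMl// mulrC h1/= -ltr_pdivlMl// mulrC.
Qed.

Lemma grid_cell_inj n (i j : J n) x : grid_cell i x -> grid_cell j x -> i = j.
Proof.
move=> [[/floor_cell a1 /floor_cell a2] /floor_cell a3] [[/floor_cell b1 /floor_cell b2] /floor_cell b3].
move: i j a1 a2 a3 b1 b2 b3 => [[i1 i2] i3] [[j1 j2] j3] /= -> -> -> e1 e2 e3.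
by rewrite (grid_index_inj e1) (grid_index_inj e2) (grid_index_inj e3).
Qed.

Lemma grid_index_floor n (t : R) : `|t| <= n%:R ->
  exists i : 'I_(half_size n).*2, grid_index i = Num.floor (n.+1%:R * t).
Proof.
move=> tn; set z := Num.floor _.
have n1 : (0 : R) < n.+1%:R by [].
have [t1 t2] : - n%:R <= t /\ t <= n%:R by move: tn; rewrite ler_norml => /andP[].
have zle : z%:~R <= n.+1%:R * t := floor_le_tmp _.
have zlt : n.+1%:R * t < (z + 1)%:~R := floorD1_gt _.
have KE : ((half_size n)%:Z)%:~R = n.+1%:R * n.+1%:R :> R by rewrite -natrM.
have u : (z < (half_size n)%:Z)%R.
  rewrite -(ltr_int R) KE; apply: (le_lt_trans zle); rewrite ltr_pM2l//.
  by apply: (le_lt_trans t2); rewrite ltr_nat.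
have l : (- (half_size n)%:Z <= z)%R.
  rewrite -ltzD1 -(ltr_int R) rmorphN/= KE; apply: le_lt_trans zlt.
  by rewrite -mulrN ler_pM2l// (le_trans _ t1)// lerN2 ler_nat.
have zK : (0 <= z + (half_size n)%:Z)%R by lia.
have zE : ((absz (z + (half_size n)%:Z))%:Z = z + (half_size n)%:Z)%R by lia.
have lt : (absz (z + (half_size n)%:Z)%R < (half_size n).*2)%N by lia.
by exists (Ordinal lt); rewrite /grid_index /= zE addrK.
Qed.

Lemma grid_cell_cover x : \forall n \near \oo, exists j, @grid_cell n j x.
Proof.
have [N xN] := box_cover x; exists N => // n /= Nn.
have /box_normP := xN _ Nn; rewrite !prod_normE !ge_max => /andP[/andP[b1 b2] b3].
have [i1 e1] := grid_index_floor b1; have [i2 e2] := grid_index_floor b2; have [i3 e3] := grid_index_floor b3.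
exists (i1, i2, i3); rewrite /grid_cell /= e1 e2 e3.
by split; [split|]; exact: cell_floor.
Qed.

Lemma grid_cell_near n (j : J n) x : grid_cell j x -> `|x - grid_site j| <= n.+1%:R^-1.
Proof.
have c (i : int) : (i%:~R / n.+1%:R : R) \in `[i%:~R / n.+1%:R, (i + 1)%:~R / n.+1%:R[.
  by rewrite in_itv/= lexx/= ltr_pM2r ?invr_gt0// ltr_int ltzD1.
move=> [[/= h1 h2] h3]; rewrite !prod_normE !ge_max/=.
by apply/andP; split; first (apply/andP; split); apply: ltW; apply: (cell_width (i := grid_index _)) => //.
Qed.

Lemma grid_point_inj n : injective (@grid_point n).
Proof.
have n1 : (n.+1%:R^-1 : R) != 0 by rewrite invr_eq0 pnatr_eq0.
have site (i : 'I_(half_size n).*2) : (grid_index i)%:~R / n.+1%:R < n%:R + 2 :> R.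
  rewrite ltr_pdivrMr// (@lt_le_trans _ _ (n.+1%:R * n.+1%:R))//.
    rewrite -natrM -[X in _ < X]/((half_size n)%:Z%:~R) ltr_int /grid_index.
    by have := ltn_ord i; lia.
  by rewrite ler_pM2r// -natr1; lra.
move=> [[[i1 i2] i3]|] [[[j1 j2] j3]|] //=.
- move=> [/(mulIf n1)/intr_inj e1 /(mulIf n1)/intr_inj e2 /(mulIf n1)/intr_inj e3].
  by rewrite (grid_index_inj e1) (grid_index_inj e2) (grid_index_inj e3).
- by move=> [e1 _ _]; have := site i1; rewrite e1 ltxx.
- by move=> [e1 _ _]; have := site j1; rewrite -e1 ltxx.
Qed.

End grid.

(** * Approximation of the diffuse part by bumps away from the nuclei *)

Section diffuse.
Variable R : realType.
Local Notation E3 := (E3 R).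
Local Notation meas3 := {measure set E3 -> \bar R}.
Local Notation J n := ('I_(half_size n).*2 * 'I_(half_size n).*2 * 'I_(half_size n).*2)%type.
Implicit Types (u : E3 -> R) (g : E3 -> E3).

Lemma measurable_grid_cell n (j : J n) : measurable (@grid_cell R n j).
Proof. exact: measurable_cell. Qed.

Lemma grid_sum_le1 n (x : E3) : \sum_(j : J n) (\1_(grid_cell j) x : R) <= 1.
Proof.
apply: lone_sum_le1 => [j|i j ij]; first by rewrite indicE; case: (x \in _); rewrite ?lexx ?ler01.
rewrite !indicE; case: (boolP (x \in grid_cell i)) => [|_]; last by left.
case: (boolP (x \in grid_cell j)) => [|_]; last by right.
by rewrite !inE => xj xi; rewrite (grid_cell_inj xi xj) eqxx in ij.
Qed.

(** The mass of each cell is put on a bump in a shell around its corner; [left], whatever is missing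
    from the prescribed mass [s], goes to the point outside of the grid. The radius is a tenth of
    the smallest relevant distance at most. *)
Lemma approx_step (sig beta : meas3) u0 g0 (s : R) (M : nat) (X : 'I_M -> E3) n :
  amplitude beta u0 g0 -> supported u0 g0 [set x | 2 <= enorm x <= 4] -> beta setT = 1%E ->
  (sig setT <= s%:E)%E ->
  exists (sn : meas3) u g (d r left : R), [/\ 0 < d, 0 < r <= n.+1%:R^-1 /\ 0 <= left <= s,
    amplitude sn u g, supported u g [set x | forall i, d <= enorm (x - X i)] &
    sn setT = s%:E /\
    forall h, measurable_fun setT h -> (forall x, 0 <= h x)%E ->
      (\int[sn]_x h x = \sum_(j : J n) sig (grid_cell j) * \int[beta]_x h (affine (grid_site R j) r x)
        + left%:E * \int[beta]_x h (affine (grid_point R (@None (J n))) r x))%E].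
Proof.
move=> ab sb bT sigT.
have sum_le : (\sum_(j : J n) sig (grid_cell j) <= s%:E)%E.
  apply: le_trans sigT; rewrite -(integral_one sig).
  under eq_bigr do rewrite -(integral_indicE sig (measurable_grid_cell _)).
  rewrite -ge0_integral_sum//; last by move=> j; apply: measurable_indicE; exact: measurable_grid_cell.
  apply: ge0_le_integral => //.
  - by move=> x _; apply: sume_ge0 => j _; rewrite lee_fin.
  - by apply: emeasurable_sum => j; apply: measurable_indicE; exact: measurable_grid_cell.
  - by move=> x _; rewrite sumEFin lee_fin grid_sum_le1.
have [c cE cs] := sum_fin (fun j => measure_ge0 sig (@grid_cell R n j)) sum_le.
have c0 j : 0 <= c j by rewrite -lee_fin -cE.
pose left := s - \sum_j c j.
pose w (o : option (J n)) := if o is Some j then c j else left.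
have w0 o : 0 <= w o by case: o => [j|]/=; rewrite ?subr_ge0.
pose y := @grid_point R n.
have pos (p q : E3) : p != q -> 0 < enorm (p - q) / 10.
  move=> pq; rewrite divr_gt0// lt0r enorm_ge0 andbT; apply: contra_neq pq => /enorm_eq0/eqP.
  by rewrite subr_eq0 => /eqP.
have [r1 r10 r1P] := @fin_lower_bound R (option (J n) * option (J n))%type
  (fun ab => if y ab.1 == y ab.2 then 1 else enorm (y ab.1 - y ab.2) / 10)
  (fun ab => ltac:(by rewrite /=; case: ifPn => [_|h]; [exact: ltr01|exact: (pos _ _ h)])).
have [r2 r20 r2P] := @fin_lower_bound R (option (J n) * 'I_M)%type
  (fun ab => if y ab.1 == X ab.2 then 1 else enorm (y ab.1 - X ab.2) / 10)
  (fun ab => ltac:(by rewrite /=; case: ifPn => [_|h]; [exact: ltr01|exact: (pos _ _ h)])).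
pose r := Num.min (Num.min r1 r2) n.+1%:R^-1.
have r0 : 0 < r by rewrite /r !lt_min r10 r20/= invr_gt0 ltr0n.
have rr1 : r <= r1 by rewrite !ge_min lexx.
have rr2 : r <= r2 by rewrite !ge_min lexx orbT.
have rn : r <= n.+1%:R^-1 by rewrite !ge_min lexx orbT.
have sep a b : a != b -> 10 * r <= enorm (y a - y b).
  move=> ab'; have := r1P (a, b); rewrite /= (inj_eq (@grid_point_inj R n)) (negbTE ab').
  by move=> h; have := le_trans rr1 h; rewrite ler_pdivlMr// mulrC.
have [sn [u [g [an sn_s snE]]]] := bump_sum ab sb r0 sep w0.
(* A nucleus is either the centre of a shell, at its inner radius 2r, or at distance at least 10r
   from the centre, hence at least 6r from the shell. *)
exists sn, u, g, (2 * r), r, left; split => //.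
- by rewrite mulr_gt0.
- by rewrite r0 (w0 None)/= lerBlDr lerDl sumr_ge0.
- move=> x nx; apply: sn_s => -[k _ /= /andP[xo xo4]]; apply: nx => i.
  have [e|ne] := eqVneq (y k) (X i); first by rewrite -e.
  have := r2P (k, i); rewrite /= (negbTE ne) => h; have {}h := le_trans rr2 h.
  move: h; rewrite ler_pdivlMr// => h.
  have := enorm_triangle (y k) x (X i); rewrite (enormB (y k) x); lra.
have expand h : (\sum_(o : option (J n)) (w o)%:E * h o = \sum_j (c j)%:E * h (Some j) + left%:E * h None)%E.
  rewrite (bigD1 None)//= addeC; congr (_ + _)%E.
  rewrite (reindex_omap Some id)//=; last by case.
  by apply: eq_bigl => j; rewrite eqxx.
split.
  rewrite -(integral_one sn) snE// expand; under eq_bigr do rewrite integral_one bT mule1.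
  by rewrite integral_one bT mule1 sumEFin -EFinD addrC subrK.
move=> h mh h0; rewrite snE// (expand (fun o => \int[beta]_x h (affine (y o) r x))%E).
by congr (_ + _)%E; apply: eq_bigr => j _; rewrite cE.
Qed.

Lemma vanishing_bounded (f : E3 -> R) : continuous f -> vanishing_at_infinity f ->
  exists2 C : R, 0 <= C & forall x, `|f x| <= C.
Proof.
move=> cf /(_ 1 ltr01)[K cK fK].
have : compact (f @` K) by apply: continuous_compact => //; exact: continuous_subspaceT.
move=> /compact_bounded[C [_ HC]]; exists (`|C| + 1); first by rewrite addr_ge0.
move=> x; have [Kx|/fK/ltW h] := pselect (K x); last by apply: (le_trans h); rewrite lerDr.
by apply: (HC (`|C| + 1)); [rewrite (le_lt_trans (ler_norm _))// ltrDl|exists x].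
Qed.

(** The mass of [sn n] is [s] even if that of [sig] is smaller: the surplus sits at the point
    outside of the grid and escapes to infinity, where [f] vanishes. The rest converges by
    continuity of [f] and dominated convergence. *)
Lemma diffuse_approx (sig : meas3) (s : R) (M : nat) (X : 'I_M -> E3) : (sig setT <= s%:E)%E ->
  exists (sn : nat -> meas3) (u : nat -> E3 -> R) (g : nat -> E3 -> E3) (d : nat -> R),
   (forall n, [/\ 0 < d n, amplitude (sn n) (u n) (g n),
     supported (u n) (g n) [set x | forall i, d n <= enorm (x - X i)] & sn n setT = s%:E]) /\
   forall f : E3 -> R, continuous f -> vanishing_at_infinity f -> (forall x, 0 <= f x) ->
     (\int[sn n]_x (f x)%:E)%E @[n --> \oo] --> (\int[sig]_x (f x)%:E)%E.
Proof.
move=> sigT.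
have [beta [u0 [g0 [ab bT sb]]]] := @bump_measure_ex R.
have [sn /choice[u /choice[g /choice[d /choice[r /choice[left P]]]]]] := choice (fun n => approx_step X n ab sb bT sigT).
exists sn, u, g, d; split; first by move=> n; have [? ? ? ? []] := P n.
move=> f cf vf f0; have [C C0 fC] := vanishing_bounded cf vf.
have mf : measurable_fun setT f by exact: continuous_measurable3.
have mfE : measurable_fun setT (fun x => (f x)%:E) by exact/measurable_EFinP.
have fsig : (sig setT < +oo)%E by exact: le_lt_trans sigT (ltry _).
have r0 n : 0 < r n by have [_ [/andP[]]] := P n.
have avg n (y : E3) (v e : R) : 0 <= v -> 0 <= e ->
    (forall x, 2 <= enorm x <= 4 -> `|f (affine y (r n) x) - v| <= e) ->
    exists2 a, (\int[beta]_x (f (affine y (r n) x))%:E)%E = a%:E & `|a - v| <= e.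
  move=> v0 e0 fv.
  have [a aE av] := integral_near ab sb bT (measurableT_comp mf (measurable_affine y (r n))) (fun x => f0 _) v0 e0 fv.
  by exists a => //; rewrite !mulr1 in av.
have [F FE] : exists F : nat -> E3 -> R, forall n y, (\int[beta]_x (f (affine y (r n) x))%:E)%E = (F n y)%:E /\ 0 <= F n y <= C.
  have H (ny : nat * E3) : exists a, (\int[beta]_x (f (affine ny.2 (r ny.1) x))%:E)%E = a%:E /\ 0 <= a <= C.
    have [a aE _] := avg ny.1 ny.2 0 C (lexx _) C0 (fun x _ => ltac:(by rewrite subr0)).
    have i0 : (0 <= \int[beta]_x (f (affine ny.2 (r ny.1) x))%:E)%E.
      by apply: integral_ge0 => x _; rewrite lee_fin.
    have iC : (\int[beta]_x (f (affine ny.2 (r ny.1) x))%:E <= C%:E)%E.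
      rewrite -[leRHS]mule1 -bT -integral_cst//; apply: ge0_le_integral => //.
      - by move=> x _; rewrite lee_fin.
      - by apply/measurable_EFinP; apply: (measurableT_comp mf); exact: measurable_affine.
      - by move=> x _; rewrite lee_fin; exact: le_trans (ler_norm _) (fC _).
    by exists a; split => //; rewrite aE !lee_fin in i0 iC; rewrite i0.
  by have [G GE] := choice H; exists (fun n y => G (n, y)) => n y; exact: (GE (n, y)).
have Fnear n y (v e : R) : 0 <= v -> 0 <= e ->
    (forall x, 2 <= enorm x <= 4 -> `|f (affine y (r n) x) - v| <= e) -> `|F n y - v| <= e.
  move=> v0 e0 fv; have [a aE av] := avg n y v e v0 e0 fv.
  by move: aE; rewrite (FE n y).1 => -[->].
have shell n y x : 2 <= enorm x <= 4 -> `|affine y (r n) x - y| <= 4 / n.+1%:R.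
  move=> /andP[_ x4]; rewrite /affine addrAC subrr add0r normrZ gtr0_norm//.
  have [_ [/andP[_ rn] _] _ _ _] := P n.
  rewrite mulrC ler_pM ?(ltW (r0 n))//; exact: le_trans (norm_le_enorm _) x4.
(* Replacing [f] on each cell by its average over the bump turns the integral against the bumps of
   the grid into one against [sig]. *)
pose H n (x : E3) : R := \sum_(j : J n) \1_(grid_cell j) x * F n (grid_site R j).
have H0 n x : 0 <= H n x.
  by apply: sumr_ge0 => j _; rewrite mulr_ge0//; have [_ /andP[]] := FE n (grid_site R j).
have HC n x : H n x <= C.
  apply: (@le_trans _ _ (\sum_(j : J n) \1_(grid_cell j) x * C)).
    by apply: ler_sum => j _; rewrite ler_wpM2l//; have [_ /andP[]] := FE n (grid_site R j).
  by rewrite -mulr_suml ler_piMl// grid_sum_le1.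
have mH n : measurable_fun setT (H n).
  by apply: measurable_sum => j; apply: measurable_funM => //; apply: measurable_indic; exact: measurable_grid_cell.
have HE n : (\sum_(j : J n) sig (grid_cell j) * \int[beta]_x (f (affine (grid_site R j) (r n) x))%:E = \int[sig]_x (H n x)%:E)%E.
  rewrite (eq_integral (fun x => \sum_(j : J n) ((F n (grid_site R j))%:E * (\1_(grid_cell j) x)%:E))%E); last first.
    by move=> x _; rewrite /H -sumEFin; apply: eq_bigr => j _; rewrite mulrC EFinM.
  have F0 j : 0 <= F n (grid_site R j) by have [_ /andP[]] := FE n (grid_site R j).
  rewrite ge0_integral_sum//; first last.
  - by move=> j x _; rewrite mule_ge0 ?lee_fin.
  - by move=> j; apply: measurable_funeM; apply: measurable_indicE; exact: measurable_grid_cell.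
  apply: eq_bigr => j _; rewrite (FE n _).1 ge0_integralZl ?lee_fin//.
  - by rewrite integral_indicE 1?muleC//; exact: measurable_grid_cell.
  - by apply: measurable_indicE; exact: measurable_grid_cell.
have H_cvg x : H n x @[n --> \oo] --> f x.
  apply/cvgrPdist_le => e e0.
  have /cvgrPdist_le/(_ e e0)/nbhs_normP[del /= del0 fdel] := cf x.
  (* One mesh from the point to the corner of its cell, and at most four from the corner to the
     bump. *)
  have small : \forall n \near \oo, 5 / n.+1%:R < del.
    have := near_infty_natSinv_lt (PosNum (ltac:(by rewrite divr_gt0) : 0 < del / 5)).
    by apply: filterS => n /= h; rewrite mulrC -ltr_pdivlMr.
  apply: filterS2 (grid_cell_cover x) small => n [j xj] ndel.
  have -> : H n x = F n (grid_site R j).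
    rewrite /H (bigD1 j)//= big1 ?addr0; first by rewrite indicE mem_set// mul1r.
    move=> i ij; rewrite indicE memNset ?mul0r// => xi.
    by rewrite (grid_cell_inj xi xj) eqxx in ij.
  rewrite distrC; apply: Fnear => [||z z24]; [exact: f0|exact: ltW|].
  rewrite distrC; apply: fdel; rewrite /ball_/=; apply: le_lt_trans ndel.
  rewrite (_ : x - affine (grid_site R j) (r n) z = (x - grid_site R j) - (affine (grid_site R j) (r n) z - grid_site R j)); last first.
    by rewrite opprB addrA subrK.
  apply: (le_trans (ler_normB _ _)).
  have := grid_cell_near xj; have := shell n (grid_site R j) z z24.
  move: (n.+1%:R^-1 : R) => q; lra.
have cv1 : (\int[sig]_x (H n x)%:E)%E @[n --> \oo] --> (\int[sig]_x (f x)%:E)%E.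
  apply: (@dominated_cvg _ _ _ sig setT measurableT _ _ (cst C%:E)).
  - by move=> n; exact/measurable_EFinP.
  - by move=> x _; apply: cvg_EFin; [exact: nearW|exact: H_cvg].
  - by [].
  - apply/integrableP; split; first exact: measurable_cst.
    by rewrite integral_cst// lte_mul_pinfty.
  - by move=> n x _; rewrite lee_fin ger0_norm.
(* The bump outside of the grid stays within 4 of a point of norm at least n + 2, so [f] is
   uniformly small on it. *)
have cv2 : ((left n)%:E * (F n (grid_point R (@None (J n))))%:E)%E @[n --> \oo] --> 0%E.
  have s0 : 0 <= s by have [_ [_ /andP[h1 h2]] _ _ _] := P 0; exact: le_trans h2.
  apply: cvg_EFin; first exact: nearW.
  apply/cvgrPdist_le => e e0.
  have e1 : 0 < e / (s + 1) by rewrite divr_gt0// ltr_wpDl.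
  have [K cK fK] := vf _ e1.
  have [B KB] : exists B : R, forall x, K x -> `|x| <= B.
    have [B [_ HB]] := compact_bounded cK.
    by exists (`|B| + 1) => x Kx; apply: (HB (`|B| + 1)) => //; rewrite (le_lt_trans (ler_norm _))// ltrDl.
  have big : \forall n \near \oo, B + 2 < n%:R :> R by exact: nbhs_infty_gtr.
  apply: filterS big => n nB.
  have Fe : F n (grid_point R (@None (J n))) <= e / (s + 1).
    have := Fnear n (grid_point R (@None (J n))) 0 (e / (s + 1)) (lexx _) (ltW e1).
    move=> h; have {}h : `|F n (grid_point R (@None (J n))) - 0| <= e / (s + 1).
      apply: h => z z24; rewrite subr0; apply/ltW/fK => /KB; apply/negP; rewrite -ltNge.
      have := shell n (grid_point R (@None (J n))) z z24; set q := affine _ _ _ => hq.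
      have h1 : `|(grid_point R (@None (J n))).1.1| <= `|grid_point R (@None (J n)) : E3|.
        by rewrite prod_normE le_max prod_normE le_max lexx.
      have h2 : `|grid_point R (@None (J n)) : E3| <= `|q| + `|q - grid_point R (@None (J n))|.
        by rewrite -{1}(subKr q (grid_point R (@None (J n)))); exact: ler_normB.
      have h3 : (grid_point R (@None (J n))).1.1 = n%:R + 2 :> R by [].
      rewrite h3 ger0_norm in h1; last by rewrite addr_ge0.
      have h4 : 4 / n.+1%:R <= (4 : R) by rewrite ler_pdivrMr// ler_peMr// ler1n.
      move: (le_trans hq h4) h1 h2 nB; clear; move: `|_| `|_| `|_| (n%:R : R) => a1 a2 a3 a4; lra.
    by apply: le_trans h; rewrite subr0 ler_norm.
  have [_ [_ /andP[l0 ls]] _ _ _] := P n.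
  have [_ /andP[F0 _]] := FE n (grid_point R (@None (J n))).
  rewrite sub0r normrN ger0_norm ?mulr_ge0//.
  apply: (@le_trans _ _ (s * (e / (s + 1)))); first exact: ler_pM.
  by rewrite mulrCA ler_piMr ?(ltW e0)// ler_pdivrMr ?ltr_wpDl// mul1r lerDl.
have : (\int[sig]_x (H n x)%:E + (left n)%:E * (F n (grid_point R (@None (J n))))%:E)%E @[n --> \oo] --> (\int[sig]_x (f x)%:E + 0)%E.
  by apply: cvgeD => //; rewrite fin_num_adde_defl.
rewrite adde0; apply: cvg_trans; apply: near_eq_cvg; apply: nearW => n.
by have [_ _ _ _ [_ ->]] := P n => //; rewrite HE (FE n _).1.
Qed.

End diffuse.

(** * Recovery measures at a given scale *)

Section recovery.
Variable R : realType.
Local Notation E3 := (E3 R).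
Local Notation leb3 := (leb3 R).
Local Notation meas3 := {measure set E3 -> \bar R}.
Local Notation meas6 := {measure set (E3 * E3) -> \bar R}.
Implicit Types (u : E3 -> R) (g : E3 -> E3).

Lemma integral_supported_le (mu : meas3) u g (S : set E3) (K m : R) (h : E3 -> \bar R) :
  amplitude mu u g -> supported u g S -> mu setT = m%:E -> measurable_fun setT h ->
  (forall x, 0 <= h x)%E -> 0 <= K -> (forall x, S x -> h x <= K%:E)%E ->
  (\int[mu]_x h x <= (K * m)%:E)%E.
Proof.
move=> au su muT mh h0 K0 hK; have mu_ := amplitude_measurable au.
have mE := amplitude_mass au; rewrite muT in mE.
have mu2 : measurable_fun setT (fun x => (u x ^+ 2)%:E).
  by apply/measurable_EFinP; exact: measurable_funX.
have -> : (\int[mu]_x h x = \int[leb3]_x ((u x ^+ 2)%:E * h x))%E by case: au => _ _ ->.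
rewrite EFinM mE -ge0_integralZl//; last by move=> x _; rewrite lee_fin sqr_ge0.
apply: ge0_le_integral => //.
- by move=> x _; rewrite mule_ge0 ?lee_fin ?sqr_ge0.
- exact: emeasurable_funM.
- exact: measurable_funeM.
move=> x _; have [Sx|/su[-> _]] := pselect (S x); last by rewrite expr0n mul0e mule0.
by rewrite muleC lee_wpmul2r ?lee_fin ?sqr_ge0// hK.
Qed.

(** Index 0 is for the diffuse piece, the others for the nuclei. *)
Definition prepend M (T : Type) (a : T) (f : 'I_M -> T) (i : 'I_M.+1) : T :=
  if unlift ord0 i is Some j then f j else a.

Lemma prepend0 M (T : Type) (a : T) (f : 'I_M -> T) : prepend a f ord0 = a.
Proof. by rewrite /prepend unlift_none. Qed.

Lemma prependS M (T : Type) (a : T) (f : 'I_M -> T) j : prepend a f (lift ord0 j) = f j.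
Proof. by rewrite /prepend liftK. Qed.

Lemma cross_swap (mu nu : meas3) : (mu setT < +oo)%E -> (nu setT < +oo)%E ->
  (\int[mu]_x \int[nu]_y coulomb_kernel x y = \int[nu]_x \int[mu]_y coulomb_kernel x y)%E.
Proof.
move=> fm fn; have [Q QE] := product_measure_ex fm fn.
have [e1 e2] := QE _ (@measurable_kernel2 R) (fun q => coulomb_kernel_ge0 q.1 q.2).
rewrite -e1 e2; apply: eq_integral => x _; apply: eq_integral => y _.
by rewrite coulomb_kernelC.
Qed.

Lemma measurable_potential (mu : meas3) : (mu setT < +oo)%E ->
  measurable_fun setT (fun x => \int[mu]_y coulomb_kernel x y)%E.
Proof.
move=> fm; exact: (measurable_fun_fubini_tonelli_F (m2 := finite_of fm) _ (@measurable_kernel2 R)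
  (fun q => coulomb_kernel_ge0 q.1 q.2)).
Qed.

Lemma potentialE (mu : meas3) x : (\int[mu]_y coulomb_kernel x y = attraction x mu)%E.
Proof. by rewrite /attraction; apply: eq_integral => y _; rewrite coulomb_kernelC. Qed.

Lemma potential_ge0 (mu : meas3) x : (0 <= \int[mu]_y coulomb_kernel x y)%E.
Proof. by apply: integral_ge0 => y _; exact: coulomb_kernel_ge0. Qed.

(* [mu j] is blown down to the nucleus [X j] and [sn] sits away from the nuclei;
   only the interactions between different pieces couple them. *)
Lemma recovery_step (b : R) (M : nat) (X : 'I_M -> E3) (Z : 'I_M -> R)
    (mu : 'I_M -> meas3) (u : 'I_M -> E3 -> R) (g : 'I_M -> E3 -> E3) (P : 'I_M -> meas6)
    (m r t c a : 'I_M -> R) (s q : R) :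
  0 < b -> (forall i, 0 < Z i) -> 0 < q -> (forall i j, i != j -> 3 * q <= enorm (X i - X j)) ->
  (forall j, amplitude (mu j) (u j) (g j)) ->
  (forall j, supported (u j) (g j) [set x | enorm x <= r j]) ->
  (forall j, partial_plan (mu j) (m j) (P j)) ->
  (forall j, P j setT = (Num.max 0 (2 * m j - 1))%:E) ->
  (forall j, energy (g j) = (t j)%:E) -> (forall j, cost (P j) = (c j)%:E) ->
  (forall j, (a j)%:E <= attraction (0 : E3)%R (mu j))%E ->
  (forall j, 0 <= m j) -> 0 <= s -> s + \sum_(j < M) m j = 1 ->
  exists2 L : R, 0 <= L & forall (sn : meas3) us gs (ts d e : R),
  amplitude sn us gs -> energy gs = ts%:E -> sn setT = s%:E ->
  supported us gs [set x | forall j, d <= enorm (x - X j)] ->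
  0 < e -> (forall j, e * r j <= q) -> (forall j, e * r j < d) ->
  exists p : probability E3 R,
   (G_eps b X Z e p <= (\sum_(j < M) (t j + b * c j - Z j * a j) + e ^+ 2 * ts
      + e * b * (3 + ts / 4 + L * (3 + ts / 4 + q^-1)))%:E)%E /\
   forall h, measurable_fun setT h -> (forall x, 0 <= h x)%E ->
     (\int[p]_x h x = \int[sn]_x h x + \sum_(j < M) \int[mu j]_x h (affine (X j) e x))%E.
Proof.
move=> b0 Z0 q0 sep au su pP PT gt Pc aA m0 s0 sm1.
pose p := prepend s m.
have p0 i : 0 <= p i.
  by case: (unliftP ord0 i) => [j ->|->]; rewrite /p ?prependS ?prepend0.
have p1 : \sum_i p i = 1.
  rewrite big_ord_recl /p prepend0 -sm1; congr (_ + _).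
  by apply: eq_bigr => j _; rewrite prependS.
have [L L0 asm] := coupling_assembly p0 p1.
exists L => // sn us gs ts d e asn gts snT ssn e0 er ed.
have ts0 : 0 <= ts by rewrite -lee_fin -gts energy_ge0.
have [mue mueP] := choice (fun j => push_measure_ex (mu j) (measurable_affine (X j) e)).
have mueI j h : measurable_fun setT h -> (forall x, 0 <= h x)%E ->
   (\int[mue j]_x h x = \int[mu j]_x h (affine (X j) e x))%E by exact: (mueP j).2.
have H1 j : exists ug : (E3 -> R) * (E3 -> E3), [/\ amplitude (mue j) ug.1 ug.2,
    energy ug.2 = (e ^- 2 * t j)%:E & supported ug.1 ug.2 [set x | enorm (x - X j) <= e * r j]].
  have [u' [g' [a' e' s']]] := amplitude_affine e0 (au j) (mueI j).
  exists (u', g'); split => //=; first by rewrite e' gt.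
  move=> y ny; apply: (s' _ (su j)) => -[x /= xr yE]; apply: ny => /=.
  by rewrite yE /affine addrAC subrr add0r enorm_scale ?(ltW e0)// ler_pM2l.
have [ug ugP] := choice H1.
have [Pe PeP] := choice (fun j => partial_plan_affine e0 (pP j) (mueI j)).
have [Q0 [pQ0 Q0T Q0c]] := product_plan_ex snT (ltac:(by rewrite s0/= -sm1 lerDl sumr_ge0) : 0 <= s <= 1).
have s1 : s <= 1 by rewrite -sm1 lerDl sumr_ge0.
have m1 j : m j <= 1.
  rewrite -sm1 (bigD1 j)//= addrCA lerDl addr_ge0// sumr_ge0//.
pose B := 3 + ts / 4.
have B0 : 0 <= B by rewrite addr_ge0// divr_ge0.
have snB x : (attraction x sn <= B%:E)%E.
  apply: (le_trans (attraction_bound x asn ltr01)).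
  rewrite snT gts -!EFinM -EFinD lee_fin !mulr1 /B [_^-1 * ts]mulrC lerD2r.
  by rewrite ler_piMr.
pose nu := prepend sn mue.
pose Q := prepend Q0 Pe.
pose U := prepend us (fun j => (ug j).1); pose G := prepend gs (fun j => (ug j).2).
pose S := prepend [set x : E3 | forall j, d <= enorm (x - X j)] (fun j => [set x : E3 | enorm (x - X j) <= e * r j]).
have aun i : amplitude (nu i) (U i) (G i).
  case: (unliftP ord0 i) => [j ->|->]; rewrite /nu /U /G ?prependS ?prepend0//.
  by case: (ugP j).
have sun i : supported (U i) (G i) (S i).
  case: (unliftP ord0 i) => [j ->|->]; rewrite /S /U /G ?prependS ?prepend0//.
  by case: (ugP j).
have nuT i : nu i setT = (p i)%:E.
  case: (unliftP ord0 i) => [j ->|->]; rewrite /nu /p ?prependS ?prepend0//.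
  by case: (PeP j) => -[].
have p1' i : p i <= 1.
  by case: (unliftP ord0 i) => [j ->|->]; rewrite /p ?prependS ?prepend0.
have fnu i : (nu i setT < +oo)%E by rewrite nuT ltry.
have dis i j : i != j -> forall x, S i x -> S j x -> False.
  case: (unliftP ord0 i) => [i' ->|->]; case: (unliftP ord0 j) => [j' ->|->]; rewrite /S ?prependS ?prepend0 ?eqxx//.
  - rewrite (inj_eq lift_inj) => /sep h x /= xi xj.
    have := enorm_triangle (X i') x (X j'); rewrite (enormB (X i') x).
    have := er i'; have := er j'; clear -h xi xj q0; lra.
  - by move=> _ x /= h /(_ i'); rewrite leNgt => /negP; apply; exact: le_lt_trans h (ed i').
  - by move=> _ x /= /(_ j') + h; rewrite leNgt => /negP; apply; exact: le_lt_trans h (ed j').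
have [rho [_ rhoE]] := sum_measure_ex nu.
have rhoT : rho setT = 1%E.
  rewrite -(integral_one rho) rhoE; [|exact: measurable_cst|by []].
  by under eq_bigr do rewrite integral_one nuT; rewrite sumEFin p1.
have [pr prE] := probability_ex rhoT.
have prI h : measurable_fun setT h -> (forall x, 0 <= h x)%E -> (\int[pr]_x h x = \sum_i \int[nu i]_x h x)%E.
  move=> mh h0; rewrite -rhoE//; apply: eq_measure_integral => A mA _; exact: prE.
have [aupr epr _] := amplitude_sum aun sun dis prI.
exists pr; split; last first.
  move=> h mh h0; rewrite prI// big_ord_recl /nu prepend0; congr (_ + _)%E.
  by apply: eq_bigr => j _; rewrite prependS mueI.
have kin : (kinetic pr <= (ts + \sum_j e ^- 2 * t j)%:E)%E.
  apply: (le_trans (kinetic_le aupr)); rewrite epr big_ord_recl /G prepend0 gts EFinD -sumEFin.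
  apply: leeD => //; apply: lee_sum => j _; rewrite prependS.
  by case: (ugP j) => _ -> _.
(* A bound for all cross interactions: those with [sn] through its potential, at most [B]; those
   between two nuclei through their distance, at least 3q - q - q = q. *)
pose K := 3 + ts / 4 + q^-1.
have qi : 0 <= q^-1 by rewrite invr_ge0 ltW.
have K0 : 0 <= K by rewrite /K addr_ge0.
have BK : B <= K by rewrite /K -/B lerDl.
have near_pot i x : (forall y, (attraction y sn <= B%:E)%E) -> (\int[nu i]_y attraction y sn <= K%:E)%E.
  move=> _; apply: (@le_trans _ _ (B%:E * (p i)%:E)%E).
    rewrite -nuT -integral_cst//; apply: ge0_le_integral => //.
    - by move=> y _; rewrite -potentialE potential_ge0.
    - under eq_fun do rewrite -potentialE.
      by apply: measurable_potential; rewrite snT ltry.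
  rewrite -EFinM lee_fin; apply: le_trans BK.
  by rewrite ler_piMr.
have cross i j : i != j -> (\int[nu i]_x \int[nu j]_y coulomb_kernel x y <= K%:E)%E.
  case: (unliftP ord0 j) => [j' ->|->]; last first.
    rewrite [nu ord0]/nu prepend0 => _; under eq_integral do rewrite potentialE.
    exact: near_pot.
  case: (unliftP ord0 i) => [i' ->|->]; last first.
    move=> _; rewrite cross_swap// [nu ord0]/nu prepend0.
    under eq_integral do rewrite potentialE.
    exact: near_pot.
  rewrite (inj_eq lift_inj) => /sep h.
  have -> : nu (lift ord0 i') = mue i' by rewrite /nu prependS.
  have -> : nu (lift ord0 j') = mue j' by rewrite /nu prependS.
  have [ai _ si] := ugP i'; have [aj _ sj] := ugP j'.
  have Ti : mue i' setT = (m i')%:E by case: (PeP i') => -[].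
  have Tj : mue j' setT = (m j')%:E by case: (PeP j') => -[].
  have qm : 0 <= q^-1 * m j' by rewrite mulr_ge0.
  have inner x : enorm (x - X i') <= e * r i' -> (\int[mue j']_y coulomb_kernel x y <= (q^-1 * m j')%:E)%E.
    move=> xi; apply: (integral_supported_le aj sj Tj) => //.
    - by apply: (eq_measurable_fun (fun y => coulomb_kernel y x)) => [y _|]; [exact: coulomb_kernelC|exact: measurable_kernel].
    - by move=> y; exact: coulomb_kernel_ge0.
    - move=> y /= yj; have qxy : q <= enorm (x - y).
        have := enorm_triangle (X i') x (X j'); have := enorm_triangle x y (X j').
        rewrite (enormB (X i') x); have := er i'; have := er j'; clear -h xi yj; lra.
      rewrite coulomb_kernelE gt_eqF ?(lt_le_trans q0)// lee_fin lef_pV2 ?posrE//.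
      exact: lt_le_trans qxy.
  apply: (le_trans (integral_supported_le ai si Ti (measurable_potential _) (potential_ge0 _) qm inner)).
    by rewrite Tj ltry.
  rewrite lee_fin; apply: (@le_trans _ _ q^-1); last by rewrite /K lerDr.
  rewrite -mulrA ler_piMr// mulr_ile1//.
have pQ i : partial_plan (nu i) (p i) (Q i).
  case: (unliftP ord0 i) => [j ->|->]; rewrite /nu /p /Q ?prependS ?prepend0//.
  by case: (PeP j).
have QT i : Q i setT = (Num.max 0 (2 * p i - 1))%:E.
  case: (unliftP ord0 i) => [j ->|->]; rewrite /p /Q ?prependS ?prepend0//.
  by case: (PeP j) => _ ->.
have coul : (coulomb_cost pr <= (B + \sum_j e^-1 * c j + L * K)%:E)%E.
  apply: (le_trans (asm nu pr Q K pQ QT cross K0 prI)).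
  rewrite [leRHS]EFinD; apply: leeD => //.
  rewrite big_ord_recl EFinD -sumEFin; apply: leeD; first by rewrite /Q prepend0 Q0c.
  apply: lee_sum => j _; rewrite /Q prependS.
  by case: (PeP j) => _ _ ->; rewrite Pc -EFinM.
(* Each nucleus keeps only the attraction of its own piece; the other contributions lower the
   functional. *)
have nuc : ((\sum_j Z j * (e^-1 * a j))%:E <= nuclear_attraction X Z pr)%E.
  rewrite -sumEFin; apply: lee_sum => k _; rewrite EFinM; apply: lee_wpmul2l; first by rewrite lee_fin ltW.
  rewrite /attraction prI; [|exact: measurable_kernel|by move=> x; exact: coulomb_kernel_ge0].
  rewrite (bigD1 (lift ord0 k))//= {1}/nu prependS -/(attraction (X k) (mue k)).
  rewrite (attraction_affine e0 (mueI k)).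
  apply: (@le_trans _ _ (e^-1%:E * attraction (0 : E3)%R (mu k))%E).
    by rewrite EFinM; apply: lee_wpmul2l => //; rewrite lee_fin invr_ge0 ltW.
  rewrite leeDl//; apply: sume_ge0 => i _; apply: integral_ge0 => x _; exact: coulomb_kernel_ge0.
rewrite /G_eps ifF; last first.
  by apply/negbTE/eqP => kE; move: kin; rewrite kE leye_eq.
have -> : \sum_(j < M) (t j + b * c j - Z j * a j) + e ^+ 2 * ts + e * b * (3 + ts / 4 + L * (3 + ts / 4 + q^-1))
  = e ^+ 2 * (ts + \sum_j e ^- 2 * t j) + e * b * (B + \sum_j e^-1 * c j + L * K)
    - e * \sum_j Z j * (e^-1 * a j).
  have -> : \sum_j Z j * (e^-1 * a j) = e^-1 * \sum_j Z j * a j.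
    by rewrite mulr_sumr; apply: eq_bigr => j _; ring.
  rewrite -!mulr_sumr !big_split/= sumrN -mulr_sumr /K -/B.
  by field; rewrite !gt_eqF.
rewrite EFinB EFinD ![in leRHS]EFinM; apply: leeB; first apply: leeD.
- by apply: lee_wpmul2l => //; rewrite lee_fin sqr_ge0.
- rewrite -EFinM; apply: lee_wpmul2l => //; rewrite lee_fin mulr_ge0// ltW//.
- by apply: lee_wpmul2l => //; rewrite lee_fin ltW.
Qed.

End recovery.

(** * The limsup inequality *)

Section upper_bound.
Variable R : realType.
Local Notation E3 := (E3 R).
Local Notation leb3 := (leb3 R).
Local Notation meas3 := {measure set E3 -> \bar R}.
Local Notation meas6 := {measure set (E3 * E3) -> \bar R}.
Implicit Types (u : E3 -> R) (g : E3 -> E3).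

(** [N x] is the largest index below 1/x, up to rounding, whose threshold exceeds [x]. Truncating at
    1/x makes the maximum finite; every fixed index becomes admissible as x tends to 0, so [N] tends
    to infinity. *)
Lemma diagonal (d : nat -> R) : (forall n, 0 < d n) ->
  exists N : R -> nat, N x @[x --> 0^'+] --> \oo /\ \forall x \near (0 : R)^'+, 0 < x < d (N x).
Proof.
move=> d0; pose K x := (Num.trunc (x^-1 : R)).+1.
exists (fun x : R => \max_(k < K x | (x < d k)%R) (k : nat))%N; split.
  move=> A [k _ kA].
  have : \forall x \near (0 : R)^'+, 0 < x /\ x < Num.min (d k) k.+1%:R^-1.
    near=> x; split; first by near: x; exact: nbhs_right_gt.
    by near: x; apply: nbhs_right_lt; rewrite lt_min d0/= invr_gt0 ltr0n.
  apply: filterS => x [x0]; rewrite lt_min => /andP[xd xk]; apply: kA => /=.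
  have kK : (k < K x)%N.
    rewrite ltnS truncn_ge_nat ?invr_ge0 ?(ltW x0)//.
    apply: (@le_trans _ _ k.+1%:R); first by rewrite ler_nat.
    by rewrite -[leLHS]invrK lef_pV2 ?posrE ?invr_gt0// ltW.
  exact: (leq_bigmax_cond (Ordinal kK)).
have : \forall x \near (0 : R)^'+, 0 < x /\ x < d 0.
  near=> x; split; first by near: x; exact: nbhs_right_gt.
  by near: x; apply: nbhs_right_lt.
(* Below [d 0] the index 0 is admissible, so the maximum is over a nonempty set and is attained by
   an admissible index. *)
apply: filterS => x [x0 xd]; rewrite x0/=.
have c0 : (0 < #|[pred k : 'I_(K x) | (x < d k)%R]|)%N by apply/card_gt0P; exists ord0.
by have [k /= xk ->] := eq_bigmax_cond (fun k : 'I_(K x) => k : nat) c0.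
Unshelve. all: by end_near. Qed.

(** Positive and negative parts inherit continuity and decay, so the recovery measures, specified by
    their integrals of nonnegative functions, need only be tested on these. *)
Lemma weak_star_ge0 (p : R -> probability E3 R) (rho : subprobability E3 R) :
  (forall f, continuous f -> vanishing_at_infinity f -> (forall x, 0 <= f x) ->
    (\int[p e]_x (f x)%:E)%E @[e --> 0^'+] --> (\int[rho]_x (f x)%:E)%E) ->
  weak_star_cvg p rho.
Proof.
move=> H f cf vf.
have cpos (h : E3 -> R) : continuous h -> vanishing_at_infinity h ->
    continuous (fun x => Num.max (h x) 0) /\ vanishing_at_infinity (fun x => Num.max (h x) 0).
  move=> ch vh; split.
    by move=> x; apply: (@continuous_max R E3 h (fun=> 0)); [exact: ch|exact: cst_continuous].
  move=> e e0; have [K cK hK] := vh e e0; exists K => // x /hK; apply: le_lt_trans.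
  by rewrite ger0_norm ?le_max ?lexx ?orbT// ge_max ler_norm normr_ge0.
have [c1 v1] := cpos f cf vf.
have [c2 v2] : continuous (fun x => Num.max (- f x) 0) /\ vanishing_at_infinity (fun x => Num.max (- f x) 0).
  apply: cpos; first by move=> x; apply: cvgN; exact: cf.
  by move=> e e0; have [K cK fK] := vf e e0; exists K => // x /fK; rewrite normrN.
have E (mu : meas3) : (\int[mu]_x (f x)%:E = \int[mu]_x (Num.max (f x) 0)%:E - \int[mu]_x (Num.max (- f x) 0)%:E)%E.
  rewrite integralE; congr (_ - _)%E; apply: eq_integral => x _.
    by rewrite funeposE EFin_max.
  by rewrite funenegE EFin_max EFinN.
have [C C0 HC] := vanishing_bounded c2 v2.
have fin : (\int[rho]_x (Num.max (- f x) 0)%:E \is a fin_num)%E.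
  rewrite ge0_fin_numE; last by apply: integral_ge0 => x _; rewrite lee_fin le_max lexx orbT.
  apply: (@le_lt_trans _ _ (\int[rho]_x (cst C%:E x))%E).
    apply: ge0_le_integral => //.
    - by move=> x _; rewrite lee_fin le_max lexx orbT.
    - by apply/measurable_EFinP; exact: continuous_measurable3.
    - by move=> x _; rewrite lee_fin; exact: le_trans (ler_norm _) (HC x).
  rewrite integral_cst//; apply: (@le_lt_trans _ _ (C%:E * 1)%E); last by rewrite mule1 ltry.
  by apply: lee_wpmul2l; [rewrite lee_fin|exact: sprobability_setT].
under eq_cvg do rewrite E.
rewrite E; apply: cvgeB; first by rewrite fin_num_adde_defl// fin_numN.
- by apply: H => // x; rewrite le_max lexx orbT.
- by apply: H => // x; rewrite le_max lexx orbT.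
Qed.

Lemma blow_down_cvg (mu : meas3) u g (X : E3) (r m : R) (f : E3 -> R) :
  amplitude mu u g -> supported u g [set x | enorm x <= r] -> mu setT = m%:E ->
  continuous f -> (forall x, 0 <= f x) ->
  (\int[mu]_x (f (affine X e x))%:E)%E @[e --> 0^'+] --> (m * f X)%:E.
Proof.
move=> au su muT cf f0; have mf : measurable_fun setT f by exact: continuous_measurable3.
have m0 : 0 <= m by rewrite -lee_fin -muT measure_ge0.
have near_v (s : R) : 0 < s -> \forall e \near (0 : R)^'+,
    exists2 y, (\int[mu]_x (f (affine X e x))%:E)%E = y%:E & `|y - m * f X| <= s.
  move=> s0; have s1 : 0 < s / (m + 1) by rewrite divr_gt0// ltr_wpDl.
  have /cvgrPdist_le/(_ _ s1)/nbhs_normP[del /= del0 fdel] := cf X.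
  have : \forall e \near (0 : R)^'+, 0 < e /\ e < del / (`|r| + 1).
    near=> e; split; first by near: e; exact: nbhs_right_gt.
    by near: e; apply: nbhs_right_lt; rewrite divr_gt0// ltr_wpDl.
  apply: filterS => e [e0 ed].
  have hS z : enorm z <= r -> `|f (affine X e z) - f X| <= s / (m + 1).
    move=> zr; rewrite distrC; apply: fdel; rewrite /ball_/= /affine opprD addrA subrr add0r normrN normrZ gtr0_norm//.
    move: ed; rewrite ltr_pdivlMr ?ltr_wpDl// => ed; apply: le_lt_trans ed.
    rewrite ler_pM2l//; apply: (le_trans (norm_le_enorm _)); apply: (le_trans zr).
    by apply: (le_trans (ler_norm _)); rewrite lerDl.
  have [y yE yv] := integral_near au su muT (measurableT_comp mf (measurable_affine X e)) (fun x => f0 _)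
    (f0 X) (ltW s1) hS.
  exists y => //; rewrite [m * _]mulrC; apply: (le_trans yv).
  by rewrite mulrAC ler_pdivrMr ?ltr_wpDl// ler_pM2l// lerDl.
apply/fine_cvgP; split.
  by have := near_v 1 ltr01; apply: filterS => e [y -> _].
apply/cvgrPdist_le => s s0; have := near_v s s0; apply: filterS => e [y yE ys].
by rewrite /= yE distrC.
Unshelve. all: by end_near. Qed.

Lemma limf_einf_le_esup (f : R -> \bar R) : (limf_einf f 0^'+ <= limf_esup f 0^'+)%E.
Proof.
rewrite limf_einfE limf_esupE; apply: ge_ereal_sup => _ [V FV <-].
apply: le_ereal_inf_tmp => _ [W FW <-].
have [x [Vx Wx]] := filter_ex (filterI FV FW).
apply: (@le_trans _ _ (f x)); first by apply: ereal_inf_lbound; exists x.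
by apply: ereal_sup_ubound; exists x.
Qed.

(** Only the mass [m i] of the truncated competitor is taken from each atom, so [sig] may keep an
    atom of mass [alpha i - m i] at the nucleus. This is why the bumps avoid the corners of their
    cells. *)
Lemma residual_measure (M : nat) (X : 'I_M -> E3) (rho : subprobability E3 R) (alpha m : 'I_M -> R) :
  injective X -> (forall i, rho [set X i] = (alpha i)%:E) -> (forall i, 0 <= m i <= alpha i) ->
  exists sig : meas3, [/\ \sum_i m i <= 1, (sig setT <= (1 - \sum_i m i)%:E)%E &
    forall h : E3 -> \bar R, measurable_fun setT h -> (forall x, 0 <= h x)%E ->
      (\int[rho]_x h x = \int[sig]_x h x + \sum_i (m i)%:E * h (X i))%E].
Proof.
move=> Xinj alE m01.
have m0 i : 0 <= m i by have /andP[] := m01 i.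
have [k kP] := choice (fun i => scale_measure_ex (\d_(X i) : meas3) (m0 i)).
have [lam [lamA lamI]] := sum_measure_ex k.
have lamE h : measurable_fun setT h -> (forall x, 0 <= h x)%E ->
    (\int[lam]_x h x = \sum_i (m i)%:E * h (X i))%E.
  move=> mh h0; rewrite lamI//; apply: eq_bigr => i _; rewrite (kP i).2//.
  by rewrite integral_dirac// diracT mul1e.
have lamle A : measurable A -> (lam A <= rho A)%E.
  move=> mA; rewrite (measure_of_integral lam mA) lamE; [|exact: measurable_indicE|by move=> x; rewrite lee_fin].
  have mAX i : measurable (A `&` [set X i]) by apply: measurableI => //; exact: measurable_singleton3.
  apply: (@le_trans _ _ (\sum_i rho (A `&` [set X i]))%E).
    apply: lee_sum => i _; rewrite indicE; case: (boolP (X i \in A)) => [XA|_]; last first.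
      by rewrite mule0 measure_ge0.
    rewrite mule1 (_ : A `&` [set X i] = [set X i]).
      by rewrite [leRHS](alE i) lee_fin; have /andP[] := m01 i.
    by apply/seteqP; split => [x []//|x /= ->]; split => //; rewrite inE in XA.
  under eq_bigr do rewrite -(integral_indicE rho (mAX _)).
  rewrite -(integral_indicE rho mA) -ge0_integral_sum//; last by move=> i; exact: measurable_indicE.
  apply: ge0_le_integral => //.
  - by move=> x _; apply: sume_ge0 => i _; rewrite lee_fin.
  - by apply: emeasurable_sum => i; exact: measurable_indicE.
  - exact: measurable_indicE.
  move=> x _; rewrite sumEFin lee_fin; case: (boolP (x \in A)) => [xA|xA]; last first.
    rewrite big1 ?indicE ?(negbTE xA)// => i _; rewrite indicE memNset// => -[xA' _].
    by rewrite mem_set in xA.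
  rewrite [leRHS]indicE xA; apply: lone_sum_le1 => [i|i j ij].
    by rewrite indicE; case: (x \in _); rewrite ?lexx ?ler01.
  rewrite !indicE; case: (boolP (x \in _ `&` [set X i])) => [|_]; last by left.
  case: (boolP (x \in _ `&` [set X j])) => [|_]; last by right.
  by rewrite !inE => -[_ /= ->] [_ /= /Xinj e]; rewrite e eqxx in ij.
have rho1 : ((rho : meas3) setT <= 1)%E by exact: sprobability_setT.
have [sig sigE] := sub_measure_ex (le_lt_trans rho1 (ltry 1)) lamle.
have lamT : lam setT = (\sum_i m i)%:E.
  rewrite -(integral_one lam) lamE; [|exact: measurable_cst|by []].
  by rewrite -sumEFin; apply: eq_bigr => i _; rewrite mule1.
have T := sigE _ measurableT; rewrite lamT in T.
exists sig; split.
- by rewrite -lee_fin -lamT; exact: le_trans (lamle _ measurableT) rho1.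
- move: rho1; rewrite T; case: (sig setT) => [x| |]//; last by move=> _; rewrite leNye.
  by rewrite -EFinD !lee_fin; lra.
- by move=> h mh h0; rewrite (sub_measure_integral sigE mh h0) lamE// addeC.
Qed.

(** As the upper limit is an infimum over families, it is enough to exceed the sum by an arbitrary
    [s]. The competitors of the cell problems are then fixed, and only the approximation of the
    diffuse part varies along the family. *)
Lemma Gamma_upper (b : R) (M : nat) (X : 'I_M -> E3) (Z : 'I_M -> R)
    (rho : subprobability E3 R) (alpha : 'I_M -> R) :
  0 < b -> injective X -> (forall i, 0 < Z i) -> (forall i, rho [set X i] = (alpha i)%:E) ->
  (Gamma_limsup (G_eps b X Z) rho <= \sum_(i < M) cell_energy b (Z i) (alpha i))%E.
Proof.
move=> b0 Xinj Z0 alE.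
have [/existsP[i0 /eqP gi]|/existsPn gfin] := boolP [exists i, cell_energy b (Z i) (alpha i) == +oo%E].
  (* An infinite cell energy makes the whole sum infinite, the other terms being above -oo. *)
  rewrite (bigD1 i0)//= gi addye ?leey//.
  apply/eqP => /esum_eqNyP[i [_ _ e]].
  by have := cell_energy_ltNy (alpha i) b0 (Z0 i); rewrite e ltxx.
have [gam gamE] : exists gam : 'I_M -> R, forall i, cell_energy b (Z i) (alpha i) = (gam i)%:E.
  exists (fun i => fine (cell_energy b (Z i) (alpha i))) => i; rewrite fineK// fin_numE gfin andbT.
  by rewrite -ltNye cell_energy_ltNy.
under eq_bigr do rewrite gamE.
rewrite sumEFin; apply/lee_addgt0Pr => s s0; rewrite -EFinD.
have al01 i : 0 <= alpha i <= 1.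
  have a0 : (0 <= (alpha i)%:E)%E by rewrite -alE; exact: measure_ge0.
  rewrite -lee_fin a0/= -lee_fin -alE; apply: le_trans (@sprobability_setT _ _ _ rho).
  by apply: le_measure => //; rewrite inE//; exact: measurable_singleton3.
(* The [M] cell errors use at most half of [s], and the terms in the scale the other half. *)
pose eta := s / (2 * (M%:R + 1)); have M1 : (0 : R) < M%:R + 1 by rewrite ltr_wpDl.
have eta0 : 0 < eta by rewrite divr_gt0// mulr_gt0.
have [mu /choice[u /choice[g /choice[P /choice[m /choice[r /choice[t /choice[c /choice[a H]]]]]]]]] :=
  choice (fun i => cell_compact b0 (Z0 i) (al01 i)
    (ltac:(by rewrite gamE lte_fin ltrDl) : (cell_energy b (Z i) (alpha i) < (gam i + eta)%:E)%E)).
have m01 i : 0 <= m i <= alpha i by have [] := H i.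
have [sig [sm sigT sigI]] := residual_measure Xinj alE m01.
pose s1 := 1 - \sum_i m i; have s10 : 0 <= s1 by rewrite subr_ge0.
have [sn [us [gs [d [snP sncv]]]]] := diffuse_approx X sigT.
have [q q0 qsep] : exists2 q : R, 0 < q & forall i j, i != j -> 3 * q <= enorm (X i - X j).
  have [q q0 qP] := @fin_lower_bound R ('I_M * 'I_M)%type
    (fun ij => if ij.1 == ij.2 then 1 else enorm (X ij.1 - X ij.2) / 3)
    (ltac:(move=> [i j]/=; case: ifPn => // ij; rewrite divr_gt0// lt0r enorm_ge0 andbT;
      apply: contra_neq ij => /enorm_eq0/eqP; rewrite subr_eq0 => /eqP; exact: Xinj)).
  exists q => // i j /negPf ij; have := qP (i, j); rewrite /= ij ler_pdivlMr// mulrC.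
  by [].
have [L L0 step] := @recovery_step R b M X Z mu u g P m r t c a s1 q b0 Z0 q0 qsep
  (fun i => let: And5 h _ _ _ _ := H i in h) (fun i => let: And5 _ h _ _ _ := H i in h)
  (fun i => let: And5 _ _ h _ _ := H i in h.1) (fun i => let: And5 _ _ h _ _ := H i in h.2)
  (fun i => ltac:(by have [_ _ _ _ []] := H i)) (fun i => ltac:(by have [_ _ _ _ []] := H i))
  (fun i => ltac:(by have [_ _ _ _ []] := H i)) (fun i => ltac:(by have /andP[] := m01 i)) s10
  (ltac:(by rewrite /s1 subrK)).
have tsE n : exists2 ts, energy (gs n) = ts%:E & 0 <= ts.
  have [_ [_ hg _] _ _] := snP n; have := energy_ge0 (gs n); have := energy_lty hg.
  by case: (energy (gs n)) => [x| |]//; rewrite lee_fin; exists x.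
have [ts tsP] := choice (fun n => ex2_and (tsE n)).
(* A bound for the coefficient of the scale in [recovery_step], using e^2 <= e; it may grow with
   [n], which the diagonal choice compensates. *)
pose K n := ts n + b * (3 + ts n / 4 + L * (3 + ts n / 4 + q^-1)) + 1.
have qi : 0 <= q^-1 by rewrite invr_ge0 ltW.
have K1 n : 1 <= K n.
  have h := (tsP n).2; have h4 : 0 <= ts n / 4 by rewrite divr_ge0.
  by rewrite /K lerDr addr_ge0// mulr_ge0 ?(ltW b0)// !addr_ge0// mulr_ge0// !addr_ge0.
pose rr := \sum_i `|r i| + 1.
have rr0 : 0 < rr by rewrite ltr_wpDl// sumr_ge0.
have rle i : r i <= rr.
  rewrite /rr (bigD1 i)//= -addrA; apply: (le_trans (ler_norm _)).
  by rewrite lerDl addr_ge0// sumr_ge0.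
(* Below this threshold the errors are at most s / 2, the contracted pieces stay in the balls of
   radius [q], and they do not reach the bumps. *)
pose e0 n := Num.min (Num.min 1 (s / 2 / K n)) (Num.min (q / rr) (d n / rr)).
have e00 n : 0 < e0 n.
  have d0 : 0 < d n by case: (snP n).
  by rewrite !lt_min ltr01/= !divr_gt0//; exact: lt_le_trans (K1 n).
have [N [Noo Nnear]] := diagonal e00.
have G1 x : exists p : probability E3 R, 0 < x < e0 (N x) ->
   (G_eps b X Z x p <= (\sum_i gam i + s)%:E)%E /\
   forall h, measurable_fun setT h -> (forall y, 0 <= h y)%E ->
     (\int[p]_y h y = \int[sn (N x)]_y h y + \sum_(j < M) \int[mu j]_y h (affine (X j) x y))%E.
  (* An arbitrary probability, the value of the family at scales that are not admissible. *)
  have [beta [u0 [g0 [_ bT _]]]] := @bump_measure_ex R.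
  have [p0 _] := probability_ex bT.
  have [/andP[x0 xe]|nx] := boolP (0 < x < e0 (N x)); last by exists p0.
  move: xe; rewrite !lt_min => /andP[/andP[x1 xK] /andP[xq xd]].
  have [dn0 an sn_s snT] := snP (N x).
  have xr i : x * r i <= x * rr by rewrite ler_pM2l.
  have [p [pG pI]] := step (sn (N x)) (us (N x)) (gs (N x)) (ts (N x)) (d (N x)) x an (tsP (N x)).1 snT sn_s x0
    (fun j => ltac:(apply: (le_trans (xr j)); rewrite -ler_pdivlMr//; exact: ltW))
    (fun j => ltac:(apply: (le_lt_trans (xr j)); by rewrite -ltr_pdivlMr)).
  exists p => _; split => //; apply: (le_trans pG); rewrite lee_fin.
  have Ksum : \sum_(j < M) (t j + b * c j - Z j * a j) <= \sum_i gam i + M%:R * eta.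
    rewrite -[M%:R * eta](_ : \sum_(i < M) eta = _); last by rewrite sumr_const card_ord mulr_natl.
    rewrite -big_split/=; apply: ler_sum => i _; apply: ltW.
    by have [_ _ _ _ []] := H i.
  have etaE : eta * (2 * (M%:R + 1)) = s by rewrite divfK// gt_eqF// mulr_gt0.
  have xK' : x * K (N x) <= s / 2 by rewrite -ler_pdivlMr ?(ltW xK)//; exact: lt_le_trans (K1 _).
  have ts0 := (tsP (N x)).2.
  have x2 : x ^+ 2 * ts (N x) <= x * ts (N x).
    by rewrite expr2 -mulrA ler_piMl ?mulr_ge0 ?(ltW x0)// ltW.
  have KE : x * K (N x) = x * ts (N x) + x * b * (3 + ts (N x) / 4 + L * (3 + ts (N x) / 4 + q^-1)) + x.
    by rewrite /K; ring.
  rewrite KE in xK'; move: xK' Ksum etaE x2 x0 eta0.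
  move: (x * b * _) (x * ts _) (x ^+ 2 * ts _) => w1 w2 w3.
  clear; lra.
have [p pP] := choice G1.
apply: (@le_trans _ _ (limf_esup (fun e => G_eps b X Z e (p e)) 0^'+)).
  apply: ereal_inf_lbound; exists p => //; apply: weak_star_ge0 => f cf vf f0.
  have mfE : measurable_fun setT (fun x => (f x)%:E).
    by apply/measurable_EFinP; exact: continuous_measurable3.
  rewrite sigI//.
  have cv1 : (\int[sn (N e)]_x (f x)%:E)%E @[e --> 0^'+] --> (\int[sig]_x (f x)%:E)%E.
    exact: (cvg_comp N (fun n => \int[sn n]_x (f x)%:E)%E Noo (sncv f cf vf f0)).
  have cv2 : (\sum_(j < M) \int[mu j]_y (f (affine (X j) e y))%:E)%E @[e --> 0^'+] -->
     (\sum_(j < M) (m j)%:E * (f (X j))%:E)%E.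
    apply: cvg_nnesum => j _.
      by apply: nearW => e; apply: integral_ge0 => y _; rewrite lee_fin.
    rewrite -EFinM; have [aj sj [[muT _ _ _] _] _ _] := H j.
    exact: blow_down_cvg aj sj muT cf f0.
  have : (\int[sn (N e)]_x (f x)%:E + \sum_(j < M) \int[mu j]_y (f (affine (X j) e y))%:E)%E @[e --> 0^'+] -->
    (\int[sig]_x (f x)%:E + \sum_(j < M) (m j)%:E * (f (X j))%:E)%E.
    apply: cvgeD => //; apply: ge0_adde_def; rewrite inE.
      by apply: integral_ge0 => x _; rewrite lee_fin.
    by apply: sume_ge0 => j _; rewrite mule_ge0 ?lee_fin//; have /andP[] := m01 j.
  apply: cvg_trans; apply: near_eq_cvg; apply: filterS Nnear => e /pP[_ ->]//.
rewrite limf_esupE; apply: (@le_trans _ _ (ereal_sup ((fun e => G_eps b X Z e (p e)) @` [set x | 0 < x < e0 (N x)]))).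
  by apply: ereal_inf_lbound; exists [set x | 0 < x < e0 (N x)].
by apply: ge_ereal_sup => _ [x /= xe <-]; have [] := pP x xe.
Qed.

End upper_bound.

Theorem theorem5p7 (R : realType) (b : R) (M : nat)
    (X : 'I_M -> E3 R) (Z : 'I_M -> R)
    (rho : subprobability (E3 R) R) (alpha : 'I_M -> R)
    (b_gt0 : 0 < b) (X_inj : injective X) (Z_gt0 : forall i, 0 < Z i)
    (alphaE : forall i, rho [set X i] = (alpha i)%:E) :
  Gamma_liminf (G_eps b X Z) rho = (\sum_(i < M) cell_energy b (Z i) (alpha i))%E
  /\
  Gamma_limsup (G_eps b X Z) rho = (\sum_(i < M) cell_energy b (Z i) (alpha i))%E.
Proof.
have lower : (\sum_(i < M) cell_energy b (Z i) (alpha i) <= Gamma_liminf (G_eps b X Z) rho)%E.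
  by apply: le_ereal_inf_tmp => _ [p wp <-]; exact: Gamma_lower.
have middle : (Gamma_liminf (G_eps b X Z) rho <= Gamma_limsup (G_eps b X Z) rho)%E.
  apply: le_ereal_inf_tmp => _ [p wp <-]; apply: le_trans (limf_einf_le_esup _).
  by apply: ereal_inf_lbound; exists p.
have upper := Gamma_upper b_gt0 X_inj Z_gt0 alphaE.
split; apply/eqP; rewrite eq_le; apply/andP; split => //.
- exact: le_trans middle upper.
- exact: le_trans lower middle.
Qed.
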